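(* The simple objects of $\mathrm{Rep}^0\,V_{-\frac12}(\mathfrak{sl}(2|1))$ are of the form $\mathcal F(S)$, where $S$ is either $\widehat A_{n,\ell}$ for $n\in\frac12\mathbb{Z}$, $\ell\in\mathbb{Z}$, or $\widehat V_{n,e}$ for $n\in\mathbb{C}$, $e\in\mathbb{C}\setminus\mathbb{Z}$ such that $2n+e\in\mathbb{Z}$. Moreover, $\mathcal F(S)\cong\mathcal F(S')$ if and only if there exists $m\in\mathbb{Z}$ such that $$S'\cong S\boxtimes\widehat A_{m-\varepsilon(m),-2m}.$$ Here $\varepsilon(m)=\frac12,0,-\frac12$ for $m>0$, $m=0$, $m<0$ respectively.
   Context: **Algebra.** $\mathfrak{gl}(1|1)$ has even basis $N,E$ and odd basis $\psi^\pm$; nonzero brackets $[N,\psi^\pm]=\pm\psi^\pm$, $\{\psi^+,\psi^-\}=E$; invariant form $\kappa(N,E)=\kappa(E,N)=1$, $\kappa(\psi^+,\psi^-)=-\kappa(\psi^-,\psi^+)=1$, zero on other pairs of basis elements. $\widehat{\mathfrak{gl}(1|1)}$ is the affinization, $[a_r,b_s]=[a,b]_{r+s}+r\kappa(a,b)\delta_{r+s,0}\mathbf{k}$. $V_1(\mathfrak{gl}(1|1))$ is the level-$1$ module induced from the trivial $\mathfrak{gl}(1|1)$-module, a vertex operator superalgebra with conformal vector $\omega=\frac12(N_{-1}E_{-1}+E_{-1}N_{-1}-\psi^+_{-1}\psi^-_{-1}+\psi^-_{-1}\psi^+_{-1})\mathbf 1+\frac12E_{-1}^2\mathbf 1$.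 **Modules (level 1).** $V_{n,e}$ is the 2-dimensional Verma $\mathfrak{gl}(1|1)$-module with highest-weight vector $v$, $Nv=(n+\frac12)v$, $Ev=ev$, $\psi^+v=0$; $A_n$ is 1-dimensional with $N=n$, $E=\psi^\pm=0$. $\widehat V_{n,e}$ is the level-1 induced module from $V_{n,e}$ (irreducible iff $e\notin\mathbb Z$); $\widehat A_{n,0}$ is induced from $A_n$; for $\ell\in\mathbb{Z}\setminus\{0\}$, $\widehat A_{n,\ell}$ is the unique irreducible quotient of $\widehat V_{n,\ell}$. **Categories.** $\mathcal O_1^{fin}$ is the supercategory of finite-length grading-restricted generalized $V_1(\mathfrak{gl}(1|1))$-modules on which $N_0,E_0$ act semisimply; it is a braided tensor supercategory with the vertex algebraic (Huang–Lepowsky–Zhang) tensor product $\boxtimes$ ($W_1\boxtimes W_2$ is universal for logarithmic intertwining operators out of $W_1\otimes W_2$) and twist $\theta=e^{2\pi iL_0}$. Isomorphisms may be even or odd. $\mathrm{Ind}(\mathcal O_1^{fin})$ is the category of generalized $V_1(\mathfrak{gl}(1|1))$-modules that are unions of submodules in $\mathcal O_1^{fin}$; it also has vertex algebraic braided tensor supercategory structure extending that of $\mathcal O_1^{fin}$. **The extension.** $V_{-\frac12}(\mathfrak{sl}(2|1))$, the simple affine vertex operator superalgebra of $\mathfrak{sl}(2|1)$ at level $-\frac12$, is (a known result) a simple current extension of $V_1(\mathfrak{gl}(1|1))$: $V_{-\frac12}(\mathfrak{sl}(2|1))=\bigoplus_{m\in\mathbb{Z}}\widehat A_{m-\varepsilon(m),-2m}$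 as a $V_1(\mathfrak{gl}(1|1))$-module. Hence it is a supercommutative algebra $A$ in $\mathrm{Ind}(\mathcal O_1^{fin})$. $\mathrm{Rep}\,V_{-\frac12}(\mathfrak{sl}(2|1))$ is the category of objects $X$ of $\mathrm{Ind}(\mathcal O_1^{fin})$ with an associative unital even action $\mu_X:A\boxtimes X\to X$ (not necessarily local modules). $\mathrm{Rep}^0$ is the full subcategory of local ones, i.e. those with $\mu_X\circ\mathcal M_{A,X}=\mu_X$ where $\mathcal M$ is the double braiding (monodromy); equivalently, (generalized) modules for the vertex operator superalgebra $V_{-\frac12}(\mathfrak{sl}(2|1))$ which lie in $\mathrm{Ind}(\mathcal O_1^{fin})$ as $V_1(\mathfrak{gl}(1|1))$-modules. $\mathcal F:\mathcal O_1^{fin}\to\mathrm{Rep}\,V_{-\frac12}(\mathfrak{sl}(2|1))$ is the induction functor $\mathcal F(S)=A\boxtimes S$ with action from the multiplication of $A$. *)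

(* Defs.v *)
(* The ground field is R[i], the complex numbers over an arbitrary realType. *)
From HB Require Import structures.
From mathcomp Require Import all_boot all_order all_algebra finmap.
From mathcomp Require Import complex.
From mathcomp Require Import boolp classical_sets functions cardinality fsbigop.
From mathcomp Require Import reals topology normedtype sequences exp trigo.

Set Implicit Arguments.
Unset Strict Implicit.
Unset Printing Implicit Defensive.

Import Order.TTheory GRing.Theory Num.Theory.
Local Open Scope ring_scope.

Section Defs.
Variable R : realType.
Local Notation C := (R[i]).

Definition sgn (b : bool) : C := (-1) ^+ b.

Definition gbinom (m : int) (i : nat) : C :=
  (\prod_(j < i) (m%:~R - j%:R)) / i`!%:R.

Definition cexp (z : C) : C :=
  ((expR (complex.Re z) * cos (complex.Im z))
   +i* (expR (complex.Re z) * sin (complex.Im z)))%C.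

Definition piI : C := (0 +i* pi)%C.

(* Unconditional (equivalently, absolute) convergence of a family of complex
   numbers indexed by complex numbers. *)
Definition csum (F : C -> C) (s : C) : Prop :=
  forall eps : C, 0 < eps -> exists J0 : {fset C}, forall J : {fset C},
    (J0 `<=` J)%fset -> `| \sum_(n <- J) F n - s | < eps.

(* A Z/2-grading is encoded by its parity involution. *)
Record superSpace := SuperSpace {
  scar :> lmodType C;
  sg : {linear scar -> scar};
  sgK : forall v, sg (sg v) = v }.

Definition parity (V : superSpace) (a : bool) (v : V) : Prop :=
  sg V v = sgn a *: v.

Definition nonzero (V : lmodType C) : Prop := exists v : V, v <> 0.

Definition spanned_by (V : lmodType C) (P : V -> Prop) (w : V) : Prop :=
  exists s : seq V, (forall x, x \in s -> P x) /\ w = \sum_(x <- s) x.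

Definition finite_dim (V : lmodType C) (P : V -> Prop) : Prop :=
  exists s : seq V, forall w, P w ->
    exists c : nat -> C, w = \sum_(i < size s) c i *: s`_i.

Definition diagonalizable (V : lmodType C) (T : V -> V) : Prop :=
  forall w, spanned_by (fun x => exists a : C, T x = a *: x) w.

Definition gen_eigen (V : lmodType C) (T : V -> V) (a : C) (w : V) : Prop :=
  exists n : nat, iter n (fun x => T x - a *: x) w = 0.

Record lieSuper := LieSuper {
  lcar :> superSpace;
  lbr : lcar -> lcar -> lcar;
  lform : lcar -> lcar -> C }.

Record lieModule (g : lieSuper) := LieModule {
  lmcar :> superSpace;
  lact : g -> lmcar -> lmcar }.

(* [rho a r] is the action of a_r; the central element acts by [k]. *)
Record affine_module (g : lieSuper) (k : C) (M : superSpace)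
    (rho : g -> int -> M -> M) : Prop := AffineModule {
  aff_linl : forall r w, linear (fun a => rho a r w);
  aff_linr : forall a r, linear (rho a r);
  aff_sg : forall a r w, sg M (rho a r w) = rho (sg g a) r (sg M w);
  aff_comm : forall (p q : bool) a b, parity p a -> parity q b ->
    forall r s w,
      rho a r (rho b s w) - sgn (p && q) *: rho b s (rho a r w)
      = rho (lbr a b) (r + s) w
        + (r%:~R * lform a b * (r + s == 0)%:R * k) *: w }.

Record extends_action (g : lieSuper) (U : lieModule g) (M : superSpace)
    (rho : g -> int -> M -> M) (u : {linear U -> M}) : Prop := ExtendsAction {
  ext_sg : forall x, u (sg U x) = sg M (u x);
  ext_zero : forall a x, u (lact a x) = rho a 0 (u x);
  ext_pos : forall a (r : int) x, 0 < r -> rho a r (u x) = 0 }.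

(* M is the level-k module induced from U, i.e. the extension of scalars along
   U(g[t] + C k) -> U(g^), pinned down by its universal property. *)
Definition induced_along (g : lieSuper) (k : C) (U : lieModule g)
    (M : superSpace) (rho : g -> int -> M -> M) (u : {linear U -> M}) : Prop :=
  [/\ affine_module k rho, extends_action rho u &
   forall (M' : superSpace) (rho' : g -> int -> M' -> M') (u' : {linear U -> M'}),
     affine_module k rho' -> extends_action rho' u' ->
     exists f : {linear M -> M'},
       [/\ forall w, f (sg M w) = sg M' (f w),
           forall a r w, f (rho a r w) = rho' a r (f w),
           forall x, f (u x) = u' x &
           forall f' : {linear M -> M'},
             (forall w, f' (sg M w) = sg M' (f' w)) ->
             (forall a r w, f' (rho a r w) = rho' a r (f' w)) ->
             (forall x, f' (u x) = u' x) -> forall w, f' w = f w]].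

(* gl(1|1), in coordinates along the basis N, E, psi^+, psi^-. *)

Definition gl11_diag : 'rV[C]_4 := \row_j sgn (2 <= j)%N.

Lemma gl11_sgK (x : 'rV[C]_4) :
  mulmxr (diag_mx gl11_diag) (mulmxr (diag_mx gl11_diag) x) = x.
Proof.
rewrite /= -mulmxA mulmx_diag (_ : (\row_j _) = const_mx 1).
  by rewrite diag_const_mx mulmx1.
by apply/rowP=> j; rewrite !mxE /sgn; case: (2 <= j)%N; rewrite !(expr0, expr1, mulr1, mulrNN).
Qed.

Definition gl11_sp : superSpace := SuperSpace gl11_sgK.

Definition row4 (a b c d : C) : 'rV[C]_4 :=
  \row_j nth 0 [:: a; b; c; d] j.

Definition gl11 : lieSuper := @LieSuper gl11_sp
  (fun x y : 'rV[C]_4 =>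
     row4 0 (x 0 2 * y 0 3 + x 0 3 * y 0 2)
          (x 0 0 * y 0 2 - x 0 2 * y 0 0)
          (x 0 3 * y 0 0 - x 0 0 * y 0 3))
  (fun x y : 'rV[C]_4 =>
     x 0 0 * y 0 1 + x 0 1 * y 0 0 + x 0 2 * y 0 3 - x 0 3 * y 0 2).

Definition glN : gl11 := row4 1 0 0 0.
Definition glE : gl11 := row4 0 1 0 0.
Definition glp : gl11 := row4 0 0 1 0.
Definition glm : gl11 := row4 0 0 0 1.

Lemma line_sgK (p : bool) (x : C^o) : sgn p *: (sgn p *: x) = x.
Proof. by rewrite scalerA /sgn -expr2 sqrr_sign scale1r. Qed.

Definition line_sp (p : bool) : superSpace :=
  @SuperSpace C^o (GRing.scale (sgn p) : {linear C^o -> C^o}) (line_sgK p).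

(* A_n; the trivial module is A_0 with p = false. *)
Definition glA (n : C) (p : bool) : lieModule gl11 :=
  @LieModule gl11 (line_sp p) (fun (x : 'rV[C]_4) (w : C^o) => (x 0 0 * n) *: w).

Definition verma_diag (p : bool) : 'rV[C]_2 := \row_j sgn (p (+) (j == 1)).

Lemma verma_sgK (p : bool) (x : 'rV[C]_2) :
  mulmxr (diag_mx (verma_diag p)) (mulmxr (diag_mx (verma_diag p)) x) = x.
Proof.
rewrite /= -mulmxA mulmx_diag (_ : (\row_j _) = const_mx 1).
  by rewrite diag_const_mx mulmx1.
by apply/rowP=> j; rewrite !mxE /sgn -expr2 sqrr_sign.
Qed.

Definition verma_sp (p : bool) : superSpace := SuperSpace (verma_sgK p).

Definition row2 (a b : C) : 'rV[C]_2 := \row_j nth 0 [:: a; b] j.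

(* V_{n,e} in the basis v, psi^- v, with v of parity p. *)
Definition glV (n e : C) (p : bool) : lieModule gl11 :=
  @LieModule gl11 (verma_sp p)
    (fun (x : 'rV[C]_4) (w : 'rV[C]_2) =>
       row2 (x 0 0 * (n + 2^-1) * w 0 0 + x 0 1 * e * w 0 0 + x 0 2 * e * w 0 1)
            (x 0 0 * (n - 2^-1) * w 0 1 + x 0 1 * e * w 0 1 + x 0 3 * w 0 0)).

(* sl(2|1): supertraceless matrices, with the supertrace form; the first two
   basis vectors are even and the third is odd. *)

Definition D21 : 'M[C]_3 := diag_mx (\row_j sgn (j == 2)).

Definition str21 (X : 'M[C]_3) : C^o := \tr (D21 *m X).

Definition sgM (X : 'M[C]_3) : 'M[C]_3 := D21 *m X *m D21.

(* [X, Y] = X Y - (-1)^{|X||Y|} Y X, extended bilinearly. *)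
Definition sbr (X Y : 'M[C]_3) : 'M[C]_3 :=
  let odd_part Z := 2^-1 *: (Z - sgM Z) in
  X *m Y - Y *m X + 2 *: (odd_part Y *m odd_part X).

Lemma str21_linear : linear str21.
Proof. by move=> a X Y; rewrite /str21 mulmxDr -scalemxAr mxtraceD mxtraceZ. Qed.
HB.instance Definition _ :=
  GRing.isLinear.Build C 'M[C]_3 C^o *:%R str21 str21_linear.

Definition sl21_vs : {vspace 'M[C]_3} := lker (linfun str21).

Definition sl21_sg (x : subvs_of sl21_vs) : subvs_of sl21_vs :=
  vsproj sl21_vs (sgM (vsval x)).

Lemma sl21_sg_linear : linear sl21_sg.
Proof.
move=> a x y; rewrite /sl21_sg /sgM -linearP /=; congr (vsproj _ _).
by rewrite mulmxDr mulmxDl -scalemxAr -scalemxAl.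
Qed.
HB.instance Definition _ :=
  GRing.isLinear.Build C (subvs_of sl21_vs) (subvs_of sl21_vs) *:%R
    sl21_sg sl21_sg_linear.

Lemma D21K : D21 *m D21 = 1%:M.
Proof.
rewrite /D21 mulmx_diag (_ : (\row_j _) = const_mx 1) ?diag_const_mx //.
by apply/rowP=> j; rewrite !mxE /sgn -expr2 sqrr_sign.
Qed.

Lemma sl21_sgK (x : subvs_of sl21_vs) : sl21_sg (sl21_sg x) = x.
Proof.
rewrite /sl21_sg vsprojK.
  by rewrite /sgM !mulmxA D21K mul1mx -mulmxA D21K mulmx1 vsvalK.
have := subvsP x; rewrite !memv_ker !lfunE /= => /eqP xP; apply/eqP.
by rewrite /str21 /sgM !mulmxA D21K mul1mx mxtrace_mulC.
Qed.

Definition sl21_sp : superSpace := SuperSpace sl21_sgK.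

Definition sl21 : lieSuper := @LieSuper sl21_sp
  (fun x y : subvs_of sl21_vs => vsproj sl21_vs (sbr (vsval x) (vsval y)))
  (fun x y : subvs_of sl21_vs => str21 (vsval x *m vsval y)).

(* Component form of the Jacobi identity for [Y : W1 (x) W2 -> W3] of parity
   [p], with exponents of the formal variable in [K] (int for module actions,
   R[i] for intertwining operators); [Y w h] is the coefficient of x^(-h-1). *)
Definition jacobi (V W1 W2 W3 : superSpace) (K : comNzRingType)
    (a1 : V -> int -> W1 -> W1) (a2 : V -> int -> W2 -> W2)
    (a3 : V -> int -> W3 -> W3) (p : bool) (Y : W1 -> K -> W2 -> W3) : Prop :=
  forall (a b : bool) (v : V) (w1 : W1), parity a v -> parity b w1 ->
  forall (w2 : W2) (m n : int) (h : K),
    \sum_(i \in [set: nat])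
      gbinom m i *: Y (a1 v (n + i%:Z) w1) (m%:~R + h - i%:R) w2
    = \sum_(i \in [set: nat])
      ((-1) ^+ i * gbinom n i) *:
        (sgn (p && a) *: a3 v (m + n - i%:Z) (Y w1 (h + i%:R) w2)
         - ((-1) ^ n * sgn (a && b)) *:
             Y w1 (n%:~R + h - i%:R) (a2 v (m + i%:Z) w2)).

(* Vertex operator superalgebras; [vprod u n v] is the n-th product u_n v. *)
Record vosa := Vosa {
  vsp :> superSpace;
  vac : vsp;
  omega : vsp;
  vprod : vsp -> int -> vsp -> vsp;
  vprod_linl : forall n v, linear (fun u => vprod u n v);
  vprod_linr : forall u n, linear (vprod u n);
  vprod_sg : forall u n v, sg vsp (vprod u n v) = vprod (sg vsp u) n (sg vsp v);
  vprod_trunc : forall u v, exists N : nat, forall n : int, N%:Z <= n ->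
    vprod u n v = 0;
  vac_even : sg vsp vac = vac;
  vac_prod : forall n v, vprod vac n v = if n == -1 then v else 0;
  vac_create : forall u, vprod u (-1) vac = u;
  vac_create0 : forall u (n : int), 0 <= n -> vprod u n vac = 0;
  vprod_jacobi : jacobi vprod vprod vprod false vprod;
  omega_even : sg vsp omega = omega;
  omega_virasoro : exists c : C, forall (m n : int) v,
    vprod omega (m + 1) (vprod omega (n + 1) v)
    - vprod omega (n + 1) (vprod omega (m + 1) v)
    = (m - n)%:~R *: vprod omega (m + n + 1) v
      + ((m ^+ 3 - m)%:~R / 12 * (m + n == 0)%:R * c) *: v;
  omega_deriv : forall v, vprod omega 0 v = vprod v (-2) vac;
  omega_grading : forall v, spanned_by
    (fun x => exists z : int, vprod omega 1 x = (z%:~R / 2) *: x) v;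
  omega_finite : forall a : C, finite_dim (fun x => vprod omega 1 x = a *: x);
  omega_lower : exists N : int, forall (z : int) x,
    vprod omega 1 x = (z%:~R / 2) *: x -> z <= N -> x = 0 }.

Record vosaHom (V A : vosa) := VosaHom {
  vhom :> {linear V -> A};
  vhom_sg : forall v, vhom (sg V v) = sg A (vhom v);
  vhom_prod : forall u n v, vhom (vprod u n v) = vprod (vhom u) n (vhom v);
  vhom_vac : vhom (vac V) = vac A;
  vhom_omega : vhom (omega V) = omega A }.

(* Weak modules: no grading condition. *)

Record vmod (V : vosa) := Vmod {
  wsp :> superSpace;
  act : V -> int -> wsp -> wsp;
  act_linl : forall n w, linear (fun v => act v n w);
  act_linr : forall v n, linear (act v n);
  act_sg : forall v n w, sg wsp (act v n w) = act (sg V v) n (sg wsp w);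
  act_trunc : forall v w, exists N : nat, forall n : int, N%:Z <= n ->
    act v n w = 0;
  act_vac : forall n w, act (vac V) n w = if n == -1 then w else 0;
  act_jacobi : jacobi (@vprod V) act act false act }.

Arguments act {V} W v n w : rename.

Definition Lop (V : vosa) (W : vmod V) (n : int) : W -> W :=
  act W (omega V) (n + 1).

Definition vself (V : vosa) : vmod V :=
  @Vmod V V (@vprod V) (@vprod_linl V) (@vprod_linr V) (@vprod_sg V)
    (@vprod_trunc V) (@vac_prod V) (@vprod_jacobi V).

(* Restriction of the adjoint module of A along j : V -> A. *)
Section Restriction.
Variables (V A : vosa) (j : vosaHom V A).
Let ract (v : V) n (a : A) := vprod (j v) n a.

Lemma ract_linl n w : linear (fun v => ract v n w).
Proof. by move=> c u v; rewrite /ract linearP vprod_linl. Qed.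
Lemma ract_sg v n w : sg A (ract v n w) = ract (sg V v) n (sg A w).
Proof. by rewrite /ract vprod_sg vhom_sg. Qed.
Lemma ract_vac n w : ract (vac V) n w = if n == -1 then w else 0.
Proof. by rewrite /ract vhom_vac vac_prod. Qed.
Lemma vhom_parity a v : parity a v -> parity a (j v).
Proof. by rewrite /parity -vhom_sg => ->; rewrite linearZ. Qed.
Lemma ract_jacobi : jacobi (@vprod V) ract ract false ract.
Proof.
move=> a b v w1 av bw1 w2 m n h.
rewrite -(vprod_jacobi (vhom_parity av) (vhom_parity bw1)).
by under eq_fsbigr do rewrite /ract vhom_prod.
Qed.

Definition vres : vmod V :=
  @Vmod V A ract ract_linl (fun v => @vprod_linr A (j v)) ract_sg
    (fun v => @vprod_trunc A (j v)) ract_vac ract_jacobi.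
End Restriction.

(* Homomorphisms of parity p. *)

Record shom (V : vosa) (p : bool) (W1 W2 : vmod V) := Shom {
  shf :> {linear W1 -> W2};
  shf_sg : forall w, sg W2 (shf w) = sgn p *: shf (sg W1 w);
  shf_act : forall a v n w, parity a v ->
    shf (act W1 v n w) = sgn (p && a) *: act W2 v n (shf w) }.

Definition iso (V : vosa) (W1 W2 : vmod V) : Prop :=
  exists (p : bool) (f : shom p W1 W2), bijective f.

Section Identity.
Variables (V : vosa) (W : vmod V).
Lemma shid_sg (w : W) : sg W (idfun w) = sgn false *: idfun (sg W w).
Proof. by rewrite /sgn expr0 scale1r. Qed.
Lemma shid_act a v n (w : W) : parity a v ->
  idfun (act W v n w) = sgn (false && a) *: act W v n (idfun w).
Proof. by rewrite /sgn expr0 scale1r. Qed.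
Definition shid : shom false W W :=
  @Shom V false W W (idfun : {linear W -> W}) shid_sg shid_act.
End Identity.

Section Composition.
Variables (V : vosa) (W1 W2 W3 : vmod V).
Variables (f : shom false W2 W3) (g : shom false W1 W2).
Let fg : {linear W1 -> W3} := f \o g.
Lemma shcomp_sg (w : W1) : sg W3 (fg w) = sgn false *: fg (sg W1 w).
Proof. by rewrite /fg /= shf_sg !(shf_sg g) /sgn !expr0 !scale1r. Qed.
Lemma shcomp_act a v n (w : W1) : parity a v ->
  fg (act W1 v n w) = sgn (false && a) *: act W3 v n (fg w).
Proof.
move=> av; rewrite /fg /= (shf_act g _ _ av) /= /sgn !expr0 !scale1r.
by rewrite (shf_act f _ _ av) /= /sgn expr0 scale1r.
Qed.
Definition shcomp : shom false W1 W3 := @Shom V false W1 W3 fg shcomp_sg shcomp_act.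
End Composition.

Section Inclusion.
Variables (V A : vosa) (j : vosaHom V A).
Lemma vinc_sg (v : vself V) : sg (vres j) (j v) = sgn false *: j (sg (vself V) v).
Proof. by rewrite /sgn expr0 scale1r vhom_sg. Qed.
Lemma vinc_act a v n (w : vself V) : parity a v ->
  j (act (vself V) v n w) = sgn (false && a) *: act (vres j) v n (j w).
Proof. by move=> _; rewrite /sgn expr0 scale1r vhom_prod. Qed.
Definition vinc : shom false (vself V) (vres j) :=
  @Shom V false (vself V) (vres j) (vhom j) vinc_sg vinc_act.
End Inclusion.

Record submodule (V : vosa) (W : vmod V) (U : W -> Prop) : Prop := Submodule {
  submod0 : U 0;
  submodP : forall (c : C) x y, U x -> U y -> U (c *: x + y);
  submod_sg : forall x, U x -> U (sg W x);
  submod_act : forall v n x, U x -> U (act W v n x) }.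

Definition irreducible (V : vosa) (W : vmod V) : Prop :=
  nonzero W /\ forall U : W -> Prop, submodule U ->
    (forall x, U x -> x = 0) \/ (forall x, U x).

Definition finite_length (V : vosa) (W : vmod V) : Prop :=
  exists (n : nat) (U : nat -> W -> Prop),
    [/\ forall i, (i <= n)%N -> submodule (U i),
        forall x, U 0%N x <-> x = 0,
        forall x, U n x &
        forall i, (i < n)%N ->
          [/\ forall x, U i x -> U i.+1 x,
              exists x, U i.+1 x /\ ~ U i x &
              forall U' : W -> Prop, submodule U' ->
                (forall x, U i x -> U' x) -> (forall x, U' x -> U i.+1 x) ->
                (forall x, U' x -> U i x) \/ (forall x, U i.+1 x -> U' x)]].

Definition weight_space (V : vosa) (W : vmod V) (h : C) (w : W) : Prop :=
  gen_eigen (Lop (W := W) 0) h w.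

Definition generalized (V : vosa) (W : vmod V) : Prop :=
  forall w : W, spanned_by (fun x => exists h, weight_space h x) w.

Definition grading_restricted (V : vosa) (W : vmod V) : Prop :=
  [/\ generalized W,
      forall h, finite_dim (weight_space (W := W) h) &
      forall h, exists N : nat, forall n : nat, (N <= n)%N ->
        forall w : W, weight_space (h - n%:R) w -> w = 0].

Definition zero_mode (V : vosa) (g : lieSuper) (J : {linear g -> V})
    (W : vmod V) (a : g) : W -> W := act W (J a) 0.

(* J a is the vector a_{-1} 1, whose modes are the a_r. *)
Record is_V1gl11 (V : vosa) (J : {linear gl11 -> V}) : Prop := IsV1gl11 {
  V1_induced : exists u : {linear glA 0 false -> V},
    u (1 : C^o) = vac V /\
    induced_along (g := gl11) 1 (fun a r => vprod (J a) r) u;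
  V1_omega : omega V =
    2^-1 *: (vprod (J glN) (-1) (J glE) + vprod (J glE) (-1) (J glN)
             - vprod (J glp) (-1) (J glm) + vprod (J glm) (-1) (J glp))
    + 2^-1 *: vprod (J glE) (-1) (J glE) }.

(* L_k(g): generated by the currents at level k, and simple; the conformal
   vector is the one for which the currents are primary of weight 1, i.e. the
   Sugawara vector. *)
Record is_simple_affine (g : lieSuper) (k : C) (A : vosa)
    (J : {linear g -> A}) : Prop := IsSimpleAffine {
  aff_modes : affine_module k (fun a r => vprod (J a) r);
  aff_generated : forall U : A -> Prop, U (vac A) ->
    (forall (c : C) x y, U x -> U y -> U (c *: x + y)) ->
    (forall a r x, U x -> U (vprod (J a) r x)) -> forall x, U x;
  aff_simple : irreducible (vself A);
  aff_weight1 : forall a, vprod (omega A) 1 (J a) = J a;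
  aff_primary : forall a (n : int), 1 < n -> vprod (omega A) n (J a) = 0 }.

Section Categories.
Variables (V : vosa) (J : {linear gl11 -> V}).

Definition induced_from (W : vmod V) (U : lieModule gl11) : Prop :=
  exists u : {linear U -> W}, induced_along 1 (fun a r => act W (J a) r) u.

(* The parity of the highest-weight vector is left free, here and in A_n. *)
Definition is_Vhat (n e : C) (W : vmod V) : Prop :=
  exists p : bool, induced_from W (glV n e p).

Definition is_Ahat (n : C) (l : int) (W : vmod V) : Prop :=
  if l == 0 then exists p : bool, induced_from W (glA n p)
  else irreducible W /\
       exists (M : vmod V) (p : bool) (f : shom p M W),
         is_Vhat n l%:~R M /\ forall w, exists x, f x = w.

Definition Ofin (W : vmod V) : Prop :=
  [/\ grading_restricted W, finite_length W,
      diagonalizable (zero_mode J (W := W) glN) &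
      diagonalizable (zero_mode J (W := W) glE)].

Definition IndO (W : vmod V) : Prop :=
  generalized W /\
  forall w : W, exists (U : vmod V) (i : shom false U W),
    [/\ Ofin U, injective i & exists u, i u = w].

(* Internal direct sum decomposition W = (+)_m (image of M m). *)
Definition is_direct_sum (W : vmod V) (M : int -> vmod V) : Prop :=
  exists (p : int -> bool) (i : forall m, shom (p m) (M m) W),
  forall w : W, exists! x : forall m, M m,
    finite_set [set m | x m <> 0] /\
    w = \sum_(m \in [set: int]) i m (x m).

Definition epsilon (m : int) : C := (Num.sg m)%:~R / 2.

(* \hat A_{m - eps(m), -2m} *)
Definition is_current (m : int) (W : vmod V) : Prop :=
  is_Ahat (m%:~R - epsilon m) (- (m *+ 2)) W.

Definition is_sl21_extension (A : vosa) (j : vosaHom V A) : Prop :=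
  exists M : int -> vmod V,
    (forall m, is_current m (M m)) /\ is_direct_sum (vres j) M.

End Categories.

(* [lfun w1 h k w2] is the coefficient of x^(-h-1) (log x)^k in Y(w1, x) w2. *)
Record intw (V : vosa) (p : bool) (W1 W2 W3 : vmod V) := Intw {
  lfun :> W1 -> C -> nat -> W2 -> W3;
  lfun_linl : forall h k w2, linear (fun w1 => lfun w1 h k w2);
  lfun_linr : forall w1 h k, linear (lfun w1 h k);
  lfun_sg : forall w1 h k w2, sg W3 (lfun w1 h k w2) =
    sgn p *: lfun (sg W1 w1) h k (sg W2 w2);
  lfun_log : forall w1 h w2, exists K : nat, forall k, (K <= k)%N ->
    lfun w1 h k w2 = 0;
  lfun_trunc : forall w1 h w2, exists N : nat, forall n k, (N <= n)%N ->
    lfun w1 (h + n%:R) k w2 = 0;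
  lfun_jacobi : forall k : nat,
    jacobi (act W1) (act W2) (act W3) p (fun w1 h w2 => lfun w1 h k w2);
  lfun_deriv : forall w1 h k w2, lfun (Lop (W := W1) (-1) w1) h k w2 =
    - h *: lfun w1 (h - 1) k w2 + k.+1%:R *: lfun w1 (h - 1) k.+1 w2 }.

(* Weight-h component of Y(w1, r) w2, r > 0, for w1, w2 of generalized
   conformal weights h1, h2, with the real branch of log r: only the exponent
   h - h1 - h2 of x contributes. *)
Definition icomp (V : vosa) p (W1 W2 W3 : vmod V) (Y : intw p W1 W2 W3)
    (r : R) (h1 h2 h : C) (w1 : W1) (w2 : W2) : W3 :=
  \sum_(k \in [set: nat])
    ((ln r)%:C%C ^+ k * cexp ((h - h1 - h2) * (ln r)%:C%C)) *:
      Y w1 (h1 + h2 - h - 1) k w2.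

Record vtensor (V : vosa) (Cat : vmod V -> Prop) := Vtensor {
  tens : vmod V -> vmod V -> vmod V;
  tens_cat : forall W1 W2, Cat W1 -> Cat W2 -> Cat (tens W1 W2);
  tY : forall W1 W2, intw false W1 W2 (tens W1 W2);
  tens_univ : forall W1 W2 W3 p (I : intw p W1 W2 W3),
    Cat W1 -> Cat W2 -> Cat W3 ->
    exists f : shom p (tens W1 W2) W3,
      (forall w1 h k w2, f (tY W1 W2 w1 h k w2) = I w1 h k w2) /\
      (forall f' : shom p (tens W1 W2) W3,
         (forall w1 h k w2, f' (tY W1 W2 w1 h k w2) = I w1 h k w2) ->
         forall x, f' x = f x);
  tmor : forall W1 W2 W1' W2' p q, shom p W1 W1' -> shom q W2 W2' ->
    shom (p (+) q) (tens W1 W2) (tens W1' W2');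
  tmorE : forall W1 W2 W1' W2' p q (f : shom p W1 W1') (g : shom q W2 W2'),
    Cat W1 -> Cat W2 -> Cat W1' -> Cat W2' ->
    forall a w1 h k w2, parity a w1 ->
      tmor f g (tY W1 W2 w1 h k w2) = sgn (q && a) *: tY W1' W2' (f w1) h k (g w2);
  (* left unit: Y(v, x) w |-> Y_W(v, x) w *)
  lunit : forall W, shom false (tens (vself V) W) W;
  lunitE : forall W, Cat (vself V) -> Cat W -> forall v w,
    (forall n : int, lunit W (tY (vself V) W v n%:~R 0 w) = act W v n w) /\
    (forall h k, (forall n : int, h <> n%:~R) \/ k <> 0%N ->
       lunit W (tY (vself V) W v h k w) = 0);
  (* braiding: Y(w1, x) w2 |->
       (-1)^{|w1||w2|} e^{x L(-1)} Y(w2, e^{pi i} x) w1 *)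
  braid : forall W1 W2, shom false (tens W1 W2) (tens W2 W1);
  braidE : forall W1 W2, Cat W1 -> Cat W2 ->
    forall a b w1 h k w2, parity a w1 -> parity b w2 ->
      braid W1 W2 (tY W1 W2 w1 h k w2) =
      sgn (a && b) *: \sum_(j \in [set: nat]) (j`!%:R)^-1 *:
        iter j (Lop (W := tens W2 W1) (-1))
          (\sum_(l \in [set: nat])
             ('C(k + l, l)%:R * piI ^+ l * cexp (piI * (- h - j%:R - 1))) *:
               tY W2 W1 w2 (h + j%:R) (k + l) w1);
  (* associativity: Y(w1, r1) Y(w2, r2) w3 |-> Y(Y(w1, r1 - r2) w2, r2) w3 for
     real r1 > r2 > r1 - r2 > 0, as an equality of absolutely convergent sums
     over the intermediate conformal weight, tested on functionals of each
     weight space of the target *)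
  assoc : forall W1 W2 W3,
    shom false (tens W1 (tens W2 W3)) (tens (tens W1 W2) W3);
  assocE : forall W1 W2 W3, Cat W1 -> Cat W2 -> Cat W3 ->
    forall (r1 r2 : R), 0 < r1 - r2 -> r1 - r2 < r2 -> r2 < r1 ->
    forall h1 h2 h3 w1 w2 w3, weight_space (W := W1) h1 w1 ->
      weight_space (W := W2) h2 w2 -> weight_space (W := W3) h3 w3 ->
    forall (h : C) (phi : {linear tens (tens W1 W2) W3 -> C^o}),
    exists s : C,
      csum (fun n => phi (assoc W1 W2 W3
        (icomp (tY W1 (tens W2 W3)) r1 h1 n h w1
           (icomp (tY W2 W3) r2 h2 h3 n w2 w3)))) s /\
      csum (fun n => phi
        (icomp (tY (tens W1 W2) W3) r2 n h3 h
           (icomp (tY W1 W2) (r1 - r2) h1 h2 n w1 w2) w3)) s }.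

Section Rep.
Variables (V A : vosa) (j : vosaHom V A) (Cat : vmod V -> Prop).
Variable T : vtensor Cat.
Local Notation "W1 ** W2" := (tens T W1 W2) (at level 40).
Local Notation AV := (vres j).

(* The multiplication of A as a morphism, induced by its vertex operator. *)
Definition is_multiplication (mu : shom false (AV ** AV) AV) : Prop :=
  forall a b : A,
    (forall n : int, mu (tY T AV AV a n%:~R 0 b) = vprod a n b) /\
    (forall h k, (forall n : int, h <> n%:~R) \/ k <> 0%N ->
       mu (tY T AV AV a h k b) = 0).

Variable mu : shom false (AV ** AV) AV.

Record algMod := AlgMod {
  amod :> vmod V;
  amu : shom false (AV ** amod) amod }.

Record isRep (X : algMod) : Prop := IsRep {
  rep_cat : Cat X;
  rep_assoc : forall x : AV ** (AV ** X),
    amu X (tmor T (shid AV) (amu X) x)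
    = amu X (tmor T mu (shid X) (assoc T AV AV X x));
  rep_unit : forall x : vself V ** X,
    amu X (tmor T (vinc j) (shid X) x) = lunit T X x }.

Definition isRep0 (X : algMod) : Prop :=
  isRep X /\
  forall x : AV ** X, amu X (braid T X AV (braid T AV X x)) = amu X x.

Definition rep_hom p (X Y : algMod) (f : shom p X Y) : Prop :=
  forall x : AV ** X, f (amu X x) = amu Y (tmor T (shid AV) f x).

Definition rep_iso (X Y : algMod) : Prop :=
  exists (p : bool) (f : shom p X Y), rep_hom f /\ bijective f.

(* Subobjects are taken in Rep^0, up to (even or odd) isomorphism. *)
Definition simple_Rep0 (X : algMod) : Prop :=
  [/\ isRep0 X, nonzero X &
   forall (Z : algMod) p (f : shom p Z X), isRep0 Z -> rep_hom f ->
     injective f -> ~ nonzero Z \/ bijective f].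

Definition induce (S : vmod V) : algMod :=
  @AlgMod (AV ** S) (shcomp (tmor T mu (shid S)) (assoc T AV AV S)).

End Rep.

Definition listed (V : vosa) (J : {linear gl11 -> V}) (S : vmod V) : Prop :=
  (exists (n : C) (l : int),
     (exists a : int, n = a%:~R / 2) /\ is_Ahat J n l S) \/
  (exists n e : C,
     [/\ forall z : int, e <> z%:~R,
         exists z : int, 2 * n + e = z%:~R &
         is_Vhat J n e S]).

End Defs.

(* Main.v *)
(* Write alpha := - 2 N - E, so that kappa(alpha, alpha) = 4.  The simple
   current of index m contains a vector e_m, a spectral flow of the vacuum, with
   L_{-1} e_m = m alpha_{-1} e_m.  Hence, for every logarithmic intertwining
   operator Y and every w with alpha_0 w = lambda w and alpha_r w = 0 for r > 0,
   the series Y(e_m, x) w has no logarithms, its exponents are m lambda + i with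
   i a natural number, and its coefficients are determined by the leading one,
   written e_m . w.  Leading coefficients of generating vectors generate a tensor
   product, because Ind(O^fin) is closed under submodules; so morphisms out of
   tensor products can be compared on them.  In the lowest conformal weight the
   associativity axiom becomes an identity between two binomial series, and says
   that the associator maps e_m . (e_m' . w) to (e_m . e_m') . w; the double
   braiding multiplies e_m . w by exp(2 pi i m lambda), so that locality means
   that lambda is an integer.

   If S is simple with highest-weight vector s of integral charge lambda, then
   F(S) is local and is generated over V_1(gl(1|1)) by the vectors e_m . s, which
   have distinct E_0-eigenvalues.  As e_m . e_{-m} is a nonzero multiple of the
   vacuum, multiplying a highest-weight vector of a nonzero subobject of F(S) by a
   suitable e_m gives a nonzero vector of the E_0-eigenspace S of F(S).  This makes
   F(S) simple, and makes a morphism out of F(S) injective as soon as it is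
   nonzero on S.  Conversely a simple local X contains some simple S, and the
   induced map F(S) -> X is bijective.  An isomorphism of F(S') with F(S)
   identifies S' with an E_0-eigenspace of F(S), which is S tensored with a
   simple current. *)
From HB Require Import structures.
From mathcomp Require Import all_boot all_order all_algebra finmap.
From mathcomp Require Import complex.
From mathcomp Require Import boolp classical_sets functions cardinality fsbigop.
From mathcomp Require Import reals sequences exp trigo.
From mathcomp Require Import zify ring lra.
Require Import Defs.

Set Implicit Arguments.
Unset Strict Implicit.
Unset Printing Implicit Defensive.

Import Order.TTheory GRing.Theory Num.Theory.
Local Open Scope ring_scope.

(** * Binomial coefficients and finite sums *)

(** The modules of the statement are pinned down by universal properties, which do not say that they
    are nonzero or simple. Much of the proof therefore builds modules. A smooth level-one module of
    the affine algebra becomes a module of V because left products by the currents make the space of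
    fields on it an affine module, so that the universal property of V supplies the state-field map.
    The Verma module of arbitrary energy is nonzero by interpolation from integral energies, where
    spectral flows of V itself are models. Homomorphisms between highest-weight modules are obtained
    as graphs inside direct sums.

    Associativity is used in two forms. For integral charge both binomial series are powers and the
    associator is computed exactly. The charge of a highest-weight vector in an arbitrary X is not
    known to be integral beforehand; there only a weak consequence is available, that e_m . w is
    nonzero for w nonzero, and this is what turns locality into integrality. *)

Section Binomials.
Variable R : realType.
Local Notation C := (R[i]).
Local Notation sgn := (sgn R).

Lemma sgn0 : sgn false = 1. Proof. by rewrite /sgn expr0. Qed.
Lemma sgn1 : sgn true = -1. Proof. by rewrite /sgn expr1. Qed.
Lemma sgnK a : sgn a * sgn a = 1.
Proof. by rewrite /sgn -expr2 sqrr_sign. Qed.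
Lemma sgn_addb a b : sgn (a (+) b) = sgn a * sgn b.
Proof. by rewrite /sgn signr_addb. Qed.
Lemma sgn_neq0 a : sgn a != 0.
Proof. by rewrite /sgn signr_eq0. Qed.

Definition cbin (z : C) (i : nat) : C := (\prod_(j < i) (z - j%:R)) / i`!%:R.

Lemma gbinomE m i : gbinom R m i = cbin m%:~R i.
Proof. by []. Qed.

Lemma natC_neq0 n : n.+1%:R != 0 :> C.
Proof. by rewrite pnatr_eq0. Qed.

Lemma cbin0 z : cbin z 0 = 1.
Proof. by rewrite /cbin big_ord0 fact0 divr1. Qed.

Lemma cbinS z i : i.+1%:R * cbin z i.+1 = (z - i%:R) * cbin z i.
Proof.
rewrite /cbin big_ord_recr /= factS natrM.
have h1 := natC_neq0 i; have h2 : i`!%:R != 0 :> C by rewrite pnatr_eq0 -lt0n fact_gt0.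
field; rewrite h2 /=; move: h1; rewrite -natr1 addrC //.
Qed.

Lemma cbinP z i : cbin (z + 1) i.+1 = cbin z i.+1 + cbin z i.
Proof.
elim: i => [|i IH].
  have e w : cbin w 1 = w.
    by have := cbinS w 0; rewrite cbin0 mul1r subr0 mulr1.
  by rewrite !e cbin0.
apply: (mulfI (natC_neq0 i.+1)).
rewrite cbinS IH [RHS]mulrDr cbinS.
have e := cbinS z i.
rewrite (_ : z + 1 - i.+1%:R = z - i%:R); last by rewrite -natr1; ring.
rewrite mulrDr -e -!natr1; ring.
Qed.

Lemma cbin_nat n i : cbin n%:R i = 'C(n, i)%:R.
Proof.
elim: n i => [|n IH] [|i]; rewrite ?cbin0 ?bin0 //.
  by rewrite /cbin big_ord_recl /= subrr mul0r mul0r bin0n.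
by rewrite -natr1 cbinP !IH binS natrD addrC addrC.
Qed.

Lemma cbin0n i : cbin 0 i = (i == 0)%:R.
Proof. by rewrite (cbin_nat 0) bin0n. Qed.

Lemma cbinN1 i : cbin (-1) i = (-1) ^+ i.
Proof.
elim: i => [|i IH]; first by rewrite cbin0.
apply: (mulfI (natC_neq0 i)); rewrite cbinS IH exprS -natr1; ring.
Qed.

(** Both sides are the falling factorial of z of length i + s divided by i! s!. *)
Lemma cbin_tri z i s : cbin z i * cbin (z - i%:R) s = cbin z s * cbin (z - s%:R) i.
Proof.
have ff k l : \prod_(j < k + l) (z - j%:R) =
    (\prod_(j < k) (z - j%:R)) * \prod_(j < l) (z - k%:R - j%:R) :> C.
  rewrite big_split_ord /=; congr (_ * _); apply: eq_bigr => j _.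
  by rewrite natrD opprD addrA.
rewrite /cbin mulrACA -ff mulrACA -ff (addnC s).
by congr (_ * _); rewrite mulrC.
Qed.

(** After multiplication by t + 1, split as i + (t + 1 - i) in each summand, the recursion [cbinS]
    makes an induction on t work for complex x and y. *)
Lemma vandermonde x y t :
  \sum_(i < t.+1) cbin x i * cbin y (t - i) = cbin (x + y) t.
Proof.
elim: t => [|t IH]; first by rewrite big_ord1 !cbin0 mulr1.
apply: (mulfI (natC_neq0 t)); rewrite cbinS -IH !mulr_sumr.
transitivity (\sum_(i < t.+1) (i.+1%:R * (cbin x i.+1 * cbin y (t - i)))
   + \sum_(i < t.+1) ((t - i).+1%:R * (cbin x i * cbin y (t - i).+1))); last first.
  rewrite -big_split /=; apply: eq_bigr => i _.
  rewrite [i.+1%:R * _]mulrA cbinS [(t - i).+1%:R * _]mulrCA cbinS.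
  rewrite (_ : x + y - t%:R = (x - i%:R) + (y - (t - i)%:R)); first by ring.
  by rewrite natrB; [ring | rewrite -ltnS].
transitivity (\sum_(i < t.+2) (i%:R * (cbin x i * cbin y (t.+1 - i)))
   + \sum_(i < t.+2) ((t.+1 - i)%:R * (cbin x i * cbin y (t.+1 - i)))).
  rewrite -big_split /=; apply: eq_bigr => i _.
  by rewrite -mulrDl -natrD subnKC // -ltnS.
congr (_ + _).
  by rewrite big_ord_recl mul0r add0r.
rewrite big_ord_recr /= subnn mul0r addr0; apply: eq_bigr => i _.
by rewrite subSn // -ltnS.
Qed.

End Binomials.

Section FinSums.
Variable R : realType.
Local Notation C := (R[i]).

Lemma fsumE (W : nmodType) (F : nat -> W) N :
  (forall i, (N <= i)%N -> F i = 0) ->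
  \sum_(i \in [set: nat]) F i = \sum_(i < N) F i.
Proof.
move=> H; rewrite (fsbigE (iota 0 N)) ?iota_uniq //.
  have -> : iota 0 N = index_iota 0 N by rewrite /index_iota subn0.
  by rewrite big_mkord; apply: eq_bigl => i; rewrite classical_sets.in_setT.
by move=> i _; rewrite mem_iota /= add0n -leqNgt => /H.
Qed.

Lemma sum_widen (W : nmodType) (F : nat -> W) N M :
  (N <= M)%N -> (forall i, (N <= i)%N -> F i = 0) ->
  \sum_(i < M) F i = \sum_(i < N) F i.
Proof.
move=> NM H; rewrite -(subnKC NM) big_split_ord /= [X in _ + X]big1 ?addr0 //.
by move=> i _; apply: H; rewrite leq_addr.
Qed.

Lemma sum_delta (W : nmodType) (F : nat -> W) N k : (k < N)%N ->
  (forall i, i <> k -> F i = 0) -> \sum_(i < N) F i = F k.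
Proof.
move=> kN H; rewrite (bigD1 (Ordinal kN)) //= big1 ?addr0 // => i /eqP ik.
by apply: H => e; apply: ik; apply: val_inj.
Qed.

Lemma sum_diag (W : nmodType) (F : nat -> nat -> W) N :
  (forall i j, (N <= i + j)%N -> F i j = 0) ->
  \sum_(i < N) \sum_(j < N) F i j = \sum_(t < N) \sum_(i < t.+1) F i (t - i)%N.
Proof.
move=> H.
transitivity (\sum_(i < N) \sum_(t < N | (i <= t)%N) F i (t - i)%N).
  apply: eq_bigr => i _.
  transitivity (\sum_(j < N - i) F i j).
    by apply: sum_widen; [lia | move=> j hj; apply: H; lia].
  rewrite -(big_mkord xpredT) -[RHS](big_mkord (fun t => (i <= t)%N) (fun t => F i (t - i)%N)).
  have iN : (i <= N)%N by apply: ltnW.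
  rewrite [RHS](big_cat_nat (n := i)) //=.
  rewrite [X in _ = _ + X]big_nat_cond [X in X + _]big_nat_cond.
  rewrite [X in _ = X + _]big_pred0; last by move=> t; lia.
  rewrite add0r.
  have := big_addn 0 N i (fun t => (i <= t < N)%N && (i <= t)%N) (fun t => F i (t - i)%N).
  rewrite add0n => ->; rewrite [LHS]big_nat_cond [RHS]big_nat_cond.
  by apply: congr_big => // t; [lia | rewrite addnK].
rewrite (exchange_big_dep predT) //=; apply: eq_bigr => t _.
by rewrite [RHS](big_ord_widen N (fun i => F i (t - i)%N)) //.
Qed.

End FinSums.

(** * Subspaces stable under the parity involution *)

Section SubSpace.
Variable R : realType.
Local Notation C := (R[i]).
Variables (M : superSpace R) (P : M -> Prop).
Record subsp : Prop := Subsp {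
  subsp0 : P 0;
  subspP : forall (c : C) x y, P x -> P y -> P (c *: x + y);
  subsp_sg : forall x, P x -> P (sg M x) }.
Hypothesis h : subsp.
(** The closure proof is an argument of the predicate, so that structure inference can recover it
    from the predicate alone. *)
Definition sspred (_ : subsp) : {pred M} := fun x => `[<P x>].
Lemma sspredP x : reflect (P x) (x \in sspred h).
Proof. exact: asboolP. Qed.
Lemma sspred_closed : submod_closed (sspred h).
Proof.
split; first by apply/sspredP/(subsp0 h).
by move=> c x y /sspredP hx /sspredP hy; apply/sspredP/(subspP h).
Qed.
HB.instance Definition _ := GRing.isSubmodClosed.Build C M (sspred h) sspred_closed.
Definition ssT := {x : M | x \in sspred h}.
HB.instance Definition _ := SubChoice.on ssT.
HB.instance Definition _ := [SubChoice_isSubLmodule of ssT by <:].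
Lemma ssT_valP (x : ssT) : P (val x).
Proof. exact/sspredP/valP. Qed.
Definition ssmk x (px : P x) : ssT := exist _ x (introT (sspredP x) px).
Definition ss_sg (x : ssT) : ssT := ssmk (subsp_sg h (ssT_valP x)).
Lemma ss_sg_linear : linear ss_sg.
Proof. by move=> c x y; apply: val_inj; rewrite /= linearP. Qed.
HB.instance Definition _ := GRing.isLinear.Build C ssT ssT *:%R ss_sg ss_sg_linear.
Lemma ss_sgK x : ss_sg (ss_sg x) = x.
Proof. by apply: val_inj; rewrite /= sgK. Qed.
Definition subSuper : superSpace R := SuperSpace ss_sgK.
Lemma ssval_linear : linear (val : subSuper -> M).
Proof. by []. Qed.
HB.instance Definition _ := GRing.isLinear.Build C subSuper M *:%R (val : subSuper -> M) ssval_linear.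
Definition ssval : {linear subSuper -> M} := (val : subSuper -> M).
End SubSpace.

HB.instance Definition _ (R : realType) (V : vosa R) (W : vmod V) (v : V) n :=
  GRing.isLinear.Build R[i] W W *:%R (act (v0 := W) v n) (act_linr v n).
HB.instance Definition _ (R : realType) (V : vosa R) (v : V) n :=
  GRing.isLinear.Build R[i] V V *:%R (vprod v n) (vprod_linr v n).

(** * Operators satisfying the Jacobi identity *)

Section Jop.
Variable R : realType.
Local Notation C := (R[i]).
Local Notation sgn := (sgn R).

(** The Koszul sign of an element of parity a passing x, as an operator: on x of parity b it is
    (-1)^(ab). It lets super-identities be stated for vectors x that are not homogeneous. *)
Definition tw (M : superSpace R) (a : bool) (x : M) : M := if a then sg M x else x.

Lemma twK (M : superSpace R) a (x : M) : tw a (tw a x) = x.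
Proof. by case: a => //=; rewrite sgK. Qed.

Lemma tw_linear (M : superSpace R) a : linear (@tw M a).
Proof. by case: a => c x y //=; rewrite linearP. Qed.
HB.instance Definition _ (M : superSpace R) a := GRing.isLinear.Build C M M *:%R (@tw M a) (@tw_linear M a).

Lemma tw_parity (M : superSpace R) a b (x : M) : parity b x -> tw a x = sgn (a && b) *: x.
Proof. by case: a => /=; rewrite ?sgn0 ?scale1r. Qed.

Definition epart (M : superSpace R) (a : bool) (x : M) : M := 2^-1 *: (x + sgn a *: sg M x).

Lemma epart_parity (M : superSpace R) a (x : M) : parity a (epart a x).
Proof.
rewrite /parity /epart linearZ linearD linearZ /= sgK !scalerDr !scalerA.
by rewrite addrC [sgn a * 2^-1]mulrC -!mulrA sgnK mulr1.
Qed.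

Lemma epartE (M : superSpace R) (x : M) : x = epart false x + epart true x.
Proof.
rewrite /epart sgn0 sgn1 scale1r scaleN1r -scalerDr addrACA subrr addr0.
by rewrite -mulr2n -[x *+ 2]scaler_nat scalerA mulVf ?scale1r // pnatr_eq0.
Qed.

Lemma lin0 (M N : lmodType C) (f : M -> N) : linear f -> f 0 = 0.
Proof. by move=> h; have := h (-1) 0 0; rewrite scaler0 addr0 scaleN1r addNr. Qed.
Lemma linD (M N : lmodType C) (f : M -> N) : linear f -> {morph f : x y / x + y}.
Proof. by move=> h x y; have := h 1 x y; rewrite !scale1r. Qed.
Lemma linZ (M N : lmodType C) (f : M -> N) : linear f -> forall c x, f (c *: x) = c *: f x.
Proof. by move=> h c x; have := h c x 0; rewrite !addr0 (lin0 h) addr0. Qed.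
Lemma lin_sum (M N : lmodType C) (f : M -> N) I (r : seq I) P F : linear f ->
  f (\sum_(i <- r | P i) F i) = \sum_(i <- r | P i) f (F i).
Proof.
by move=> h; apply: (big_morph f (linD h) (lin0 h)).
Qed.

Variable V : vosa R.

(** Common interface of module actions, with integral exponents, and of the coefficient of a fixed
    power of log x in an intertwining operator, with complex exponents. The Jacobi identity does not
    mix powers of the logarithm, so its consequences can be proved once for both. *)
Record jop (K : comNzRingType) (p : bool) (W1 W2 W3 : vmod V) (Y : W1 -> K -> W2 -> W3)
    : Prop := Jop {
  jop_linl : forall h w2, linear (fun w1 => Y w1 h w2);
  jop_linr : forall w1 h, linear (Y w1 h);
  jop_sg : forall w1 h w2, sg W3 (Y w1 h w2) = sgn p *: Y (sg W1 w1) h (sg W2 w2);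
  jop_trunc : forall w1 h w2, exists N : nat, forall n, (N <= n)%N -> Y w1 (h + n%:R) w2 = 0;
  jop_jacobi : jacobi (act (v0 := W1)) (act (v0 := W2)) (act (v0 := W3)) p Y }.

Lemma jop_act (W : vmod V) : @jop int false (vself V) W W (act (v0 := W)).
Proof.
split; last exact: act_jacobi.
- exact: act_linl.
- exact: act_linr.
- by move=> *; rewrite sgn0 scale1r act_sg.
- move=> w1 h w2; have [N HN] := act_trunc w1 w2; exists (N + `|h|)%N => n hn; apply: HN.
  by rewrite -[n%:R]/(n%:R : int) pmulrn intz; lia.
Qed.

Lemma jop_intw p (W1 W2 W3 : vmod V) (I : intw p W1 W2 W3) k :
  @jop C p W1 W2 W3 (fun w1 h w2 => I w1 h k w2).
Proof.
split; last exact: lfun_jacobi.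
- by move=> h w2; apply: lfun_linl.
- by move=> w1 h; apply: lfun_linr.
- by move=> w1 h w2; apply: lfun_sg.
- by move=> w1 h w2; have [N HN] := lfun_trunc I w1 h w2; exists N => n; apply: HN.
Qed.

Section Theory.
Variables (K : comNzRingType) (p : bool) (W1 W2 W3 : vmod V) (Y : W1 -> K -> W2 -> W3).
Hypothesis HY : jop p Y.

Lemma act_trunc_ge (W : vmod V) (v : V) (m : int) (w : W) :
  exists N : nat, forall i : nat, (N <= i)%N -> act v (m + i%:Z) w = 0.
Proof.
have [N HN] := act_trunc v w; exists (N + `|m|)%N => i hi; apply: HN; lia.
Qed.

(** Truncation makes both sums finite. The bound is left existential and every larger one is
    allowed, so that several identities can later be brought to a common bound. *)
Lemma jopJ a v w1 w2 (m n : int) (h : K) : parity a v ->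
  exists N0, forall N, (N0 <= N)%N ->
    \sum_(i < N) cbin m%:~R i *: Y (act v (n + i%:Z) w1) (m%:~R + h - i%:R) w2
    = \sum_(i < N) ((-1) ^+ i * cbin n%:~R i) *:
        (sgn (p && a) *: act v (m + n - i%:Z) (Y w1 (h + i%:R) w2)
         - (-1) ^ n *: Y (tw a w1) (n%:~R + h - i%:R) (act v (m + i%:Z) w2)).
Proof.
move=> av.
have hom b (x1 : W1) : parity b x1 -> exists N0, forall N, (N0 <= N)%N ->
    \sum_(i < N) cbin m%:~R i *: Y (act v (n + i%:Z) x1) (m%:~R + h - i%:R) w2
    = \sum_(i < N) ((-1) ^+ i * cbin n%:~R i) *:
        (sgn (p && a) *: act v (m + n - i%:Z) (Y x1 (h + i%:R) w2)
         - (-1) ^ n *: Y (tw a x1) (n%:~R + h - i%:R) (act v (m + i%:Z) w2)).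
  move=> bx.
  have [N1 h1] := act_trunc_ge v n x1.
  have [N2 h2] := jop_trunc HY x1 h w2.
  have [N3 h3] := act_trunc_ge v m w2.
  exists (N1 + N2 + N3)%N => N hN.
  have := jop_jacobi HY av bx w2 m n h.
  rewrite (@fsumE _ _ N); last first.
    move=> i hi; rewrite h1 ?(lin0 (jop_linl HY _ _)) ?scaler0 //; lia.
  rewrite (@fsumE _ _ N); last first.
    move=> i hi; rewrite h2; last lia.
    rewrite h3; last lia.
    by rewrite linear0 (lin0 (jop_linr HY _ _)) !scaler0 subr0 scaler0.
  move=> ->; apply: eq_bigr => i _; congr (_ *: (_ - _)).
  by rewrite (tw_parity _ bx) (linZ (jop_linl HY _ _)) scalerA.
have [N1 h1] := hom _ _ (epart_parity false w1).
have [N2 h2] := hom _ _ (epart_parity true w1).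
move: (epartE w1) h1 h2; move: (epart false w1) (epart true w1) => x y -> h1 h2.
exists (N1 + N2)%N => N hN.
have := h1 N ltac:(lia); have := h2 N ltac:(lia) => e2 e1.
under eq_bigr => i _ do rewrite linearD (linD (jop_linl HY _ _)) scalerDr.
rewrite big_split /= e1 e2 -big_split /=; apply: eq_bigr => i _.
rewrite -scalerDr; congr (_ *: _).
rewrite (linD (@tw_linear _ _)) !(linD (jop_linl HY _ _)).
by rewrite linearD !scalerDr opprD addrACA.
Qed.

(** The case n = 0 of the Jacobi identity, where the right-hand side reduces to its term i = 0:
    Borcherds' commutator formula. *)
Lemma jop_comm a v w1 w2 (m : int) (h : K) N0 : parity a v ->
  (forall i : nat, (N0 <= i)%N -> act v i%:Z w1 = 0) ->
  sgn (p && a) *: act v m (Y w1 h w2) - Y (tw a w1) h (act v m w2)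
  = \sum_(i < N0) cbin m%:~R i *: Y (act v i%:Z w1) (m%:~R + h - i%:R) w2.
Proof.
move=> av hN0; have [N1 H1] := jopJ w1 w2 m 0 h av.
have := H1 (N0 + N1).+1 ltac:(lia).
rewrite (@sum_widen _ (fun i => cbin m%:~R i *: Y (act v (0 + i%:Z) w1) (m%:~R + h - i%:R) w2) N0); first last.
- by move=> i /hN0 e; rewrite add0r e (lin0 (jop_linl HY _ _)) scaler0.
- lia.
under eq_bigr do rewrite add0r.
move=> ->; rewrite big_ord_recl big1 ?addr0; last first.
  by move=> i _; rewrite mulr0z cbin0n mulr0 scale0r.
by rewrite expr0 cbin0 mulr1 scale1r expr0z scale1r mulr0z add0r subr0.
Qed.

(** The case m = 0, where the left-hand side reduces to its term i = 0: the iterate formula. *)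
Lemma jop_iter a v w1 w2 (n : int) (h : K) : parity a v ->
  exists N0, forall N, (N0 <= N)%N ->
  Y (act v n w1) h w2
  = \sum_(i < N) ((-1) ^+ i * cbin n%:~R i) *:
        (sgn (p && a) *: act v (n - i%:Z) (Y w1 (h + i%:R) w2)
         - (-1) ^ n *: Y (tw a w1) (n%:~R + h - i%:R) (act v i%:Z w2)).
Proof.
move=> av; have [N0 H0] := jopJ w1 w2 0 n h av.
exists N0.+1 => N hN; have := H0 N ltac:(lia).
case: N hN => // N hN.
rewrite big_ord_recl [X in _ + X = _ -> _]big1 ?addr0; last first.
  by move=> i _; rewrite mulr0z cbin0n scale0r.
rewrite cbin0 scale1r mulr0z add0r subr0 => ->.
by apply: eq_bigr => i _; rewrite !add0r.
Qed.

(** With m so large that the modes of v from m on kill w2, half of the right-hand side disappears: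
    weak associativity. *)
Lemma jop_assoc a v w1 w2 (m n : int) (h : K) : parity a v ->
  (forall i : nat, act v (m + i%:Z) w2 = 0) ->
  exists N0, forall N, (N0 <= N)%N ->
    \sum_(i < N) cbin m%:~R i *: Y (act v (n + i%:Z) w1) (m%:~R + h - i%:R) w2
    = \sum_(i < N) ((-1) ^+ i * cbin n%:~R i) *:
        (sgn (p && a) *: act v (m + n - i%:Z) (Y w1 (h + i%:R) w2)).
Proof.
move=> av hm; have [N0 H0] := jopJ w1 w2 m n h av.
exists N0 => N hN; rewrite (H0 N hN); apply: eq_bigr => i _.
by rewrite hm (lin0 (jop_linr HY _ _)) scaler0 subr0.
Qed.

End Theory.

Record actsub (W : vmod V) (U : W -> Prop) : Prop := Actsub {
  actsub0 : U 0;
  actsubP : forall (c : C) x y, U x -> U y -> U (c *: x + y);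
  actsub_act : forall v n x, U x -> U (act v n x) }.

Definition generates (W : vmod V) (G : W -> Prop) :=
  forall U : W -> Prop, actsub U -> (forall x, G x -> U x) -> forall x, U x.

Lemma actsubZ (W : vmod V) (U : W -> Prop) c x : actsub U -> U x -> U (c *: x).
Proof. by move=> h ux; rewrite -[_ *: _]addr0; apply: actsubP => //; apply: actsub0. Qed.
Lemma actsubD (W : vmod V) (U : W -> Prop) x y : actsub U -> U x -> U y -> U (x + y).
Proof. by move=> h ux uy; rewrite -[x]scale1r; apply: actsubP. Qed.
Lemma actsubN (W : vmod V) (U : W -> Prop) x : actsub U -> U x -> U (- x).
Proof. by move=> h ux; rewrite -scaleN1r; apply: actsubZ. Qed.
Lemma actsub_sum (W : vmod V) (U : W -> Prop) I (r : seq I) (P : pred I) F : actsub U ->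
  (forall i, P i -> U (F i)) -> U (\sum_(i <- r | P i) F i).
Proof. by move=> h hF; apply: big_ind => //; [apply: actsub0 | move=> x y; apply: actsubD]. Qed.

(* If [v_m w2 = 0] for all [m >= M], then the Jacobi identity with this [m]
   expresses [Y(v_n w1)] through [Y(v_{n+i} w1)], i > 0, and [v Y(w1)]. *)
Lemma jop_gen (K : comNzRingType) p (W1 W2 W3 : vmod V) (Y : W1 -> K -> W2 -> W3)
    (U : W3 -> Prop) (G1 : W1 -> Prop) (G2 : W2 -> Prop) :
  jop p Y -> actsub U -> generates G1 -> generates G2 ->
  (forall w1 w2 h, G1 w1 -> G2 w2 -> U (Y w1 h w2)) ->
  forall w1 h w2, U (Y w1 h w2).
Proof.
move=> HY HU g1 g2 H.
have s1 w2 : G2 w2 -> forall w1 h, U (Y w1 h w2).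
  move=> gw2; apply: g1; last by move=> x gx h; apply: H.
  split.
  - by move=> h; rewrite (lin0 (jop_linl HY _ _)); apply: actsub0.
  - by move=> c x y hx hy h; rewrite (jop_linl HY); apply: actsubP.
  move=> v n x hx.
  suff hom a u : parity a u -> forall h, U (Y (act u n x) h w2).
    move=> h; rewrite (epartE v) (linD (act_linl _ _)) (linD (jop_linl HY _ _)).
    by apply: actsubD => //; [apply: hom (epart_parity _ _) _|apply: hom (epart_parity _ _) _].
  move=> au.
  have [N1 h1] := act_trunc_ge u n x.
  have [M hM0] := act_trunc u w2.
  have hM (i : nat) : act u (M%:Z + i%:Z) w2 = 0 by apply: hM0; lia.
  (* Downward induction on i: the vector [act u (n + i) x] is 0 from i = N1 on, and weak
     associativity expresses the i-th term through later ones. *)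
  suff: forall k i : nat, (N1 <= i + k)%N -> forall h, U (Y (act u (n + i%:Z) x) h w2).
    by move=> /(_ N1 0%N) /(_ (leqnn _)) hh h; have := hh h; rewrite addr0.
  elim=> [|k IH] i hi h.
    by rewrite h1; [rewrite (lin0 (jop_linl HY _ _)); apply: actsub0 | lia].
  have [N0 HN0] := @jop_assoc _ _ _ _ _ _ HY a u x w2 M%:Z (n + i%:Z) (h - M%:R) au hM.
  have := HN0 N0.+1 (leqnSn _).
  have e : M%:Z%:~R + (h - M%:R) = h by rewrite -pmulrn addrC subrK.
  rewrite big_ord_recl cbin0 scale1r e ?addr0 subr0.
  move/(canRL (addrK _)) => ->; apply: actsubD => //.
    apply: actsub_sum => // j _; apply: actsubZ => //; apply: actsubZ => //.
    by apply: actsub_act.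
  apply: actsubN => //; apply: actsub_sum => // j _; apply: actsubZ => //.
  rewrite lift0 -addrA -PoszD; apply: IH; lia.
move=> w1 h w2; move: w2 w1 h.
apply: g2 => [|x gx w1 h]; last exact: s1.
split.
- by move=> w1 h; rewrite (lin0 (jop_linr HY _ _)); apply: actsub0.
- by move=> c x y hx hy w1 h; rewrite (jop_linr HY); apply: actsubP.
move=> v n x hx w1 h.
suff hom a u : parity a u -> U (Y w1 h (act u n x)).
  rewrite (epartE v) (linD (act_linl _ _)) (linD (jop_linr HY _ _)).
  by apply: actsubD => //; apply: hom (epart_parity _ _).
(* The commutator formula is applied to [tw a w1], so that its own twist restores w1 in the term of
   interest. *)
move=> au; have [N1 h1] := act_trunc_ge u 0 (tw a w1).
have := @jop_comm _ _ _ _ _ _ HY a u (tw a w1) x n h N1 au.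
rewrite twK => /(_ _) e.
have {}e := e ltac:(move=> i /h1; rewrite add0r //).
rewrite -[Y w1 h _]opprK; apply: actsubN => //.
move/(canRL (addKr _)): e => ->; apply: actsubD => //.
  by apply: actsubN => //; apply: actsubZ => //; apply: actsub_act.
by apply: actsub_sum => // j _; apply: actsubZ.
Qed.

End Jop.

(** * Modes of the affine superalgebra gl(1|1) *)

Inductive gen := GN | GE | GP | GM.
Definition gpar g := match g with GP | GM => true | _ => false end.
(** Weight under the adjoint action of N. It is also the direction in which spectral flow shifts a
    mode. *)
Definition gch g : int := match g with GP => 1 | GM => -1 | _ => 0 end.

Section Gl11.
Variable R : realType.
Local Notation C := (R[i]).
Local Notation sgn := (sgn R).

Definition glv g : gl11 R :=
  match g with GN => glN R | GE => glE R | GP => glp R | GM => glm R end.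
(** Every bracket of two basis vectors is a multiple of a single basis vector, [a, b] = [cf a b]
    times [tg a b]; [GE] is a placeholder where the bracket vanishes. *)
Definition tg (a b : gen) : gen :=
  match a, b with
  | GN, GP | GP, GN => GP
  | GN, GM | GM, GN => GM
  | _, _ => GE end.
Definition cf (a b : gen) : C :=
  match a, b with
  | GN, GP | GM, GN | GP, GM | GM, GP => 1
  | GP, GN | GN, GM => -1
  | _, _ => 0 end.
Definition kap (a b : gen) : C :=
  match a, b with
  | GN, GE | GE, GN | GP, GM => 1 | GM, GP => -1 | _, _ => 0 end.
Definition cg (a : gl11 R) g : C :=
  match g with GN => (a : 'rV[C]_4) 0 0 | GE => (a : 'rV[C]_4) 0 1
  | GP => (a : 'rV[C]_4) 0 2 | GM => (a : 'rV[C]_4) 0 3 end.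

Lemma row4E (a b c d : C) : (row4 a b c d 0 0 = a) * (row4 a b c d 0 1 = b)
  * (row4 a b c d 0 2 = c) * (row4 a b c d 0 3 = d).
Proof. by rewrite !mxE. Qed.

Lemma row4_ext (x y : 'rV[C]_4) : x 0 0 = y 0 0 -> x 0 1 = y 0 1 -> x 0 2 = y 0 2 ->
  x 0 3 = y 0 3 -> x = y.
Proof.
move=> h0 h1 h2 h3; apply/rowP => -[[|[|[|[|//]]]] ji].
- by have -> : Ordinal ji = 0 by apply: val_inj.
- by have -> : Ordinal ji = 1 by apply: val_inj.
- by have -> : Ordinal ji = 2 by apply: val_inj.
- by have -> : Ordinal ji = 3 by apply: val_inj.
Qed.

Lemma glv_decomp (a : gl11 R) :
  a = cg a GN *: glv GN + cg a GE *: glv GE + cg a GP *: glv GP + cg a GM *: glv GM.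
Proof.
rewrite /cg /glv /glN /glE /glp /glm; apply: row4_ext; rewrite !mxE /=; ring.
Qed.

Lemma lbr_gen a b : lbr (glv a) (glv b) = cf a b *: glv (tg a b).
Proof.
case: a; case: b; rewrite /glv /glN /glE /glp /glm /lbr /=;
  apply: row4_ext; rewrite !mxE /= ; ring.
Qed.

Lemma lform_gen a b : lform (glv a) (glv b) = kap a b.
Proof. by case: a; case: b; rewrite /glv /glN /glE /glp /glm /lform /= !mxE /=; ring. Qed.

Lemma glv_parity g : parity (gpar g) (glv g).
Proof.
rewrite /parity; case: g; rewrite /glv /glN /glE /glp /glm /=; apply: row4_ext;
  by rewrite mul_mx_diag !mxE /= ?mulr0 ?mul0r ?mulr1 ?mul1r.
Qed.

Lemma sg_cg (a : gl11 R) g : cg (sg _ a) g = sgn (gpar g) * cg a g.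
Proof.
by case: g; rewrite /cg /= mul_mx_diag !mxE /= mulrC.
Qed.

Lemma cg_parity p (a : gl11 R) g : parity p a -> cg a g != 0 -> gpar g = p.
Proof.
move=> pa nz; have := sg_cg a g; rewrite pa.
have -> : cg (sgn p *: a) g = sgn p * cg a g by case: g nz => _; rewrite /cg mxE.
have n1 : (-1 == 1 :> C) = false by rewrite eqNr oner_eq0.
move/(mulIf nz)/eqP; rewrite /sgn; case: (gpar g); case: p {pa} => //=;
  rewrite expr0 expr1 ?n1 // eq_sym n1 //.
Qed.

Lemma tg_par a b : cf a b != 0 -> gpar (tg a b) = gpar a (+) gpar b.
Proof. by case: a; case: b => //=; rewrite eqxx. Qed.
Lemma tg_ch a b : cf a b != 0 -> gch (tg a b) = gch a + gch b.
Proof. by case: a; case: b => //=; rewrite eqxx. Qed.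
Lemma kap_ch a b : kap a b != 0 -> gch a + gch b = 0.
Proof. by case: a; case: b => //=; rewrite eqxx. Qed.
Lemma kap_par a b : kap a b != 0 -> gpar a = gpar b.
Proof. by case: a; case: b => //=; rewrite eqxx. Qed.

(** Level-one affine relations between modes of basis vectors. In contrast to [affine_module] the
    carrier has no parity involution, so bare vector spaces such as families of vectors are
    allowed. *)
Record modes (W : lmodType C) (op : gen -> int -> W -> W) : Prop := Modes {
  md_lin : forall a r, linear (op a r);
  md_comm : forall a b r s x, op a r (op b s x)
    = sgn (gpar a && gpar b) *: op b s (op a r x) + cf a b *: op (tg a b) (r + s) x
      + (r%:~R * kap a b * (r + s == 0)%:R) *: x }.

Definition gens4 := [:: GN; GE; GP; GM].
Definition opsum (W : lmodType C) (op : gen -> int -> W -> W) (a : gl11 R) r (x : W) : W :=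
  \sum_(g <- gens4) cg a g *: op g r x.

Lemma affine_modes (M : superSpace R) (rho : gl11 R -> int -> M -> M) :
  affine_module 1 rho -> modes (fun g => rho (glv g)).
Proof.
case=> ll lr _ cm; split => [a r|a b r s x]; first exact: lr.
have := cm _ _ _ _ (glv_parity a) (glv_parity b) r s x.
by rewrite lbr_gen lform_gen mulr1 (linZ (ll _ _)) => /(canRL (subrK _)) ->; rewrite addrC addrA.
Qed.

Lemma affine_opsum (M : superSpace R) (rho : gl11 R -> int -> M -> M) :
  affine_module 1 rho -> forall a r x, rho a r x = opsum (fun g => rho (glv g)) a r x.
Proof.
case=> ll _ _ _ a r x; rewrite {1}(glv_decomp a).
by rewrite !(linD (ll _ _)) !(linZ (ll _ _)) /opsum !big_cons big_nil addr0 !addrA.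
Qed.

Lemma lform_opsum (a b : gl11 R) : lform a b =
  \sum_(g <- gens4) \sum_(h <- gens4) cg a g * cg b h * kap g h.
Proof. by rewrite !big_cons !big_nil /= /lform /cg /=; ring. Qed.

Lemma lbr_opsum (W : lmodType C) (op : gen -> int -> W -> W) (a b : gl11 R) r x :
  opsum op (lbr a b) r x =
  \sum_(g <- gens4) \sum_(h <- gens4) (cg a g * cg b h * cf g h) *: op (tg g h) r x.
Proof.
rewrite /opsum !big_cons !big_nil /= !mulr0 !scale0r !mulr1 !mulrN1 !scaleNr !addr0 !add0r.
rewrite !row4E scale0r add0r !scalerDl !scaleNr.
by rewrite [RHS](AC (2*(2*2)) ((4*6)*((1*3)*(5*2)))).
Qed.

Lemma modes_affine (M : superSpace R) (op : gen -> int -> M -> M) : modes op ->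
  (forall g r x, sg M (op g r x) = sgn (gpar g) *: op g r (sg M x)) ->
  affine_module 1 (opsum op).
Proof.
case=> lo cm hsg; split.
- move=> r w c a b; rewrite /opsum scaler_sumr -big_split; apply: eq_bigr => g _ /=.
  have -> : cg (c *: a + b) g = c * cg a g + cg b g by case: g; rewrite /cg !mxE.
  by rewrite scalerDl scalerA.
- move=> a r c x y; rewrite /opsum scaler_sumr -big_split; apply: eq_bigr => g _ /=.
  by rewrite lo scalerDr !scalerA mulrC.
- move=> a r x; rewrite /opsum linear_sum; apply: eq_bigr => g _ /=.
  by rewrite linearZ /= hsg sg_cg scalerA mulrC.
move=> p q a b pa qb r s x.
have EE a' b' r' s' : opsum op a' r' (opsum op b' s' x) =
    \sum_(g <- gens4) \sum_(h <- gens4) (cg a' g * cg b' h) *: op g r' (op h s' x).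
  apply: eq_bigr => g _; rewrite (lin_sum _ _ _ (lo _ _)) scaler_sumr.
  by apply: eq_bigr => h _; rewrite (linZ (lo _ _)) scalerA.
apply/eqP; rewrite subr_eq; apply/eqP; rewrite !EE.
rewrite lbr_opsum lform_opsum mulr1 mulr_sumr mulr_suml scaler_suml.
rewrite [X in _ *: X]exchange_big /= scaler_sumr -!big_split /=; apply: eq_bigr => g _.
rewrite mulr_sumr mulr_suml scaler_suml scaler_sumr -!big_split /=; apply: eq_bigr => h _.
have [->|ag] := eqVneq (cg a g) 0; first by rewrite !(mul0r, mulr0, scale0r, scaler0, addr0).
have [->|bh] := eqVneq (cg b h) 0; first by rewrite !(mul0r, mulr0, scale0r, scaler0, addr0).
rewrite cm (cg_parity pa ag) (cg_parity qb bh) !scalerDr !scalerA.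
rewrite [RHS]addrC addrA; congr (_ *: _ + _ *: _ + _ *: _); ring.
Qed.
End Gl11.

Section ModesComm.
Variable R : realType.
Local Notation C := (R[i]).
Variables (W : lmodType C) (op : gen -> int -> W -> W).
Hypothesis H : modes op.
Local Notation N := (op GN). Local Notation E := (op GE).
Local Notation P := (op GP). Local Notation M := (op GM).

Local Ltac md := rewrite (md_comm H) /= ?sgn0 ?sgn1 ?mulr0 ?mul0r ?mulr1 ?mulrN1 ?scale0r ?addr0
  ?scale1r ?scaleN1r //.

Lemma mNN r s x : N r (N s x) = N s (N r x). Proof. md. Qed.
Lemma mNE r s x : N r (E s x) = E s (N r x) + (r%:~R * (r + s == 0)%:R) *: x. Proof. md. Qed.
Lemma mEN r s x : E r (N s x) = N s (E r x) + (r%:~R * (r + s == 0)%:R) *: x. Proof. md. Qed.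
Lemma mEE r s x : E r (E s x) = E s (E r x). Proof. md. Qed.
Lemma mEP r s x : E r (P s x) = P s (E r x). Proof. md. Qed.
Lemma mEM r s x : E r (M s x) = M s (E r x). Proof. md. Qed.
Lemma mPE r s x : P r (E s x) = E s (P r x). Proof. md. Qed.
Lemma mME r s x : M r (E s x) = E s (M r x). Proof. md. Qed.
Lemma mNP r s x : N r (P s x) = P s (N r x) + P (r + s) x. Proof. md. Qed.
Lemma mPN r s x : P r (N s x) = N s (P r x) - P (r + s) x. Proof. md. Qed.
Lemma mNM r s x : N r (M s x) = M s (N r x) - M (r + s) x. Proof. md. Qed.
Lemma mMN r s x : M r (N s x) = N s (M r x) + M (r + s) x. Proof. md. Qed.
Lemma mPP r s x : P r (P s x) = - P s (P r x). Proof. md. Qed.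
Lemma mMM r s x : M r (M s x) = - M s (M r x). Proof. md. Qed.
Lemma mPM r s x : P r (M s x) = - M s (P r x) + E (r + s) x + (r%:~R * (r + s == 0)%:R) *: x.
Proof. md. Qed.
Lemma mMP r s x : M r (P s x) = - P s (M r x) + E (r + s) x - (r%:~R * (r + s == 0)%:R) *: x.
Proof. by md; rewrite mulNr scaleNr. Qed.
End ModesComm.

(** * The vertex algebra V_1(gl(1|1)) and its modules *)

Section Span.
Variable R : realType.
Local Notation C := (R[i]).

Inductive mspan (I : Type) (M : lmodType C) (op : I -> int -> M -> M) (G : M -> Prop) : M -> Prop :=
| mspan_gen x : G x -> mspan op G x
| mspan0 : mspan op G 0
| mspan_lin c x y : mspan op G x -> mspan op G y -> mspan op G (c *: x + y)
| mspan_op a r x : mspan op G x -> mspan op G (op a r x).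

(** The universal property gives a map from M to the submodule generated by the image of U; followed
    by the inclusion it is the identity, by uniqueness. *)
Lemma induced_gen (g : lieSuper R) k (U : lieModule g) (M : superSpace R)
    (rho : g -> int -> M -> M) (u : {linear U -> M}) : induced_along k rho u ->
  forall x, mspan rho (fun y => exists z, y = u z) x.
Proof.
case=> af [esg e0 ep] un.
set G := fun y => _.
have hs : subsp (mspan rho G).
  split; first exact: mspan0.
  - exact: mspan_lin.
  move=> x; elim.
  - by move=> _ [z ->]; rewrite -esg; apply: mspan_gen; exists (sg U z).
  - by rewrite linear0; apply: mspan0.
  - by move=> c y z _ hy _ hz; rewrite linearP; apply: mspan_lin.
  - by move=> a r y _ hy; rewrite (aff_sg af); apply: mspan_op.
pose M' := subSuper hs.
pose rho' a r (x : M') : M' := ssmk hs (mspan_op a r (ssT_valP x)).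
have af' : @affine_module _ g k M' rho'.
  split.
  - by move=> r w c a b; apply: val_inj; rewrite /= (aff_linl af).
  - by move=> a r c x y; apply: val_inj; rewrite /= (aff_linr af).
  - by move=> a r x; apply: val_inj; rewrite /= (aff_sg af).
  - by move=> p q a b pa qb r s x; apply: val_inj; rewrite /= (aff_comm af pa qb).
pose u0 z : M' := ssmk hs (mspan_gen rho (ex_intro _ z erefl : G (u z))).
have u0l : linear u0 by move=> c x y; apply: val_inj; rewrite /= linearP.
pose u' : {linear U -> M'} := HB.pack u0 (GRing.isLinear.Build C U M' *:%R u0 u0l).
have eu' : extends_action rho' u'.
  split.
  - by move=> x; apply: val_inj; rewrite /= esg.
  - by move=> a x; apply: val_inj; rewrite /= e0.
  - by move=> a r x r0; apply: val_inj; rewrite /= ep.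
have [f [f1 f2 f3 _]] := un M' rho' u' af' eu'.
have [f0 [_ _ _ uq]] := un M rho u af (ExtendsAction esg e0 ep).
move=> x.
have e1 := uq (idfun : {linear M -> M}) (fun _ => erefl) (fun _ _ _ => erefl) (fun _ => erefl) x.
have e2 := uq (ssval hs \o f : {linear M -> M}) _ _ _ x.
have e : ssval hs (f x) = x.
  rewrite [RHS]e1; apply: e2 => [w|a r w|z] /=; first by rewrite f1.
  - by rewrite f2.
  - by rewrite f3.
by rewrite -e; apply: ssT_valP.
Qed.
End Span.

Section VBasics.
Variable R : realType.
Local Notation C := (R[i]).
Local Notation sgn := (sgn R).
Variables (V : vosa R) (J : {linear gl11 R -> V}).
Hypothesis HV : is_V1gl11 J.

Lemma V_aff : affine_module 1 (fun a r => vprod (J a) r).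
Proof. by have [[u [_ [h _ _]]] _] := HV. Qed.

Lemma V_vac0 a (r : int) : 0 <= r -> vprod (J a) r (vac V) = 0.
Proof. exact: vac_create0. Qed.

Lemma J_sg a : sg V (J a) = J (sg _ a).
Proof.
by rewrite -(vac_create (J a)) (aff_sg V_aff) vac_even vac_create.
Qed.

Lemma J_parity p a : parity p a -> parity p (J a).
Proof. by rewrite /parity J_sg => ->; rewrite linearZ. Qed.

Lemma V_ind (P : V -> Prop) : P (vac V) -> P 0 ->
  (forall (c : C) x y, P x -> P y -> P (c *: x + y)) ->
  (forall a r x, P x -> P (vprod (J a) r x)) -> forall x, P x.
Proof.
move=> Pv P0 Pl Pa x; have [[u [u1 iu]] _] := HV.
elim: (induced_gen iu x) => //; last by move=> a r y _; apply: Pa.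
  move=> _ [z ->].
  have -> : z = (z : C) *: (1 : C^o) by rewrite /GRing.scale /= mulr1.
  by rewrite linearZ /= u1 -[_ *: _]addr0; apply: Pl.
by move=> c y z _ hy _ hz; apply: Pl.
Qed.

Lemma J_prod p q a b (i : nat) : parity p a -> parity q b -> vprod (J a) i%:Z (J b) =
  if i == 0%N then J (lbr a b) else if i == 1%N then lform a b *: vac V else 0.
Proof.
move=> pa qb; have := aff_comm V_aff pa qb i%:Z (-1) (vac V).
rewrite vac_create (V_vac0 a) // (lin0 (vprod_linr _ _)) scaler0 subr0 => ->.
case: i => [|[|i]]; rewrite [in RHS]/=.
- by rewrite add0r vac_create mulr0z !mul0r scale0r addr0.
- by rewrite subrr V_vac0 // add0r mulr1z mul1r eqxx !mulr1.
- rewrite V_vac0 ?add0r; last by lia.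
  by rewrite (_ : (_ == 0) = false) ?mulr0 ?mul0r ?scale0r //; apply/eqP; lia.
Qed.

(** The commutator formula on W involves only the products [J_prod] of currents in V; the level is 1
    because the vacuum acts as the identity. *)
Lemma W_aff (W : vmod V) : affine_module 1 (fun a r => act (v0 := W) (J a) r).
Proof.
split.
- by move=> r w c a b; rewrite linearP act_linl.
- by move=> a r; apply: act_linr.
- by move=> a r w; rewrite act_sg J_sg.
move=> p q a b pa qb r s w.
have h2 (i : nat) : (2 <= i)%N -> act (v0 := vself V) (J a) i%:Z (J b) = 0.
  by move=> hi; rewrite [LHS](J_prod _ pa qb); case: i hi => [|[|]].
have e0 : act (v0 := vself V) (J a) 0%N (J b) = J (lbr a b) := J_prod 0 pa qb.
have e1 : act (v0 := vself V) (J a) 1%N (J b) = lform a b *: vac V := J_prod 1 pa qb.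
have := jop_comm (jop_act W) w r s (J_parity pa) h2.
rewrite andFb sgn0 scale1r (tw_parity _ (J_parity qb)) (linZ (act_linl _ _)) => ->.
rewrite !big_ord_recl big_ord0 addr0 -[nat_of_ord ord0]/0%N -[nat_of_ord (lift _ _)]/1%N e0 e1.
rewrite cbin0 scale1r.
rewrite addr0 intz; congr (_ + _).
have -> : cbin r%:~R 1 = r%:~R :> C.
  by have := cbinS (r%:~R : C) 0; rewrite cbin0 mul1r subr0 mulr1.
rewrite (linZ (act_linl _ _)) act_vac.
rewrite (_ : (r + s - 1 == -1) = (r + s == 0)); last by apply/eqP/eqP; lia.
by case: eqP => _; rewrite !mulr1 ?mulr0 ?scaler0 ?scale0r // scalerA.
Qed.

Definition Wop (W : vmod V) g r : W -> W := act (J (glv R g)) r.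

Lemma Wop_modes (W : vmod V) : modes (@Wop W).
Proof. exact: (affine_modes (W_aff W)). Qed.

Lemma Wop_sg (W : vmod V) g r (x : W) : sg W (Wop g r x) = sgn (gpar g) *: Wop g r (sg W x).
Proof.
by rewrite (aff_sg (W_aff W)) glv_parity (linZ (aff_linl (W_aff W) _ _)).
Qed.

(** By the iterate formula the modes of a_r v are combinations of products of modes of a and of v,
    and V is generated from the vacuum by the currents. *)
Lemma Jclosed_actsub (W : vmod V) (U : W -> Prop) : U 0 ->
  (forall (c : C) x y, U x -> U y -> U (c *: x + y)) ->
  (forall g r x, U x -> U (Wop g r x)) -> actsub U.
Proof.
move=> U0 Ul Ug; split=> // v.
have Uz c x : U x -> U (c *: x) by move=> ux; rewrite -[_ *: _]addr0; apply: (Ul _).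
have Ud x y : U x -> U y -> U (x + y) by move=> ux uy; rewrite -[x]scale1r; apply: (Ul _).
have UJ a r x : U x -> U (act (J a) r x).
  move=> ux; rewrite (affine_opsum (W_aff W)) /opsum.
  by apply: big_ind => // g _; apply: (Uz _); apply: Ug.
(* The claim is made for v together with its parity image, because the Koszul sign of the iterate
   formula twists v. *)
suff: forall n x, U x -> U (act v n x) /\ U (act (sg V v) n x) by move=> h n x ux; have [] := h n x ux.
move: v; apply: V_ind.
- by move=> n x ux; rewrite vac_even act_vac; case: ifP.
- by move=> n x ux; rewrite linear0 (lin0 (act_linl _ _)).
- move=> c x y hx hy n z uz; have [? ?] := hx n z uz; have [? ?] := hy n z uz.
  by rewrite linearP !act_linl; split; apply: (Ul _).
move=> a r v IH.
have step b y : (forall n x, U x -> U (act y n x) /\ U (act (sg V y) n x)) ->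
  forall n x, U x -> U (act (vprod (J b) r y) n x).
  move=> hy n x ux; rewrite (epartE b) linearD (linD (vprod_linl _ _)) (linD (act_linl _ _)).
  have hom p : U (act (vprod (J (epart p b)) r y) n x).
    have pp := J_parity (epart_parity p b).
    have [N0 HN] := jop_iter (jop_act W) y x r n pp.
    rewrite (HN N0 (leqnn _)) /=; apply: big_ind => // i _; apply: (Uz _); apply: (Ud _).
      by apply: (Uz _); apply: (UJ _); have [] := hy (n + i%:R) x ux.
    rewrite -scaleN1r; apply: (Uz _); apply: (Uz _).
    by case: (p) => /=; [have [] := hy (r%:~R + n - i%:R) _ (UJ (epart true b) i%:Z x ux)
      | have [] := hy (r%:~R + n - i%:R) _ (UJ (epart false b) i%:Z x ux)].
  by apply: (Ud _); apply: hom.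
move=> n x ux; split; first exact: step.
rewrite vprod_sg J_sg; apply: step => // m y uy; rewrite sgK.
by have [] := IH m y uy.
Qed.

(** The same induction along the iterate formula, now with signs: it reduces the verification that a
    map is a homomorphism to the four families of current modes. *)
Lemma Jhom_act (W1 W2 : vmod V) (p : bool) (f : {linear W1 -> W2}) :
  (forall g r x, f (Wop g r x) = sgn (p && gpar g) *: Wop g r (f x)) ->
  forall a v n w, parity a v -> f (act v n w) = sgn (p && a) *: act v n (f w).
Proof.
move=> fg.
have fJ a r x : f (act (J a) r x) = act (tw p (J a)) r (f x).
  rewrite (affine_opsum (W_aff W1)) /opsum linear_sum.
  have -> : tw p (J a) = J (tw p a) by case: p {fg} => //=; rewrite J_sg.
  rewrite (affine_opsum (W_aff W2)) /opsum; apply: eq_bigr => g _.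
  rewrite linearZ /= [f _]fg scalerA; congr (_ *: _).
  by case: p {fg} => /=; rewrite ?sgn0 ?mulr1 // sg_cg mulrC.
(* Written with twists instead of signs, the claim makes sense for v that is not homogeneous and is
   stable under the induction. *)
suff h v : forall c n w, f (act (tw c v) n w) = act (tw p (tw c v)) n (f w).
  move=> a v n w av; have := h v false n w; rewrite -[tw false v]/v => ->.
  by rewrite (tw_parity _ av) (linZ (act_linl _ _)).
have step y : (forall c n w, f (act (tw c y) n w) = act (tw p (tw c y)) n (f w)) ->
    forall a r n w, f (act (vprod (J a) r y) n w) = act (tw p (vprod (J a) r y)) n (f w).
  move=> IH a r n w; rewrite (epartE a) linearD (linD (vprod_linl _ _)).
  rewrite (linD (@tw_linear _ _ _)) !(linD (act_linl _ _)) linearD.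
  have hom q b : parity q b -> f (act (vprod (J b) r y) n w) = act (tw p (vprod (J b) r y)) n (f w).
    move=> qb; have pp := J_parity qb.
    have -> : tw p (vprod (J b) r y) = sgn (p && q) *: vprod (J b) r (tw p y).
      case: p {IH fg fJ} => /=; rewrite ?sgn0 ?scale1r // vprod_sg pp.
      by rewrite (linZ (vprod_linl _ _)).
    have [N1 HN1] := jop_iter (jop_act W1) y w r n pp.
    have [N2 HN2] := jop_iter (jop_act W2) (tw p y) (f w) r n pp.
    rewrite /= in HN1 HN2.
    rewrite (linZ (act_linl _ _)) (HN1 (N1 + N2)%N) ?leq_addr //.
    rewrite (HN2 (N1 + N2)%N) ?leq_addl // scaler_sumr linear_sum /=.
    apply: eq_bigr => i _; rewrite linearZ /= linearB !linearZ /= fJ.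
    have := IH false (n + i%:R) w; rewrite -[tw false y]/y => ->; rewrite IH fJ.
    rewrite !(tw_parity _ pp) !(linZ (act_linl _ _)) linearZ /= !sgn0 !scale1r.
    have -> : tw p (tw q y) = tw q (tw p y) by case: p {IH fg fJ HN2}; case: q {qb pp HN1}.
    rewrite !(linZ (act_linr _ _)) !scalerN !scalerDr !scalerN !scalerA.
    by congr (_ *: _ - _ *: _); ring.
  by congr (_ + _); apply: hom (epart_parity _ _).
move: v; apply: V_ind.
- move=> c n x; have e b : tw b (vac V) = vac V by case: b => //=; rewrite vac_even.
  by rewrite !e !act_vac; case: ifP => _ //; rewrite linear0.
- move=> c n x; have e b : tw b 0 = 0 :> V by apply: lin0; apply: tw_linear.
  by rewrite !e !(lin0 (act_linl _ _)) linear0.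
- by move=> c x y hx hy b n z; rewrite !tw_linear !act_linl linearP hx hy.
move=> a r v IH c n w.
have -> : tw c (vprod (J a) r v) = vprod (J (tw c a)) r (tw c v).
  by case: c => //=; rewrite vprod_sg J_sg.
apply: step => b m x; rewrite -[tw b (tw c v)]/(tw b (tw c v)).
have -> : tw b (tw c v) = tw (b (+) c) v by case: b; case: c => //=; rewrite sgK.
exact: IH.
Qed.

End VBasics.

Definition zr := (@mul0r, @mulr0, @scale0r, @scaler0, @oppr0, @addr0, @add0r, @subr0, @mulr1, @mul1r).

(** * The conformal vector and its commutation with the currents *)

Section SugawaraVector.

Variable R : realType.
Local Notation C := (R[i]).
Variables (W : lmodType C) (o : gen -> int -> W -> W) (v : W).
Hypothesis Hm : modes o.
Hypothesis k0 : forall g (r : int), 0 <= r -> o g r v = 0.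
Let lo g r : linear (o g r) := md_lin Hm g r.

(** The vector is the conformal vector, reordered as in [omegaE]; the term with E_{-2} comes from
    anticommuting psi^+_{-1} and psi^-_{-1}. Only a_1 survives on it, which is what makes the
    currents primary of weight one. *)
Lemma sugawara_modes g (i : nat) :
  o g i (o GN (-1) (o GE (-1) v) + o GM (-1) (o GP (-1) v)
    - 2^-1 *: o GE (-2) v + 2^-1 *: o GE (-1) (o GE (-1) v)) = if i == 1%N then o g (-1) v else 0.
Proof.
have i0 : 0 <= i%:Z by [].
rewrite !(linD (lo _ _)) -!scaleNr !(linZ (lo _ _)).
have z0 h r : o h r (0 : W) = 0 by exact: lin0.
case: g.
- rewrite (mNN Hm) (mNM Hm) (mNP Hm) !(mNE Hm) !(k0 _ i0) !(z0, linD (lo _ _), linZ (lo _ _)) !add0r.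
  case: i i0 => [|[|[|i]]] i0 /=.
  + by rewrite (_ : 0%:Z - 1 = -1) // ?zr subrr ?zr.
  + rewrite (_ : 1%:Z - 1 = 0) // ?zr mulr1z scale1r (k0 GP) // z0 ?zr (mMP Hm) (k0 GM) // z0.
    rewrite ?zr ?mulr0z ?zr scalerDr -scalerDl (_ : 2^-1 + 2^-1 = 1) ?scale1r ?subrK //; by field.
  + rewrite (_ : 2%:Z - 1 = 1) // ?zr (k0 GP) // z0 ?zr (mMP Hm) (k0 GM) // z0.
    rewrite ?zr (k0 GE) // ?zr mulr1z scale1r opprK scalerA.
    by rewrite -{1}[v]scale1r -scalerDl (_ : _ + _ = 0) ?scale0r // -[2%Z%:~R]/(2 : C); field.
  + rewrite ?zr (k0 GP) // z0 ?zr (mMP Hm) (k0 GM) // z0 ?zr (k0 GE) //.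
    by rewrite oppr0.
- rewrite !(mEN Hm) !(mEM Hm) !(mEP Hm) !(mEE Hm i) !(k0 _ i0) ?(z0, zr).
  by case: i i0 => [|[|i]] i0 /=; rewrite ?zr ?mulr1z ?scale1r.
- rewrite (mPN Hm) (mPM Hm) !(mPE Hm) (mPP Hm) !(k0 _ i0) ?(z0, zr).
  case: i i0 => [|[|i]] i0 /=.
  + by rewrite (_ : 0%:Z - 1 = -1) // ?zr addNr.
  + by rewrite (_ : 1%:Z - 1 = 0) // ?zr mulr1z scale1r (k0 GP) // (mEP Hm) (k0 GE) // !z0 oppr0 ?zr.
  + by rewrite ?zr (k0 GP) // z0 (mEP Hm) (k0 GE) // z0 oppr0 ?zr.
- rewrite (mMN Hm) (mMM Hm) (mMP Hm) !(mME Hm) !(k0 _ i0) ?(z0, zr).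
  case: i i0 => [|[|i]] i0 /=.
  + by rewrite (_ : 0%:Z - 1 = -1) // ?zr (mME Hm) addrN.
  + rewrite (_ : 1%:Z - 1 = 0) // ?zr mulr1z scale1r (k0 GM) // (k0 GE) // z0 ?zr.
    by rewrite -[- v]scaleN1r (linZ (lo _ _)) scaleN1r opprK.
  + by rewrite ?zr (k0 GM) // (k0 GE) // ?zr !z0 subr0.
Qed.
End SugawaraVector.

Section Conformal.
Variable R : realType.
Local Notation C := (R[i]).
Local Notation sgn := (sgn R).
Variables (V : vosa R) (J : {linear gl11 R -> V}).
Hypothesis HV : is_V1gl11 J.

Let vV := vself V.
Local Notation o := (Wop J (W := vV)).
Let Hm : modes o := Wop_modes HV vV.
Let k0 g (r : int) : 0 <= r -> o g r (vac V) = 0.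
Proof. exact: V_vac0. Qed.
Let lo g r : linear (o g r) := md_lin Hm g r.

Lemma J_glv g : J (glv R g) = o g (-1) (vac V).
Proof. by rewrite /Wop /= vac_create. Qed.

Lemma omegaE : omega V = o GN (-1) (o GE (-1) (vac V)) + o GM (-1) (o GP (-1) (vac V))
  - 2^-1 *: o GE (-2) (vac V) + 2^-1 *: o GE (-1) (o GE (-1) (vac V)).
Proof.
have e1 : vprod (J (glN R)) (-1) (J (glE R)) = o GN (-1) (o GE (-1) (vac V)).
  by rewrite -J_glv.
have e2 : vprod (J (glE R)) (-1) (J (glN R)) = o GE (-1) (o GN (-1) (vac V)).
  by rewrite -J_glv.
have e3 : vprod (J (glp R)) (-1) (J (glm R)) = o GP (-1) (o GM (-1) (vac V)).
  by rewrite -J_glv.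
have e4 : vprod (J (glm R)) (-1) (J (glp R)) = o GM (-1) (o GP (-1) (vac V)).
  by rewrite -J_glv.
have e5 : vprod (J (glE R)) (-1) (J (glE R)) = o GE (-1) (o GE (-1) (vac V)).
  by rewrite -J_glv.
rewrite (V1_omega HV) e1 e2 e3 e4 e5 (mEN Hm) (mPM Hm) !mulr0 !scale0r !addr0.
congr (_ + _); set x := o GN _ _; set y := o GM _ _; set z := o GE _ _.
rewrite opprD opprK !scalerDr scalerN.
have h2 w : 2^-1 *: w + 2^-1 *: w = w :> V.
  by rewrite -scalerDl -[X in X *: _](@mulr1 C) -[RHS]scale1r; congr (_ *: _); field.
by rewrite h2 -addrA [_ - _ + _]addrAC h2 addrA.
Qed.

Lemma J_omega g (i : nat) : vprod (J (glv R g)) i (omega V) = if i == 1%N then J (glv R g) else 0.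
Proof.
rewrite -[vprod _ _ _]/(o g i (omega V)) omegaE J_glv; exact: (sugawara_modes Hm k0).
Qed.

Variable W : vmod V.
Local Notation w := (Wop J (W := W)).

(** Computed as the commutator of a_r with the modes of [omega], not the other way round, since
    [J_omega] gives the products of the currents with [omega]. *)
Lemma Lop_comm n g r (x : W) : Lop n (w g r x) = w g r (Lop n x) - r%:~R *: w g (r + n) x.
Proof.
have h2 (i : nat) : (2 <= i)%N -> act (v0 := vself V) (J (glv R g)) i%:Z (omega V) = 0.
  by move=> hi; rewrite [LHS]J_omega; case: i hi => [|[|]].
have e0 : act (v0 := vself V) (J (glv R g)) 0%N (omega V) = 0 := J_omega g 0.
have e1 : act (v0 := vself V) (J (glv R g)) 1%N (omega V) = J (glv R g) := J_omega g 1.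
have := jop_comm (jop_act W) x r (n + 1) (J_parity HV (glv_parity R g)) h2.
have -> : tw (gpar g) (omega V) = omega V by case: g {h2 e0 e1} => //=; rewrite omega_even.
rewrite andFb sgn0 scale1r => /(canRL (subrK _)).
rewrite !big_ord_recl big_ord0 addr0 -[nat_of_ord ord0]/0%N -[nat_of_ord (lift _ _)]/1%N e0 e1.
rewrite (lin0 (act_linl _ _)) scaler0 add0r.
have -> : cbin r%:~R 1 = r%:~R :> C.
  by have := cbinS (r%:~R : C) 0; rewrite cbin0 mul1r subr0 mulr1.
rewrite /Lop /Wop intz (_ : r + (n + 1) - 1%:R = r + n); last by lia.
by move=> ->; rewrite addr0 [_ *: _ + _]addrC addrK.
Qed.

(** On a vector killed by positive modes, the iterate formula for the normally ordered product keeps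
    only the term i = 0 of its second half. *)
Lemma normal_top p q a b (x : W) : parity p a -> parity q b ->
  (forall c (r : int), 0 < r -> act (J c) r x = 0) ->
  act (vprod (J a) (-1) (J b)) 1 x = sgn (p && q) *: act (J b) 0 (act (J a) 0 x).
Proof.
move=> pa qb x0; have pp := J_parity HV pa.
have [N0 HN] := jop_iter (jop_act W) (J b) x (-1) 1 pp.
rewrite (HN N0.+1) ?leqnSn // big_ord_recl big1 ?addr0 => [|i _].
  rewrite (x0 b) // (lin0 (act_linr _ _)) scaler0 sub0r expr0 cbin0 mulr1 scale1r.
  rewrite (tw_parity _ (J_parity HV qb)) (linZ (act_linl _ _)).
  by rewrite exprN1 invrN1 scaleN1r opprK.
have eb : act (J b) (1 + (lift ord0 i)%:R) x = 0 by apply: x0; rewrite ltr_wpDr ?ler0n.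
have ea : act (J a) (lift ord0 i) x = 0 by apply: x0.
by rewrite eb ea !(lin0 (act_linr _ _)) !scaler0 subr0 scaler0.
Qed.

(** With n = nu - 1/2 this is the weight n e + e^2 / 2 of the highest-weight vector of V_{n,e}. The
    shift by 1/2 comes from psi^+_0 psi^-_0 x = e x. *)
Lemma L0_top nu e (x : W) : (forall g (r : int), 0 < r -> w g r x = 0) ->
  w GN 0 x = nu *: x -> w GE 0 x = e *: x -> w GP 0 x = 0 ->
  Lop 0 x = ((nu - 2^-1) * e + 2^-1 * e ^+ 2) *: x.
Proof.
move=> x0 hN hE hP.
have x0' c (r : int) : 0 < r -> act (J c) r x = 0.
  move=> r0; rewrite (affine_opsum (W_aff HV W)) /opsum big1 // => g _.
  by rewrite [act _ _ _](x0 g) ?scaler0.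
have lw g r : linear (w g r) := md_lin (Wop_modes HV W) g r.
have ll : linear (fun v => act (v0 := W) v 1 x) := act_linl 1 x.
have E a b c d f : act (2^-1 *: (a + b - c + d) + 2^-1 *: f) 1 x =
  2^-1 *: (act a 1 x + act b 1 x - act c 1 x + act d 1 x) + 2^-1 *: act f 1 x.
  by rewrite (linD ll) !(linZ ll) !(linD ll) -[- c]scaleN1r (linZ ll) scaleN1r.
have e1 : act (vprod (J (glN R)) (-1) (J (glE R))) 1 x = sgn false *: w GE 0 (w GN 0 x) :=
  normal_top (glv_parity R GN) (glv_parity R GE) x0'.
have e2 : act (vprod (J (glE R)) (-1) (J (glN R))) 1 x = sgn false *: w GN 0 (w GE 0 x) :=
  normal_top (glv_parity R GE) (glv_parity R GN) x0'.
have e3 : act (vprod (J (glp R)) (-1) (J (glm R))) 1 x = sgn true *: w GM 0 (w GP 0 x) :=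
  normal_top (glv_parity R GP) (glv_parity R GM) x0'.
have e4 : act (vprod (J (glm R)) (-1) (J (glp R))) 1 x = sgn true *: w GP 0 (w GM 0 x) :=
  normal_top (glv_parity R GM) (glv_parity R GP) x0'.
have e5 : act (vprod (J (glE R)) (-1) (J (glE R))) 1 x = sgn false *: w GE 0 (w GE 0 x) :=
  normal_top (glv_parity R GE) (glv_parity R GE) x0'.
rewrite /Lop add0r (V1_omega HV) E e1 e2 e3 e4 e5.
rewrite (mPM (Wop_modes HV W)) hP hN hE (lin0 (lw _ _)) oppr0 add0r !addr0 !(linZ (lw _ _)) hN hE.
rewrite sgn0 sgn1 scaler0 subr0 mul0r scale0r addr0 !scalerA -!scalerDl !scalerA -scalerDl.
by congr (_ *: _); field.
Qed.

End Conformal.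

(** * Linear algebra *)

Section LinAlg.
Variable R : realType.
Local Notation C := (R[i]).

Inductive lspan (W : lmodType C) (G : W -> Prop) : W -> Prop :=
| lspan_gen x : G x -> lspan G x
| lspan0 : lspan G 0
| lspan_lin c x y : lspan G x -> lspan G y -> lspan G (c *: x + y).

Lemma lspanD (W : lmodType C) (G : W -> Prop) x y : lspan G x -> lspan G y -> lspan G (x + y).
Proof. by move=> hx hy; rewrite -[x]scale1r; apply: lspan_lin. Qed.

Lemma lspan_sub (W : lmodType C) (G H : W -> Prop) x : (forall y, G y -> lspan H y) ->
  lspan G x -> lspan H x.
Proof. by move=> h; elim=> [y /h|| c y z _ hy _ hz] //; [apply: lspan0|apply: lspan_lin]. Qed.

Lemma lspan_sum (W : lmodType C) (G : W -> Prop) I (r : seq I) (P : pred I) F :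
  (forall i, P i -> lspan G (F i)) -> lspan G (\sum_(i <- r | P i) F i).
Proof. by move=> h; apply: big_ind => //; [apply: lspan0|move=> x y; apply: lspanD]. Qed.

Lemma lspan_spanned (W : lmodType C) (G : W -> Prop) x : (forall c y, G y -> G (c *: y)) ->
  lspan G x -> spanned_by G x.
Proof.
move=> hZ; elim=> [y gy||c y z _ [s [hs ->]] _ [t [ht ->]]].
- exists [:: y]; rewrite big_seq1; split=> // z; by rewrite inE => /eqP ->.
- by exists [::]; rewrite big_nil.
exists ([seq c *: y | y <- s] ++ t); rewrite big_cat big_map scaler_sumr; split=> // u.
by rewrite mem_cat => /orP[/mapP[v /hs hv ->]|/ht //]; apply: hZ.
Qed.

Lemma spanned_lspan (W : lmodType C) (G : W -> Prop) x : spanned_by G x -> lspan G x.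
Proof.
case=> s [hs ->]; rewrite big_seq; apply: lspan_sum => y /hs; exact: lspan_gen.
Qed.

Definition in_span (W : lmodType C) (s : seq W) (w : W) :=
  exists c : nat -> C, w = \sum_(i < size s) c i *: s`_i.

Lemma in_span0 (W : lmodType C) (s : seq W) : in_span s 0.
Proof. by exists (fun=> 0); rewrite big1 // => i _; rewrite scale0r. Qed.
Lemma in_span_lin (W : lmodType C) (s : seq W) c x y :
  in_span s x -> in_span s y -> in_span s (c *: x + y).
Proof.
case=> a -> [b ->]; exists (fun i => c * a i + b i).
rewrite scaler_sumr -big_split; apply: eq_bigr => i _; by rewrite scalerDl scalerA.
Qed.
Lemma in_span_mem (W : lmodType C) (s : seq W) x : x \in s -> in_span s x.
Proof.
move=> xs; exists (fun i => (i == index x s)%:R).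
rewrite (bigD1 (Ordinal (introT idP (etrans (index_mem x s) xs : (index x s < size s)%N)))) //=.
rewrite eqxx scale1r nth_index // big1 ?addr0 // => i /eqP h.
case: eqP => [e|]; last by rewrite scale0r.
by case: h; apply: val_inj.
Qed.
Lemma in_span_sum (W : lmodType C) (s : seq W) I (r : seq I) (P : pred I) F :
  (forall i, P i -> in_span s (F i)) -> in_span s (\sum_(i <- r | P i) F i).
Proof.
move=> h; apply: big_ind => //; first exact: in_span0.
by move=> x y hx hy; rewrite -[x]scale1r; apply: in_span_lin.
Qed.
Lemma in_span_map (W W' : lmodType C) (f : W -> W') (s : seq W) (t : seq W') x : linear f ->
  (forall y, y \in s -> in_span t (f y)) -> in_span s x -> in_span t (f x).
Proof.
move=> lf h [c ->]; rewrite (lin_sum _ _ _ lf); apply: in_span_sum => i _.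
rewrite (linZ lf) -[_ *: _]addr0; apply: in_span_lin; last exact: in_span0.
by apply: h; apply: mem_nth.
Qed.

Section Peval.
Variables (W : lmodType C) (T : W -> W).
Hypothesis lT : linear T.

Lemma iter_lin n : linear (iter n T).
Proof. by elim: n => [|n IH] c x y //=; rewrite IH lT. Qed.

Definition peval (p : {poly C}) (x : W) : W := \sum_(i < size p) p`_i *: iter i T x.

Lemma pevalE n (p : {poly C}) x : (size p <= n)%N -> peval p x = \sum_(i < n) p`_i *: iter i T x.
Proof.
move=> h; rewrite /peval [RHS](sum_widen (N := size p) (F := fun i => p`_i *: iter i T x)) //.
by move=> i hi; rewrite nth_default // scale0r.
Qed.

Lemma pevalD p q x : peval (p + q) x = peval p x + peval q x.
Proof.
rewrite !(@pevalE (maxn (size p) (size q))) ?leq_maxl ?leq_maxr ?size_polyD //.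
by rewrite -big_split; apply: eq_bigr => i _; rewrite coefD scalerDl.
Qed.

Lemma pevalC c x : peval c%:P x = c *: x.
Proof. by rewrite (@pevalE 1) ?size_polyC_leq1 // big_ord1 coefC. Qed.

Lemma pevalZ c p x : peval (c *: p) x = c *: peval p x.
Proof.
rewrite (@pevalE (size p)) ?size_scale_leq // /peval scaler_sumr.
by apply: eq_bigr => i _; rewrite coefZ scalerA.
Qed.

Lemma peval_lin p : linear (peval p).
Proof.
move=> c x y; rewrite /peval scaler_sumr -big_split; apply: eq_bigr => i _ /=.
by rewrite iter_lin scalerDr !scalerA mulrC.
Qed.

Lemma pevalX p x : peval (p * 'X) x = T (peval p x).
Proof.
rewrite (@pevalE (size p).+1); last first.
  by have [->|nz] := eqVneq p 0; rewrite ?mul0r ?size_poly0 // size_mulX.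
rewrite big_ord_recl coefMX scale0r add0r /peval (lin_sum _ _ _ lT).
by apply: eq_bigr => i _; rewrite coefMX (linZ lT).
Qed.

Lemma pevalM p q x : peval (p * q) x = peval p (peval q x).
Proof.
elim/poly_ind: p x => [|p c IH] x.
  by rewrite mul0r -polyC0 !pevalC !scale0r.
rewrite mulrDl mul_polyC pevalD -mulrA ['X * q]mulrC mulrA pevalX IH pevalD pevalX pevalC.
by rewrite pevalZ.
Qed.

Lemma pevalXsubC a x : peval ('X - a%:P) x = T x - a *: x.
Proof.
have e1 : peval 1 x = x by rewrite -polyC1 pevalC scale1r.
by rewrite -['X]mul1r -polyCN pevalD pevalX e1 pevalC scaleNr.
Qed.

Lemma peval_closed (U : W -> Prop) p x : U 0 -> (forall (c : C) y z, U y -> U z -> U (c *: y + z)) ->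
  (forall y, U y -> U (T y)) -> U x -> U (peval p x).
Proof.
move=> U0 Ul UT Ux; rewrite /peval; elim: (size p) => [|n IH]; first by rewrite big_ord0.
rewrite big_ord_recr /= addrC; apply: (Ul _ _ _ _) IH.
by elim: n => //= n; apply: UT.
Qed.

Lemma iter_peval n a x : iter n (fun y => T y - a *: y) x = peval (('X - a%:P) ^+ n) x.
Proof.
elim: n => [|n IH]; first by rewrite expr0 pevalC scale1r.
by rewrite exprS pevalM pevalXsubC iterS IH.
Qed.

(* A family of subspaces, one for each eigenvalue: eigenspaces or generalized ones *)
Variable E : C -> W -> Prop.
Hypothesis E0 : forall a, E a 0.
Hypothesis El : forall a c x y, E a x -> E a y -> E a (c *: x + y).
Hypothesis En : forall a x, E a x -> exists n, peval (('X - a%:P) ^+ n) x = 0.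

(** The eigencomponents of a vector are polynomials in T applied to it, so they remain in every
    T-stable subspace containing the vector. *)
Lemma eig_proj (s : seq C) (y : C -> W) a : uniq s -> a \in s -> (forall b, b \in s -> E b (y b)) ->
  exists p, y a = peval p (\sum_(b <- s) y b).
Proof.
move=> us sa hy.
have [n hn] : exists n : C -> nat, forall b, b \in s -> peval (('X - b%:P) ^+ n b) (y b) = 0.
  have h b : exists m : nat, b \in s -> peval (('X - b%:P) ^+ m) (y b) = 0.
    have [bs|nb] := boolP (b \in s); last by exists 0%N.
    by have [m hm] := En (hy b bs); exists m.
  by exists (fun b => projT1 (cid (h b))) => b; apply: (projT2 (cid (h b))).
pose P b := ('X - b%:P) ^+ n b.
pose Q := \prod_(b <- rem a s) P b.
have ra b : b \in rem a s -> b != a /\ b \in s by rewrite mem_rem_uniq // !inE => /andP.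
have cop : coprimep (P a) Q.
  rewrite /Q big_seq; apply: (big_ind (fun q => coprimep (P a) q)) => [|u v hu hv|b /ra[ba _]].
  - exact: coprimep1.
  - by rewrite coprimepMr hu hv.
  apply: coprimep_expl; apply: coprimep_expr.
  by rewrite coprimep_XsubC root_XsubC.
have /Bezout_coprimepP[[u v] /= huv] := cop.
move: huv; rewrite -size_poly_eq1 => /size_poly1P[c c0 e].
(* By Bezout u [P a] + v Q = c, so this polynomial is 1 modulo [P a] and 0 modulo every other
   [P b]. *)
exists (c^-1 *: (v * Q)).
rewrite (lin_sum _ _ _ (peval_lin _)) (big_rem a sa) /= [X in _ + X]big_seq big1 => [|b /ra[ba bs]].
  rewrite addr0 (_ : v * Q = c%:P - u * P a); last by rewrite -e addrC addKr.
  rewrite scalerBr pevalD -scaleNr !pevalZ pevalM hn // (lin0 (peval_lin _)) scaler0 addr0.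
  by rewrite pevalC scalerA mulVf // scale1r.
have br : b \in rem a s by rewrite mem_rem_uniq // !inE ba.
rewrite pevalZ /Q (big_rem b br) /= mulrCA mulrC pevalM hn // (lin0 (peval_lin _)) scaler0 //.
Qed.

Lemma eig_indep (s : seq C) (y : C -> W) a : uniq s -> a \in s ->
  (forall b, b \in s -> E b (y b)) -> \sum_(b <- s) y b = 0 -> y a = 0.
Proof.
by move=> us sa hy e; have [p ->] := eig_proj us sa hy; rewrite e (lin0 (peval_lin p)).
Qed.

Lemma eig_group x : lspan (fun x => exists a, E a x) x ->
  exists (s : seq C) (y : C -> W), [/\ uniq s, forall b, E b (y b) & x = \sum_(b <- s) y b].
Proof.
elim=> [z [a az]||c u v _ [s [y [us hy eu]]] _ [t [z [ut hz ev]]]].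
- exists [:: a], (fun b => if b == a then z else 0); rewrite big_seq1 eqxx; split=> // b.
  by case: eqP => [->|].
- by exists [::], (fun=> 0); rewrite big_nil.
exists (undup (s ++ t)), (fun b => c *: (if b \in s then y b else 0) + (if b \in t then z b else 0)).
split; first exact: undup_uniq.
  by move=> b; apply: El; case: ifP.
have ext r (f : C -> W) : uniq r -> {subset r <= undup (s ++ t)} ->
    \sum_(b <- undup (s ++ t)) (if b \in r then f b else 0) = \sum_(b <- r) f b.
  move=> ur sr; rewrite -big_mkcond -big_filter; apply: perm_big; apply: uniq_perm => //.
    by rewrite filter_uniq // undup_uniq.
  move=> b; rewrite mem_filter; case: (boolP (b \in r)) => //= /sr //.
rewrite big_split -scaler_sumr /= !ext ?eu ?ev // => b; rewrite mem_undup mem_cat => ->; rewrite ?orbT //.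
Qed.

Lemma eig_stable (U : W -> Prop) x : U 0 -> (forall (c : C) y z, U y -> U z -> U (c *: y + z)) ->
  (forall y, U y -> U (T y)) -> lspan (fun x => exists a, E a x) x -> U x ->
  lspan (fun x => U x /\ exists a, E a x) x.
Proof.
move=> U0 Ul UT /eig_group[s [y [us hy ->]]] Ux.
rewrite big_seq; apply: lspan_sum => a sa; apply: lspan_gen; split; last by exists a.
have [p ->] := eig_proj us sa (fun b _ => hy b); exact: peval_closed.
Qed.

Lemma eig_graded (I : eqType) (f : I -> C) (G : I -> W -> Prop) a x : injective f ->
  (forall i y, G i y -> E (f i) y) -> (forall i, G i 0) ->
  (forall i c y z, G i y -> G i z -> G i (c *: y + z)) ->
  lspan (fun y => exists i, G i y) x -> E a x -> x = 0 \/ exists i, f i = a /\ G i x.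
Proof.
move=> fi GE G0 Gl hx ax.
have [s [y [us hy e]]] : exists (s : seq I) (y : I -> W),
    [/\ uniq s, forall i, G i (y i) & x = \sum_(i <- s) y i].
  elim: hx {ax} => [z [i iz]||c u v _ [s [y [us hy eu]]] _ [t [z [ut hz ev]]]].
  - exists [:: i], (fun b => if b == i then z else 0); rewrite big_seq1 eqxx; split=> // b.
    by case: eqP => [->|].
  - by exists [::], (fun=> 0); rewrite big_nil.
  exists (undup (s ++ t)), (fun b => c *: (if b \in s then y b else 0) + (if b \in t then z b else 0)).
  split; first exact: undup_uniq.
    by move=> b; apply: Gl; case: ifP.
  have ext r (g : I -> W) : uniq r -> {subset r <= undup (s ++ t)} ->
      \sum_(b <- undup (s ++ t)) (if b \in r then g b else 0) = \sum_(b <- r) g b.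
    move=> ur sr; rewrite -big_mkcond -big_filter; apply: perm_big; apply: uniq_perm => //.
      by rewrite filter_uniq // undup_uniq.
    move=> b; rewrite mem_filter; case: (boolP (b \in r)) => //= /sr //.
  rewrite big_split -scaler_sumr /= !ext ?eu ?ev // => b; rewrite mem_undup mem_cat => ->; rewrite ?orbT //.
have h0 : forall i, i \in s -> f i != a -> y i = 0.
  move=> i si fa.
  (* Independence is applied to a vanishing sum: at the eigenvalue a it has the components of that
     value minus x, at the other eigenvalues the remaining components. *)
  pose t := a :: map f [seq j <- s | f j != a].
  pose y' b := (if b == a then \sum_(j <- s | f j == a) y j - x else 0)
    + \sum_(j <- s | f j == b) (if f j == a then 0 else y j).
  have ut : uniq t.
    rewrite /= map_inj_uniq // filter_uniq // andbT; apply/mapP => -[j].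
    by rewrite mem_filter => /andP[/eqP h _] /esym.
  have hy' b : b \in t -> E b (y' b).
    move=> _; rewrite /y' -[X in E b X]scale1r scalerDr; apply: El.
      case: eqP => [->|_] //; rewrite -[x]scale1r -scaleNr addrC; apply: El => //.
      by apply: big_ind => // [u v hu hv|j /eqP <-]; [rewrite -[u]scale1r; apply: El|apply: GE].
    rewrite scale1r; apply: big_ind => // [u v hu hv|j /eqP <-]; first by rewrite -[u]scale1r; apply: El.
    by case: ifP => // _; apply: GE.
  have es : \sum_(b <- t) y' b = 0.
    rewrite big_cons /y' eqxx [X in _ + X + _]big1 ?addr0; last by move=> j ->.
    rewrite big_map big_filter.
    have -> : \sum_(j <- s | f j != a) ((if f j == a then \sum_(j0 <- s | f j0 == a) y j0 - x else 0)
       + \sum_(j0 <- s | f j0 == f j) (if f j0 == a then 0 else y j0))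
       = \sum_(j <- s | f j != a) y j.
      rewrite big_seq_cond [RHS]big_seq_cond; apply: eq_bigr => j /andP[sj nj].
      rewrite (negbTE nj) add0r -big_filter (perm_big [:: j]) ?big_seq1 ?(negbTE nj) //.
      apply: uniq_perm; rewrite ?filter_uniq // => k; rewrite mem_filter inE (inj_eq fi).
      by case: eqP => [->|].
    by rewrite addrAC e [X in _ - X](bigID (fun j => f j == a)) /= subrr.
  have : y' (f i) = 0.
    apply: (eig_indep ut) => //; rewrite inE; apply/orP; right; apply: map_f.
    by rewrite mem_filter fa.
  rewrite /y' (negbTE fa) add0r -big_filter (perm_big [:: i]) ?big_seq1 ?(negbTE fa) //.
  apply: uniq_perm; rewrite ?filter_uniq // => k; rewrite mem_filter inE (inj_eq fi).
  by case: eqP => [->|].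
have [/hasP[i si /eqP fa]|/hasPn hn] := boolP (has (fun i => f i == a) s).
  right; exists i; split=> //; rewrite e (big_rem i si) /= big_seq big1 ?addr0 // => j.
  rewrite mem_rem_uniq // !inE => /andP[ji sj]; apply: h0 => //.
  by apply: contraNneq ji => fj; apply/eqP; apply: fi; rewrite fa.
left; rewrite e big_seq big1 // => i si; exact: (h0 i si (hn i si)).
Qed.
End Peval.

(** A maximal subspace A missing x, given by Zorn's lemma, is a complement of the line of x, and phi
    is the coordinate along x. *)
Lemma separate (W : lmodType C) (x : W) : x <> 0 -> exists phi : {linear W -> C^o}, phi x = 1.
Proof.
move=> x0.
pose lc (A : set W) := forall (c : C) a b, A a -> A b -> A (c *: a + b).
pose P (A : set W) := lc A /\ ~ A x.
have [A [[lA nA] mA]] : exists A, P A /\ forall B, (A `<` B)%classic -> ~ P B.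
  apply: Zorn_bigcup => F FP tF; split; last by case=> B /FP[_ nB] /nB.
  move=> c a b [B1 F1 h1] [B2 F2 h2].
  have [h|h] := tF _ _ F1 F2.
    by exists B2 => //; have [l _] := FP _ F2; apply: l => //; apply: h.
  by exists B1 => //; have [l _] := FP _ F1; apply: l => //; apply: h.
(* The condition [lc] does not require 0, so that the union of the empty chain is admissible;
   maximality now excludes that A is empty. *)
have A0 : A 0.
  apply: contrapT => nA0; apply: (mA (A `|` [set 0])%classic).
    split; first by move=> y hy; left.
    by move=> h; apply: nA0; apply: h; right.
  have eA y : ~ A y.
    by move=> hy; apply: nA0; rewrite -(addNr y) -scaleN1r; apply: lA.
  split=> [c a b [/eA //|->] [/eA //|->]|[/eA //|/x0 //]].
  by right; rewrite scaler0 addr0.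
have AZ c y : A y -> A (c *: y) by move=> hy; rewrite -[_ *: _]addr0; apply: lA.
have AD y z : A y -> A z -> A (y + z) by move=> hy hz; rewrite -[y]scale1r; apply: lA.
have dec y : exists c, A (y - c *: x).
  have [hy|ny] := pselect (A y); first by exists 0; rewrite scale0r subr0.
  have [c [a [Aa ex]]] : exists c a, A a /\ x = a + c *: y.
    apply: contrapT => nh; apply: (mA [set z | exists c a, A a /\ z = a + c *: y]%classic).
      split=> [z hz|h]; first by exists 0, z; rewrite scale0r addr0.
      by apply: ny; apply: h; exists 1, 0; rewrite scale1r add0r.
    split=> // c z1 z2 [c1 [a1 [h1 ->]]] [c2 [a2 [h2 ->]]].
    exists (c * c1 + c2), (c *: a1 + a2); split; first exact: lA.
    by rewrite scalerDr scalerDl addrACA scalerA.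
  have c0 : c != 0 by apply/eqP => c0; apply: nA; rewrite ex c0 scale0r addr0.
  exists c^-1; rewrite ex scalerDr scalerA mulVf // scale1r opprD addrCA subrr addr0 -scaleNr.
  exact: AZ.
pose phi y : C^o := projT1 (cid (dec y)).
have phiP y : A (y - phi y *: x) := projT2 (cid (dec y)).
have uq y c : A (y - c *: x) -> phi y = c.
  move=> hc; apply/eqP; rewrite -subr_eq0; apply/negPn/negP => d0; apply: nA.
  have h : A ((phi y - c) *: x).
    rewrite scalerBl (_ : _ - _ = (y - c *: x) + - 1 *: (y - phi y *: x)).
      by apply: AD => //; apply: AZ.
    by rewrite scaleN1r opprB [RHS]addrC addrA subrK.
  by have := AZ (phi y - c)^-1 _ h; rewrite scalerA mulVf // scale1r.
have lphi : linear phi.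
  move=> c y z; apply: uq.
  rewrite (_ : _ - _ = c *: (y - phi y *: x) + (z - phi z *: x)); first exact: lA.
  by rewrite scalerBr scalerA addrACA -opprD -scalerDl.
pose phiL : {linear W -> C^o} := HB.pack phi (GRing.isLinear.Build C W C^o *:%R phi lphi).
exists phiL; rewrite -[phiL x]/(phi x).
by apply: uq; rewrite scale1r subrr.
Qed.

End LinAlg.

(** * Graded pieces generated by lowering modes *)

Section Triangular.
Variable R : realType.
Local Notation C := (R[i]).
Local Notation sgn := (sgn R).
Variables (W : lmodType C) (op : gen -> int -> W -> W) (kf : gen -> gen -> int -> int -> C).
Hypothesis lo : forall a r, linear (op a r).
Hypothesis rel : forall a b r s x, op a r (op b s x)
  = sgn (gpar a && gpar b) *: op b s (op a r x) + cf R a b *: op (tg a b) (r + s) x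
    + kf a b r s *: x.
Hypothesis kf0 : forall a b r s, r + s <> 0 -> kf a b r s = 0.
Variable T0 : W -> Prop.

(** Products of lowering modes of total degree k applied to [T0], in any order; no ordered basis is
    chosen. *)
Inductive TT : nat -> W -> Prop :=
| TT_base x : T0 x -> TT 0 x
| TT_zero k : TT k 0
| TT_lin k c x y : TT k x -> TT k y -> TT k (c *: x + y)
| TT_step a r k x : (0 < r)%N -> TT k x -> TT (k + r)%N (op a (- r%:Z) x).

Definition TTz (k : int) x := match k with Posz n => TT n x | Negz _ => x = 0 end.

Lemma TTz0 k : TTz k 0. Proof. by case: k => //= n; apply: TT_zero. Qed.
Lemma TTz_lin k c x y : TTz k x -> TTz k y -> TTz k (c *: x + y).
Proof. by case: k => n /=; [apply: TT_lin|move=> -> ->; rewrite scaler0 addr0]. Qed.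
Lemma TTzZ k c x : TTz k x -> TTz k (c *: x).
Proof. by move=> h; rewrite -[_ *: _]addr0; apply: TTz_lin => //; apply: TTz0. Qed.
Lemma TTzD k x y : TTz k x -> TTz k y -> TTz k (x + y).
Proof. by move=> hx hy; rewrite -[x]scale1r; apply: TTz_lin. Qed.
Lemma TTz_step k a r x : (0 < r)%N -> TTz k x -> TTz (k + r%:Z) (op a (- r%:Z) x).
Proof.
case: k => n r0 h; first exact: TT_step.
by rewrite h (lin0 (lo _ _)); apply: TTz0.
Qed.

Hypothesis T0pos : forall x a (r : int), T0 x -> 0 < r -> op a r x = 0.
Hypothesis T0zero : forall x a, T0 x -> TT 0 (op a 0 x).

Lemma TT_mode k x : TT k x -> forall a (r : int), TTz (k%:Z - r) (op a r x).
Proof.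
elim=> {k x} [x hx|k|k c x y _ hx _ hy|b q k x q0 hx IH] a r.
- have [r0|[->|r0]] : (0 < r) \/ (r = 0) \/ (r < 0) by lia.
  + by rewrite (T0pos _ hx r0); apply: TTz0.
  + exact: T0zero.
  + have -> : r = - `|r|%N%:Z by lia.
    rewrite opprK; apply: (TTz_step (k := 0%N)); first by lia.
    exact: TT_base.
- by rewrite (lin0 (lo _ _)); apply: TTz0.
- by rewrite lo; apply: TTz_lin.
rewrite rel; apply: TTzD; first apply: TTzD.
- apply: TTzZ; rewrite (_ : (k + q)%N%:Z - r = (k%:Z - r) + q%:Z); last by lia.
  exact: TTz_step.
- apply: TTzZ; rewrite (_ : (k + q)%N%:Z - r = k%:Z - (r - q%:Z)); last by lia.
  exact: IH.
have [e|ne] := eqVneq (r - q%:Z) 0.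
  by apply: TTzZ; rewrite (_ : (k + q)%N%:Z - r = k%:Z); last by lia.
by rewrite kf0 ?scale0r; [apply: TTz0|apply/eqP].
Qed.

Lemma TT_all_op x a r : lspan (fun y => exists k, TT k y) x -> lspan (fun y => exists k, TT k y) (op a r x).
Proof.
elim=> [y [k hy]||c y z _ hy _ hz].
- have := TT_mode hy a r; case: (_ - r) => [n h|n /= ->]; last exact: lspan0.
  by apply: lspan_gen; exists n.
- by rewrite (lin0 (lo _ _)); apply: lspan0.
- by rewrite lo; apply: lspan_lin.
Qed.

Lemma TT0_span x : TT 0 x -> lspan T0 x.
Proof.
have : forall k, TT k x -> k = 0%N -> lspan T0 x.
  move=> k; elim=> {k x} [x hx _|k _|k c x y _ hx _ hy k0|a r k x r0 _ _ e].
  - exact: lspan_gen.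
  - exact: lspan0.
  - by apply: lspan_lin; [apply: hx|apply: hy].
  - lia.
by move=> h /h; apply.
Qed.

Lemma TT_fd (s0 : seq W) : (forall x, T0 x -> x \in s0) -> forall k, finite_dim (TT k).
Proof.
move=> h0; elim/ltn_ind => k IH.
have [S hS] : exists S : nat -> seq W, forall j, (j < k)%N -> forall x, TT j x -> in_span (S j) x.
  have h j : exists s : seq W, (j < k)%N -> forall x, TT j x -> in_span s x.
    have [jk|nj] := boolP (j < k)%N; last by exists [::].
    by have [s hs] := IH j jk; exists s => _ x /hs.
  by exists (fun j => projT1 (cid (h j))) => j; apply: (projT2 (cid (h j))).
pose S' := s0 ++ flatten [seq flatten [seq [seq op a (- r%:Z) y | y <- S (k - r)%N]
     | a <- gens4] | r <- iota 1 k].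
exists S' => w hw.
have : forall k', TT k' w -> k' = k -> in_span S' w.
  move=> k'; elim=> {k' w hw} [x hx _|k' _|k' c x y _ hx _ hy e|a r k' x r0 hx _ e].
  - by apply: in_span_mem; rewrite mem_cat h0.
  - exact: in_span0.
  - by apply: in_span_lin; [apply: hx|apply: hy].
  apply: (@in_span_map _ _ _ (op a (- r%:Z)) (S (k - r)%N)) => //.
    move=> y hy; apply: in_span_mem; rewrite mem_cat; apply/orP; right.
    apply/flattenP; exists (flatten [seq [seq op a (- r%:Z) y | y <- S (k - r)%N] | a <- gens4]).
      by apply/mapP; exists r => //; rewrite mem_iota; lia.
    apply/flattenP; exists [seq op a (- r%:Z) y | y <- S (k - r)%N]; last exact: map_f.
    by case: (a); rewrite /= !inE eqxx ?orbT.
  by apply: hS; [lia|have -> : (k - r)%N = k' by lia].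
by move=> h; apply: (h k).
Qed.
End Triangular.

(** * Spectral flow and highest-weight vectors of the flowed modes *)

Section Flow.
Variable R : realType.
Local Notation C := (R[i]).
Local Notation sgn := (sgn R).
Variables (W : lmodType C) (op : gen -> int -> W -> W).
Hypothesis H : modes op.
Let lo a r : linear (op a r) := md_lin H a r.

(** The constants by which spectral flow would shift the zero modes are not added to the operators;
    they are moved into the central term [flow_k]. *)
Definition flow (p : int) a r := op a (r + p * gch a).
Definition flow_k (p : int) a b r s : C :=
  (r + p * gch a)%:~R * kap R a b * ((r + p * gch a) + (s + p * gch b) == 0)%:R.

Lemma flow_rel p a b r s x : flow p a r (flow p b s x)
  = sgn (gpar a && gpar b) *: flow p b s (flow p a r x) + cf R a b *: flow p (tg a b) (r + s) x
    + flow_k p a b r s *: x.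
Proof.
rewrite /flow (md_comm H) /flow_k; congr (_ + _ + _).
have [->|nz] := eqVneq (cf R a b) 0; first by rewrite !scale0r.
congr (_ *: op _ _ _); rewrite (tg_ch nz); ring.
Qed.

Lemma flow_k0 p a b r s : r + s <> 0 -> flow_k p a b r s = 0.
Proof.
move=> rs; rewrite /flow_k; have [->|nz] := eqVneq (kap R a b) 0; first by rewrite mulr0 mul0r.
rewrite (_ : _ == 0 = false) ?mulr0 //; apply/eqP => e; apply: rs.
have := kap_ch nz => h; rewrite -e addrACA -mulrDr h; ring.
Qed.

Lemma N0_op a r x : op GN 0 (op a r x) = op a r (op GN 0 x) + (gch a)%:~R *: op a r x.
Proof.
case: a.
- by rewrite (mNN H) mulr0z scale0r addr0.
- by rewrite (mNE H) mulr0z mul0r !scale0r.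
- by rewrite (mNP H) add0r mulr1z scale1r.
- by rewrite (mNM H) add0r mulrN1z scaleN1r.
Qed.

Lemma E0_op a r x : op GE 0 (op a r x) = op a r (op GE 0 x).
Proof.
case: a; last exact: (mEM H).
- by rewrite (mEN H) mulr0z mul0r scale0r addr0.
- exact: (mEE H).
- exact: (mEP H).
Qed.

(* [x] is a highest-weight vector for the [p]-th spectral flow. *)
Record FH (p : int) (nu e : C) (x : W) : Prop := FHmk {
  FH_M : forall r, 1 - p <= r -> op GM r x = 0;
  FH_P : forall r, p <= r -> op GP r x = 0;
  FH_NE : forall r : int, 0 < r -> op GN r x = 0 /\ op GE r x = 0;
  FH_N0 : op GN 0 x = nu *: x;
  FH_E0 : op GE 0 x = e *: x }.

Lemma sq0 (y : W) : y = - y -> y = 0.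
Proof.
move=> h; have : (2 : C) *: y = 0 by rewrite scaler_nat mulr2n {2}h subrr.
by move/eqP; rewrite scaler_eq0 pnatr_eq0 /= => /eqP.
Qed.

(** An odd reflection: psi^-_{-p} is the one mode of psi^- that kills highest-weight vectors of the
    flow p + 1 but not necessarily those of the flow p. *)
Lemma FH_up p nu e x : FH p nu e x -> FH (p + 1) (nu - 1) e (op GM (- p) x).
Proof.
case=> hM hP hNE hN hE; split.
- move=> r hr; have [->|rp] := eqVneq r (- p).
    by apply: sq0; rewrite {1}(mMM H).
  by rewrite (mMM H) hM ?(lin0 (lo _ _)) ?oppr0 //; lia.
- move=> r hr; rewrite (mPM H) hP ?(lin0 (lo _ _)) ?oppr0 ?add0r; last lia.
  have [_ ->] := hNE (r - p) ltac:(lia).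
  by rewrite add0r (_ : (_ == 0) = false) ?mulr0 ?scale0r //; lia.
- move=> r r0; have [h1 h2] := hNE r r0; split.
    by rewrite (mNM H) h1 (lin0 (lo _ _)) hM ?subr0 //; lia.
  by rewrite (mEM H) h2 (lin0 (lo _ _)).
- by rewrite N0_op hN (linZ (lo _ _)) -scalerDl.
- by rewrite E0_op hE (linZ (lo _ _)).
Qed.

(** The scalar e + p decides whether the odd reflection can be undone. *)
Lemma FH_upK p nu e x : FH p nu e x -> op GP p (op GM (- p) x) = (e + p%:~R) *: x.
Proof.
case=> hM hP hNE hN hE; rewrite (mPM H) hP // (lin0 (lo _ _)) oppr0 add0r subrr hE.
by rewrite eqxx mulr1 -scalerDl.
Qed.

Lemma FH_down p nu e x : FH p nu e x -> FH (p - 1) (nu + 1) e (op GP (p - 1) x).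
Proof.
case=> hM hP hNE hN hE; split.
- move=> r hr; rewrite (mMP H) hM ?(lin0 (lo _ _)) ?oppr0 ?add0r; last lia.
  have [_ ->] := hNE (r + (p - 1)) ltac:(lia).
  by rewrite sub0r (_ : (_ == 0) = false) ?mulr0 ?scale0r ?oppr0 //; lia.
- move=> r hr; have [->|rp] := eqVneq r (p - 1).
    by apply: sq0; rewrite {1}(mPP H).
  by rewrite (mPP H) hP ?(lin0 (lo _ _)) ?oppr0 //; lia.
- move=> r r0; have [h1 h2] := hNE r r0; split.
    by rewrite (mNP H) h1 (lin0 (lo _ _)) hP ?addr0 //; lia.
  by rewrite (mEP H) h2 (lin0 (lo _ _)).
- by rewrite N0_op hN (linZ (lo _ _)) -scalerDl.
- by rewrite E0_op hE (linZ (lo _ _)).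
Qed.

Lemma FH_downK p nu e x : FH p nu e x -> op GM (1 - p) (op GP (p - 1) x) = (e + (p - 1)%:~R) *: x.
Proof.
case=> hM hP hNE hN hE; rewrite (mMP H) hM ?(lin0 (lo _ _)) ?oppr0 ?add0r //.
rewrite (_ : 1 - p + (p - 1) = 0) ?hE ?eqxx ?mulr1; last by ring.
by rewrite -scalerBl; congr (_ *: _); rewrite -[1 - p]opprB mulrNz opprK.
Qed.

Lemma FH_pos p nu e x a (r : int) : FH p nu e x -> 0 < r -> flow p a r x = 0.
Proof.
case=> hM hP hNE hN hE r0; have [h1 h2] := hNE r r0.
rewrite /flow; case: a; rewrite /= ?mulr0 ?addr0 //.
- apply: hP; lia.
- apply: hM; lia.
Qed.

Definition FHset p (x y : W) := y = x \/ y = op GM (- p) x.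

Lemma FHset_pos p nu e x : FH p nu e x ->
  forall y a (r : int), FHset p x y -> 0 < r -> flow p a r y = 0.
Proof.
move=> h y a r [->|->] r0; first exact: FH_pos h r0.
have [hM hP hNE hN hE] := FH_up h; have [h1 h2] := hNE r r0.
rewrite /flow; case: a; rewrite /= ?mulr0 ?addr0 //.
- apply: hP; lia.
- apply: hM; lia.
Qed.

Lemma FHset_zero p nu e x : FH p nu e x ->
  forall y a, FHset p x y -> TT (flow p) (FHset p x) 0 (flow p a 0 y).
Proof.
move=> h y a hy; have bs z : FHset p x z -> TT (flow p) (FHset p x) 0 z by apply: TT_base.
have bz c z : FHset p x z -> TT (flow p) (FHset p x) 0 (c *: z).
  by move=> hz; rewrite -[_ *: _]addr0; apply: TT_lin (TT_zero _ _ _); apply: bs.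
have [hM hP hNE hN hE] := h; have [uM uP uNE uN uE] := FH_up h.
case: hy => ->; rewrite /flow add0r; case: a => /=; rewrite ?mulr0 ?mulr1 ?mulrN1.
- by rewrite hN; apply: bz; left.
- by rewrite hE; apply: bz; left.
- by rewrite hP //; apply: TT_zero.
- by apply: bs; right.
- by rewrite uN; apply: bz; right.
- by rewrite uE; apply: bz; right.
- by rewrite (FH_upK h); apply: bz; left.
- by rewrite uM; [apply: TT_zero|lia].
Qed.

End Flow.

(** * Homomorphisms and submodules *)

Section Homs.
Variable R : realType.
Local Notation C := (R[i]).
Local Notation sgn := (sgn R).
Variable V : vosa R.

Definition mklin (M N : lmodType C) (f : M -> N) (lf : linear f) : {linear M -> N} :=
  HB.pack f (GRing.isLinear.Build C M N *:%R f lf).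

Lemma sgn_andb_addb (p q a : bool) : sgn ((p (+) q) && a) = sgn (p && a) * sgn (q && a).
Proof. by rewrite -sgn_addb; congr sgn; case: p; case: q; case: a. Qed.

Lemma shomc_sg p q (W1 W2 W3 : vmod V) (f : shom p W2 W3) (g : shom q W1 W2) w :
  sg W3 ((f \o g : {linear W1 -> W3}) w) = sgn (p (+) q) *: (f \o g : {linear W1 -> W3}) (sg W1 w).
Proof. by rewrite /= shf_sg (shf_sg g) linearZ /= scalerA sgn_addb. Qed.
Lemma shomc_act p q (W1 W2 W3 : vmod V) (f : shom p W2 W3) (g : shom q W1 W2) a v n w :
  parity a v -> (f \o g : {linear W1 -> W3}) (act v n w)
  = sgn ((p (+) q) && a) *: act v n ((f \o g : {linear W1 -> W3}) w).
Proof.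
by move=> av; rewrite /= (shf_act g _ _ av) linearZ /= (shf_act f _ _ av) scalerA sgn_andb_addb mulrC.
Qed.
Definition shomc p q (W1 W2 W3 : vmod V) (f : shom p W2 W3) (g : shom q W1 W2) :
  shom (p (+) q) W1 W3 := Shom (shomc_sg f g) (@shomc_act p q W1 W2 W3 f g).

Lemma shom_inv p (W1 W2 : vmod V) (f : shom p W1 W2) : bijective f ->
  exists g : shom p W2 W1, cancel f g /\ cancel g f.
Proof.
case=> g fg gf.
have lg : linear g by move=> c x y; apply: (can_inj fg); rewrite linearP !gf.
have sgg : forall w, sg W1 (mklin lg w) = sgn p *: mklin lg (sg W2 w).
  move=> w; apply: (can_inj fg); rewrite linearZ /= gf -[X in f (sg W1 X)]/(g w).
  have := shf_sg f (g w); rewrite gf => ->; by rewrite scalerA sgnK scale1r.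
have ga : forall a v n w, parity a v -> mklin lg (act v n w) = sgn (p && a) *: act v n (mklin lg w).
  move=> a v n w av; apply: (can_inj fg); rewrite linearZ /= (shf_act f _ _ av) scalerA sgnK.
  by rewrite scale1r !gf.
by exists (Shom sgg ga).
Qed.

Lemma bij_inj_surj (A B : Type) (f : A -> B) : injective f -> (forall y, exists x, f x = y) -> bijective f.
Proof.
move=> fi fs; pose g y := projT1 (cid (fs y)).
have gf y : f (g y) = y := projT2 (cid (fs y)).
by exists g => // x; apply: fi; rewrite gf.
Qed.

Lemma shom_inj p (W1 W2 : vmod V) (f : shom p W1 W2) : (forall x, f x = 0 -> x = 0) -> injective f.
Proof. by move=> h x y e; apply/eqP; rewrite -subr_eq0; apply/eqP/h; rewrite linearB /= e subrr. Qed.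

Lemma submodule_actsub (W : vmod V) (U : W -> Prop) : submodule U -> actsub U.
Proof. by case. Qed.

Lemma sub_ker p (W1 W2 : vmod V) (f : shom p W1 W2) : submodule (fun x => f x = 0).
Proof.
split.
- exact: linear0.
- by move=> c x y hx hy; rewrite linearP hx hy scaler0 addr0.
- move=> x hx; have := shf_sg f x; rewrite hx linear0 => /esym/eqP.
  by rewrite scaler_eq0 (negbTE (sgn_neq0 _ _)) => /eqP.
move=> v n x hx; rewrite (epartE v) (linD (act_linl _ _)) linearD.
by rewrite !(shf_act f _ _ (epart_parity _ _)) hx !linear0 ?scaler0 addr0.
Qed.

Lemma sub_im p (W1 W2 : vmod V) (f : shom p W1 W2) : submodule (fun y => exists x, f x = y).
Proof.
split.
- by exists 0; rewrite linear0.
- by move=> c _ _ [x <-] [y <-]; exists (c *: x + y); rewrite linearP.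
- by move=> _ [x <-]; exists (sgn p *: sg _ x); rewrite linearZ /= shf_sg.
move=> v n _ [x <-].
have h a : exists y, f y = act (epart a v) n (f x).
  exists (sgn (p && a) *: act (epart a v) n x).
  by rewrite linearZ /= (shf_act f _ _ (epart_parity _ _)) scalerA sgnK scale1r.
have [y ey] := h false; have [z ez] := h true.
by exists (y + z); rewrite linearD /= ey ez [in RHS](epartE v) (linD (act_linl _ _)).
Qed.

Lemma sub_preim p (W1 W2 : vmod V) (f : shom p W1 W2) (U : W2 -> Prop) : submodule U ->
  submodule (fun x => U (f x)).
Proof.
move=> hU; have aU := submodule_actsub hU; split.
- by rewrite linear0; apply: submod0.
- by move=> c x y hx hy; rewrite linearP; apply: submodP.
- move=> x hx; have -> : f (sg W1 x) = sgn p *: sg W2 (f x).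
    by rewrite shf_sg scalerA sgnK scale1r.
  by apply: actsubZ => //; apply: submod_sg.
move=> v n x hx; rewrite (epartE v) (linD (act_linl _ _)) linearD.
rewrite !(shf_act f _ _ (epart_parity _ _)); apply: actsubD => //;
  by apply: actsubZ => //; apply: submod_act.
Qed.

Lemma irr_shom_inj p (W1 W2 : vmod V) (f : shom p W1 W2) x : irreducible W1 -> f x <> 0 -> injective f.
Proof.
case=> _ /(_ _ (sub_ker f))[h|h] fx; [exact: shom_inj | by case: fx].
Qed.

Lemma irr_shom_surj p (W1 W2 : vmod V) (f : shom p W1 W2) x : irreducible W2 -> f x <> 0 ->
  forall y, exists z, f z = y.
Proof.
case=> _ /(_ _ (sub_im f))[h|h] fx //; case: fx; apply: h; by exists x.
Qed.

(** The subspaces in [generates] need not be stable under parity, so simplicity does not apply to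
    them directly. The intersection K of those containing x is stable because x is homogeneous. *)
Lemma irr_gen (W : vmod V) a (x : W) : irreducible W -> parity a x -> x <> 0 -> generates (eq^~ x).
Proof.
move=> irr px x0 U hU hx y; pose K y := forall U : W -> Prop, actsub U -> U x -> U y.
have sK : submodule K.
  split=> [U' h _|c u v hu hv U' h hx'|u hu U' h hx'|v n u hu U' h hx'].
  - exact: actsub0.
  - by apply: actsubP => //; [apply: hu|apply: hv].
  - apply: (hu (fun z => U' (sg _ z))); last by rewrite px; apply: actsubZ.
    split=> [|c z t hz ht|v n z hz]; first by rewrite linear0; apply: actsub0.
      by rewrite linearP; apply: actsubP.
    by rewrite act_sg; apply: actsub_act.
  - by apply: actsub_act => //; apply: hu.
have [h|h] := irr.2 K sK; first by case: x0; apply: h => U' _.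
by apply: (h y) => //; apply: hx.
Qed.

Section SubModule.
Variables (W : vmod V) (U : W -> Prop).
Hypothesis hU : submodule U.

Lemma submod_subsp : subsp U.
Proof. by case: hU. Qed.

Let S := subSuper submod_subsp.
Definition sub_act (v : V) n (x : S) : S := ssmk submod_subsp (submod_act hU v n (ssT_valP x)).

Lemma sub_jacobi : jacobi (@vprod R V) sub_act sub_act false sub_act.
Proof.
move=> a b v w1 av bw1 w2 m n h; apply: val_inj.
have hl (f : nat -> S) : (exists N, forall i, (N <= i)%N -> f i = 0) ->
    val (\sum_(i \in [set: nat]) f i) = \sum_(i \in [set: nat]) val (f i).
  case=> N hN; rewrite (fsumE hN) (@fsumE _ (fun i => val (f i)) N).
    by rewrite (big_morph (val : S -> W) (id1 := 0) (op1 := +%R)).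
  by move=> i /hN ->.
have [N1 h1] := act_trunc_ge (W := vself V) v n w1.
have [N2 h2] := act_trunc_ge w1 h (val w2).
have [N3 h3] := act_trunc_ge v m (val w2).
rewrite !hl; first exact: (act_jacobi av bw1 (val w2) m n h).
- exists (N2 + N3)%N => i hi; apply: val_inj; rewrite /= h3; last lia.
  rewrite (_ : h + i%:R = h + i%:Z); last by rewrite -[i%:R]/(i%:R : int) pmulrn intz.
  by rewrite h2 ?linear0 ?scaler0 ?subr0 ?addr0 ?scaler0 //; lia.
exists N1 => i hi; apply: val_inj => /=.
by rewrite [vprod _ _ _]h1 ?(lin0 (act_linl _ _)) ?scaler0; last lia.
Qed.

Definition subvmod : vmod V.
Proof.
refine (@Vmod _ V S sub_act _ _ _ _ _ sub_jacobi).
- by move=> n x c u v; apply: val_inj; rewrite /= act_linl.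
- by move=> v n c x y; apply: val_inj; rewrite /= linearP.
- by move=> v n x; apply: val_inj; rewrite /= act_sg.
- move=> v x; have [N hN] := act_trunc v (val x); exists N => n hn; apply: val_inj; exact: hN.
- by move=> n x; apply: val_inj; rewrite /= act_vac; case: ifP.
Defined.

Lemma subinc_sg (x : subvmod) : sg W (ssval submod_subsp x) = sgn false *: ssval submod_subsp (sg _ x).
Proof. by rewrite sgn0 scale1r. Qed.
Lemma subinc_act a v n (x : subvmod) : parity a v ->
  ssval submod_subsp (act v n x) = sgn (false && a) *: act v n (ssval submod_subsp x).
Proof. by rewrite sgn0 scale1r. Qed.
Definition subinc : shom false subvmod W :=
  @Shom R V false subvmod W (ssval submod_subsp) subinc_sg subinc_act.

Lemma subinc_inj : injective subinc. Proof. exact: val_inj. Qed.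
Lemma subincP x : U (subinc x). Proof. exact: ssT_valP. Qed.
Lemma subinc_im x : U x -> exists y, subinc y = x.
Proof. by move=> ux; exists (ssmk submod_subsp ux). Qed.
End SubModule.

End Homs.

(** * Highest-weight theory *)

Section HighestWeight.
Variable R : realType.
Local Notation C := (R[i]).
Local Notation sgn := (sgn R).
Variables (V : vosa R) (J : {linear gl11 R -> V}).
Hypothesis HV : is_V1gl11 J.

Section OneModule.
Variable W : vmod V.
Local Notation w := (Wop J (W := W)).
Local Notation L0 := (Lop (W := W) 0).
Let Hm : modes w := Wop_modes HV W.
Let lw a r : linear (w a r) := md_lin Hm a r.

Lemma Lop_lin n : linear (Lop (W := W) n).
Proof. exact: act_linr. Qed.

Lemma actsub_w (U : W -> Prop) : actsub U -> forall g r x, U x -> U (w g r x).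
Proof. by move=> h g r x; apply: actsub_act. Qed.

Lemma w_sg g r (x : W) : w g r (sg W x) = sgn (gpar g) *: sg W (w g r x).
Proof. by rewrite (Wop_sg HV) scalerA sgnK scale1r. Qed.

Lemma w_parity b g r (x : W) : parity b x -> parity (gpar g (+) b) (w g r x).
Proof. by move=> h; rewrite /parity (Wop_sg HV) h (linZ (lw _ _)) scalerA sgn_addb. Qed.

Lemma weight_op h g (r : int) x : weight_space h x -> weight_space (h - r%:~R) (w g r x).
Proof.
case=> n hn; exists n; suff e y : forall m, iter m (fun x => L0 x - (h - r%:~R) *: x) (w g r y)
   = w g r (iter m (fun x => L0 x - h *: x) y) by rewrite e hn (lin0 (lw _ _)).
elim=> //= m ->; rewrite (Lop_comm HV) addr0 (linD (lw _ _)) -[- (h *: _)]scaleNr (linZ (lw _ _)).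
by rewrite -addrA; congr (_ + _); rewrite scaleNr scalerBl opprB addrA addNr add0r.
Qed.

Definition chain_of (g y : W) := forall U : W -> Prop, actsub U -> (U g <-> U y).

Lemma FH_nz_up p nu e b x : FH w p nu e x -> e + p%:~R <> 0 -> x <> 0 -> parity b x ->
  [/\ w GM (- p) x <> 0, parity (~~ b) (w GM (- p) x) & chain_of x (w GM (- p) x)].
Proof.
move=> h ep x0 bx; have hK := FH_upK Hm h; split; last 1 first.
- move=> U hU; split=> [ux|hu]; first exact: actsub_w.
  have := actsub_w hU GP p hu; rewrite hK => /(actsubZ (e + p%:~R)^-1 hU).
  by rewrite scalerA mulVf ?scale1r //; apply/eqP.
- move=> z; move: hK; rewrite z (lin0 (lw _ _)) => /esym/eqP.
  by rewrite scaler_eq0 => /orP[/eqP|/eqP].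
- exact: (w_parity GM).
Qed.

Lemma FH_nz_down p nu e b x : FH w p nu e x -> e + (p - 1)%:~R <> 0 -> x <> 0 -> parity b x ->
  [/\ w GP (p - 1) x <> 0, parity (~~ b) (w GP (p - 1) x) & chain_of x (w GP (p - 1) x)].
Proof.
move=> h ep x0 bx; have hK := FH_downK Hm h; split; last 1 first.
- move=> U hU; split=> [ux|hu]; first exact: actsub_w.
  have := actsub_w hU GM (1 - p) hu; rewrite hK => /(actsubZ (e + (p - 1)%:~R)^-1 hU).
  by rewrite scalerA mulVf ?scale1r //; apply/eqP.
- move=> z; move: hK; rewrite z (lin0 (lw _ _)) => /esym/eqP.
  by rewrite scaler_eq0 => /orP[/eqP|/eqP].
- exact: (w_parity GP).
Qed.

(** The reflection psi^-_{-q} raises L_0 by q, and 0 + 1 + ... + (p - 1) = p (p - 1) / 2; the same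
    polynomial counts the reflections by psi^+ for negative p. *)
Definition flow_wt (D : C) (p : int) : C := D + p%:~R * (p%:~R - 1) / 2.

Lemma chain_up nu e D b g (n : nat) : (forall q : nat, (q < n)%N -> e + q%:R <> 0) ->
  FH w 0 nu e g -> L0 g = D *: g -> g <> 0 -> parity b g ->
  exists y b', [/\ FH w n (nu - n%:R) e y, L0 y = flow_wt D n *: y, y <> 0, parity b' y & chain_of g y].
Proof.
move=> he h hL g0 bg; elim: n he => [|n IH] he.
  exists g, b; split=> //; first by rewrite subr0.
  by rewrite /flow_wt mulr0z mul0r mul0r addr0.
have [y [b' [fy ly y0 by' cy]]] := IH (fun q hq => he q (ltnW hq)).
have [z0 bz cz] := FH_nz_up fy (he n (leqnn _)) y0 by'.
exists (w GM (- n%:Z) y), (~~ b'); split=> //.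
- have := FH_up Hm fy; rewrite -addrA -opprD natr1.
  by rewrite (_ : n%:Z + 1 = n.+1%:Z) //; lia.
- rewrite (Lop_comm HV) addr0 ly (linZ (lw _ _)) -scalerBl; congr (_ *: _).
  by rewrite /flow_wt mulrNz opprK -!pmulrn -natr1; field.
by move=> U hU; have [? ?] := cy U hU; have [? ?] := cz U hU; split; auto.
Qed.

Lemma chain_down nu e D b g (n : nat) : (forall q : nat, (q < n)%N -> e - q.+1%:R <> 0) ->
  FH w 0 nu e g -> L0 g = D *: g -> g <> 0 -> parity b g ->
  exists y b', 
  [/\ FH w (- n%:Z) (nu + n%:R) e y, L0 y = flow_wt D (- n%:Z) *: y, y <> 0, parity b' y & chain_of g y].
Proof.
move=> he h hL g0 bg; elim: n he => [|n IH] he.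
  exists g, b; split=> //; first by rewrite addr0.
  by rewrite /flow_wt mulr0z mul0r mul0r addr0.
have [y [b' [fy ly y0 by' cy]]] := IH (fun q hq => he q (ltnW hq)).
have ep : e + (- n%:Z - 1)%:~R <> 0.
  rewrite (_ : - n%:Z - 1 = - n.+1%:Z); last lia.
  by rewrite mulrNz; apply: (he n).
have [z0 bz cz] := FH_nz_down fy ep y0 by'.
exists (w GP (- n%:Z - 1) y), (~~ b'); split=> //.
- have := FH_down Hm fy; rewrite -addrA natr1.
  by rewrite (_ : - n%:Z - 1 = - n.+1%:Z) //; lia.
- rewrite (Lop_comm HV) addr0 ly (linZ (lw _ _)) -scalerBl; congr (_ *: _).
  rewrite /flow_wt (_ : - n%:Z - 1 = - n.+1%:Z); last lia.
  by rewrite !mulrNz -!pmulrn -natr1; field.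
by move=> U hU; have [? ?] := cy U hU; have [? ?] := cz U hU; split; auto.
Qed.

Lemma chain nu e D b g (p : int) : (forall z : int, e <> z%:~R) ->
  FH w 0 nu e g -> L0 g = D *: g -> g <> 0 -> parity b g ->
  exists y b', 
  [/\ FH w p (nu - p%:~R) e y, L0 y = flow_wt D p *: y, y <> 0, parity b' y & chain_of g y].
Proof.
move=> he h hL g0 bg.
have [n [->|->]] : exists n : nat, p = n%:Z \/ p = - n%:Z by exists `|p|%N; lia.
  have hn (q : nat) : (q < n)%N -> e + q%:R <> 0.
    by move=> _ /eqP; rewrite addr_eq0 => /eqP ee; apply: (he (- q%:Z)); rewrite mulrNz -pmulrn.
  have [y [b' hy]] := chain_up hn h hL g0 bg.
  by exists y, b'.
have hn (q : nat) : (q < n)%N -> e - q.+1%:R <> 0.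
  by move=> _ /eqP; rewrite subr_eq0 => /eqP ee; apply: (he q.+1%:Z); rewrite -pmulrn.
have [y [b' [h1 h2 h3 h4 h5]]] := chain_down hn h hL g0 bg.
by exists y, b'; split=> //; rewrite mulrNz opprK -pmulrn.
Qed.

(* The operator measuring the degree of the [p]-th flow *)
Definition Dp (p : int) (x : W) : W := L0 x + p%:~R *: w GN 0 x.

Lemma Dp_lin p : linear (Dp p).
Proof.
move=> c x y; rewrite /Dp (Lop_lin 0) lw !scalerDr !scalerA addrACA.
by rewrite [p%:~R * c]mulrC.
Qed.

Lemma Dp_flow p a r x : Dp p (flow w p a r x) = flow w p a r (Dp p x) - r%:~R *: flow w p a r x.
Proof.
rewrite /Dp /flow (Lop_comm HV) (N0_op Hm) addr0 (linD (lw _ _)) (linZ (lw _ _)) scalerDr.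
rewrite addrACA -addrA [RHS]addrAC -!addrA; congr (_ + _); rewrite [RHS]addrC; congr (_ + _).
rewrite scalerA -scaleNr -scalerDl -scaleNr; congr (_ *: _).
by rewrite intrD intrM; ring.
Qed.

Section Graded.
Variables (p : int) (T0 : W -> Prop) (d : C).
Hypothesis T0pos : forall y a (r : int), T0 y -> 0 < r -> flow w p a r y = 0.
Hypothesis T0zero : forall y a, T0 y -> TT (flow w p) T0 0 (flow w p a 0 y).
Hypothesis T0d : forall y, T0 y -> Dp p y = d *: y.
Hypothesis T0gen : generates T0.
Local Notation G := (TT (flow w p) T0).

Lemma graded_all x : lspan (fun y => exists k, G k y) x.
Proof.
apply: T0gen x => [|y hy]; last by apply: lspan_gen; exists 0%N; apply: TT_base.
apply: (Jclosed_actsub HV); [exact: lspan0|exact: lspan_lin|move=> a r x hx].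
have -> : w a r x = flow w p a (r - p * gch a) x by rewrite /flow subrK.
apply: (@TT_all_op R W (flow w p) (flow_k R p)) => //; first by move=> *; apply: lw.
- exact: flow_rel.
- by move=> *; apply: flow_k0.
Qed.

Lemma graded_Dp k x : G k x -> Dp p x = (d + k%:R) *: x.
Proof.
elim=> {k x}[x /T0d ->|k|k c x y _ hx _ hy|a r k x r0 _ hx].
- by rewrite addr0.
- by rewrite (lin0 (Dp_lin p)) scaler0.
- by rewrite Dp_lin hx hy scalerDr !scalerA mulrC.
rewrite Dp_flow hx [flow w p a _ (_ *: _)](linZ (lw _ _)) -scalerBl; congr (_ *: _).
by rewrite mulrNz opprK -pmulrn natrD addrA.
Qed.

Lemma graded_deg c x : Dp p x = c *: x -> x <> 0 -> exists k : nat, c = d + k%:R /\ G k x.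
Proof.
move=> hx x0.
have fi : injective (fun k : nat => d + k%:R : C).
  by move=> k l /addrI /eqP; rewrite eqr_nat => /eqP.
suff [//|[k [e gk]]] : x = 0 \/ exists k, d + k%:R = c /\ G k x by exists k.
apply: (@eig_graded R W (Dp p) (Dp_lin p) (fun a x => Dp p x = a *: x) _ _ _ nat
  (fun k => d + k%:R) G c x fi _ _ _ (graded_all x) hx).
- by move=> a; rewrite (lin0 (Dp_lin p)) scaler0.
- by move=> a c' u v hu hv; rewrite Dp_lin hu hv scalerDr !scalerA mulrC.
- by move=> a u hu; exists 1%N; rewrite expr1 (pevalXsubC (Dp_lin p)) hu subrr.
- by move=> i y; apply: graded_Dp.
- by move=> i; apply: TT_zero.
- by move=> i; apply: TT_lin.
Qed.

End Graded.

Lemma Dp_eig p nu D (x : W) : w GN 0 x = nu *: x -> L0 x = D *: x -> Dp p x = (D + p%:~R * nu) *: x.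
Proof. by move=> hN hL; rewrite /Dp hN hL scalerA -scalerDl. Qed.

Lemma FHset_Dp p nu e D x : FH w p nu e x -> L0 x = D *: x ->
  forall y, FHset w p x y -> Dp p y = (D + p%:~R * nu) *: y.
Proof.
move=> h hL y [->|->]; first by apply: Dp_eig => //; case: h.
have := Dp_flow p GM 0 x; rewrite /flow add0r /= mulrN1 scale0r subr0 => ->.
by rewrite (Dp_eig p (FH_N0 h) hL) (linZ (lw _ _)).
Qed.

Lemma FHset_gen p (x : W) : generates (eq^~ x) -> generates (FHset w p x).
Proof. by move=> g U hU h; apply: g => // _ ->; apply: h; left. Qed.

(** What the search for singular vectors uses. It holds for objects of O^fin, and by [lowest_gen]
    for modules generated by a highest-weight vector, before their simplicity or membership in O^fin
    is known. *)
Record lowest : Prop := Lowest {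
  lw_gen : forall x : W, lspan (fun x => exists h, weight_space h x) x;
  lw_bnd : forall h, exists N : nat, forall n : nat, (N <= n)%N ->
    forall x : W, weight_space (h - n%:R) x -> x = 0;
  lw_N : forall x : W, lspan (fun x => exists a : C, w GN 0 x = a *: x) x;
  lw_E : forall x : W, lspan (fun x => exists a : C, w GE 0 x = a *: x) x }.

Lemma lspan_nz (G : W -> Prop) x : lspan G x -> x <> 0 -> exists y, G y /\ y <> 0.
Proof.
elim=> [y gy y0||c y z _ hy _ hz e] //; first by exists y.
have [yz|yn] := pselect (y = 0); last exact: hy.
by apply: hz => z0; apply: e; rewrite yz z0 scaler0 addr0.
Qed.

Lemma weight_lin h c (x y : W) : weight_space h x -> weight_space h y -> weight_space h (c *: x + y).
Proof.
case=> n hn [m hm]; exists (n + m)%N; set T := fun x => _.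
have lT : linear T.
  move=> a u v; rewrite /T (Lop_lin 0) scalerBr scalerDr opprD addrACA !scalerA.
  by rewrite [h * a]mulrC.
rewrite (iter_lin lT) {1}addnC !iterD hn hm.
by rewrite !(lin0 (iter_lin lT _)) scaler0 addr0.
Qed.

Lemma weight0 h : weight_space h (0 : W).
Proof. by exists 0%N. Qed.

Lemma weight_eig h (x : W) : L0 x = h *: x -> weight_space h x.
Proof. by move=> e; exists 1%N; rewrite /= e subrr. Qed.

Lemma weight_ops (U : W -> Prop) x : U 0 -> (forall (c : C) y z, U y -> U z -> U (c *: y + z)) ->
  (forall y, U y -> U (L0 y)) -> lspan (fun x => exists h, weight_space h x) x -> U x ->
  lspan (fun x => U x /\ exists h, weight_space h x) x.
Proof.
move=> U0 Ul UT hx Ux; have l0 := Lop_lin 0.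
apply: (@eig_stable _ W L0 l0 (@weight_space R V W) _ _ _ U x) => //.
- exact: weight0.
- by move=> a c u v; apply: weight_lin.
- by move=> a u [n hn]; exists n; rewrite -(iter_peval l0).
Qed.

Lemma eig_ops (T : W -> W) (U : W -> Prop) x : linear T -> U 0 ->
  (forall (c : C) y z, U y -> U z -> U (c *: y + z)) ->
  (forall y, U y -> U (T y)) -> lspan (fun x => exists a : C, T x = a *: x) x -> U x ->
  lspan (fun x => U x /\ exists a : C, T x = a *: x) x.
Proof.
move=> lT U0 Ul UT hx Ux; apply: (@eig_stable _ W T lT (fun a x => T x = a *: x) _ _ _ U x) => //.
- by move=> a; rewrite (lin0 lT) scaler0.
- by move=> a c' u v hu hv; rewrite lT hu hv scalerDr !scalerA mulrC.
- by move=> a u hu; exists 1%N; rewrite expr1 (pevalXsubC lT) hu subrr.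
Qed.

Lemma FH_top nu e x : FH w 0 nu e x -> L0 x = ((nu - 2^-1) * e + 2^-1 * e ^+ 2) *: x.
Proof.
move=> h; have [hM hP hNE hN hE] := h; apply: (L0_top HV) => //; last exact: hP.
move=> g r r0; have [h1 h2] := hNE r r0; case: g => //.
- apply: hP; lia.
- apply: hM; lia.
Qed.

Lemma singular_exists (K : W -> Prop) : lowest -> submodule K -> (exists x, K x /\ x <> 0) ->
  exists x nu e b, [/\ K x, x <> 0, FH w 0 nu e x & parity b x].
Proof.
case=> hg hb hN hE sK [x [Kx x0]]; have aK := submodule_actsub sK.
have lL0 := Lop_lin 0.
have [y [[Ky [h wy]] y0]] := lspan_nz (weight_ops (actsub0 aK) (actsubP aK)
  (fun y => actsub_act aK (omega V) (0 + 1) (x := y)) (hg x) Kx) x0.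
(* Weights in K can be lowered by integers only up to a bound. At the maximal n all positive modes
   must kill the weight space. *)
pose P n := `[< exists y, [/\ K y, y <> 0 & weight_space (h - n%:R) y] >].
have [N hN0] := hb h.
have P0 : exists n, P n by exists 0%N; apply/asboolP; exists y; rewrite subr0.
have PN n : P n -> (n <= N)%N.
  move=> /asboolP[z [Kz z0 wz]]; rewrite leqNgt; apply/negP => nN; apply: z0.
  exact: (hN0 n (ltnW nN)).
case: (ex_maxnP P0 PN) => n /asboolP[z [Kz z0 wz]] mx.
pose U1 u := [/\ K u, weight_space (h - n%:R) u & forall g (r : int), 0 < r -> w g r u = 0].
have U1z : U1 z.
  split=> // g r r0; apply: contrapT => nz.
  have : P (n + `|r|)%N.
    apply/asboolP; exists (w g r z); split=> //; first exact: actsub_w.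
    have := weight_op g r wz; rewrite -addrA -opprD.
    by rewrite (_ : n%:R + r%:~R = (n + `|r|)%:R) // natrD; congr (_ + _); rewrite pmulrn; congr (_%:~R); lia.
  by move/mx; lia.
have U10 : U1 0.
  split; [exact: actsub0|exact: weight0|by move=> g r _; apply: lin0; apply: lw].
have U1l (c : C) u v : U1 u -> U1 v -> U1 (c *: u + v).
  move=> [k1 w1 p1] [k2 w2 p2]; split; [exact: actsubP|exact: weight_lin|].
  by move=> g r r0; rewrite lw p1 // p2 // scaler0 addr0.
have U1op a u : U1 u -> U1 (w a 0 u).
  move=> [k1 w1 p1]; split; first exact: actsub_w.
    by have := weight_op a 0 w1; rewrite subr0.
  move=> g r r0; rewrite (md_comm Hm) addr0 (p1 g r r0) (p1 (tg g a) r r0) (lin0 (lw _ _)) !scaler0.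
  by rewrite (_ : (r == 0) = false) ?mulr0 ?scale0r ?addr0 //; lia.
have [y1 [[U1y [nu ny]] y10]] := lspan_nz (eig_ops (lw GN 0) U10 U1l (U1op GN) (hN z) U1z) z0.
pose U2 u := U1 u /\ w GN 0 u = nu *: u.
have U20 : U2 0 by split=> //; rewrite (lin0 (lw _ _)) scaler0.
have U2l (c : C) u v : U2 u -> U2 v -> U2 (c *: u + v).
  move=> [u1 n1] [v1 n2]; split; first exact: U1l.
  by rewrite lw n1 n2 scalerDr !scalerA mulrC.
have U2E u : U2 u -> U2 (w GE 0 u).
  move=> [u1 n1]; split; first exact: U1op.
  by rewrite (N0_op Hm) n1 (linZ (lw _ _)) mulr0z scale0r addr0.
have [y2 [[[U2y ny2] [e ey2]] y20]] :=
  lspan_nz (eig_ops (lw GE 0) U20 U2l U2E (hE y1) (conj U1y ny)) y10.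
(* If psi^+_0 does not kill the vector, it is replaced by its image, which psi^+_0 kills because its
   square is zero. *)
have [y3 [nu3 [U3 ny3 ey3 p3 y30]]] : exists y3 nu3, [/\ U1 y3, w GN 0 y3 = nu3 *: y3,
    w GE 0 y3 = e *: y3, w GP 0 y3 = 0 & y3 <> 0].
  have [z1|nz1] := pselect (w GP 0 y2 = 0); first by exists y2, nu.
  exists (w GP 0 y2), (nu + 1); split=> //; first exact: U1op.
  - by rewrite (N0_op Hm) ny2 (linZ (lw _ _)) mulr1z -scalerDl.
  - by rewrite (E0_op Hm) ey2 (linZ (lw _ _)).
  - by apply: sq0; rewrite {1}(mPP Hm).
have [K3 w3 pos3] := U3.
have fh : FH w 0 nu3 e y3.
  split=> //.
  - by move=> r hr; apply: pos3; lia.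
  - by move=> r hr; have [->|rn] := eqVneq r 0; [exact: p3|apply: pos3; lia].
  - by move=> r r0; split; apply: pos3.
have fhe b : FH w 0 nu3 e (epart b y3).
  have lin g r : w g r (epart b y3) = 2^-1 *: (w g r y3 + (sgn b * sgn (gpar g)) *: sg W (w g r y3)).
    by rewrite /epart (linZ (lw _ _)) (linD (lw _ _)) (linZ (lw _ _)) w_sg scalerA.
  have zz g r : w g r y3 = 0 -> w g r (epart b y3) = 0.
    by rewrite lin => ->; rewrite linear0 ?(scaler0, addr0).
  have sc g r c : gpar g = false -> w g r y3 = c *: y3 -> w g r (epart b y3) = c *: epart b y3.
    move=> gp; rewrite lin => ->; rewrite gp sgn0 mulr1 linearZ /= /epart !scalerDr !scalerA.
    by congr (_ *: _ + _ *: _); ring.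
  case: fh => hM hP hNE hN0' hE0; split.
  - by move=> r hr; apply: zz; apply: hM.
  - by move=> r hr; apply: zz; apply: hP.
  - by move=> r r0; have [? ?] := hNE r r0; split; apply: zz.
  - exact: sc.
  - exact: sc.
have Ke b : K (epart b y3).
  rewrite /epart; apply: actsubZ => //; apply: actsubD => //; apply: actsubZ => //.
  exact: (submod_sg sK).
have [e0|e0] := pselect (epart false y3 = 0).
  exists (epart true y3), nu3, e, true; split=> //; last exact: epart_parity.
  by move=> e1; apply: y30; rewrite (epartE y3) e0 e1 addr0.
by exists (epart false y3), nu3, e, false; split=> //; apply: epart_parity.
Qed.

Lemma weight_deg nu e (x : W) h (z : W) : FH w 0 nu e x -> generates (eq^~ x) ->
  weight_space h z -> z <> 0 -> exists k : nat,
  ((nu - 2^-1) * e + 2^-1 * e ^+ 2) + k%:R = h /\ TT (flow w 0) (FHset w 0 x) k z.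
Proof.
move=> fx gx hz z0; have hL := FH_top fx; set D := _ + _ in hL *.
have l0 := Lop_lin 0.
have fi : injective (fun k : nat => D + k%:R : C).
  by move=> k l /addrI /eqP; rewrite eqr_nat => /eqP.
have h1 := FHset_pos Hm fx; have h2 := FHset_zero Hm fx.
have h3 := FHset_Dp fx hL; have h4 := FHset_gen (p := 0) gx.
suff [//|[k [ek gk]]] : z = 0 \/ exists k, D + k%:R = h /\ TT (flow w 0) (FHset w 0 x) k z.
  by exists k.
apply: (@eig_graded R W L0 l0 (@weight_space R V W) _ _ _ nat (fun k => D + k%:R)
  (TT (flow w 0) (FHset w 0 x)) h z fi _ _ _ (graded_all h1 h2 h4 z) hz).
- exact: weight0.
- by move=> a c u v; apply: weight_lin.
- by move=> a u [m hm]; exists m; rewrite -(iter_peval l0).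
- move=> i y hy; apply: weight_eig; have := graded_Dp h3 hy.
  by rewrite /Dp mulr0z scale0r addr0 mul0r addr0.
- by move=> i; apply: TT_zero.
- by move=> i; apply: TT_lin.
Qed.

Lemma lowest_gen nu e (x : W) : FH w 0 nu e x -> generates (eq^~ x) -> lowest.
Proof.
move=> fx gx; have hL := FH_top fx; set D := _ + _ in hL.
pose good y := [/\ exists a : C, w GN 0 y = a *: y, w GE 0 y = e *: y & exists a : C, L0 y = a *: y].
have gd y : lspan good y.
  apply: gx y => [|_ ->]; last first.
    by apply: lspan_gen; split; [exists nu; case: fx|case: fx|exists D].
  apply: (Jclosed_actsub HV); [exact: lspan0|exact: lspan_lin|move=> g r y].
  elim=> [z [[a ha] hb [c hc]]||c u v _ hu _ hv].
  - apply: lspan_gen; split.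
    + by exists (a + (gch g)%:~R); rewrite (N0_op Hm) ha (linZ (lw _ _)) -scalerDl.
    + by rewrite (E0_op Hm) hb (linZ (lw _ _)).
    + by exists (c - r%:~R); rewrite (Lop_comm HV) addr0 hc (linZ (lw _ _)) -scalerBl.
  - by rewrite (lin0 (lw _ _)); apply: lspan0.
  - by rewrite lw; apply: lspan_lin.
have wt h (n : nat) (z : W) : weight_space (h - n%:R) z -> z <> 0 -> exists k : nat, h - n%:R = D + k%:R.
  by move=> hz z0; have [k [ek _]] := weight_deg fx gx hz z0; exists k.
split.
- by move=> y; apply: lspan_sub (gd y) => z [_ _ [a ha]]; apply: lspan_gen; exists a; apply: weight_eig.
- move=> h; have [[n0 [k0 ek]]|nh] := pselect (exists n0 k0 : nat, h - n0%:R = D + k0%:R).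
    exists (n0 + k0).+1 => n hn z wz; apply: contrapT => z0.
    have [k ek'] := wt h n z wz z0.
    have : (n0 + k0)%:R = (n + k)%:R :> C.
      rewrite !natrD -[k0%:R](addKr D) -ek -[k%:R](addKr D) -ek'; ring.
    by move/eqP; rewrite eqr_nat => /eqP; lia.
  exists 0%N => n _ z wz; apply: contrapT => z0; apply: nh; exists n; exact: (wt h n z wz z0).
- by move=> y; apply: lspan_sub (gd y) => z [? _ _]; apply: lspan_gen.
- by move=> y; apply: lspan_sub (gd y) => z [_ ? _]; apply: lspan_gen; exists e.
Qed.

End OneModule.
End HighestWeight.

(* Identities between linear combinations are checked on linear forms. *)
Lemma lin_ext (R : realType) (W : lmodType R[i]) (x y : W) :
  (forall phi : W -> R[i], {morph phi : u v / u + v} -> {morph phi : u / - u} ->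
    (forall c u, phi (c *: u) = c * phi u) -> phi 0 = 0 -> phi x = phi y) -> x = y.
Proof.
move=> h; apply: contrapT => n; have n0 : x - y <> 0 by move=> /eqP; rewrite subr_eq0 => /eqP.
have [phi] := separate n0; rewrite linearB /= (h (fun u => phi u)) ?subrr.
- by move=> /eqP; rewrite eq_sym oner_eq0.
- by move=> u v; rewrite linearD.
- by move=> u; rewrite linearN.
- by move=> c u; rewrite linearZ.
- by rewrite linear0.
Qed.
Ltac lmod := apply: lin_ext; let p := fresh "p" in let pD := fresh "pD" in
  let pN := fresh "pN" in let pZ := fresh "pZ" in let p0 := fresh "p0" in
  intros p pD pN pZ p0; rewrite ?(pD, pN, pZ, p0); ring.

(** * Simplicity of highest-weight modules, and extremal vectors of the simple currents *)

Section Irreducibility.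
Variable R : realType.
Local Notation C := (R[i]).
Local Notation sgn := (sgn R).
Variables (V : vosa R) (J : {linear gl11 R -> V}).
Hypothesis HV : is_V1gl11 J.
Variable W : vmod V.
Local Notation w := (Wop J (W := W)).
Local Notation L0 := (Lop (W := W) 0).
Let Hm : modes w := Wop_modes HV W.
Let lw a r : linear (w a r) := md_lin Hm a r.

(** Degree zero is spanned by x and psi^-_{-p} x, whose charges nu and nu - 1 differ. *)
Lemma FHset_span nu e p (x y : W) : FH w p nu e x -> TT (flow w p) (FHset w p x) 0 y ->
  w GN 0 y = nu *: y -> exists c, y = c *: x.
Proof.
move=> fx /(TT0_span) hy ny.
have [a [b ey]] : exists a b, y = a *: x + b *: w GM (- p) x.
  elim: hy {ny} => [z [->|->]||c u v _ [a1 [b1 ->]] _ [a2 [b2 ->]]].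
  - by exists 1, 0; rewrite scale1r scale0r addr0.
  - by exists 0, 1; rewrite scale1r scale0r add0r.
  - by exists 0, 0; rewrite !scale0r addr0.
  - by exists (c * a1 + a2), (c * b1 + b2); rewrite !scalerDr !scalerDl !scalerA addrACA.
exists a; rewrite ey; suff -> : b *: w GM (- p) x = 0 by rewrite addr0.
move: ny; rewrite ey lw (linZ (lw _ _)) (FH_N0 fx) (FH_N0 (FH_up Hm fx)).
rewrite !scalerDr !scalerA [nu * a]mulrC => /addrI/eqP; rewrite -subr_eq0 -scalerBl => /eqP e0.
have -> : b = - (b * (nu - 1) - nu * b) by ring.
by rewrite scaleNr e0 oppr0.
Qed.

Lemma generates_E0 e (g : W) : w GE 0 g = e *: g -> generates (eq^~ g) -> forall x, w GE 0 x = e *: x.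
Proof.
move=> hg gg; apply: gg => [|_ -> //]; apply: (Jclosed_actsub HV).
- by rewrite (lin0 (lw _ _)) scaler0.
- by move=> c x y hx hy; rewrite lw hx hy scalerDr !scalerA mulrC.
- by move=> a r x hx; rewrite (E0_op Hm) hx (linZ (lw _ _)).
Qed.

(* Comparing the degrees of a singular vector and of the generator along all
   spectral flows forces them to have the same charge. *)
Lemma verma_irr nu e b (g : W) : (forall z : int, e <> z%:~R) -> FH w 0 nu e g ->
  parity b g -> g <> 0 -> generates (eq^~ g) -> irreducible W.
Proof.
move=> he fg bg g0 gg; split; first by exists g.
move=> K sK; have [[x [Kx x0]]|nK] := pselect (exists x, K x /\ x <> 0); last first.
  by left=> x Kx; apply: contrapT => x0; apply: nK; exists x.
right; have [y [nu' [e' [b' [Ky y0 fy by']]]]] :=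
  singular_exists HV (lowest_gen HV fg gg) sK (ex_intro _ x (conj Kx x0)).
have ee : e' = e.
  apply: contrapT => ne; apply: y0; have := generates_E0 (FH_E0 fg) gg y.
  rewrite (FH_E0 fy) => /eqP; rewrite -subr_eq0 -scalerBl scaler_eq0 => /orP[|/eqP //].
  by rewrite subr_eq0 => /eqP.
subst e'.
(* Both highest-weight vectors are moved to the p-th flow, which is possible for every p since e is
   not an integer. The degree of the second relative to the first is a natural number. *)
have deg (p : int) : exists k : nat, (nu' - nu) * e + p%:~R * (nu' - nu) = k%:R.
  have [gp [bg' [fgp lgp gp0 _ cgp]]] := chain HV p he fg (FH_top HV fg) g0 bg.
  have [yp [by'' [fyp lyp yp0 _ _]]] := chain HV p he fy (FH_top HV fy) y0 by'.
  have ggp : generates (eq^~ gp).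
    move=> U hU h; apply: gg => // _ ->; apply/(cgp U hU); exact: h.
  have [k [ek _]] := graded_deg HV (FHset_pos Hm fgp) (FHset_zero Hm fgp) (FHset_Dp HV fgp lgp)
    (FHset_gen (p := p) ggp) (Dp_eig p (FH_N0 fyp) lyp) yp0.
  exists k; rewrite -[k%:R](addKr (flow_wt ((nu - 2^-1) * e + 2^-1 * e ^+ 2) p + p%:~R * (nu - p%:~R))) -ek /flow_wt; field; rewrite ?pnatr_eq0 //.
have [k0 h0] := deg 0; have [k1 h1] := deg 1.
rewrite mul0r addr0 in h0; rewrite mul1r in h1.
pose z : int := k1%:Z - k0%:Z.
have ez : nu' - nu = z%:~R.
  by rewrite intrB -!pmulrn -h1 h0; ring.
have z0 : z = 0.
  apply/eqP/negPn/negP => zn.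
  (* For this p the natural number k would be k0 - (k0 + 1) z^2, negative for z nonzero. *)
  have [k] := deg (- (k0%:Z + 1) * z); rewrite h0 ez -intrM pmulrn -intrD => /eqP.
  rewrite pmulrn eqr_int => /eqP hk.
  have z2 : 1 <= z * z.
    have [h|h] : z <= -1 \/ 1 <= z by lia.
    + nia.
    + nia.
  nia.
have enu : nu' = nu by apply/eqP; rewrite -subr_eq0 ez z0.
have hLy := FH_top HV fy; rewrite enu in hLy fy.
have [k [ek tk]] := weight_deg HV fg gg (weight_eig hLy) y0.
have k00 : k = 0%N by move/eqP: ek; rewrite -subr_eq0 addrC addKr pnatr_eq0 => /eqP.
rewrite k00 in tk; have [c ec] := FHset_span fg tk (FH_N0 fy).
have c0 : c != 0 by apply/eqP => c0; apply: y0; rewrite ec c0 scale0r.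
apply: gg (submodule_actsub sK) _ => _ ->.
have := actsubZ c^-1 (submodule_actsub sK) Ky.
by rewrite ec scalerA mulVf // scale1r.
Qed.

Lemma atypical_irr nu b (g : W) : FH w 0 nu 0 g -> w GM 0 g = 0 ->
  parity b g -> g <> 0 -> generates (eq^~ g) -> irreducible W.
Proof.
move=> fg mg bg g0 gg; split; first by exists g.
move=> K sK; have [[x [Kx x0]]|nK] := pselect (exists x, K x /\ x <> 0); last first.
  by left=> x Kx; apply: contrapT => x0; apply: nK; exists x.
right; have [y [nu' [e' [b' [Ky y0 fy by']]]]] :=
  singular_exists HV (lowest_gen HV fg gg) sK (ex_intro _ x (conj Kx x0)).
have ee : e' = 0.
  apply: contrapT => ne; apply: y0; have := generates_E0 (FH_E0 fg) gg y.
  by rewrite (FH_E0 fy) => /eqP; rewrite scale0r scaler_eq0 => /orP[/eqP|/eqP //].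
subst e'; have hLy := FH_top HV fy; rewrite mulr0 expr0n mulr0 addr0 in hLy.
have [k [ek tk]] := weight_deg HV fg gg (weight_eig hLy) y0.
have k00 : k = 0%N by move/eqP: ek; rewrite mulr0 expr0n mulr0 !add0r pnatr_eq0 => /eqP.
rewrite k00 in tk.
have [c ec] : exists c, y = c *: g.
  elim: (TT0_span tk) => [u [->|->]||c u v _ [a ->] _ [d ->]].
  - by exists 1; rewrite scale1r.
  - by exists 0; rewrite scale0r oppr0 mg.
  - by exists 0; rewrite scale0r.
  - by exists (c * a + d); rewrite scalerDl scalerA.
have c0 : c != 0 by apply/eqP => c0; apply: y0; rewrite ec c0 scale0r.
apply: gg (submodule_actsub sK) _ => _ ->.
have := actsubZ c^-1 (submodule_actsub sK) Ky.
by rewrite ec scalerA mulVf // scale1r.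
Qed.

(** A device to show that a singular vector x vanishes in a simple module. If nonzero, x would
    generate the module with degrees d, d + 1, ... and only its own line in degree d; a known vector
    y whose degree and charge do not fit gives the contradiction. *)
Lemma flow_singular0 p nu e b d d' (y x : W) : irreducible W -> parity b x ->
  (forall a (r : int), 0 < r -> flow w p a r x = 0) ->
  w GN 0 x = nu *: x -> w GE 0 x = e *: x -> w GP p x = 0 -> w GM (- p) x = 0 ->
  Dp J p x = d *: x -> Dp J p y = d' *: y -> y <> 0 ->
  (forall k : nat, d' = d + k%:R -> k = 0%N /\ exists nu', w GN 0 y = nu' *: y /\ nu' <> nu) ->
  x = 0.
Proof.
move=> irr bx xpos hN hE hP hM hd hd' y0 hk; apply: contrapT => x0.
have gx := irr_gen irr bx x0.
have tz z a : z = x -> TT (flow w p) (eq^~ x) 0 (flow w p a 0 z).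
  move=> ->; have bz c : TT (flow w p) (eq^~ x) 0 (c *: x).
    by rewrite -[_ *: _]addr0; apply: TT_lin (TT_zero _ _ _); apply: TT_base.
  by rewrite /flow add0r; case: a => /=; rewrite ?mulr0 ?mulr1 ?mulrN1 ?hN ?hE ?hP ?hM //;
    apply: TT_zero.
have [k [ek tk]] := graded_deg HV (fun z a r (e : z = x) => eq_ind_r (fun z => 0 < r -> flow w p a r z = 0)
  (xpos a r) e) tz (fun z (e : z = x) => eq_ind_r (fun z => Dp J p z = d *: z) hd e) gx hd' y0.
have [k0 [nu' [ny ne]]] := hk k ek; rewrite k0 in tk.
have [c ec] : exists c, y = c *: x.
  elim: (TT0_span tk) => [u ->||c u v _ [a ->] _ [a' ->]].
  - by exists 1; rewrite scale1r.
  - by exists 0; rewrite scale0r.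
  - by exists (c * a + a'); rewrite scalerDl scalerA.
apply: ne; move: ny; rewrite ec (linZ (lw _ _)) hN !scalerA => /eqP.
rewrite -subr_eq0 -scalerBl scaler_eq0 => /orP[|/eqP //].
rewrite [c * nu]mulrC -mulrBl mulf_eq0 => /orP[|/eqP c0]; first by rewrite subr_eq0 => /eqP.
by case: y0; rewrite ec c0 scale0r.
Qed.

(* The extremal vector of the simple current of index [m] *)
Record extremal (m : int) (y : W) : Prop := Extremal {
  ex_FH : FH w (m *+ 2) (- m%:~R) (- m%:~R *+ 2) y;
  ex_M : w GM (- (m *+ 2)) y = 0;
  ex_L0 : L0 y = (2 * m%:~R ^+ 2) *: y }.

Definition alpha r (x : W) : W := - 2 *: w GN r x - w GE r x.

(** The Virasoro axiom is given on V only; on W the commutator formula is used. The commutator is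
    written in both orders so that the contribution of omega_0 omega cancels, leaving only omega_1
    omega = 2 omega to be computed. *)
Lemma L0_deriv (y : W) : L0 (Lop (-1) y) = Lop (-1) (L0 y) + Lop (-1) y.
Proof.
have oe : parity false (omega V) by rewrite /parity omega_even sgn0 scale1r.
have [N hN] := act_trunc_ge (W := vself V) (omega V) 0 (omega V).
have c1 := jop_comm (jop_act W) (w1 := omega V : vself V) (N0 := maxn N 2) y 1 0 oe.
have c0 := jop_comm (jop_act W) (w1 := omega V : vself V) (N0 := maxn N 2) y 0 1 oe.
have oo : vprod (omega V) 1 (omega V) = 2 *: omega V.
  have Lv : Lop (W := vself V) 0 (vac V) = 0 by exact: vac_create0.
  have lL : linear (Lop (W := vself V) 0) by exact: act_linr.
  have lo g r : linear (Wop J (W := vself V) g r) by exact: act_linr.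
  rewrite -[vprod _ _ _]/(Lop (W := vself V) 0 (omega V)) (omegaE HV) -[- (_ *: _)]scaleNr.
  rewrite !(linD lL) !(linZ lL) !(Lop_comm HV) Lv !addr0 !(lin0 (lo _ _)) !sub0r -!scaleNr.
  rewrite !(linZ (lo _ _)).
  lmod.
have k2 (i : nat) : (maxn N 2 <= i)%N -> act (v0 := vself V) (omega V) i%:Z (omega V) = 0.
  by move=> hi; rewrite -[i%:Z]add0r hN //; lia.
have h0 K (F : nat -> W) : (forall i, (2 <= i)%N -> F i = 0) -> (2 <= K)%N -> \sum_(i < K) F i = F 0%N + F 1%N.
  by move=> hF hK; rewrite (sum_widen hK hF) big_ord_recl big_ord1.
have n2 : (2 <= maxn N 2)%N by lia.
pose G c (a : int) (i : nat) : W := cbin c i *: act (act (v0 := vself V) (omega V) i%:Z (omega V)) (a - i%:R) y.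
have p1 (i : nat) : (2 <= i)%N -> G 1 (1%:~R + 0) i = 0 by move=> hi; rewrite /G (cbin_nat R 1) bin_small ?scale0r.
have p0 (i : nat) : (2 <= i)%N -> G 0 (0%:~R + 1) i = 0.
  by move=> hi; rewrite /G (cbin_nat R 0) bin_small ?scale0r //; lia.
have {c1} := etrans (c1 k2) (h0 _ _ p1 n2); have {c0} := etrans (c0 k2) (h0 _ _ p0 n2).
rewrite /tw sgn0 !scale1r /G.
rewrite (cbin_nat R 0 0) (cbin_nat R 0 1) (cbin_nat R 1 0) (cbin_nat R 1 1) !bin0 bin_small // binn !scale1r scale0r addr0.
rewrite -[act (v0 := vself V) (omega V) 1%N (omega V)]/(vprod (omega V) 1 (omega V)) oo.
rewrite -[X in X = _ -> _]opprB.
rewrite (linZ (fun a u v => act_linl 0 y a u v)).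
rewrite -[act (omega V) 1 (act _ 0 y)]/(L0 (Lop (-1) y)) -[act (omega V) 0 (act _ 1 y)]/(Lop (-1) (L0 y)).
rewrite -[act (omega V) 0 y]/(Lop (-1) y) => <- e.
apply/eqP; rewrite addrC -subr_eq; apply/eqP; move: e; set D := _ - _ => e.
have e2 : D + D = 2 *: Lop (-1) y by rewrite {1}e; lmod.
by apply: (scalerI (natC_neq0 R 1)); rewrite -e2; lmod.
Qed.

(** The difference x of the two sides is killed by all nonnegative flowed modes of psi^+ and psi^-
    and by the positive modes of N and E, so [flow_singular0] applies with y as the comparison
    vector. *)
Lemma extremal_deriv b m y : irreducible W -> extremal m y -> y <> 0 -> parity b y ->
  Lop (-1) y = m%:~R *: alpha (-1) y.
Proof.
move=> irr [fy my ly] y0 by'; have [hM hP hNE hN hE] := fy.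
apply/eqP; rewrite -subr_eq0; apply/eqP.
set x := _ - _.
have lL := Lop_lin (W := W) (-1).
have xE g r : w g r x = Lop (-1) (w g r y) + r%:~R *: w g (r - 1) y
   + (2 * m%:~R) *: w g r (w GN (-1) y) + m%:~R *: w g r (w GE (-1) y).
  rewrite /x /alpha (linD (lw _ _)) -!scaleNr (linZ (lw _ _)) (linD (lw _ _)) (linZ (lw _ _)).
  rewrite -scaleN1r (linZ (lw _ _)) (Lop_comm HV) subrK scalerDr !scalerA -!addrA.
  by congr (_ + (_ *: _ + _ *: _)); ring.
have hM' r : - (m *+ 2) <= r -> w GM r y = 0.
  by move=> hr; have [->|] := eqVneq r (- (m *+ 2)) => // rn; apply: hM; lia.
have z0 g r : w g r 0 = 0 by apply: lin0; apply: lw.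
have xN r : 0 < r -> w GN r x = 0.
  move=> r0; have [n0 e0] := hNE r r0.
  rewrite xE (mNN Hm) (mNE Hm) n0 !z0 (lin0 lL) !zr.
  have [->|r1] := eqVneq r 1.
    by rewrite subrr hN eqxx !zr scale1r scaler_nat mulr1n scaleNr addNr.
  have [n1 _] := hNE (r - 1) ltac:(lia).
  by rewrite n1 (_ : (_ == 0) = false) ?zr //; lia.
have xEE r : 0 < r -> w GE r x = 0.
  move=> r0; have [n0 e0] := hNE r r0.
  rewrite xE (mEN Hm) (mEE Hm) e0 !z0 (lin0 lL) !zr.
  have [->|r1] := eqVneq r 1.
    by rewrite subrr hE eqxx mulr1 !scalerA -scalerDl -[RHS](scale0r y); congr (_ *: _); ring.
  have [_ n1] := hNE (r - 1) ltac:(lia).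
  by rewrite n1 (_ : (_ == 0) = false) ?zr //; lia.
have xP r : m *+ 2 <= r -> w GP r x = 0.
  move=> hr; rewrite xE (mPN Hm) (mPE Hm) hP // !z0 (lin0 lL) !zr.
  rewrite scalerN -scalerBl; have [->|rn] := eqVneq r (m *+ 2).
    by rewrite (_ : _ - _ = 0) ?scale0r // mulr2n intrD; ring.
  by rewrite hP ?scaler0 //; lia.
have xM r : - (m *+ 2) <= r -> w GM r x = 0.
  move=> hr; rewrite xE (mMN Hm) (mME Hm) hM' // !z0 (lin0 lL) !zr.
  rewrite -scalerDl; have [->|rn] := eqVneq r (- (m *+ 2)).
    by rewrite (_ : _ + _ = 0) ?scale0r // mulr2n mulrNz intrD; ring.
  by rewrite hM' ?scaler0 //; lia.
have xN0 : w GN 0 x = - m%:~R *: x.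
  rewrite xE mulr0z scale0r addr0 !(N0_op Hm) !mulr0z !scale0r !addr0 hN !(linZ (lw _ _)) (linZ lL).
  rewrite /x /alpha -!scaleNr -[- w GE _ _]scaleN1r !scalerDr !scalerA -!addrA.
  by congr (_ *: _ + (_ *: _ + _ *: _)); ring.
have xE0 : w GE 0 x = (- m%:~R *+ 2) *: x.
  rewrite xE mulr0z scale0r addr0 !(E0_op Hm) hE !(linZ (lw _ _)) (linZ lL).
  rewrite /x /alpha -!scaleNr -[- w GE _ _]scaleN1r !scalerDr !scalerA -!addrA.
  by congr (_ *: _ + (_ *: _ + _ *: _)); ring.
have xL : L0 x = (2 * m%:~R ^+ 2 + 1) *: x.
  have LL : L0 (Lop (-1) y) = Lop (-1) (L0 y) + Lop (-1) y.
    exact: L0_deriv.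
  rewrite {1}/x /alpha (linD (Lop_lin 0)) LL -!scaleNr (linZ (Lop_lin 0)) (linD (Lop_lin 0)).
  rewrite (linZ (Lop_lin 0)) -scaleN1r (linZ (Lop_lin 0)) !(Lop_comm HV) ly !addr0 !(linZ (lw _ _)) (linZ lL).
  by rewrite /x /alpha; lmod.
have bx : parity b x.
  have bg g r : gpar g = false -> parity b (w g r y) by move=> gp; have := w_parity HV g r by'; rewrite gp.
  have bl : parity b (Lop (-1) y) by rewrite /parity act_sg omega_even by' linearZ.
  by move: (bg GN (-1) erefl) (bg GE (-1) erefl) bl; rewrite /x /alpha /parity !(linearB, linearZ) /= => -> -> ->; lmod.
apply: (flow_singular0 (p := m *+ 2) irr bx _ xN0 xE0 _ _ (Dp_eig _ xN0 xL) (Dp_eig _ hN ly) y0).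
- by case=> r r0; rewrite /flow /= ?mulr0 ?addr0 ?mulr1 ?mulrN1; [apply: xN|apply: xEE|apply: xP; lia|apply: xM; lia].
- exact: xP.
- exact: xM.
(* The degree of x is one more than that of y, so y would have relative degree k = -1. *)
move=> k; rewrite -[X in X = _]addr0 => /eqP; rewrite -subr_eq0 => /eqP h; exfalso.
suff : (k%:R + 1 : C) = 0 by move=> /eqP; rewrite natr1 pnatr_eq0.
by rewrite -[0]oppr0 -h; ring.
Qed.

(** N_0-eigenvalue of the highest-weight vector of the simple current of index m: m - eps(m),
    increased by 1/2 for m nonzero because of the labelling of Verma modules. *)
Definition cnu (m : int) : C := m%:~R + (m < 0)%R%:R.

(** For e + p = 0 the reflected vector cannot be brought back; it is singular, and a simple module
    has no room for it. *)
Lemma flow_gone p e D b (y : W) nu : irreducible W -> FH w p nu e y -> L0 y = D *: y -> y <> 0 ->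
  parity b y -> e + p%:~R = 0 -> w GM (- p) y = 0.
Proof.
move=> irr fy ly y0 by' ep; have fx := FH_up Hm fy.
have lx : L0 (w GM (- p) y) = (D + p%:~R) *: w GM (- p) y.
  by rewrite (Lop_comm HV) ly addr0 (linZ (lw _ _)); lmod.
apply: (flow_singular0 (p := p) irr (w_parity HV GM (- p) by') _ (FH_N0 fx) (FH_E0 fx) _ _
   (Dp_eig _ (FH_N0 fx) lx) (Dp_eig _ (FH_N0 fy) ly) y0).
- by move=> a r r0; apply: (FHset_pos Hm fy) => //; right.
- by rewrite (FH_upK Hm fy) ep scale0r.
- by apply: sq0; rewrite {1}(mMM Hm).
move=> k e1; split; last first.
  exists nu; split; first exact: FH_N0 fy.
  by move=> /eqP; rewrite -subr_eq0 opprB addrC subrK oner_eq0.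
have : (k%:R : C) = 0 by rewrite -[k%:R](addKr (D + p%:~R + p%:~R * (nu - 1))) -e1; ring.
by move=> /eqP; rewrite pnatr_eq0 => /eqP.
Qed.

Lemma flow_gone_down p e D b (y : W) nu : irreducible W -> FH w p nu e y -> L0 y = D *: y -> y <> 0 ->
  parity b y -> e + (p - 1)%:~R = 0 -> w GP (p - 1) y = 0.
Proof.
move=> irr fy ly y0 by' ep; have fx := FH_down Hm fy.
have lx : L0 (w GP (p - 1) y) = (D - (p - 1)%:~R) *: w GP (p - 1) y.
  by rewrite (Lop_comm HV) ly addr0 (linZ (lw _ _)) -scalerBl.
apply: (flow_singular0 (p := p - 1) irr (w_parity HV GP (p - 1) by') _ (FH_N0 fx) (FH_E0 fx) _ _
   (Dp_eig _ (FH_N0 fx) lx) (Dp_eig _ (FH_N0 fy) ly) y0).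
- by move=> a r r0; apply: (FHset_pos Hm fx) => //; left.
- by apply: sq0; rewrite {1}(mPP Hm).
- by rewrite opprB (FH_downK Hm fy) ep scale0r.
move=> k e1; split; last first.
  exists nu; split; first exact: FH_N0 fy.
  by move=> /eqP; rewrite -subr_eq0 opprD addNKr oppr_eq0 oner_eq0.
have : (k%:R : C) = 0.
  by rewrite -[k%:R](addKr (D - (p - 1)%:~R + (p - 1)%:~R * (nu + 1))) -e1; ring.
by move=> /eqP; rewrite pnatr_eq0 => /eqP.
Qed.

(** Reflect the highest-weight vector until the flow 2m. The scalars e + q, with e = -2m, are
    nonzero on the way, and the first one to vanish makes the last vector extremal by [flow_gone] or
    [flow_gone_down]. *)
Lemma extremal_exists m b (x : W) : irreducible W ->
  FH w 0 (cnu m) (- m%:~R *+ 2) x -> (m = 0 -> w GM 0 x = 0) -> parity b x -> x <> 0 ->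
  exists y b', [/\ extremal m y, y <> 0, parity b' y & chain_of x y].
Proof.
move=> irr fx x0M bx x0; have lx := FH_top HV fx.
have [m0|[m0|m0]] : m = 0 \/ (0 < m \/ m < 0) by lia.
- subst m; exists x, b; split=> //; split.
  + by move: fx; rewrite /cnu ltxx mulr0z addr0 oppr0 mul0rn.
  + exact: x0M.
  + by rewrite lx /cnu ltxx mulr0z oppr0 mul0rn expr0n /= !mulr0 addr0.
- have [k em] : exists k : nat, k%:Z = m *+ 2 by exists `|m *+ 2|%N; lia.
  have [|y [b' [fy ly y0 by' cy]]] := @chain_up _ _ _ HV W _ _ _ _ _ k _ fx lx x0 bx.
    move=> q hq; apply/eqP; rewrite (_ : _ + _ = (q%:Z - m *+ 2)%:~R) ?intr_eq0; first by lia.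
    by rewrite intrB [m *+ 2]mulr2n intrD -pmulrn; ring.
  have nm : (k%:R : C) = m%:~R *+ 2 by rewrite -[k%:R]/(k%:Z%:~R : C) em [m *+ 2]mulr2n intrD mulr2n.
  have cm : cnu m = m%:~R by rewrite /cnu ltNge (ltW m0) addr0.
  exists y, b'; split=> //; rewrite em nm in fy ly; rewrite cm in fy ly.
  have fy' : FH w (m *+ 2) (- m%:~R) (- m%:~R *+ 2) y.
    by move: fy; congr FH; ring.
  have my : w GM (- (m *+ 2)) y = 0.
    by apply: (flow_gone irr fy' ly y0 by'); rewrite [m *+ 2]mulr2n intrD; ring.
  split=> //.
  by rewrite ly /flow_wt [m *+ 2]mulr2n intrD; congr (_ *: _); field; rewrite ?pnatr_eq0.
(* For negative m one stops at the flow 2m + 1: there psi^+_{2m} kills the vector, which is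
   therefore also of highest weight for the flow 2m. *)
- have [k em] : exists k : nat, - k%:Z = m *+ 2 + 1 by exists (`|m *+ 2| - 1)%N; lia.
  have [|y [b' [fy ly y0 by' cy]]] := @chain_down _ _ _ HV W _ _ _ _ _ k _ fx lx x0 bx.
    move=> q hq; apply/eqP; rewrite (_ : _ - _ = (- m *+ 2 - q.+1%:Z)%:~R).
      by rewrite intr_eq0; lia.
    by rewrite intrB [- m *+ 2]mulr2n intrD intrN -pmulrn; ring.
  have nm : (k%:R : C) = - (m%:~R *+ 2) - 1.
    by rewrite -[k%:R]/(k%:Z%:~R : C) -[k%:Z]opprK em mulrNz intrD [m *+ 2]mulr2n intrD; ring.
  have cm : cnu m = m%:~R + 1 by rewrite /cnu m0.
  exists y, b'; split=> //; rewrite em nm in fy ly; rewrite cm in fy ly.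
  have py : w GP (m *+ 2) y = 0.
    by have := flow_gone_down irr fy ly y0 by'; rewrite addrK [m *+ 2]mulr2n intrD; apply; ring.
  have [hM hP hNE hN hE] := fy; split.
  + split=> //; first by move=> r hr; apply: hM; lia.
    * by move=> r hr; have [->|n] := eqVneq r (m *+ 2); [exact: py|apply: hP; lia].
    * by rewrite hN; congr (_ *: _); ring.
  + apply: hM; lia.
  + by rewrite ly /flow_wt intrD [m *+ 2]mulr2n intrD; congr (_ *: _); field; rewrite ?pnatr_eq0.
Qed.

End Irreducibility.

(** * Fields on a superspace *)

Section Fields.
Variable R : realType.
Local Notation C := (R[i]).
Local Notation sgn := (sgn R).
Local Notation cbin := (@cbin R).
Variable M : superSpace R.
Local Notation field := (int -> M -> M).

Definition em1 (n : int) : C := (-1) ^ n.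
Lemma em1D m n : em1 (m + n) = em1 m * em1 n.
Proof. by rewrite /em1 expfzDr // oppr_eq0 oner_eq0. Qed.
Lemma em1_nat (n : nat) : em1 n%:Z = (-1) ^+ n. Proof. by []. Qed.
Lemma em1K n : em1 n * em1 n = 1.
Proof.
rewrite -em1D /em1 (_ : n + n = 2%:Z * n); last by lia.
by rewrite -exprz_exp -exprnP sqrrN expr1n exp1rz. Qed.
Lemma em1N n : em1 (- n) = em1 n.
Proof. by rewrite -[LHS]mulr1 -(em1K n) mulrA -em1D addNr /em1 expr0z mul1r. Qed.

Record isF (f : field) : Prop := IsF {
  F_lin : forall k, linear (f k);
  F_tr : forall x, exists N : int, forall n, N <= n -> f n x = 0 }.

Definition twf p (f : field) : field := fun k x => tw p (f k (tw p x)).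
Definition fparity p (f : field) := forall k x, sg M (f k (sg M x)) = sgn p *: f k x.

(** Summand of the n-th product u_(n) f of two fields, p being the parity of u: the iterate formula
    read as a definition. *)
Definition fterm p (u : field) (n : int) (f : field) k x (i : nat) : M :=
  ((-1) ^+ i * cbin n%:~R i) *:
    (u (n - i%:Z) (f (k + i%:Z) x) - em1 n *: twf p f (k + n - i%:Z) (u i%:Z x)).
Definition fprod p u n f : field := fun k x => \sum_(i \in [set: nat]) fterm p u n f k x i.

Lemma twf_isF p f : isF f -> isF (twf p f).
Proof.
case=> fl ft; split=> [k c x y|x]; first by rewrite /twf !(linearP, fl).
by have [N hN] := ft (tw p x); exists N => n hn; rewrite /twf hN // linear0.
Qed.

Lemma tw_comm p q (x : M) : tw p (tw q x) = tw q (tw p x).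
Proof. by case: p; case: q. Qed.
Lemma twf_comm p q f k x : twf p (twf q f) k x = twf q (twf p f) k x.
Proof. by rewrite /twf ![tw p (tw q _)]tw_comm. Qed.
Lemma twf_par p q f k x : fparity q f -> twf p f k x = sgn (p && q) *: f k x.
Proof. by rewrite /twf; case: p => /= h; rewrite ?h // sgn0 scale1r. Qed.

Lemma F_nat f k x : isF f -> exists N : nat, forall i : nat, (N <= i)%N -> f (k + i%:Z) x = 0.
Proof. by case=> _ /(_ x)[N hN]; exists `|N - k|%N => i hi; apply: hN; lia. Qed.
Lemma F_nat0 f x : isF f -> exists N : nat, forall i : nat, (N <= i)%N -> f i%:Z x = 0.
Proof. by move=> h; have [N hN] := F_nat 0 x h; exists N => i /hN; rewrite add0r. Qed.
Lemma F_0 f k : isF f -> f k 0 = 0. Proof. by case=> h _; apply: lin0. Qed.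

Lemma fprod_N p u n f k x N :
  (forall i : nat, (N <= i)%N -> u (n - i%:Z) (f (k + i%:Z) x) = 0 /\ twf p f (k + n - i%:Z) (u i%:Z x) = 0) ->
  fprod p u n f k x = \sum_(i < N) fterm p u n f k x i.
Proof.
move=> h; rewrite /fprod (fsumE (N := N)) // => i /h[e1 e2].
by rewrite /fterm e1 e2 scaler0 subrr scaler0.
Qed.

Lemma fprod_ex p u n f k x : isF u -> isF f ->
  exists N0, forall N, (N0 <= N)%N -> fprod p u n f k x = \sum_(i < N) fterm p u n f k x i.
Proof.
move=> hu hf; have [N1 h1] := F_nat k x hf; have [N2 h2] := F_nat0 x hu.
exists (maxn N1 N2) => N hN; apply: fprod_N => i hi; rewrite h1 ?h2 ?(F_0 _ hu) ?(F_0 _ (twf_isF p hf)) //; lia.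
Qed.

Lemma unif (P : nat -> nat -> Prop) L : (forall l, exists N, forall j, (N <= j)%N -> P l j) ->
  exists N, forall l j, (l < L)%N -> (N <= j)%N -> P l j.
Proof.
move=> h; elim: L => [|L [N hN]]; first by exists 0%N.
have [K hK] := h L; exists (maxn N K) => l j hl hj.
have [->|nl] := eqVneq l L; [apply: hK|apply: hN]; lia.
Qed.

Lemma vanish2 (F : nat -> nat -> M) : (exists L, forall l j, (L <= l)%N -> F l j = 0) ->
  (forall l, exists J, forall j, (J <= j)%N -> F l j = 0) ->
  exists N, forall l j, (N <= l)%N || (N <= j)%N -> F l j = 0.
Proof.
move=> [L hL] /(unif L)[J hJ]; exists (maxn L J) => l j h.
have [lL|Ll] := ltnP l L; [apply: hJ => //; lia|exact: hL].
Qed.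

Lemma fprod_isF p u n f : isF u -> isF f -> isF (fprod p u n f).
Proof.
move=> hu hf; have hf' := twf_isF p hf; split=> [k c x y|x].
  have [N1 h1] := fprod_ex p n k x hu hf; have [N2 h2] := fprod_ex p n k y hu hf.
  have [N3 h3] := fprod_ex p n k (c *: x + y) hu hf.
  pose N := maxn N1 (maxn N2 N3).
  rewrite (h1 N) ?(h2 N) ?(h3 N); try lia.
  rewrite scaler_sumr -big_split; apply: eq_bigr => i _.
  rewrite /fterm (F_lin hf) !(F_lin hu) (F_lin hf'); lmod.
have [K hK] := F_tr hf x; have [L hL] := F_nat0 x hu.
have [N hN] := unif L (fun l => F_nat 0 (u l%:Z x) hf').
exists (K + N%:Z + L%:Z + `|n|%N%:Z + `|K|%N%:Z) => k hk; rewrite (@fprod_N _ _ _ _ _ _ 0) ?big_ord0 // => i _.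
rewrite hK; last lia; split; first exact: F_0.
have [iL|Li] := ltnP i L; last by rewrite hL // F_0.
have [j ej] : exists j : nat, k + n - i%:Z = 0 + j%:Z by exists `|(k + n - i%:Z)%R|%N; lia.
by rewrite ej; apply: hN => //; lia.
Qed.

Lemma twf_fprod q p u n f k x : fparity p u -> isF u -> isF f ->
  twf q (fprod p u n f) k x = sgn (q && p) *: fprod p u n (twf q f) k x.
Proof.
move=> pu hu hf; have hf' := twf_isF q hf; rewrite {1}/twf.
have [N1 h1] := fprod_ex p n k (tw q x) hu hf; have [N2 h2] := fprod_ex p n k x hu hf'.
rewrite (h1 (maxn N1 N2)) ?(h2 (maxn N1 N2)); try lia.
rewrite linear_sum scaler_sumr; apply: eq_bigr => i _.
rewrite /fterm [LHS]linearZ linearB linearZ /=.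
have e1 j y : tw q (u j y) = sgn (q && p) *: u j (tw q y).
  by rewrite -(twf_par _ _ _ pu) /twf twK.
rewrite e1 -/(twf q f _ _) /twf ![tw q (tw p _)]tw_comm.
rewrite [u i%:Z (tw q x)](_ : _ = sgn (q && p) *: tw q (u i%:Z x)); last by rewrite e1 scalerA sgnK scale1r.
rewrite !(linearZ, linZ (F_lin hf _)) /=; lmod.
Qed.

Lemma fprod_linf p u n f g h c : isF u -> isF f -> isF g -> isF h ->
  (forall k x, h k x = c *: f k x + g k x) ->
  forall k x, fprod p u n h k x = c *: fprod p u n f k x + fprod p u n g k x.
Proof.
move=> hu hf hg hh e k x; have [N1 h1] := fprod_ex p n k x hu hf.
have [N2 h2] := fprod_ex p n k x hu hg; have [N3 h3] := fprod_ex p n k x hu hh.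
pose N := maxn N1 (maxn N2 N3); rewrite (h1 N) ?(h2 N) ?(h3 N); try lia.
rewrite scaler_sumr -big_split; apply: eq_bigr => i _.
rewrite /fterm /twf !e !(F_lin hu) !linearP /=; lmod.
Qed.

Lemma sum_vand p q (G : nat -> M) N : (forall t, (N <= t)%N -> G t = 0) ->
  \sum_(j < N) \sum_(l < N) (((-1) ^+ j * cbin p j) * ((-1) ^+ l * cbin q l)) *: G (j + l)%N
  = \sum_(t < N) ((-1) ^+ t * cbin (p + q) t) *: G t.
Proof.
move=> h; rewrite (@sum_diag _ (fun j l => (((-1) ^+ j * cbin p j) * ((-1) ^+ l * cbin q l)) *: G (j + l)%N)).
  apply: eq_bigr => t _; rewrite -vandermonde mulr_sumr scaler_suml; apply: eq_bigr => i _.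
  have it : (i <= t)%N by rewrite -ltnS.
  rewrite subnKC //; congr (_ *: _).
  have -> : (-1) ^+ t = (-1) ^+ i * (-1) ^+ (t - i) :> C by rewrite -exprD subnKC.
  ring.
by move=> j l /h ->; rewrite scaler0.
Qed.

Lemma cbin_split z i j : cbin z (i + j) * 'C(i + j, i)%:R = cbin z i * cbin (z - i%:R) j.
Proof.
have bf : ('C(i + j, i)%:R * (i`!%:R * j`!%:R) = (i + j)`!%:R :> C).
  by rewrite -!natrM; congr _%:R; rewrite -(bin_fact (leq_addr j i)) addKn.
rewrite /cbin -bf big_split_ord /= (eq_bigr (fun j0 : 'I_j => z - i%:R - j0%:R)); last first.
  by move=> l _; rewrite natrD opprD addrA.
field; rewrite !pnatr_eq0 -!lt0n !fact_gt0 bin_gt0 leq_addr //.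
Qed.

(** C(z, j) C(j, i) = C(z, i) C(z - i, j - i), followed by a shift of the summation index by i. *)
Lemma sum_cshift z i (G : nat -> M) N L : (forall t, (N <= t)%N -> G t = 0) -> (N + i <= L)%N ->
  \sum_(j < L) ((-1) ^+ j * cbin z j * cbin j%:R i) *: G (j - i)%N
  = ((-1) ^+ i * cbin z i) *: \sum_(j < L) ((-1) ^+ j * cbin (z - i%:R) j) *: G j.
Proof.
move=> h; have [/subnKC <-|iL] := leqP i L; last lia.
move: (L - i)%N => K hL; rewrite ?addKn in hL *.
have -> : \sum_(j < i + K) ((-1) ^+ j * cbin (z - i%:R) j) *: G j
    = \sum_(j < K) ((-1) ^+ j * cbin (z - i%:R) j) *: G j.
  by apply: (sum_widen (F := fun j => ((-1) ^+ j * cbin (z - i%:R) j) *: G j)); [exact: leq_addl|move=> j hj; rewrite h ?scaler0 //; lia].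
rewrite big_split_ord /= big1 ?add0r => [|j _]; last first.
  by rewrite cbin_nat bin_small // mulr0 scale0r.
rewrite scaler_sumr; apply: eq_bigr => j _; rewrite addKn scalerA; congr (_ *: _).
by rewrite -mulrA cbin_nat cbin_split exprD; ring.
Qed.

Lemma tw_addb p q (x : M) : tw (p (+) q) x = tw p (tw q x).
Proof. by case: p; case: q => //=; rewrite sgK. Qed.

(** All four kinds of terms of the iterated product are cut off at one bound N, so that finite
    double sums can be exchanged afterwards. *)
Lemma fprod2 pa pu a u r n f k x (N : nat) : isF a -> isF u -> isF f -> fparity pu u ->
  (forall j l : nat, (N <= j)%N || (N <= l)%N -> f (k + j%:Z + l%:Z) x = 0) ->
  (forall j l : nat, (N <= j)%N || (N <= l)%N -> twf pu f (k + j%:Z + n - l%:Z) (u l%:Z x) = 0) ->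
  (forall j l : nat, (N <= j)%N || (N <= l)%N -> twf pa f (k + r - j%:Z + l%:Z) (a j%:Z x) = 0) ->
  (forall j l : nat, (N <= j)%N || (N <= l)%N -> u l%:Z (a j%:Z x) = 0) ->
  fprod pa a r (fprod pu u n f) k x = \sum_(j < N) \sum_(l < N)
    (((-1) ^+ j * cbin r%:~R j) * ((-1) ^+ l * cbin n%:~R l)) *:
    (a (r - j%:Z) (u (n - l%:Z) (f (k + j%:Z + l%:Z) x))
     - em1 n *: a (r - j%:Z) (twf pu f (k + j%:Z + n - l%:Z) (u l%:Z x))
     - (em1 r * sgn (pa && pu)) *: u (n - l%:Z) (twf pa f (k + r - j%:Z + l%:Z) (a j%:Z x))
     + (em1 r * em1 n * sgn (pa && pu)) *:
          twf pu (twf pa f) (k + r - j%:Z + n - l%:Z) (u l%:Z (a j%:Z x))).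
Proof.
move=> ha hu hf fu v1 v2 v3 v4; have hf' := twf_isF pa hf.
have e1 j : fprod pu u n f (k + j%:Z) x = \sum_(l < N) fterm pu u n f (k + j%:Z) x l.
  by apply: fprod_N => l hl; rewrite v1 ?v2 ?hl ?orbT // F_0.
have e2 (j : nat) : twf pa (fprod pu u n f) (k + r - j%:Z) (a j%:Z x)
   = sgn (pa && pu) *: \sum_(l < N) fterm pu u n (twf pa f) (k + r - j%:Z) (a j%:Z x) l.
  rewrite twf_fprod //; congr (_ *: _).
  by apply: fprod_N => l hl; rewrite v3 ?v4 ?hl ?orbT // !F_0 //; apply: twf_isF.
rewrite (@fprod_N _ _ _ _ _ _ N) => [|j hj].
  apply: eq_bigr => j _; rewrite /fterm e1 e2 (lin_sum _ _ _ (F_lin ha _)) !scaler_sumr -sumrB scaler_sumr.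
  apply: eq_bigr => l _; rewrite /fterm !(linZ (F_lin ha _)) -[- (em1 n *: twf pu f _ _)]scaleNr !(linD (F_lin ha _)) !(linZ (F_lin ha _)); lmod.
rewrite e1 e2 !big1 ?scaler0 ?F_0 // => l _; rewrite /fterm.
  by rewrite v3 ?v4 ?hj ?orbT // !F_0 ?scaler0 ?subrr ?scaler0 //; apply: twf_isF.
by rewrite v1 ?v2 ?hj ?orbT // F_0 ?scaler0 ?subrr ?scaler0.
Qed.

Section Commutator.
Variables (pa pu : bool) (a u : field) (c : nat -> field) (I : nat).
Hypotheses (ha : isF a) (hu : isF u) (hc : forall i, isF (c i)).
Hypotheses (fa : fparity pa a) (fu : fparity pu u).
Hypothesis comm : forall p q x, a p (u q x) = sgn (pa && pu) *: u q (a p x)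
  + \sum_(i < I) cbin p%:~R i *: c i (p + q - i%:Z) x.

(** If the modes of a and u commute up to the fields c_i, then the left products a_(r) and u_(n)
    satisfy the same commutator formula on every field f. No locality between f and a or u is
    assumed. *)
Lemma fprod_comm r n f k x : isF f ->
  fprod pa a r (fprod pu u n f) k x = sgn (pa && pu) *: fprod pu u n (fprod pa a r f) k x
  + \sum_(i < I) cbin r%:~R i *: fprod (pa (+) pu) (c i) (n + r - i%:Z) f k x.
Proof.
move=> hf; have hfa := twf_isF pa hf; have hfu := twf_isF pu hf; have hfau := twf_isF pu hfa.
have [N0 h0] := F_nat k x hf.
have [Nu hNu] := F_nat0 x hu; have [Na hNa] := F_nat0 x ha.
have [N2 h2] : exists N, forall l j : nat, (N <= l)%N || (N <= j)%N -> twf pu f (k + j%:Z + n - l%:Z) (u l%:Z x) = 0.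
  apply: vanish2 => [|l]; first by exists Nu => l j hl; rewrite hNu // F_0.
  have [J hJ] := F_nat (k + n - l%:Z) (u l%:Z x) hfu; exists J => j /hJ.
  by rewrite (_ : k + n - l%:Z + j%:Z = k + j%:Z + n - l%:Z); last lia.
have [N3 h3] : exists N, forall j l : nat, (N <= j)%N || (N <= l)%N -> twf pa f (k + r - j%:Z + l%:Z) (a j%:Z x) = 0.
  apply: vanish2 => [|j]; first by exists Na => l j hl; rewrite hNa // F_0.
  by have [J hJ] := F_nat (k + r - j%:Z) (a j%:Z x) hfa; exists J.
have [N4 h4] : exists N, forall j l : nat, (N <= j)%N || (N <= l)%N -> u l%:Z (a j%:Z x) = 0.
  apply: vanish2 => [|j]; first by exists Na => l j hl; rewrite hNa // F_0.
  by have [J hJ] := F_nat0 (a j%:Z x) hu; exists J.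
have [N5 h5] : exists N, forall l j : nat, (N <= l)%N || (N <= j)%N -> a j%:Z (u l%:Z x) = 0.
  apply: vanish2 => [|l]; first by exists Nu => l j hl; rewrite hNu // F_0.
  by have [J hJ] := F_nat0 (u l%:Z x) ha; exists J.
have [N6 h6] := unif I (fun i => F_nat0 x (hc i)).
pose N := (N0 + N2 + N3 + N4 + N5 + N6 + I)%N.
rewrite (@fprod2 _ _ _ _ _ _ _ _ _ N) //; try by move=> j l h; (apply: h2 || apply: h3 || apply: h4); lia.
  2: by move=> j l h; rewrite -addrA -PoszD; apply: h0; lia.
rewrite (@fprod2 _ _ _ _ _ _ _ _ _ N) //.
  2: by move=> j l h; rewrite -addrA -PoszD; apply: h0; lia.
  2: by move=> l j h; rewrite (_ : k + l%:Z + r - j%:Z = k + r - j%:Z + l%:Z); [apply: h3; lia|lia].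
  2: by move=> l j h; rewrite (_ : k + n - l%:Z + j%:Z = k + j%:Z + n - l%:Z); [apply: h2; lia|lia].
  2: by move=> l j h; apply: h5; lia.
rewrite [X in _ = _ *: X + _]exchange_big /=; apply/eqP; rewrite [X in _ == X]addrC -subr_eq; apply/eqP.
pose T := twf pu (twf pa f); have lT q : linear (T q) := F_lin hfau q.
transitivity (\sum_(j < N) \sum_(l < N) \sum_(i < I)
   ((((-1) ^+ j * cbin r%:~R j) * ((-1) ^+ l * cbin n%:~R l) * cbin (r%:~R - j%:R) i)
        *: c i (r - j%:Z + (n - l%:Z) - i%:Z) (f (k + j%:Z + l%:Z) x)
    - (em1 r * em1 n * (((-1) ^+ j * cbin r%:~R j) * ((-1) ^+ l * cbin n%:~R l)) * cbin j%:R i)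
        *: T (k + r - j%:Z + n - l%:Z) (c i (j%:Z + l%:Z - i%:Z) x))).
  rewrite scaler_sumr -sumrB; apply: eq_bigr => j _; rewrite scaler_sumr -sumrB; apply: eq_bigr => l _.
  rewrite [a (r - j%:Z) (u _ _)]comm (_ : (r - j%:Z)%:~R = r%:~R - j%:R :> C); last by rewrite intrB.
  rewrite (_ : k + l%:Z + j%:Z = k + j%:Z + l%:Z); last lia.
  rewrite (_ : k + l%:Z + r - j%:Z = k + r - j%:Z + l%:Z); last lia.
  rewrite (_ : k + n - l%:Z + j%:Z = k + j%:Z + n - l%:Z); last lia.
  rewrite (_ : k + n - l%:Z + r - j%:Z = k + r - j%:Z + n - l%:Z); last lia.
  rewrite [twf pa (twf pu f) _ _]twf_comm -/T [a j%:Z (u _ _)]comm (linD (lT _)) (linZ (lT _)).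
  rewrite (lin_sum _ _ _ (lT _)) sumrB.
  have -> : \sum_(i < I) T (k + r - j%:Z + n - l%:Z) (cbin j%:Z%:~R i *: c i (j%:Z + l%:Z - i%:Z) x)
    = \sum_(i < I) cbin j%:R i *: T (k + r - j%:Z + n - l%:Z) (c i (j%:Z + l%:Z - i%:Z) x).
    by apply: eq_bigr => i _; rewrite (linZ (lT _)).
  under [X in _ = X - _]eq_bigr do rewrite -scalerA.
  under [X in _ = _ - X]eq_bigr do rewrite -scalerA.
  by rewrite -!scaler_sumr [pu && pa]andbC; case: (pa && pu); rewrite ?sgn0 ?sgn1; lmod.
rewrite (eq_bigr _ (fun j _ => exchange_big _ _ _ _ _ _)) exchange_big /=; apply: eq_bigr => i _.
have iI := ltn_ord i.
have hT y q : T q 0 = 0 by apply: F_0.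
rewrite (@fprod_N _ _ _ _ _ _ N); last first.
  move=> t ht; rewrite h0 ?(F_0 _ (hc i)); last lia.
  by rewrite h6 ?F_0 //; [apply: twf_isF|lia].
rewrite (eq_bigr (fun j : 'I_N => \sum_(l < N) ((-1) ^+ j * cbin r%:~R j * ((-1) ^+ l * cbin n%:~R l) *
         cbin (r%:~R - j%:R) i) *: c i (r - j%:Z + (n - l%:Z) - i%:Z) (f (k + j%:Z + l%:Z) x)
     - \sum_(l < N) (em1 r * em1 n * ((-1) ^+ j * cbin r%:~R j * ((-1) ^+ l * cbin n%:~R l)) *
         cbin j%:R i) *: T (k + r - j%:Z + n - l%:Z) (c i (j%:Z + l%:Z - i%:Z) x))); last first.
  by move=> j _; rewrite -sumrB.
rewrite sumrB.
pose G t := c i (n + r - i%:Z - t%:Z) (f (k + t%:Z) x).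
pose G2 t := T (k + (n + r - i%:Z) - t%:Z) (c i t%:Z x).
have g1 (t : nat) : (N <= t)%N -> G t = 0 by move=> ht; rewrite /G h0 ?F_0 //; lia.
have g2 (t : nat) : (N6 <= t)%N -> G2 t = 0 by move=> ht; rewrite /G2 h6 ?F_0.
have g3 (t : nat) : (N <= t)%N -> G2 t = 0 by move=> ht; rewrite g2 //; lia.
have sv1 := sum_vand (r%:~R - i%:R) n%:~R g1; have sv2 := sum_vand (r%:~R - i%:R) n%:~R g3.
(* Terms in which f acts first: they depend on j + l only, and trinomial revision with Vandermonde
   leaves a single sum. *)
have -> : \sum_(j < N) \sum_(l < N) ((-1) ^+ j * cbin r%:~R j * ((-1) ^+ l * cbin n%:~R l) *
         cbin (r%:~R - j%:R) i) *: c i (r - j%:Z + (n - l%:Z) - i%:Z) (f (k + j%:Z + l%:Z) x)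
   = cbin r%:~R i *: \sum_(t < N) ((-1) ^+ t * cbin (r%:~R - i%:R + n%:~R) t) *: G t.
  rewrite -sv1 scaler_sumr; apply: eq_bigr => j _; rewrite scaler_sumr; apply: eq_bigr => l _.
  rewrite scalerA /G; congr (_ *: c i _ (f _ x)); try lia.
  have tri : cbin r%:~R i * cbin (r%:~R - i%:R) j = cbin r%:~R j * cbin (r%:~R - j%:R) i by apply: cbin_tri.
  transitivity ((-1) ^+ j * (-1) ^+ l * cbin n%:~R l * (cbin r%:~R j * cbin (r%:~R - j%:R) i)); first ring.
  by rewrite -tri; ring.
(* Terms in which f acts last: [sum_cshift] in j moves the index by i, after which Vandermonde
   applies. *)
have -> : \sum_(j < N) \sum_(l < N) (em1 r * em1 n * ((-1) ^+ j * cbin r%:~R j * ((-1) ^+ l * cbin n%:~R l)) *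
         cbin j%:R i) *: T (k + r - j%:Z + n - l%:Z) (c i (j%:Z + l%:Z - i%:Z) x)
   = (em1 (n + r - i%:Z) * cbin r%:~R i) *: \sum_(t < N) ((-1) ^+ t * cbin (r%:~R - i%:R + n%:~R) t) *: G2 t.
  rewrite -sv2 exchange_big [X in _ = _ *: X]exchange_big /= scaler_sumr; apply: eq_bigr => l _.
  have g4 t : (N6 <= t)%N -> G2 (t + l)%N = 0 by move=> ht; rewrite g2 //; lia.
  have cs := @sum_cshift r%:~R i (fun t => G2 (t + l)%N) N6 N g4 ltac:(lia).
  transitivity ((em1 r * em1 n * ((-1) ^+ l * cbin n%:~R l)) *:
     \sum_(j < N) ((-1) ^+ j * cbin r%:~R j * cbin j%:R i) *: G2 (j - i + l)%N).
    rewrite scaler_sumr; apply: eq_bigr => j _; rewrite scalerA.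
    have [ij|ji] := leqP i j.
      rewrite /G2; congr (_ *: T _ (c i _ x)); [ring|lia|lia].
    by rewrite [cbin j%:R i]cbin_nat bin_small // !mulr0 !scale0r.
  rewrite cs !scaler_sumr; apply: eq_bigr => j _; rewrite !scalerA; congr (_ *: _).
  by rewrite !em1D em1N em1_nat; ring.
have -> : r%:~R - i%:R + n%:~R = (n + r - i%:Z)%:~R :> C by rewrite intrB intrD; ring.
rewrite !scaler_sumr -sumrB; apply: eq_bigr => t _; rewrite /fterm /G /G2 /T.
rewrite -[twf (pa (+) pu) f _ _]/(tw (pa (+) pu) (f _ (tw (pa (+) pu) _))) !tw_addb.
rewrite /twf [tw pu (tw pa _)]tw_comm; lmod.
Qed.
End Commutator.

End Fields.

(** * Identity field, derivatives, and the Borcherds identity for fields *)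

Section FieldsII.
Variable R : realType.
Local Notation C := (R[i]).
Local Notation sgn := (sgn R).
Local Notation cbin := (@cbin R).
Local Notation em1 := (em1 R).
Variable M : superSpace R.
Local Notation field := (int -> M -> M).

Definition idf : field := fun k x => if k == -1 then x else 0.

Lemma idf_isF : isF idf.
Proof.
split=> [k c x y|x]; first by rewrite /idf; case: ifP => // _; rewrite scaler0 addr0.
by exists 0 => n hn; rewrite /idf (_ : (n == -1) = false) //; lia.
Qed.

Lemma twf_id p k x : twf p idf k x = idf k x :> M.
Proof. by rewrite /twf /idf; case: ifP => _; rewrite ?twK ?linear0. Qed.

Lemma fprod_id0 p (f : field) (n : nat) k x : isF f -> fprod p f n idf k x = 0.
Proof.
move=> hf; have [N0 h0] := fprod_ex p n k x hf idf_isF.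
rewrite (h0 (N0 + `|k|%N + n).+2); last lia.
have [hk|hk] := boolP ((- 1 - n%:Z <= k) && (k <= - 1)); last first.
  apply: big1 => i _; rewrite /fterm twf_id /idf.
  have [i1|i1] := boolP (i <= n)%N; last by rewrite (cbin_nat R n) bin_small ?mulr0 ?scale0r //; lia.
  have -> : (k + i%:Z == -1) = false by lia.
  have -> : (k + n%:Z - i%:Z == -1) = false by lia.
  by rewrite (F_0 _ hf) scaler0 subrr scaler0.
have [j ej] : exists j : nat, j%:Z = - 1 - k by exists `|(- 1 - k)%R|%N; lia.
have jn : (j <= n)%N by lia.
have e (i : nat) : fterm p f n idf k x i = (if i == j then ((-1) ^+ j * 'C(n, j)%:R) *: f (n%:Z - j%:Z) x else 0)
    - (if i == (n - j)%N then ((-1) ^+ j * 'C(n, j)%:R) *: f (n%:Z - j%:Z) x else 0).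
  rewrite /fterm twf_id /idf (cbin_nat R n) scalerBr; congr (_ - _).
    have [->|nj] := eqVneq i j; first by rewrite (_ : (_ == _) = true) //; lia.
    by rewrite (_ : (_ == _) = false) ?(F_0 _ hf) ?scaler0 //; lia.
  have [->|nj] := eqVneq i (n - j)%N; last by rewrite (_ : (_ == _) = false) ?scaler0 //; lia.
  rewrite (_ : (_ == _) = true) ?bin_sub // ?scalerA; last lia.
  congr (_ *: f _ x); last lia.
  rewrite em1_nat -mulrA [_ * (-1) ^+ n]mulrC mulrA -exprD.
  rewrite (_ : (n - j + n = j + (n - j).*2)%N); last by lia.
  by rewrite exprD -mul2n exprM sqrrN expr1n expr1n mulr1.
under eq_bigr do rewrite e.
rewrite sumrB.
have sd (l : nat) y : (l < (N0 + `|k|%N + n).+2)%N -> \sum_(i < (N0 + `|k|%N + n).+2) (if i == l :> nat then y else 0) = y :> M.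
  move=> hl; rewrite (@sum_delta _ (fun i => if i == l then y else 0) _ l hl) ?eqxx // => i /eqP/negbTE -> //.
by rewrite !sd ?subrr //; lia.
Qed.

Lemma fprod_idN1 p (f : field) k x : isF f -> fprod p f (-1) idf k x = f k x.
Proof.
move=> hf; have [N0 h0] := fprod_ex p (-1) k x hf idf_isF.
rewrite (h0 (N0 + `|k|%N).+2); last lia.
have e (i : nat) : fterm p f (-1) idf k x i = if i%:Z == (if k < 0 then -1 - k else k) then f k x else 0.
  have eN : em1 (-1) = -1 :> C by rewrite em1N /em1 expr1z.
  rewrite /fterm twf_id /idf eN scaleN1r opprK.
  rewrite (_ : (-1)%:~R = -1 :> C) // cbinN1 -exprMn mulrNN mulr1 expr1n scale1r.
  have [k0|k0] := ltP k 0.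
    have -> : (k + -1 - i%:Z == -1) = false by lia.
    rewrite addr0.
    have [ei|ei] := eqVneq i%:Z (- 1 - k).
      have -> : (k + i%:Z == -1) = true by lia.
      by have -> : -1 - i%:Z = k by lia.
    have -> : (k + i%:Z == -1) = false by lia.
    by rewrite (F_0 _ hf).
  have -> : (k + i%:Z == -1) = false by lia.
  rewrite (F_0 _ hf) add0r.
  have [ei|ei] := eqVneq i%:Z k; first by rewrite (_ : (_ == _) = true) ?ei //; apply/eqP; lia.
  by have -> : (k + -1 - i%:Z == -1) = false by lia.
under eq_bigr do rewrite e.
have [j ej] : exists j : nat, j%:Z = (if k < 0 then -1 - k else k).
  by case: (ltP k 0) => hk; [exists `|(-1 - k)%R|%N|exists `|k|%N]; lia.
rewrite -ej (@sum_delta _ (fun i => if i%:Z == j%:Z then f k x else 0) _ j) ?eqxx // => [|i ni].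
  by move: ej; case: ifP; lia.
by rewrite (_ : (_ == _) = false) //; lia.
Qed.

Lemma cbinM1 (z : C) i : z * cbin (z - 1) i = (z - i%:R) * cbin z i.
Proof.
have e w : cbin w 1 = w by have := cbinS w 0; rewrite cbin0 mul1r subr0 mulr1.
by have := cbin_tri z 1 i; rewrite !e mulrC => ->; rewrite mulrC.
Qed.

Definition fder (f : field) : field := fun k x => - k%:~R *: f (k - 1) x.

Lemma fder_isF f : isF f -> isF (fder f).
Proof.
move=> [fl ft]; split=> [k c x y|x]; first by rewrite /fder fl; lmod.
by have [N hN] := ft x; exists (N + 1) => n hn; rewrite /fder hN ?scaler0 //; lia.
Qed.

Lemma twf_der p f k x : twf p (fder f) k x = fder (twf p f) k x.
Proof. by rewrite /twf /fder linearZ. Qed.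

Lemma fprod_der p u n f k x : isF u -> isF f ->
  fder (fprod p u n f) k x = fprod p u n (fder f) k x - n%:~R *: fprod p u (n - 1) f k x.
Proof.
move=> hu hf; have hf' := fder_isF hf.
have [N1 h1] := fprod_ex p n (k - 1) x hu hf; have [N2 h2] := fprod_ex p n k x hu hf'.
have [N3 h3] := fprod_ex p (n - 1) k x hu hf; have [N5 h5] := F_nat0 x hu.
pose N := (N1 + N2 + N3 + N5)%N.
rewrite /fder -/(fder f) (h1 N.+1) ?(h2 N.+1) ?(h3 N); try lia.
pose X (i : nat) := u (n - i%:Z) (f (k + i%:Z - 1) x).
pose Y (i : nat) := twf p f (k + n - i%:Z - 1) (u i%:Z x).
pose c i := (-1) ^+ i * cbin n%:~R i.
transitivity (\sum_(i < N.+1) ((- k%:~R * c i) *: X i + (k%:~R * em1 n * c i) *: Y i)).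
  rewrite scaler_sumr; apply: eq_bigr => i _; rewrite /fterm /X /Y /c.
  rewrite (_ : k - 1 + i%:Z = k + i%:Z - 1); last lia.
  by rewrite (_ : k - 1 + n - i%:Z = k + n - i%:Z - 1); [lmod|lia].
have -> : \sum_(i < N.+1) fterm p u n (fder f) k x i = \sum_(i < N.+1)
   ((- (k + i%:Z)%:~R * c i) *: X i + ((k + n - i%:Z)%:~R * em1 n * c i) *: Y i).
  apply: eq_bigr => i _; rewrite /fterm /X /Y /c twf_der /fder (linZ (F_lin hu _)).
  lmod.
have -> : n%:~R *: \sum_(i < N) fterm p u (n - 1) f k x i =
   \sum_(i < N.+1) (- (i%:R * c i) *: X i + ((n%:~R - i%:R) * em1 n * c i) *: Y i).
  rewrite big_split /= big_ord_recl mul0r oppr0 scale0r add0r [X in _ = _ + X]big_ord_recr /=.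
  have -> : Y N = 0 by rewrite /Y h5 ?F_0 //; [apply: twf_isF|lia].
  rewrite scaler0 addr0 -big_split scaler_sumr; apply: eq_bigr => i _; rewrite -[bump 0 i]/(i.+1) /fterm /X /Y /c.
  rewrite (_ : k + i.+1%:Z - 1 = k + i%:Z); last lia.
  rewrite (_ : n - i.+1%:Z = n - 1 - i%:Z); last lia.
  rewrite (_ : k + n - i%:Z - 1 = k + (n - 1) - i%:Z); last lia.
  rewrite (_ : em1 (n - 1) = - em1 n); last by rewrite em1D em1N /em1 expr1z mulrN1.
  rewrite intrB scalerA mulrCA cbinM1 exprS [i.+1%:R * _]mulrCA cbinS [RHS]/=; lmod.
rewrite -sumrB; apply: eq_bigr => i _; rewrite !intrD !intrN -!pmulrn; lmod.
Qed.

Section Borcherds.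
Variables (p : bool) (u f : field) (g : int -> field).
Hypotheses (hu : isF u) (hf : isF f) (hg : exists N : nat, forall n : int, N%:Z <= n -> forall k x, g n k x = 0).
Definition BLt m n k x (i : nat) : M := cbin m%:~R i *: g (n + i%:Z) (m + k - i%:Z) x.
Definition BRt m n k x (i : nat) : M := ((-1) ^+ i * cbin n%:~R i) *:
  (u (m + n - i%:Z) (f (k + i%:Z) x) - em1 n *: twf p f (n + k - i%:Z) (u (m + i%:Z) x)).
Definition BL m n k x : M := \sum_(i \in [set: nat]) BLt m n k x i.
Definition BR m n k x : M := \sum_(i \in [set: nat]) BRt m n k x i.

Lemma BL_ex m n k x : exists N0, forall N, (N0 <= N)%N -> BL m n k x = \sum_(i < N) BLt m n k x i.
Proof.
have [N hN] := hg; exists (N + `|n|)%N => L hL; apply: fsumE => i hi.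
by rewrite /BLt hN ?scaler0 //; lia.
Qed.
Lemma BR_ex m n k x : exists N0, forall N, (N0 <= N)%N -> BR m n k x = \sum_(i < N) BRt m n k x i.
Proof.
have [N1 h1] := F_nat k x hf; have [N2 h2] := F_nat m x hu.
exists (N1 + N2)%N => L hL; apply: fsumE => i hi.
rewrite /BRt h1 ?h2 ?(F_0 _ hu) ?(F_0 _ (twf_isF p hf)) ?scaler0 ?subrr ?scaler0 //; lia.
Qed.

Lemma sum_pascal z (F : nat -> M) N :
  \sum_(i < N.+1) ((-1) ^+ i * cbin (z + 1) i) *: F i =
  \sum_(i < N.+1) ((-1) ^+ i * cbin z i) *: F i - \sum_(i < N) ((-1) ^+ i * cbin z i) *: F i.+1.
Proof.
rewrite big_ord_recl [X in _ = X - _]big_ord_recl -addrA; congr (_ + _); first by rewrite !cbin0.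
rewrite -sumrB; apply: eq_bigr => i _; rewrite !lift0 cbinP exprS; lmod.
Qed.

Lemma BL_rec m n k x : BL (m + 1) n k x = BL m (n + 1) k x + BL m n (k + 1) x.
Proof.
have [N1 h1] := BL_ex (m + 1) n k x; have [N2 h2] := BL_ex m (n + 1) k x.
have [N3 h3] := BL_ex m n (k + 1) x; pose N := (N1 + N2 + N3)%N.
rewrite (h1 N.+1) ?(h2 N) ?(h3 N.+1); try lia.
rewrite big_ord_recl [X in _ = _ + X]big_ord_recl addrCA; congr (_ + _).
  by rewrite /BLt !cbin0; congr (_ *: g _ _ _); lia.
rewrite -big_split; apply: eq_bigr => i _; rewrite /BLt !lift0.
rewrite (_ : (m + 1)%:~R = m%:~R + 1 :> C) ?cbinP; last by rewrite intrD.
rewrite scalerDl addrC; congr (_ *: g _ _ _ + _ *: g _ _ _); lia.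
Qed.

Lemma BR_rec m n k x : BR (m + 1) n k x = BR m (n + 1) k x + BR m n (k + 1) x.
Proof.
have [N1 h1] := BR_ex (m + 1) n k x; have [N2 h2] := BR_ex m (n + 1) k x.
have [N3 h3] := BR_ex m n (k + 1) x; have [N4 h4] := F_nat k x hf; have [N5 h5] := F_nat m x hu.
pose N := (N1 + N2 + N3 + N4 + N5)%N.
rewrite (h1 N) ?(h2 N.+1) ?(h3 N); try lia.
pose P (i : nat) := u (m + n + 1 - i%:Z) (f (k + i%:Z) x).
pose Q (i : nat) := twf p f (n + 1 + k - i%:Z) (u (m + i%:Z) x).
have PN : P N = 0 by rewrite /P h4 ?F_0 //; lia.
have QN : Q N = 0 by rewrite /Q h5 ?F_0 //; [apply: twf_isF|lia].
rewrite (eq_bigr (fun i : 'I_N.+1 => ((-1) ^+ i * cbin (n%:~R + 1) i) *: (P i + em1 n *: Q i))); last first.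
  move=> i _; rewrite /BRt /P /Q (_ : (n + 1)%:~R = n%:~R + 1 :> C) ?intrD //.
  rewrite (_ : em1 (n + 1) = - em1 n); last by rewrite em1D /em1 expr1z mulrN1.
  by rewrite scaleNr opprK (_ : m + (n + 1) - i%:Z = m + n + 1 - i%:Z); last lia.
rewrite (sum_pascal _ (fun i => P i + em1 n *: Q i)) big_ord_recr /= PN QN !(scaler0, addr0).
rewrite -sumrB -big_split; apply: eq_bigr => i _; rewrite /BRt /P /Q /=.
rewrite (_ : m + 1 + n - i%:Z = m + n + 1 - i%:Z); last lia.
rewrite (_ : m + n + 1 - i.+1%:Z = m + n - i%:Z); last lia.
rewrite (_ : k + 1 + i%:Z = k + i.+1%:Z); last lia.
rewrite (_ : n + 1 + k - i.+1%:Z = n + k - i%:Z); last lia.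
rewrite (_ : n + (k + 1) - i%:Z = n + 1 + k - i%:Z); last lia.
rewrite (_ : m + 1 + i%:Z = m + i.+1%:Z); last lia.
lmod.
Qed.

(** Both sides satisfy B(m + 1, n, k) = B(m, n + 1, k) + B(m, n, k + 1). The iterate formula is the
    case m = 0, the commutator formula the case n = 0, and the recursion propagates equality from
    these two axes to all m and n. *)
Lemma BB : (forall n k x, g n k x = fprod p u n f k x) ->
  (forall m k x, BL m 0 k x = u m (f k x) - twf p f k (u m x)) ->
  forall m n k x, BL m n k x = BR m n k x.
Proof.
move=> it cm.
have B0 n k x : BL 0 n k x = BR 0 n k x.
  have [N1 h1] := BL_ex 0 n k x; have [N2 h2] := BR_ex 0 n k x; have [N3 h3] := fprod_ex p n k x hu hf.
  rewrite (h1 (N1 + N2 + N3).+1) ?(h2 (N1 + N2 + N3).+1); try lia.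
  rewrite big_ord_recl big1 => [|i _]; last by rewrite /BLt lift0 cbin0n scale0r.
  rewrite /BLt cbin0 scale1r addr0 !add0r subr0 addr0 it (h3 (N1 + N2 + N3).+1); last lia.
  apply: eq_bigr => i _; rewrite /fterm /BRt !add0r; congr (_ *: (u _ _ - _ *: twf p f _ _)); lia.
have C0 m k x : BL m 0 k x = BR m 0 k x.
  have [N2 h2] := BR_ex m 0 k x; rewrite cm (h2 N2.+1); last lia.
  rewrite big_ord_recl big1 => [|i _]; last by rewrite /BRt lift0 cbin0n mulr0 scale0r.
  rewrite addr0 /BRt cbin0 /em1 expr0z expr0 mul1r !scale1r.
  have -> : m + 0 - (ord0 : 'I_N2.+1)%:Z = m by rewrite addr0 subr0.
  have -> : m + (ord0 : 'I_N2.+1)%:Z = m by rewrite addr0.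
  have -> : k + (ord0 : 'I_N2.+1)%:Z = k by rewrite addr0.
  by have -> : 0 + k - (ord0 : 'I_N2.+1)%:Z = k by rewrite add0r subr0.
have mpos (m : nat) n k x : BL m n k x = BR m n k x.
  elim: m n k => [|m IH] n k //.
  by rewrite (_ : m.+1%:Z = m%:Z + 1) ?BL_rec ?BR_rec ?IH //; lia.
have npos (n : nat) m k x : BL m n k x = BR m n k x.
  elim: n m k => [|n IH] m k //.
  have := BL_rec m n k x; rewrite !IH BR_rec => /addIr e.
  by rewrite (_ : n.+1%:Z = n%:Z + 1) ?e //; lia.
(* In the quadrant of negative m and n the recursion is solved for its last term, by a double
   induction on the distances to the axes. *)
have nneg (q r : nat) k x : BL (- q%:Z) (- r%:Z) k x = BR (- q%:Z) (- r%:Z) k x.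
  elim: q r k => [|q IHq] r k; first by rewrite oppr0.
  elim: r k => [|r IHr] k; first by rewrite oppr0.
  have e1 (l : nat) : - l.+1%:Z + 1 = - l%:Z by lia.
  have := BL_rec (- q.+1%:Z) (- r.+1%:Z) (k - 1) x; have := BR_rec (- q.+1%:Z) (- r.+1%:Z) (k - 1) x.
  by rewrite !e1 subrK IHq IHr => -> /addrI ->.
move=> [m|m] n k x; first exact: mpos.
case: n => n; first exact: npos.
by rewrite !NegzE.
Qed.
End Borcherds.

Section StepComm.
Variables (pa pu : bool) (a u f : field) (c d : nat -> field) (e : nat -> int -> field) (I T : nat).
Hypotheses (ha : isF a) (hu : isF u) (hf : isF f) (hc : forall i, isF (c i)) (hd : forall i, isF (d i)).
Hypotheses (fa : fparity pa a) (fu : fparity pu u).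
Hypothesis comm : forall p q x, a p (u q x) = sgn (pa && pu) *: u q (a p x)
  + \sum_(i < I) cbin p%:~R i *: c i (p + q - i%:Z) x.
Hypothesis commf : forall m k x, u m (f k x) = twf pu f k (u m x)
  + \sum_(t < T) cbin m%:~R t *: d t (m + k - t%:Z) x.
Variable r : int.
Hypothesis he : forall m k x (i : nat), (i < I)%N ->
  BL (e i) m (r - i%:Z) k x = BR (pa (+) pu) (c i) f m (r - i%:Z) k x.
Hypothesis heT : forall i t : nat, (T <= t)%N -> forall k x, e i (r - i%:Z + t%:Z) k x = 0.

(** This plays the part of Dong's lemma: the commutator formula passes from the pair (u, f) to the
    pair (u, a_(r) f). The terms produced by exchanging a and u are reorganised by the Borcherds
    identity of the c_i with f. *)
Lemma step_comm m k x : u m (fprod pa a r f k x) = twf pu (fprod pa a r f) k (u m x)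
  + \sum_(t < T) cbin m%:~R t *: (sgn (pa && pu) *:
      (fprod pa a r (d t) (m + k - t%:Z) x
       - \sum_(i < I) cbin r%:~R i *: e i (r - i%:Z + t%:Z) (m + k - t%:Z) x)).
Proof.
have hfa := twf_isF pa hf; have hfu := twf_isF pu hf; have hfau := twf_isF pu hfa.
have [N1 h1] := fprod_ex pa r k x ha hf; have [N2 h2] := fprod_ex pa r k (u m x) ha hfu.
have [N3 h3] := unif T (fun t => fprod_ex pa r (m + k - t%:Z) x ha (hd t)).
have [N6 h6] := unif I (fun i => F_nat m x (hc i)). have [N7 h7] := F_nat k x hf.
pose N := (N1 + N2 + N3 + N6 + N7 + I)%N.
rewrite twf_fprod // (h1 N) ?(h2 N); try lia.
pose S := twf pu (twf pa f); have lS q : linear (S q) := F_lin hfau q.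
pose al (j : nat) := (-1) ^+ j * cbin r%:~R j.
rewrite (lin_sum _ _ _ (F_lin hu _)).
have commfa q y : u m (twf pa f q y) = S q (u m y)
   + \sum_(t < T) cbin m%:~R t *: (sgn (pa && pu) *: twf pa (d t) (m + q - t%:Z) y).
  have ut z : u m (tw pa z) = sgn (pa && pu) *: tw pa (u m z).
    by rewrite -[in RHS](twK pa z) -/(twf pa u m (tw pa z)) (twf_par _ _ _ fu) scalerA sgnK scale1r.
  rewrite {1}/twf ut commf ut linearD linear_sum /= {1}/twf.
  rewrite scalerDr scaler_sumr; congr (_ + _); last first.
    by apply: eq_bigr => t _; rewrite linearZ /= /twf !scalerA mulrC.
  rewrite !(linearZ, linZ (F_lin hf _)) /= scalerA sgnK scale1r /S /twf.
  by rewrite [tw pu (tw pa (f _ _))]tw_comm [tw pu (tw pa _)]tw_comm.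
have ua q p y : u q (a p y) = sgn (pa && pu) *: (a p (u q y) - \sum_(i < I) cbin p%:~R i *: c i (p + q - i%:Z) y).
  by rewrite comm addrK scalerA sgnK scale1r.
pose F1 j t : M := (al j * cbin m%:~R t) *: (a (r - j%:Z) (d t (m + k - t%:Z + j%:Z) x)
   - em1 r *: twf pa (d t) (m + k - t%:Z + r - j%:Z) (a j%:Z x)).
pose F2 j i : M := al j *: (cbin (r%:~R - j%:R) i *: c i (r - j%:Z + m - i%:Z) (f (k + j%:Z) x)
   - (em1 r * cbin j%:R i) *: S (k + r - j%:Z) (c i (j%:Z + m - i%:Z) x)).
transitivity (sgn (pu && pa) *: \sum_(i < N) fterm pa a r (twf pu f) k (u m x) i
   + sgn (pa && pu) *: (\sum_(j < N) \sum_(t < T) F1 j t - \sum_(j < N) \sum_(i < I) F2 j i)).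
  rewrite scaler_sumr -sumrB scaler_sumr -big_split; apply: eq_bigr => j _ /=.
  rewrite /fterm (linZ (F_lin hu _)) -scaleNr (linD (F_lin hu _)) (linZ (F_lin hu _)) commfa !ua commf.
  rewrite (linD (F_lin ha _)) (lin_sum _ _ _ (F_lin ha _)) (linZ (lS _)) -scaleNr -[- \sum_(i < I) cbin j%:Z%:~R i *: _]scaleN1r.
  rewrite (linD (lS _)) (linZ (lS _)) (lin_sum _ _ _ (lS _)) /F1 /F2 -/(al j).
  have -> : \sum_(t < T) a (r - j%:Z) (cbin m%:~R t *: d t (m + (k + j%:Z) - t%:Z) x)
     = \sum_(t < T) cbin m%:~R t *: a (r - j%:Z) (d t (m + k - t%:Z + j%:Z) x).
    apply: eq_bigr => t _; rewrite (linZ (F_lin ha _)); congr (_ *: a _ (d t _ x)); lia.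
  have -> : \sum_(t < T) cbin m%:~R t *: (sgn (pa && pu) *: twf pa (d t) (m + (k + r - j%:Z) - t%:Z) (a j%:Z x))
     = sgn (pa && pu) *: \sum_(t < T) cbin m%:~R t *: twf pa (d t) (m + k - t%:Z + r - j%:Z) (a j%:Z x).
    rewrite scaler_sumr; apply: eq_bigr => t _; rewrite !scalerA mulrC; congr (_ *: twf pa (d t) _ _); lia.
  have -> : \sum_(i < I) S (k + r - j%:Z) (cbin j%:Z%:~R i *: c i (j%:Z + m - i%:Z) x)
     = \sum_(i < I) cbin j%:R i *: S (k + r - j%:Z) (c i (j%:Z + m - i%:Z) x).
    by apply: eq_bigr => i _; rewrite (linZ (lS _)).
  rewrite (_ : (r - j%:Z)%:~R = r%:~R - j%:R :> C); last by rewrite intrB.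
  have -> : \sum_(t < T) (al j * cbin m%:~R t) *: (a (r - j%:Z) (d t (m + k - t%:Z + j%:Z) x)
       - em1 r *: twf pa (d t) (m + k - t%:Z + r - j%:Z) (a j%:Z x)) =
     al j *: (\sum_(t < T) cbin m%:~R t *: a (r - j%:Z) (d t (m + k - t%:Z + j%:Z) x)
       - em1 r *: \sum_(t < T) cbin m%:~R t *: twf pa (d t) (m + k - t%:Z + r - j%:Z) (a j%:Z x)).
    rewrite scaler_sumr -sumrB scaler_sumr; apply: eq_bigr => t _; lmod.
  have -> : \sum_(i < I) al j *: (cbin (r%:~R - j%:R) i *: c i (r - j%:Z + m - i%:Z) (f (k + j%:Z) x)
       - (em1 r * cbin j%:R i) *: S (k + r - j%:Z) (c i (j%:Z + m - i%:Z) x)) =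
     al j *: (\sum_(i < I) cbin (r%:~R - j%:R) i *: c i (r - j%:Z + m - i%:Z) (f (k + j%:Z) x)
       - em1 r *: \sum_(i < I) cbin j%:R i *: S (k + r - j%:Z) (c i (j%:Z + m - i%:Z) x)).
    rewrite scaler_sumr -sumrB scaler_sumr; apply: eq_bigr => t _; lmod.
  rewrite [pu && pa]andbC [twf pa (twf pu f) _ _]twf_comm -/S.
  by case: (pa && pu); rewrite ?sgn0 ?sgn1; lmod.
congr (_ + _).
rewrite [X in X - _]exchange_big [X in _ - X]exchange_big /=.
have -> : \sum_(t < T) \sum_(j < N) F1 j t = \sum_(t < T) cbin m%:~R t *: fprod pa a r (d t) (m + k - t%:Z) x.
  apply: eq_bigr => t _; rewrite (h3 t N) ?scaler_sumr //; last lia.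
  by apply: eq_bigr => j _; rewrite /F1 /fterm -/(al j) scalerA mulrC.
have -> : \sum_(i < I) \sum_(j < N) F2 j i = \sum_(i < I) cbin r%:~R i *:
    \sum_(t < T) cbin m%:~R t *: e i (r - i%:Z + t%:Z) (m + k - t%:Z) x.
  apply: eq_bigr => i _; have iI := ltn_ord i.
  have -> : \sum_(t < T) cbin m%:~R t *: e i (r - i%:Z + t%:Z) (m + k - t%:Z) x = BL (e i) m (r - i%:Z) k x.
    by rewrite /BL (fsumE (N := T)) // => t ht; rewrite /BLt heT ?scaler0.
  rewrite he // /BR (fsumE (N := N)); last first.
    move=> t ht; rewrite /BRt h7 ?(F_0 _ (hc i)); last lia.
    by rewrite h6 ?F_0 ?scaler0 ?subrr ?scaler0 //; [apply: twf_isF|lia].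
  pose G (t : nat) := S (k + r - i%:Z - t%:Z) (c i (m + t%:Z) x).
  have g t : (N6 <= t)%N -> G t = 0 by move=> ht; rewrite /G h6 // (lin0 (lS _)).
  have cs := @sum_cshift R M r%:~R i G N6 N g ltac:(lia).
  transitivity (cbin r%:~R i *: (\sum_(j < N) ((-1) ^+ j * cbin (r%:~R - i%:R) j) *: c i (m + (r - i%:Z) - j%:Z) (f (k + j%:Z) x))
     - em1 r *: \sum_(j < N) ((-1) ^+ j * cbin r%:~R j * cbin j%:R i) *: G (j - i)%N).
    rewrite !scaler_sumr -sumrB; apply: eq_bigr => j _; rewrite /F2 /al /G.
    have tri : cbin r%:~R i * cbin (r%:~R - i%:R) j = cbin r%:~R j * cbin (r%:~R - j%:R) i by apply: cbin_tri.
    rewrite scalerBr !scalerA; congr (_ *: c i _ _ - _); [|lia|].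
      by rewrite -mulrA -tri; ring.
    have [ij|ji] := leqP i j; last by rewrite [cbin j%:R i]cbin_nat bin_small // !mulr0 !scale0r.
    congr (_ *: S _ (c i _ x)); [ring|lia|lia].
  rewrite cs !scaler_sumr -sumrB; apply: eq_bigr => t _; rewrite /BRt /G.
  rewrite -[twf (pa (+) pu) f _ _]/(tw (pa (+) pu) (f _ (tw (pa (+) pu) _))) !tw_addb.
  rewrite /S /twf [tw pu (tw pa (f _ _))]tw_comm (_ : (r - i%:Z)%:~R = r%:~R - i%:R :> C) ?intrB //.
  rewrite (_ : r - i%:Z + k - t%:Z = k + r - i%:Z - t%:Z); last lia.
  rewrite !em1D em1N em1_nat; lmod.
have -> : \sum_(t < T) cbin m%:~R t *: (sgn (pa && pu) *: (fprod pa a r (d t) (m + k - t%:Z) x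
      - \sum_(i < I) cbin r%:~R i *: e i (r - i%:Z + t%:Z) (m + k - t%:Z) x))
  = sgn (pa && pu) *: (\sum_(t < T) cbin m%:~R t *: fprod pa a r (d t) (m + k - t%:Z) x
      - \sum_(t < T) \sum_(i < I) cbin m%:~R t *: (cbin r%:~R i *: e i (r - i%:Z + t%:Z) (m + k - t%:Z) x)).
  by rewrite -sumrB scaler_sumr; apply: eq_bigr => t _; rewrite -scaler_sumr; lmod.
congr (_ *: (_ - _)); rewrite exchange_big; apply: eq_bigr => i _; rewrite scaler_sumr.
by apply: eq_bigr => t _; rewrite !scalerA mulrC.
Qed.
End StepComm.

End FieldsII.

(** * Smooth affine modules are modules of the vertex algebra *)

Section FieldSpace.
Variable R : realType.
Local Notation C := (R[i]).
Local Notation sgn := (sgn R).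
Variable M : superSpace R.
Local Notation field := (int -> M -> M).

Definition rawsg (f : field) : field := twf true f.
Lemma rawsg_linear : linear rawsg.
Proof. by move=> c f g; apply/funext => k; apply/funext => x; rewrite /rawsg /twf linearP. Qed.
HB.instance Definition _ := GRing.isLinear.Build C field field *:%R rawsg rawsg_linear.
Lemma rawsgK f : rawsg (rawsg f) = f.
Proof. by apply/funext => k; apply/funext => x; rewrite /rawsg /twf /= !sgK. Qed.
Definition rawSS : superSpace R := SuperSpace rawsgK.

Lemma isF_subsp : subsp (M := rawSS) (fun f : field => isF f).
Proof.
split=> [|c f g hf hg|f hf]; last exact: twf_isF.
- by split=> [k c x y|x]; [rewrite /= scaler0 addr0|exists 0].
split=> [k a x y|x]; first by rewrite -[LHS]/(c *: f k _ + g k _) (F_lin hf) (F_lin hg) -[(c *: f + g) k]/(fun x => c *: f k x + g k x); lmod.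
have [N1 h1] := F_tr hf x; have [N2 h2] := F_tr hg x.
exists (Num.max N1 N2) => n hn; rewrite -[LHS]/(c *: f n x + g n x) h1 ?h2 ?scaler0 ?addr0 //; lia.
Qed.
Definition Fd : superSpace R := subSuper isF_subsp.
Definition fval (f : Fd) : field := val f.
Lemma fvalF (f : Fd) : isF (fval f). Proof. exact: ssT_valP. Qed.
Lemma fval_lin c (f g : Fd) k x : fval (c *: f + g) k x = c *: fval f k x + fval g k x.
Proof. by []. Qed.
Lemma fvalZ c (f : Fd) k x : fval (c *: f) k x = c *: fval f k x.
Proof. by []. Qed.
Lemma fvalD (f g : Fd) k x : fval (f + g) k x = fval f k x + fval g k x.
Proof. by []. Qed.
Lemma fval_sg (f : Fd) k x : fval (sg Fd f) k x = twf true (fval f) k x.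
Proof. by []. Qed.
Definition fmk f (hf : isF f) : Fd := @ssmk _ rawSS _ isF_subsp f hf.
Lemma fval_mk f (hf : isF f) : fval (fmk hf) = f. Proof. by []. Qed.
Lemma fval_inj (f g : Fd) : (forall k x, fval f k x = fval g k x) -> f = g.
Proof. by move=> h; apply: val_inj; apply/funext => k; apply/funext => x; apply: h. Qed.

Lemma cbin1 (z : C) : @cbin R z 1 = z.
Proof. by have := cbinS z 0; rewrite cbin0 mul1r subr0 mulr1. Qed.

Lemma fprod_idl (p : bool) n f k x : isF f -> fprod p (@idf R M) n f k x = if n == -1 then f k x else 0.
Proof.
move=> hf; have hf' := twf_isF p hf.
have [N0 h0] := fprod_ex p n k x (idf_isF (R:=R) M) hf; rewrite (h0 (N0 + `|n|%N).+2); last lia.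
have [->|n1] := eqVneq n (-1).
  rewrite big_ord_recl big1 => [|i _]; rewrite /fterm ?lift0.
    by rewrite /idf subr0 eqxx (_ : (0%:Z == -1) = false) // (F_0 _ hf') scaler0 !subr0 expr0 cbin0 mulr1 scale1r !addr0.
  rewrite /idf; have -> : (-1 - i.+1%:Z == -1) = false by lia.
  by rewrite (F_0 _ hf') scaler0 subrr scaler0.
apply: big1 => i _; rewrite /fterm /idf (_ : (i%:Z == -1) = false) // (F_0 _ hf') scaler0 subr0.
case: ifP => [ei|_]; last by rewrite scaler0.
have [m em] : exists m : nat, n = m%:Z by exists `|n|%N; lia.
have -> : n%:~R = m%:R :> C by rewrite em.
by rewrite cbin_nat bin_small ?mulr0 ?scale0r //; lia.
Qed.

Lemma fprod_scale p (u v : field) c n f k x : (forall j y, v j y = c *: u j y) -> isF u -> isF v -> isF f ->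
  fprod p v n f k x = c *: fprod p u n f k x.
Proof.
move=> e hu hv hf; have hf' := twf_isF p hf.
have [N1 h1] := fprod_ex p n k x hu hf; have [N2 h2] := fprod_ex p n k x hv hf.
rewrite (h1 (N1 + N2)%N) ?(h2 (N1 + N2)%N); try lia.
rewrite scaler_sumr; apply: eq_bigr => i _; rewrite /fterm !e (linZ (F_lin hf' _)); lmod.
Qed.
End FieldSpace.

(** * The state-field map of a smooth module *)

Section Smooth.
Variable R : realType.
Local Notation C := (R[i]).
Local Notation sgn := (sgn R).
Local Notation cbin := (@cbin R).
Variables (V : vosa R) (J : {linear gl11 R -> V}).
Hypothesis HV : is_V1gl11 J.
Local Notation o := (Wop J (W := vself V)).
Let Ho : modes o := Wop_modes HV (vself V).

Lemma V_indg (P : V -> Prop) : P (vac V) -> P 0 ->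
  (forall (c : C) x y, P x -> P y -> P (c *: x + y)) ->
  (forall g r x, P x -> P (o g r x)) -> forall x, P x.
Proof.
move=> pv p0 pl po; apply: (V_ind HV) => // a r x px.
rewrite -[vprod _ _ _]/(act (v0 := vself V) (J a) r x) (affine_opsum (W_aff HV (vself V))) /opsum.
apply: big_ind => // [y z hy hz|g _]; first by rewrite -[y]scale1r; apply: pl.
by rewrite -[_ *: _]addr0; apply: pl => //; apply: po.
Qed.

Lemma opsum_gen (N : lmodType C) (op : gen -> int -> N -> N) g r x : opsum op (glv R g) r x = op g r x.
Proof.
by rewrite /opsum !big_cons big_nil /cg; case: g; rewrite /glv /glN /glE /glp /glm !row4E !scale0r scale1r ?addr0 ?add0r.
Qed.

Variables (M : superSpace R) (op : gen -> int -> M -> M).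
Hypothesis Hm : modes op.
Hypothesis Hsg : forall g r x, sg M (op g r x) = sgn (gpar g) *: op g r (sg M x).
Hypothesis Hsm : forall g x, exists N : int, forall n, N <= n -> op g n x = 0.

Lemma op_isF g : isF (op g). Proof. by split=> [k|x]; [apply: md_lin|apply: Hsm]. Qed.
Lemma op_par g : fparity (gpar g) (op g).
Proof. by move=> k x; rewrite Hsg sgK. Qed.

Definition opF g r (f : Fd M) : Fd M := fmk (fprod_isF (gpar g) r (op_isF g) (fvalF f)).

Definition cc (a b : gen) (i : nat) : int -> M -> M := fun k x =>
  if i == 0%N then cf R a b *: op (tg a b) k x else if i == 1%N then kap R a b *: @idf R M k x else 0.

Lemma cc_isF a b i : isF (cc a b i).
Proof.
have s c u : isF u -> isF (fun k x => c *: u k x : M).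
  case=> ul ut; split=> [k d x y|x]; first by rewrite ul; lmod.
  by have [N hN] := ut x; exists N => n hn; rewrite hN ?scaler0.
rewrite /cc; case: i => [|[|i]] /=; [exact: s (op_isF _)|exact: s (idf_isF (R:=R) M)|].
by split=> [k d x y|x]; [rewrite scaler0 addr0|exists 0].
Qed.

Lemma op_comm a b p q x : op a p (op b q x) = sgn (gpar a && gpar b) *: op b q (op a p x)
  + \sum_(i < 2) cbin p%:~R i *: cc a b i (p + q - i%:Z) x.
Proof.
rewrite (md_comm Hm) -addrA; congr (_ + _); rewrite big_ord_recl big_ord1 lift0 cbin0 scale1r subr0 /cc /=.
congr (_ + _); rewrite cbin1.
rewrite /idf (_ : (p + q - 1 == -1) = (p + q == 0)); last by lia.
by case: ifP => _; rewrite !scalerA ?mulr1 ?mulr0 ?scale0r ?scaler0.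
Qed.

Lemma cc_prod a b (i : nat) n f k x : isF f -> fprod (gpar a (+) gpar b) (cc a b i) n f k x =
  if i == 0%N then cf R a b *: fprod (gpar (tg a b)) (op (tg a b)) n f k x
  else if i == 1%N then (kap R a b * (n == -1)%:R) *: f k x else 0.
Proof.
move=> hf; case: i => [|[|i]] /=.
- rewrite (@fprod_scale _ _ _ (op (tg a b)) _ (cf R a b)) //; [|exact: op_isF|exact: cc_isF].
  by have [->|nz] := eqVneq (cf R a b) 0; rewrite ?scale0r // (tg_par nz).
- rewrite (@fprod_scale _ _ _ (@idf R M) _ (kap R a b)) //; [|exact: idf_isF|exact: cc_isF].
  by rewrite fprod_idl //; case: ifP => _; rewrite ?mulr1 ?mulr0 ?scale0r ?scaler0.
- have [N hN] := fprod_ex (gpar a (+) gpar b) n k x (cc_isF a b i.+2) hf.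
  rewrite (hN N) // big1 // => j _; rewrite /fterm /cc /= (F_0 _ (twf_isF _ hf)); lmod.
Qed.

(** By [fprod_comm] the left products by the currents obey the affine relations on the space of all
    fields, without any locality condition. *)
Lemma opF_modes : modes opF.
Proof.
split=> [a r c f g|a b r s f]; apply: fval_inj => k x.
  rewrite fval_lin !fval_mk; apply: fprod_linf; [exact: op_isF|exact: fvalF|exact: fvalF|exact: fvalF|by []].
rewrite !fvalD !fvalZ !fval_mk (fprod_comm (op_isF a) (op_isF b) (cc_isF a b) (op_par a) (op_par b) (op_comm a b) _ _ _ _ (fvalF f)).
rewrite -addrA; congr (_ + _); have hF := fvalF f.
rewrite big_ord_recl big_ord1 lift0 cbin0 scale1r !cc_prod //=.
rewrite subr0 [s + r]addrC; congr (_ + _).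
by rewrite cbin1 (_ : (r + s - 1 == -1) = (r + s == 0)) ?scalerA ?mulrA //; lia.
Qed.

Lemma opF_sg g r f : sg (Fd M) (opF g r f) = sgn (gpar g) *: opF g r (sg (Fd M) f).
Proof.
apply: fval_inj => k x; rewrite fvalZ fval_sg !fval_mk.
rewrite (twf_fprod true _ _ _ (op_par g) (op_isF g) (fvalF f)) /=.
by congr (_ *: _).
Qed.

Definition idF : Fd M := fmk (@idf_isF R M).

Lemma opF_id g (n : nat) : opF g n idF = 0.
Proof. by apply: fval_inj => k x; rewrite fval_mk fprod_id0 //; apply: op_isF. Qed.

(** The identity field is killed by the products of index r >= 0, hence spans a trivial
    gl(1|1)-module, and V is induced from the trivial module. *)
Lemma Y_exists : exists Y : {linear V -> Fd M},
  [/\ Y (vac V) = idF, forall v, Y (sg V v) = sg (Fd M) (Y v) &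
      forall g r v, Y (o g r v) = opF g r (Y v)].
Proof.
have [[u [u1 [_ _ univ]]] _] := HV.
have lu : linear (fun z : C^o => (z : C) *: idF).
  by move=> c y z; rewrite -[c *: y]/(c * y : C) scalerDl scalerA.
have h0 a (n : nat) : opsum opF a n idF = 0 by rewrite /opsum big1 // => g _; rewrite opF_id scaler0.
have ll a r : linear (opsum opF a r) := aff_linr (modes_affine opF_modes opF_sg) a r.
have [||f [f1 f2 f3 _]] := univ (Fd M) (opsum opF) (mklin lu).
- exact: modes_affine opF_modes opF_sg.
- split=> [z|a z|a r z r0] /=.
  + rewrite sgn0 scale1r -[RHS]/(sg (Fd M) (z *: idF)) linearZ; congr (_ *: _).
    by apply: fval_inj => k x; rewrite fval_sg twf_id.
  + by rewrite (linZ (ll _ _)) (h0 a 0%N) scaler0 mulr0 scale0r scale0r.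
  + have [n ->] : exists n : nat, r = n%:Z by exists `|r|%N; lia.
    by rewrite (linZ (ll _ _)) h0 scaler0.
exists f; split=> //.
- by rewrite -u1 f3 /= scale1r.
- by move=> g r v; rewrite -[o g r v]/(vprod (J (glv R g)) r v) f2 opsum_gen.
Qed.

Variable Y : {linear V -> Fd M}.
Hypothesis Yvac : Y (vac V) = idF.
Hypothesis Ysg : forall v, Y (sg V v) = sg (Fd M) (Y v).
Hypothesis Yop : forall g r v, Y (o g r v) = opF g r (Y v).
Definition y v : int -> M -> M := fval (Y v).

Lemma y_isF v : isF (y v). Proof. exact: fvalF. Qed.
Lemma y_lin c u v k x : y (c *: u + v) k x = c *: y u k x + y v k x.
Proof. by rewrite /y linearP fval_lin. Qed.
Lemma yZ c u k x : y (c *: u) k x = c *: y u k x.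
Proof. by rewrite /y linearZ fvalZ. Qed.
Lemma y0 k x : y 0 k x = 0. Proof. by rewrite /y linear0. Qed.
Lemma y_sum I (r : seq I) (P : pred I) F k x :
  y (\sum_(i <- r | P i) F i) k x = \sum_(i <- r | P i) y (F i) k x.
Proof. by elim/big_rec2: _ => [|i a b _ <-]; rewrite ?y0 // -[F i]scale1r y_lin !scale1r. Qed.
Lemma y_sg v k x : y (sg V v) k x = twf true (y v) k x.
Proof. by rewrite /y Ysg fval_sg. Qed.
Lemma y_par p v : parity p v -> fparity p (y v).
Proof. by move=> pv k x; rewrite -[LHS]/(twf true (y v) k x) -y_sg pv yZ. Qed.
Lemma y_vac k x : y (vac V) k x = @idf R M k x. Proof. by rewrite /y Yvac. Qed.
Lemma y_op g r v k x : y (o g r v) k x = fprod (gpar g) (op g) r (y v) k x.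
Proof. by rewrite /y Yop. Qed.
Lemma y_J g k x : y (J (glv R g)) k x = op g k x.
Proof. by rewrite (J_glv) y_op /y Yvac fprod_idN1 //; apply: op_isF. Qed.
Lemma fprod_ext p u u' n f f' k x : (forall j z, u j z = u' j z :> M) -> (forall j z, f j z = f' j z) ->
  fprod p u n f k x = fprod p u' n f' k x.
Proof.
move=> e1 e2; suff [-> ->] : u = u' /\ f = f' by [].
by split; apply/funext => j; apply/funext => z.
Qed.

Lemma y_der v k x : y (Lop (W := vself V) (-1) v) k x = fder (y v) k x.
Proof.
have lL : linear (Lop (W := vself V) (-1)) by exact: act_linr.
move: v k x; apply: V_indg => [k x||c u v hu hv k x|g r v hv k x].
- have -> : Lop (W := vself V) (-1) (vac V) = 0 by exact: vac_create0.
  rewrite y0 /fder y_vac /idf; case: eqP => [k1|_]; last by rewrite scaler0.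
  by rewrite (_ : k = 0) ?mulr0z ?oppr0 ?scale0r //; lia.
- by move=> k x; rewrite (lin0 lL) /fder !y0 scaler0.
- by rewrite lL y_lin hu hv /fder y_lin; lmod.
rewrite (Lop_comm HV) -scaleNr addrC y_lin !y_op.
rewrite [fder _ _ _](_ : _ = fder (fprod (gpar g) (op g) r (y v)) k x); last by rewrite /fder y_op.
rewrite (fprod_der _ _ _ _ (op_isF g) (y_isF v)).
have -> : fprod (gpar g) (op g) r (y (Lop (W := vself V) (-1) v)) k x = fprod (gpar g) (op g) r (fder (y v)) k x.
  by apply: fprod_ext => // j z; exact: hv.
by rewrite addrC scaleNr.
Qed.

Definition it p u v := forall n k x, y (vprod u n v) k x = fprod p (y u) n (y v) k x.
Definition cmm p u v := exists T0, forall T, (T0 <= T)%N -> forall m k x,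
  y u m (y v k x) = twf p (y v) k (y u m x)
    + \sum_(t < T) cbin m%:~R t *: y (vprod u t%:Z v) (m + k - t%:Z) x.

(** For n >= 0 both sides vanish and n = -1 is direct; from n = -1 - q to n = -2 - q both sides are
    differentiated by [y_der] and divided by q + 1. *)
Lemma it_vac p u : parity p u -> it p u (vac V).
Proof.
move=> pu n k x; rewrite [RHS](fprod_ext (u' := y u) (f' := @idf R M) p n k x) //; last exact: y_vac.
have [n0|n0] := leP 0 n.
  have [m ->] : exists m : nat, n = m%:Z by exists `|n|%N; lia.
  by rewrite fprod_id0 ?vac_create0 ?y0 //; apply: y_isF.
have [q ->] : exists q : nat, n = -1 - q%:Z by exists `|(-1 - n)%R|%N; lia.
elim: q k {n n0} => [|q IH] k.
  by rewrite subr0 fprod_idN1 ?vac_create //; apply: y_isF.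
have e1 : Lop (W := vself V) (-1) (vprod u (-1 - q%:Z) (vac V)) = q.+1%:R *: vprod u (-1 - q.+1%:Z) (vac V).
  rewrite -[LHS]/(vprod (omega V) 0 _) omega_deriv.
  have [N0 hN] := jop_iter (jop_act (vself V)) (vac V : vself V) (vac V : vself V) (-1 - q%:Z) (-2) pu.
  rewrite -[LHS]/(act (v0 := vself V) (act (v0 := vself V) u (-1 - q%:Z) (vac V)) (-2) (vac V)) (hN N0.+2) //; last lia.
  pose F (i : nat) : V := if i == 1%N then q.+1%:R *: vprod u (-1 - q.+1%:Z) (vac V) else 0.
  rewrite (eq_bigr (fun i : 'I_N0.+2 => F i)) => [|i _].
    by rewrite (@sum_delta _ F _ 1%N) // => i; rewrite /F => /eqP/negbTE ->.
  have ui : act (v0 := vself V) u i%:Z (vac V) = 0 by exact: vac_create0.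
  have vi : act (v0 := vself V) (vac V) (-2 + i%:R) (vac V) = if i == 1%N :> nat then vac V else 0.
    by rewrite act_vac; congr (if _ then _ else _); rewrite natz; lia.
  rewrite ui vi (linear0 (act _ _)) scaler0 subr0 sgn0 scale1r /F.
  case: eqP => [->|_]; last by rewrite (linear0 (act _ _)) scaler0.
  rewrite cbin1 expr1 -[-1 - q%:Z - 1]addrA -[act _ _ _]/(vprod u _ (vac V)); congr (_ *: vprod u _ _); last lia.
  by rewrite intrB -pmulrn -natr1; ring.
apply: (scalerI (natC_neq0 R q)); rewrite -yZ -e1 y_der.
rewrite [LHS](_ : _ = fder (fprod p (y u) (-1 - q%:Z) (@idf R M)) k x); last by rewrite /fder IH.
have hi := @idf_isF R M; have hd := fder_isF hi.
rewrite (fprod_der _ _ _ _ (y_isF u) hi).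
have -> : fprod p (y u) (-1 - q%:Z) (fder (@idf R M)) k x = 0.
  rewrite (@fprod_linf _ _ p (y u) _ (fder (@idf R M)) (fder (@idf R M)) _ (-1) (y_isF u) hd hd hd) ?scaleN1r ?addNr // => j z.
  rewrite /fder /idf; case: eqP => j1; last by rewrite !scaler0 addr0.
  by rewrite (_ : j = 0) ?mulr0z ?oppr0 ?scale0r ?scaler0 ?addr0 //; lia.
rewrite sub0r -scaleNr (_ : -1 - q%:Z - 1 = -1 - q.+1%:Z); last lia.
by congr (_ *: _); rewrite intrB -pmulrn -natr1; ring.
Qed.

Lemma cmm_vac p u : cmm p u (vac V).
Proof.
exists 0%N => T _ m k x; rewrite big1 => [|t _]; last by rewrite vac_create0 // y0 scaler0.
rewrite addr0 -[twf _ _ _ _]/(tw p (y (vac V) k (tw p _))) !y_vac -/(twf p (@idf R M) k _) twf_id /idf.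
by case: ifP => // _; rewrite (F_0 _ (y_isF u)).
Qed.

Lemma it_lin p u c v w : it p u v -> it p u w -> it p u (c *: v + w).
Proof.
move=> hv hw n k x; rewrite linearP y_lin hv hw.
by rewrite (fprod_linf _ _ (y_isF u) (y_isF v) (y_isF w) (y_isF _) (y_lin c v w)).
Qed.
Lemma it0 p u : it p u 0.
Proof.
move=> n k x; rewrite linear0 y0.
rewrite (fprod_linf (f := y 0) (g := y 0) (c := -1) _ _ (y_isF u) (y_isF _) (y_isF _) (y_isF _)) ?scaleN1r ?addNr //.
by move=> j z; rewrite !y0 scaler0 addr0.
Qed.
Lemma cmm_lin p u c v w : cmm p u v -> cmm p u w -> cmm p u (c *: v + w).
Proof.
move=> [T1 h1] [T2 h2]; exists (maxn T1 T2) => T hT m k x; have hu := F_lin (y_isF u).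
rewrite /twf !y_lin hu (h1 T) ?(h2 T); try lia.
under [X in _ = _ + X]eq_bigr do rewrite linearP y_lin scalerDr scalerA mulrC -scalerA.
rewrite big_split -scaler_sumr /twf linearP /=; lmod.
Qed.
Lemma cmm0 p u : cmm p u 0.
Proof.
exists 0%N => T _ m k x; rewrite /twf !y0 (F_0 _ (y_isF u)) linear0 big1 ?addr0 // => t _.
by rewrite linear0 y0 scaler0.
Qed.

Lemma vprodZ c u n v : vprod (c *: u) n v = c *: vprod u n v :> V.
Proof. exact: (linZ (@vprod_linl _ V n v)). Qed.
Lemma vprod0l n v : vprod 0 n v = 0 :> V.
Proof. exact: (lin0 (@vprod_linl _ V n v)). Qed.

Definition good p u v := it p u v /\ cmm p u v.
Lemma goodZ p c u v : good p u v -> good p (c *: u) v.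
Proof.
move=> [i [T0 h]]; split=> [n k x|].
  by rewrite vprodZ yZ i; apply/esym/fprod_scale; try exact: y_isF; apply: yZ.
exists T0 => T hT m k x; rewrite !yZ (h T hT) (linZ (F_lin (twf_isF p (y_isF v)) _)) scalerDr scaler_sumr.
by congr (_ + _); apply: eq_bigr => t _; rewrite vprodZ yZ !scalerA mulrC.
Qed.
Lemma good0 p v : good p 0 v.
Proof.
have := @cmm0; split=> [n k x|].
  rewrite vprod0l y0 (@fprod_scale _ _ p (y 0) _ 0) ?scale0r //; try exact: y_isF.
  by move=> j z; rewrite y0 scaler0.
exists 0%N => T hT m k x; rewrite !y0 (F_0 _ (twf_isF p (y_isF v))) add0r big1 // => t _.
by rewrite vprod0l y0 scaler0.
Qed.
Lemma good_vac v : good false (vac V) v.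
Proof.
split=> [n k x|].
  have -> : fprod false (y (vac V)) n (y v) k x = fprod false (@idf R M) n (y v) k x.
    by apply: fprod_ext => // j z; exact: y_vac.
  by rewrite fprod_idl ?vac_prod; [case: ifP; rewrite ?y0|exact: y_isF].
exists 0%N => T hT m k x; rewrite !y_vac big1 => [|t _]; last by rewrite vac_prod y0 scaler0.
by rewrite addr0 /twf /idf /=; case: ifP => // _; rewrite (F_0 _ (y_isF v)).
Qed.

Lemma good_BB p u v m n k x : good p u v ->
  BL (fun n => y (vprod u n v)) m n k x = BR p (y u) (y v) m n k x.
Proof.
have [N hN] := vprod_trunc u v.
have tr : exists N : nat, forall n : int, N%:Z <= n -> forall k x, y (vprod u n v) k x = 0.
  by exists N => l hl k' x'; rewrite hN // y0.
move=> [i [T0 h]]; apply: BB => //; try exact: y_isF.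
move=> {}m {}k {}x; rewrite (h (T0 + N)%N) ?leq_addr // addrC addKr.
rewrite /BL (fsumE (N := (T0 + N)%N)) => [|t ht]; last by rewrite /BLt hN ?y0 ?scaler0 //; lia.
by apply: eq_bigr => t _; rewrite /BLt add0r.
Qed.

Lemma V_comm b pu u r n v I : parity pu u -> (forall i : nat, (I <= i)%N -> o b i u = 0) ->
  vprod u n (o b r v) = sgn (gpar b && pu) *: (o b r (vprod u n v)
    - \sum_(i < I) cbin r%:~R i *: vprod (o b i u) (n + r - i%:Z) v).
Proof.
move=> pu' hI; have hb : parity (gpar b) (J (glv R b)) by apply: (J_parity HV); apply: glv_parity.
have := jop_comm (jop_act (vself V)) (w1 := u : vself V) (N0 := I) v r n hb hI.
rewrite sgn0 scale1r (tw_parity _ pu') /=.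
have -> : vprod (sgn (gpar b && pu) *: u) n (vprod (J (glv R b)) r v) = sgn (gpar b && pu) *: vprod u n (o b r v).
  by rewrite vprodZ.
move=> e; apply: (scalerI (sgn_neq0 R (gpar b && pu))); rewrite scalerA sgnK scale1r.
apply/eqP; rewrite eq_sym subr_eq addrC -subr_eq; apply/eqP; rewrite e; apply: eq_bigr => i _.
by congr (_ *: vprod _ _ _); rewrite -[r%:~R]/(r%:~R : int) intz; lia.
Qed.

Lemma comm_hyp b pu u : parity pu u -> cmm (gpar b) (J (glv R b)) u -> exists I0, forall I, (I0 <= I)%N ->
  forall p q x, op b p (y u q x) = sgn (gpar b && pu) *: y u q (op b p x)
  + \sum_(i < I) cbin p%:~R i *: y (o b i u) (p + q - i%:Z) x.
Proof.
move=> pu' [T0 h]; exists T0 => I hI p q x; have := h I hI p q x.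
by rewrite !y_J (twf_par _ _ _ (y_par pu')).
Qed.

(** Induction step in the second argument. The iterate formula for b_r v follows by exchanging u_(n)
    and b_(r), in V by [V_comm] and on fields by [fprod_comm]. The commutator formula is
    [step_comm], whose Borcherds hypothesis comes from the pairs (b_i u, v). *)
Lemma good_step b r pu u v : parity pu u -> cmm (gpar b) (J (glv R b)) u -> good pu u v ->
  (forall i : nat, good (gpar b (+) pu) (o b i u) v) -> good pu u (o b r v).
Proof.
move=> pu' cb [i0 [T0 c0]] gi; have [I1 h1] := comm_hyp pu' cb.
have [I2 h2] := act_trunc_ge (W := vself V) (J (glv R b)) 0 u.
pose I := maxn I1 I2; have hI := h1 I (leq_maxl _ _).
have oI (i : nat) : (I <= i)%N -> o b i u = 0.
  by move=> hi; rewrite -[i%:Z]add0r; apply: h2; lia.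
have E : y (o b r v) = fprod (gpar b) (op b) r (y v) by apply/funext => k; apply/funext => x; apply: y_op.
have ei n k x : y (vprod u n (o b r v)) k x = sgn (gpar b && pu) *: (y (o b r (vprod u n v)) k x
   - \sum_(i < I) cbin r%:~R i *: y (vprod (o b i u) (n + r - i%:Z) v) k x).
  rewrite (V_comm r n v pu' oI) yZ; congr (_ *: _).
  rewrite -scaleN1r addrC y_lin y_sum scaleN1r addrC; congr (_ - _).
  by apply: eq_bigr => i _; rewrite yZ.
have i1 : it pu u (o b r v).
  move=> n k x; rewrite E ei y_op.
  have := fprod_comm (op_isF b) (y_isF u) (fun i => y_isF (o b i u)) (op_par b) (y_par pu') hI r n k x (y_isF v).
  have -> : fprod (gpar b) (op b) r (y (vprod u n v)) k x = fprod (gpar b) (op b) r (fprod pu (y u) n (y v)) k x.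
    by apply: fprod_ext => // j z; apply: i0.
  have -> : \sum_(i < I) cbin r%:~R i *: y (vprod (o b i u) (n + r - i%:Z) v) k x =
    \sum_(i < I) cbin r%:~R i *: fprod (gpar b (+) pu) (y (o b i u)) (n + r - i%:Z) (y v) k x.
    by apply: eq_bigr => i _; rewrite (gi i).1.
  by move=> ->; rewrite addrK scalerA sgnK scale1r.
split=> //.
have [T1 t1] := act_trunc_ge (W := vself V) u 0 v.
have [T2 t2] : exists T2, forall i t : nat, (i < I)%N -> (T2 <= t)%N -> vprod (o b i u) (r - i%:Z + t%:Z) v = 0.
  by apply: unif => i; have [N hN] := act_trunc_ge (W := vself V) (o b i u : V) (r - i%:Z) v; exists N.
exists (T0 + T2)%N => T hT m k x.
have hs := @step_comm R M (gpar b) pu (op b) (y u) (y v) (fun i => y (o b i u)) (fun t => y (vprod u t%:Z v))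
  (fun i n => y (vprod (o b i u) n v)) I T (op_isF b) (y_isF u) (y_isF v) (fun i => y_isF _) (fun t => y_isF _)
  (op_par b) (y_par pu') hI (c0 T ltac:(lia)) r (fun m k x i hi => good_BB m (r - i%:Z) k x (gi i)).
rewrite E hs; last first.
  move=> i t ht k' x'; have [iI|Ii] := ltnP i I; last by rewrite oI // vprod0l y0.
  by rewrite t2 ?y0 //; lia.
congr (_ + _); apply: eq_bigr => t _; rewrite ei y_op; congr (_ *: (_ *: (_ - _))).
by apply: eq_bigr => i _; congr (_ *: y (vprod _ _ _) _ _); lia.
Qed.

Lemma cmm_JJ b g : cmm (gpar b) (J (glv R b)) (J (glv R g)).
Proof.
exists 2 => T hT m k x; rewrite !y_J op_comm [twf _ _ _ _](_ : _ = twf (gpar b) (op g) k (op b m x)); last first.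
  by rewrite /twf y_J.
rewrite (twf_par _ _ _ (op_par g)); congr (_ + _).
have Jp t : vprod (J (glv R b)) t%:Z (J (glv R g)) = if t == 0%N then J (lbr (glv R b) (glv R g)) else
   if t == 1%N then lform (glv R b) (glv R g) *: vac V else 0.
  exact: (J_prod HV _ (glv_parity R b) (glv_parity R g)).
rewrite (@sum_widen _ (fun t => cbin m%:~R t *: y (vprod (J (glv R b)) t%:Z (J (glv R g))) (m + k - t%:Z) x) 2 T) //.
  apply: eq_bigr => t _; congr (_ *: _); rewrite Jp lbr_gen lform_gen linearZ /cc.
  by case: ifP => _; [rewrite yZ y_J|case: ifP => _; rewrite ?yZ ?y_vac ?y0].
by move=> [|[|t]] // _; rewrite Jp y0 scaler0.
Qed.

(** Currents are treated before general vectors: [good_step] needs the commutator of b with u, which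
    is [cmm_JJ] when u is a current, and which this lemma supplies for all other u. *)
Lemma good_J v g : good (gpar g) (J (glv R g)) v.
Proof.
have iJ w h : it (gpar h) (J (glv R h)) w.
  move=> n k x; rewrite -[vprod _ _ _]/(o h n w) y_op; apply: fprod_ext => // j z; exact/esym/y_J.
split=> //; have gp h : parity (gpar h) (J (glv R h)) by apply: (J_parity HV); apply: glv_parity.
move: v g; apply: V_indg => [g||c u v hu hv g|b r v IH g].
- exact: cmm_vac.
- by move=> g; apply: cmm0.
- exact: cmm_lin.
suff [] : good (gpar g) (J (glv R g)) (o b r v) by [].
apply: (good_step _ (gp g) (cmm_JJ b g) (conj (iJ v g) (IH g))) => i.
have -> : o b i (J (glv R g)) = if i == 0%N then J (lbr (glv R b) (glv R g)) else
   if i == 1%N then lform (glv R b) (glv R g) *: vac V else 0.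
  exact: (J_prod HV _ (glv_parity R b) (glv_parity R g)).
rewrite lbr_gen lform_gen linearZ /=; case: ifP => _; last case: ifP => _; last exact: good0.
- have [->|nz] := eqVneq (cf R b g) 0; first by rewrite scale0r; apply: good0.
  by rewrite -(tg_par nz); apply: goodZ; split.
- have [->|nz] := eqVneq (kap R b g) 0; first by rewrite scale0r; apply: good0.
  by rewrite (kap_par nz) addbb; apply: goodZ; apply: good_vac.
Qed.

(** Induction on v for all u at once, since the step refers to the vectors b_i u. *)
Lemma good_all v p u : parity p u -> good p u v.
Proof.
move: v p u; apply: V_indg => [p u pu||c w v hw hv p u pu|b r v IH p u pu].
- by split; [apply: it_vac|apply: cmm_vac].
- by move=> p u pu; split; [apply: it0|apply: cmm0].
- by have [a1 a2] := hw p u pu; have [b1 b2] := hv p u pu; split; [apply: it_lin|apply: cmm_lin].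
apply: (good_step _ pu (good_J u b).2 (IH p u pu)) => i; apply: IH.
exact: (@w_parity _ _ _ HV (vself V)).
Qed.

Lemma y_trunc v x : exists N : nat, forall n : int, N%:Z <= n -> y v n x = 0.
Proof. by have [N hN] := F_tr (y_isF v) x; exists `|N|%N => n hn; apply: hN; lia. Qed.
Lemma y_sgg v n x : sg M (y v n x) = y (sg V v) n (sg M x).
Proof. by rewrite y_sg /twf /= sgK. Qed.
Lemma y_vacE n x : y (vac V) n x = if n == -1 then x else 0.
Proof. exact: y_vac. Qed.
Lemma y_jacobi : jacobi (@vprod R V) y y false y.
Proof.
move=> a b u v pa pb x m n k; have := good_BB m n k x (good_all v pa).
rewrite /BL /BLt /BR /BRt => e.
have im : m%:~R = m :> int by rewrite intz.
have i_n : n%:~R = n :> int by rewrite intz.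
have ii (i : nat) : i%:R = i%:Z :> int by rewrite natz.
under eq_fsbigr do rewrite gbinomE im ii.
rewrite e; apply: eq_fsbigr => i _; rewrite gbinomE sgn0 scale1r i_n ii (twf_par _ _ _ (y_par pb)).
by rewrite scalerA.
Qed.

Definition smooth_vmod : vmod V :=
  @Vmod R V M y (fun n x c u v => y_lin c u v n x) (fun v k => F_lin (y_isF v) k) y_sgg y_trunc y_vacE y_jacobi.

Lemma smooth_vmodE g r x : Wop J (W := smooth_vmod) g r x = op g r x.
Proof. exact: y_J. Qed.
End Smooth.

(** * Highest-weight modules and their homomorphisms *)

Section Pairs.
Variable R : realType.
Local Notation C := (R[i]).
Local Notation sgn := (sgn R).

Definition twist_sg p (M : superSpace R) (x : M) : M := sgn p *: sg M x.
Lemma twist_sg_linear p (M : superSpace R) : linear (@twist_sg p M).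
Proof. by move=> c x y; rewrite /twist_sg linearP; lmod. Qed.
HB.instance Definition _ p (M : superSpace R) :=
  GRing.isLinear.Build C M M *:%R (@twist_sg p M) (@twist_sg_linear p M).
Lemma twist_sgK p (M : superSpace R) x : @twist_sg p M (twist_sg p x) = x.
Proof. by rewrite /twist_sg linearZ sgK scalerA sgnK scale1r. Qed.
Definition twist p (M : superSpace R) : superSpace R := SuperSpace (@twist_sgK p M).

Definition pair_sg (M N : superSpace R) (x : (M * N)%type) : (M * N)%type := (sg M x.1, sg N x.2).
Lemma pair_sg_linear (M N : superSpace R) : linear (@pair_sg M N).
Proof. by move=> c x y; rewrite /pair_sg !linearP. Qed.
HB.instance Definition _ (M N : superSpace R) :=
  GRing.isLinear.Build C (M * N)%type (M * N)%type *:%R (@pair_sg M N) (@pair_sg_linear M N).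
Lemma pair_sgK (M N : superSpace R) x : @pair_sg M N (pair_sg x) = x.
Proof. by case: x => x y; rewrite /pair_sg /= !sgK. Qed.
Definition pairSS (M N : superSpace R) : superSpace R := SuperSpace (@pair_sgK M N).

Definition opP (M N : lmodType C) (o1 : gen -> int -> M -> M) (o2 : gen -> int -> N -> N) a r
  (x : (M * N)%type) : (M * N)%type := (o1 a r x.1, o2 a r x.2).
Lemma opP_modes (M N : lmodType C) (o1 : gen -> int -> M -> M) (o2 : gen -> int -> N -> N) :
  modes o1 -> modes o2 -> modes (opP o1 o2).
Proof.
move=> h1 h2; split=> [a r c x y|a b r s x]; rewrite /opP /=.
  by rewrite (md_lin h1) (md_lin h2).
by rewrite (md_comm h1) (md_comm h2).
Qed.
(** Together with [twist] this absorbs the signs of a homomorphism of parity p: it becomes an even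
    map commuting with all modes. *)
Definition opT p (M : lmodType C) (o : gen -> int -> M -> M) a r x := sgn (p && gpar a) *: o a r x.
Lemma opT_modes p (M : lmodType C) (o : gen -> int -> M -> M) : modes o -> modes (opT p o).
Proof.
move=> h; case: p; last first.
  suff -> : opT false o = o by [].
  by apply/funext => a; apply/funext => r; apply/funext => x; rewrite /opT sgn0 scale1r.
split=> [a r c x y|a b r s x]; rewrite /opT /=; first by rewrite (md_lin h); lmod.
rewrite !(linZ (md_lin h _ _)) (md_comm h); case: a; case: b => //=; rewrite ?sgn0 ?sgn1 ?mulr0 ?mul0r; lmod.
Qed.
End Pairs.

(** * Homomorphisms as graphs inside direct sums *)

Section Graph.
Variable R : realType.
Local Notation C := (R[i]).
Local Notation sgn := (sgn R).
Variables (V : vosa R) (J : {linear gl11 R -> V}).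
Hypothesis HV : is_V1gl11 J.
Local Notation w := (Wop J).

Section HwMod.
Variables (M : superSpace R) (op : gen -> int -> M -> M).
Hypothesis Hm : modes op.
Hypothesis Hsg : forall g r x, sg M (op g r x) = sgn (gpar g) *: op g r (sg M x).
Variables (g : M) (b : bool).
Hypothesis bg : parity b g.
Hypothesis gs : forall a, exists N : int, forall n, N <= n -> op a n g = 0.
Local Notation P := (mspan op (eq^~ g)).

Lemma hw_subsp : subsp P.
Proof.
split; [exact: mspan0|exact: mspan_lin|move=> x]; elim=> {x} [x ->||c x y _ hx _ hy|a r x _ hx].
- by rewrite bg -[_ *: _]addr0; apply: mspan_lin; [apply: mspan_gen|apply: mspan0].
- by rewrite linear0; apply: mspan0.
- by rewrite linearP; apply: mspan_lin.
- by rewrite Hsg -[_ *: _]addr0; apply: mspan_lin; [apply: mspan_op|apply: mspan0].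
Qed.
Let N := subSuper hw_subsp.
Definition opN a r (x : N) : N := ssmk hw_subsp (mspan_op (op := op) a r (ssT_valP x)).

Lemma opN_modes : modes opN.
Proof.
split=> [a r c x y|a b' r s x]; apply: val_inj; rewrite /=; first exact: (md_lin Hm).
exact: (md_comm Hm).
Qed.

(** Only g has to be smooth: smoothness spreads to everything generated from g, and [smooth_vmod]
    makes this part a module of V. The ambient M may violate truncation. *)
Lemma hw_mod : exists (W : vmod V) (i : {linear W -> M}) (x : W),
  [/\ injective i, forall z, i (sg W z) = sg M (i z), forall a r z, i (w a r z) = op a r (i z),
      i x = g & generates (eq^~ x)].
Proof.
have hs a (x : N) : exists K : int, forall n, K <= n -> opN a n x = 0.
  suff [K hK] : exists K : int, forall n, K <= n -> op a n (val x) = 0.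
    by exists K => n hn; apply: val_inj; apply: hK.
  elim: (ssT_valP x) a => {x} [x ->||c x y _ hx _ hy|a' r x _ hx] a //.
  - by exists 0 => n _; apply: (lin0 (md_lin Hm _ _)).
  - have [K1 h1] := hx a; have [K2 h2] := hy a; exists (`|K1| + `|K2|) => n hn.
    by rewrite (md_lin Hm) h1 ?h2 ?scaler0 ?addr0 //; lia.
  - have [K1 h1] := hx a; have [K2 h2] := hx (tg a a'); exists (`|K1| + `|K2| + `|r| + 1) => n hn.
    have e0 : (n + r == 0) = false by lia.
    rewrite (md_comm Hm) h1 ?h2 ?e0 ?(lin0 (md_lin Hm _ _)); try lia.
    by rewrite !mulr0 !scaler0 scale0r !addr0.
have hsg a r (x : N) : sg N (opN a r x) = sgn (gpar a) *: opN a r (sg N x).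
  by apply: val_inj; rewrite /= Hsg.
have [Y [y1 y2 y3]] := Y_exists HV opN_modes hsg hs.
pose W := smooth_vmod HV hsg y1 y2 y3.
have wE a r (z : W) : w a r z = opN a r z by apply: smooth_vmodE.
pose i : {linear W -> M} := ssval hw_subsp.
have ii : injective i by exact: val_inj.
have gP : P g by apply: mspan_gen.
exists W, i, (ssmk hw_subsp gP); split=> //.
  by move=> a r z; rewrite wE.
move=> U hU Ug z; suff [z' [/ii <-]] : exists z', i z' = i z /\ U z' by [].
have : P (i z) by apply: ssT_valP.
elim=> [y ->||c x y _ [x' [<- ux]] _ [y' [<- uy]]|a r x _ [x' [<- ux]]].
- by exists (ssmk hw_subsp gP); split=> //; apply: Ug.
- by exists 0; rewrite linear0; split=> //; apply: actsub0.
- by exists (c *: x' + y'); rewrite linearP; split=> //; apply: actsubP.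
- by exists (w a r x'); rewrite wE; split=> //; rewrite -wE; apply: (actsub_act hU).
Qed.
End HwMod.

(** The span of (x, g) under the modes projects onto W because x generates W; the assumption that it
    meets the second summand only in 0 makes it the graph of a map. *)
Lemma hw_map (W : vmod V) (x : W) (M : superSpace R) (op : gen -> int -> M -> M) (g : M) b :
  generates (eq^~ x) -> modes op ->
  (forall a r x, sg M (op a r x) = sgn (gpar a) *: op a r (sg M x)) -> parity b x -> parity b g ->
  (forall y, mspan (opP (@w W) op) (eq^~ (x, g)) (0, y) -> y = 0) ->
  exists f : {linear W -> M}, [/\ f x = g, forall a r z, f (w a r z) = op a r (f z) &
    forall z, f (sg W z) = sg M (f z)].
Proof.
move=> gx Hm Hsg bx bg nog; pose G := mspan (opP (@w W) op) (eq^~ (x, g)).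
have HW := Wop_modes HV W.
have tot z : exists y, G (z, y).
  move: z; apply: (gx (fun z => exists y, G (z, y))) => [|_ ->]; last by exists g; apply: mspan_gen.
  apply: (Jclosed_actsub HV) => [|c u v [u' hu] [v' hv]|a r u [u' hu]].
  - by exists 0; apply: mspan0.
  - by exists (c *: u' + v'); apply: (mspan_lin c hu hv).
  - by exists (op a r u'); apply: (mspan_op a r hu).
have fun1 z y y' : G (z, y) -> G (z, y') -> y = y'.
  move=> h h'; apply/eqP; rewrite -subr_eq0; apply/eqP/nog.
  have := mspan_lin (-1) h' h; rewrite !scaleN1r.
  by congr (mspan _ _ (_, _)); rewrite /= ?addNr // addrC.
pose f z := projT1 (cid (tot z)); have fG z : G (z, f z) := projT2 (cid (tot z)).
have lf : linear f by move=> c u v; apply: fun1 (fG _) (mspan_lin c (fG u) (fG v)).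
have sG z y : G (z, y) -> G (sg W z, sg M y).
  move=> h; rewrite -[(_, _)]/(sg (pairSS W M) (z, y)).
  apply: (subsp_sg (hw_subsp (M := pairSS W M) (op := opP (@w W) op) (b := b) _ _) h).
    by move=> a r [u v]; rewrite /= /pair_sg /opP /= (Wop_sg HV) Hsg.
  by rewrite /parity /= /pair_sg /= bx bg.
exists (mklin lf); split.
- by apply: fun1 (fG x) _; apply: mspan_gen.
- by move=> a r z; apply: fun1 (fG _) (mspan_op a r (fG z)).
- by move=> z; apply: fun1 (fG _) (sG _ _ (fG z)).
Qed.

Lemma opT_sg p (W : vmod V) a r (z : W) :
  sg (twist p W) (opT p (@w W) a r z) = sgn (gpar a) *: opT p (@w W) a r (sg (twist p W) z).
Proof.
have lw := md_lin (Wop_modes HV W).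
by rewrite /= /twist_sg /opT linearZ /= (Wop_sg HV) (linZ (lw _ _)); lmod.
Qed.

Lemma FH_pair (M N : lmodType C) (o1 : gen -> int -> M -> M) (o2 : gen -> int -> N -> N) nu e x y :
  FH o1 0 nu e x -> FH o2 0 nu e y -> FH (opP o1 o2) 0 nu e (x, y).
Proof.
case=> m1 p1 n1 z1 e1 [m2 p2 n2 z2 e2]; split=> [r hr|r hr|r hr||].
- by rewrite /opP /= m1 ?m2.
- by rewrite /opP /= p1 ?p2.
- by have [a1 a2] := n1 r hr; have [b1 b2] := n2 r hr; rewrite /opP /= a1 a2 b1 b2.
- by rewrite /opP /= z1 z2.
- by rewrite /opP /= e1 e2.
Qed.
Lemma FH_inj (M N : lmodType C) (o1 : gen -> int -> M -> M) (o2 : gen -> int -> N -> N)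
  (i : {linear M -> N}) nu e x : injective i -> (forall a r z, i (o1 a r z) = o2 a r (i z)) ->
  FH o2 0 nu e (i x) -> FH o1 0 nu e x.
Proof.
move=> ii io [m p n z ee]; split=> [r hr|r hr|r hr||].
- by apply: ii; rewrite io m ?linear0.
- by apply: ii; rewrite io p ?linear0.
- by have [n1 n2] := n r hr; split; apply: ii; rewrite io ?n1 ?n2 linear0.
- by apply: ii; rewrite io z linearZ.
- by apply: ii; rewrite io ee linearZ.
Qed.
Lemma FH_smooth (M : lmodType C) (o : gen -> int -> M -> M) nu e x : modes o -> FH o 0 nu e x ->
  forall a, exists N : int, forall n, N <= n -> o a n x = 0.
Proof.
move=> Hm fx a; exists 1 => n hn; have := FH_pos a (r := n) fx; rewrite /flow mul0r addr0; apply; lia.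
Qed.
Lemma FH_opT p (M : lmodType C) (o : gen -> int -> M -> M) nu e x : FH o 0 nu e x -> FH (opT p o) 0 nu e x.
Proof.
case=> m pp n z ee; split=> [r hr|r hr|r hr||]; rewrite /opT ?andbF ?sgn0 ?scale1r //.
- by rewrite m ?scaler0.
- by rewrite pp ?scaler0.
- exact: n.
Qed.

(** If the span of (x1, x2) met the second summand, it would contain it by simplicity, and with it
    (0, x2). By degree and charge a highest-weight vector with these data is a multiple of (x1, x2),
    and x1 is nonzero. *)
Lemma hw_iso (W1 W2 : vmod V) x1 x2 nu e b1 b2 : irreducible W1 -> irreducible W2 ->
  FH (@w W1) 0 nu e x1 -> FH (@w W2) 0 nu e x2 -> parity b1 x1 -> parity b2 x2 -> x1 <> 0 -> x2 <> 0 ->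
  iso W1 W2.
Proof.
move=> i1 i2 f1 f2 p1 p2 n1 n2; pose p := b1 (+) b2.
have H1 := Wop_modes HV W1; have H2 := Wop_modes HV W2; have HT := opT_modes p H2.
have p2' : parity b1 (x2 : twist p W2).
  by rewrite /parity /= /twist_sg p2 scalerA -sgn_addb /p -addbA addbb addbF.
have HP := opP_modes H1 HT; have fP := FH_pair f1 (FH_opT p f2).
have HPs a r (z : pairSS W1 (twist p W2)) : sg (pairSS W1 (twist p W2)) (opP (@w W1) (opT p (@w W2)) a r z)
    = sgn (gpar a) *: (opP (@w W1) (opT p (@w W2)) a r (sg (pairSS W1 (twist p W2)) z) : pairSS W1 (twist p W2)).
  case: z => u v; rewrite -[LHS]/(sg W1 (w a r u), sg (twist p W2) (opT p (@w W2) a r v)).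
  by rewrite opT_sg (Wop_sg HV).
have pP : parity b1 ((x1, x2) : pairSS W1 (twist p W2)).
  by rewrite /parity -[LHS]/(sg W1 x1, sg (twist p W2) x2) p1 p2'.
have [W [i [x [ii isg iw ix gx]]]] := @hw_mod (pairSS W1 (twist p W2)) (opP (@w W1) (opT p (@w W2))) HP HPs _ b1 pP (FH_smooth HP fP).
have fx : FH (@w W) 0 nu e x by apply: (FH_inj ii iw); rewrite ix.
have wsp z : mspan (opP (@w W1) (opT p (@w W2))) (eq^~ (x1, x2)) z -> exists y, i y = z.
  elim=> [u ->||c u v _ [u' <-] _ [v' <-]|a r u _ [u' <-]].
  - by exists x.
  - by exists 0; rewrite linear0.
  - by exists (c *: u' + v'); rewrite linearP.
  - by exists (w a r u'); rewrite iw.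
have nog y : mspan (opP (@w W1) (opT p (@w W2))) (eq^~ (x1, x2)) (0, y) -> y = 0.
  move=> hy; apply: contrapT => y0.
  pose K (z : W2) := exists t : W, i t = (0, z).
  have aK : actsub K.
    apply: (Jclosed_actsub HV) => [|c u v [u' hu] [v' hv]|a r u [u' hu]].
    - by exists 0; rewrite linear0.
    - by exists (c *: u' + v'); rewrite linearP hu hv -[LHS]/(c *: 0 + 0, c *: u + v) scaler0 addr0.
    - exists (sgn (p && gpar a) *: w a r u'); rewrite linearZ /= iw hu.
      rewrite -[LHS]/(sgn (p && gpar a) *: w a r 0, sgn (p && gpar a) *: (sgn (p && gpar a) *: w a r u)).
      by rewrite (lin0 (md_lin H1 _ _)) scaler0 scalerA sgnK scale1r.
  have sK : submodule K.
    split; try exact: actsub0 aK; try exact: actsubP aK; last exact: actsub_act aK.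
    move=> z [t ht]; exists (sgn p *: sg W t); rewrite linearZ /= isg ht.
    rewrite -[LHS]/(sgn p *: sg W1 0, sgn p *: (sgn p *: sg W2 z)).
    by rewrite linear0 scaler0 scalerA sgnK scale1r.
  case: (i2.2 K sK) => [K0|KT]; first by apply: y0; apply: K0; apply: wsp.
  have [t ht] := KT x2.
  have ft : FH (@w W) 0 nu e t.
    apply: (FH_inj ii iw); rewrite ht; apply: FH_pair (FH_opT p f2).
    by split=> *; rewrite ?(lin0 (md_lin H1 _ _)) ?scaler0.
  have t0 : t <> 0 by move=> t0; move: ht; rewrite t0 linear0 => -[] /esym.
  have [k [ek tk]] := weight_deg HV fx gx (weight_eig (FH_top HV ft)) t0.
  have k0 : k = 0%N by move/eqP: ek; rewrite -subr_eq0 addrAC subrr add0r pnatr_eq0 => /eqP.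
  rewrite k0 in tk; have [c ec] := FHset_span HV fx tk (FH_N0 ft).
  move: ht; rewrite ec linearZ /= ix -[c *: (x1, x2)]/(c *: x1, c *: x2) => -[] /eqP; rewrite scaler_eq0 => /orP[/eqP c0|/eqP //] _.
  by apply: t0; rewrite ec c0 scale0r.
have gx1 := irr_gen i1 p1 n1.
have [f [fx1 fw fs]] := @hw_map W1 x1 (twist p W2) (opT p (@w W2)) x2 b1 gx1 HT (@opT_sg p W2) p1 p2' nog.
have fsg z : sg W2 ((f : {linear W1 -> W2}) z) = sgn p *: f (sg W1 z).
  by rewrite fs /= /twist_sg scalerA sgnK scale1r.
pose F := @Shom R V p W1 W2 f fsg (Jhom_act HV fw).
exists p, F; apply: bij_inj_surj.
  by apply: (@irr_shom_inj _ _ _ _ _ F x1 i1); rewrite /= fx1.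
by apply: (@irr_shom_surj _ _ _ _ _ F x1 i2); rewrite /= fx1.
Qed.

End Graph.

(** * Verma modules *)

Section Words.
Variable R : realType.
Local Notation C := (R[i]).
Local Notation sgn := (sgn R).
Definition word := seq (gen * int).

Section Action.
Variables (W : lmodType C) (op : gen -> int -> W -> W).
Definition wact (u : word) (x : W) : W := foldr (fun a y => op a.1 a.2 y) x u.
Lemma wact_cat u v x : wact (u ++ v) x = wact u (wact v x).
Proof. exact: foldr_cat. Qed.
Lemma wact_lin u : modes op -> linear (wact u).
Proof. by move=> h; elim: u => [|a u IH] c x y //=; rewrite IH (md_lin h). Qed.
End Action.

Definition kk a b (r s : int) : C := r%:~R * kap R a b * (r + s == 0)%:R.

(** The properties of u |-> phi(u g), for g a highest-weight vector and phi a linear form: relations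
    of the affine algebra and highest-weight conditions, written on words in the modes. *)
Record hwform (nu e : C) (f : word -> C) : Prop := Hwform {
  hf_rel : forall u a b r s v, f (u ++ (a, r) :: (b, s) :: v) =
    sgn (gpar a && gpar b) * f (u ++ (b, s) :: (a, r) :: v)
    + cf R a b * f (u ++ (tg a b, r + s) :: v) + kk a b r s * f (u ++ v);
  hf_pos : forall u a (r : int), 0 < r -> f (u ++ [:: (a, r)]) = 0;
  hf_N : forall u, f (u ++ [:: (GN, 0)]) = nu * f u;
  hf_E : forall u, f (u ++ [:: (GE, 0)]) = e * f u;
  hf_P : forall u, f (u ++ [:: (GP, 0)]) = 0 }.

Definition wpar (u : word) : bool := foldr (fun a b => gpar a.1 (+) b) false u.
Lemma wpar_cat u v : wpar (u ++ v) = wpar u (+) wpar v.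
Proof. by elim: u => //= a u ->; rewrite addbA. Qed.

Lemma hwform_lin nu e f g c : hwform nu e f -> hwform nu e g -> hwform nu e (fun u => c * f u + g u).
Proof.
move=> [f1 f2 f3 f4 f5] [g1 g2 g3 g4 g5]; split=> [u a b r s v|u a r r0|u|u|u].
- by rewrite f1 g1; ring.
- by rewrite f2 ?g2 // mulr0 addr0.
- by rewrite f3 g3; ring.
- by rewrite f4 g4; ring.
- by rewrite f5 g5 mulr0 addr0.
Qed.
Lemma hwform_shift nu e f a r : hwform nu e f -> hwform nu e (fun u => f ((a, r) :: u)).
Proof.
case=> f1 f2 f3 f4 f5; split=> [u|u|u|u|u]; [exact: (f1 ((a, r) :: u))|exact: (f2 ((a, r) :: u))|
  exact: (f3 ((a, r) :: u))|exact: (f4 ((a, r) :: u))|exact: (f5 ((a, r) :: u))].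
Qed.
Lemma hwform_sg nu e f : hwform nu e f -> hwform nu e (fun u => sgn (wpar u) * f u).
Proof.
case=> f1 f2 f3 f4 f5; split=> [u a b r s v|u a r r0|u|u|u]; last first.
- by rewrite f5 mulr0.
- by rewrite f4 wpar_cat /= addbF mulrCA.
- by rewrite f3 wpar_cat /= addbF mulrCA.
- by rewrite f2 // mulr0.
rewrite f1 !wpar_cat /= /kk.
have [c0|cn] := eqVneq (cf R a b) 0; have [k0|kn] := eqVneq (kap R a b) 0.
- by rewrite c0 k0; case: (gpar a); case: (gpar b); case: (wpar u); case: (wpar v); rewrite /= ?sgn0 ?sgn1; ring.
- by rewrite c0 (kap_par kn); case: (gpar b); case: (wpar u); case: (wpar v); rewrite /= ?sgn0 ?sgn1; ring.
- by rewrite k0 (tg_par cn); case: (gpar a); case: (gpar b); case: (wpar u); case: (wpar v); rewrite /= ?sgn0 ?sgn1; ring.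
- rewrite (tg_par cn) (kap_par kn); case: (gpar b); case: (wpar u); case: (wpar v); rewrite /= ?sgn0 ?sgn1; ring.
Qed.

Section Universal.
Variables (nu e : C).
Definition hwf := {f : word -> C | hwform nu e f}.
Definition hshift a r (f : hwf) : hwf := exist _ _ (hwform_shift a r (svalP f)).
Definition hsg (f : hwf) : hwf := exist _ _ (hwform_sg (svalP f)).

Definition preV := hwf -> C^o.
Definition preV_sg (F : preV) : preV := fun f => F (hsg f).
Lemma preV_sg_linear : linear preV_sg.
Proof. by move=> c F G; apply/funext => f. Qed.
HB.instance Definition _ := GRing.isLinear.Build C preV preV *:%R preV_sg preV_sg_linear.
Lemma hsgK f : hsg (hsg f) = f.
Proof.
case: f => f hf; apply: eq_sig_hprop => [? ? ?|/=]; first exact: Prop_irrelevance.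
by apply/funext => u; rewrite mulrA sgnK mul1r.
Qed.
Lemma preV_sgK F : preV_sg (preV_sg F) = F.
Proof. by apply/funext => f; rewrite /preV_sg hsgK. Qed.
Definition preSS : superSpace R := SuperSpace preV_sgK.

(** Linearity, expressed through pointwise identities between forms because [hwf] is a bare subtype
    without addition. *)
Definition compat (F : preSS) := forall c (f g h : hwf),
  (forall u, sval h u = c * sval f u + sval g u) -> (F : preV) h = c * (F : preV) f + (F : preV) g.

Lemma compat_subsp : subsp compat.
Proof.
split=> [c f g h _|a F G hF hG c f g h hh|F hF c f g h hh].
- by rewrite /= mulr0 addr0.
- have el k : ((a *: F + G : preSS) : preV) k = a * (F : preV) k + (G : preV) k by [].
  by rewrite !el (hF _ _ _ _ hh) (hG _ _ _ _ hh); ring.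
- by apply: hF => u /=; rewrite hh; ring.
Qed.
(** Linear functions on the forms of [hwform]: the Verma module sits in this bidual as the part
    generated by [vhw], evaluation at the empty word. No quotient of a word algebra has to be
    formed. *)
Definition verma := subSuper compat_subsp.
Definition vv (F : verma) : preV := val F.
Lemma vvP (F : verma) c (f g h : hwf) : (forall u, sval h u = c * sval f u + sval g u) ->
  vv F h = c * vv F f + vv F g.
Proof. exact: (ssT_valP F). Qed.
Lemma vv_ext (F : verma) (f g : hwf) : (forall u, sval f u = sval g u) -> vv F f = vv F g.
Proof. by move=> h; rewrite (vvP F (c := 0) (f := f) (g := g)) ?mul0r ?add0r // => u; rewrite mul0r add0r. Qed.
Lemma vop_subproof a r (F : verma) : compat ((fun f => vv F (hshift a r f)) : preV).
Proof. by move=> c f g h hh; apply: vvP => u /=; apply: hh. Qed.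
Definition vop a r (F : verma) : verma := ssmk compat_subsp (vop_subproof a r F).
Lemma vopE a r F f : vv (vop a r F) f = vv F (hshift a r f). Proof. by []. Qed.
Lemma vv_lin c F G f : vv (c *: F + G) f = c * vv F f + vv G f. Proof. by []. Qed.
Lemma vvZ c F f : vv (c *: F) f = c * vv F f. Proof. by []. Qed.
Lemma vvD F G f : vv (F + G) f = vv F f + vv G f. Proof. by []. Qed.
Lemma vv_sg F f : vv (sg verma F) f = vv F (hsg f). Proof. by []. Qed.
Lemma vv0 f : vv 0 f = 0. Proof. by []. Qed.
Lemma vv_inj F G : (forall f, vv F f = vv G f) -> F = G.
Proof. by move=> h; apply: val_inj; apply/funext. Qed.

Definition hlin c (f g : hwf) : hwf := exist _ _ (hwform_lin c (svalP f) (svalP g)).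
Lemma hlinE c f g u : sval (hlin c f g) u = c * sval f u + sval g u. Proof. by []. Qed.
Lemma vv_eq0 F h : (forall u, sval h u = 0) -> vv F h = 0.
Proof. by move=> h0; rewrite (@vvP F (-1) h h h) => [|u]; rewrite ?h0; ring. Qed.
Lemma vv_hlin F c f g : vv F (hlin c f g) = c * vv F f + vv F g.
Proof. by apply: vvP => u; rewrite hlinE. Qed.
Definition hzero (f : hwf) : hwf := hlin (-1) f f.
Lemma hzeroE f u : sval (hzero f) u = 0. Proof. by rewrite hlinE; ring. Qed.
Lemma vv_scale F c f h : (forall u, sval h u = c * sval f u) -> vv F h = c * vv F f.
Proof.
move=> hh; rewrite (@vvP F c f (hzero f) h) => [|u]; first by rewrite (vv_eq0 F (hzeroE f)) addr0.
by rewrite hh hzeroE addr0.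
Qed.
Lemma vv_comb F c1 f1 c2 f2 c3 f3 h :
  (forall u, sval h u = c1 * sval f1 u + c2 * sval f2 u + c3 * sval f3 u) ->
  vv F h = c1 * vv F f1 + c2 * vv F f2 + c3 * vv F f3.
Proof.
move=> hh; pose g := hlin c3 f3 (hzero f3).
have gE : vv F g = c3 * vv F f3 by apply: vv_scale => u; rewrite hlinE hzeroE addr0.
rewrite (@vvP F c1 f1 (hlin c2 f2 g) h) => [|u]; first by rewrite vv_hlin gE addrA.
have gu : sval g u = c3 * sval f3 u by rewrite hlinE hzeroE addr0.
by rewrite hh hlinE gu addrA.
Qed.

Lemma vop_modes : modes vop.
Proof.
split=> [a r c F G|a b r s F]; apply: vv_inj => f; first by rewrite vopE !vv_lin !vopE.
rewrite !vvD !vvZ !vopE; apply: vv_comb => u.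
exact: (hf_rel (svalP f) [::]).
Qed.

Lemma vop_sg a r F : sg verma (vop a r F) = sgn (gpar a) *: vop a r (sg verma F).
Proof.
apply: vv_inj => f; rewrite vvZ vopE !vv_sg vopE; apply: vv_scale => u.
by rewrite /= sgn_addb mulrA.
Qed.

Lemma vhw_subproof : compat ((fun f : hwf => sval f [::]) : preV).
Proof. by move=> c f g h hh; apply: hh. Qed.
Definition vhw : verma := ssmk compat_subsp vhw_subproof.
Lemma vhwE f : vv vhw f = sval f [::]. Proof. by []. Qed.

Lemma vhw_FH : FH vop 0 nu e vhw.
Proof.
split=> [r hr|r hr|r hr||]; try (split; apply: vv_inj => f); try (apply: vv_inj => f); rewrite ?vv0 ?vvZ vopE vhwE /=.
- by apply: (hf_pos (svalP f) [::]); lia.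
- have [->|r0] := eqVneq r 0; first exact: (hf_P (svalP f) [::]).
  by apply: (hf_pos (svalP f) [::]); lia.
- exact: (hf_pos (svalP f) [::]).
- exact: (hf_pos (svalP f) [::]).
- exact: (hf_N (svalP f) [::]).
- exact: (hf_E (svalP f) [::]).
Qed.

Lemma vhw_par : parity false vhw.
Proof. by apply: vv_inj => f; rewrite vvZ vv_sg !vhwE /= sgn0. Qed.

Lemma form_hwform (M : lmodType C) (op : gen -> int -> M -> M) (g : M) (phi : M -> C) : modes op ->
  FH op 0 nu e g -> {morph phi : u v / u + v} -> (forall c u, phi (c *: u) = c * phi u) ->
  hwform nu e (fun u => phi (wact op u g)).
Proof.
move=> Hm fg pD pZ; have p0 : phi 0 = 0 by rewrite -(scale0r 0) pZ mul0r.
split=> [u a b r s v|u a r r0|u|u|u]; rewrite !wact_cat /=.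
- by rewrite (md_comm Hm) !(linD (wact_lin _ Hm)) !(linZ (wact_lin _ Hm)) !pD !pZ.
- have := FH_pos a fg r0; rewrite /flow mul0r addr0 => ->.
  by rewrite (lin0 (wact_lin _ Hm)) p0.
- by rewrite (FH_N0 fg) (linZ (wact_lin _ Hm)) pZ.
- by rewrite (FH_E0 fg) (linZ (wact_lin _ Hm)) pZ.
- by rewrite (FH_P fg) // (lin0 (wact_lin _ Hm)) p0.
Qed.

(* A relation among the vectors [u vhw] holds in every highest-weight module:
   test it on linear forms. *)
Lemma verma_univ (M : lmodType C) (op : gen -> int -> M -> M) (g : M) : modes op ->
  FH op 0 nu e g -> forall y, mspan (opP vop op) (eq^~ (vhw, g)) (0, y) -> y = 0.
Proof.
move=> Hm fg y hy; apply: lin_ext => phi pD pN pZ p0.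
have key : forall z, mspan (opP vop op) (eq^~ (vhw, g)) z ->
  forall psi (hD : {morph psi : u v / u + v}) (hZ : forall c u, psi (c *: u) = c * psi u),
  vv z.1 (exist _ _ (form_hwform Hm fg hD hZ)) = psi z.2.
  move=> z; elim=> {z} [z ->||c z z' _ IH _ IH'|a r z _ IH] psi hD hZ //.
  - have z0 : psi 0 = 0 by rewrite -(scale0r (0 : M)) hZ mul0r.
    exact: (esym z0).
  - by rewrite -[(c *: z + z').1]/(c *: z.1 + z'.1) -[(c *: z + z').2]/(c *: z.2 + z'.2) vv_lin IH IH' hD hZ.
  have hD' : {morph psi \o op a r : u v / u + v} by move=> u v; rewrite /= (linD (md_lin Hm _ _)) hD.
  have hZ' c u : (psi \o op a r) (c *: u) = c * (psi \o op a r) u.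
    by rewrite /= (linZ (md_lin Hm _ _)) hZ.
  rewrite -[RHS]/((psi \o op a r) z.2) -(IH _ hD' hZ') -[(opP _ op a r z).1]/(vop a r z.1) vopE.
  by apply: vv_ext.
by rewrite -(key _ hy phi pD pZ) vv0.
Qed.
End Universal.
End Words.

(* The coefficient of [g] in [u g], for [g] the highest-weight vector of charge
   [nu] and energy [e], is a polynomial in [e]; it is read off at [e = 1, 2, ...],
   where spectral flows of the vacuum provide the modules. *)
Section Interpolation.
Variable R : realType.
Local Notation C := (R[i]).
Local Notation sgn := (sgn R).
Variables (V : vosa R) (J : {linear gl11 R -> V}).
Hypothesis HV : is_V1gl11 J.
Hypothesis V0 : vac V <> 0.
Variable nu : C.
Local Notation o := (Wop J (W := vself V)).
Let Ho : modes o := Wop_modes HV (vself V).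
Let lo a r : linear (o a r) := md_lin Ho a r.

Fixpoint gn (n : nat) : V := if n is m.+1 then o GM (- m.+1%:Z) (gn m) else vac V.
Definition fam := nat -> V.
(** The shifts of the zero modes that complete the flow by n + 1: with them [gn n] has charge nu and
    energy n + 1. *)
Definition scn (a : gen) (r : int) (n : nat) : C :=
  if r == 0 then match a with GN => nu + n%:R | GE => n.+1%:R | _ => 0 end else 0.
Definition opn a r (x : fam) : fam := fun n => flow o n.+1 a r (x n) + scn a r n *: x n.

Lemma gn_FH n : FH o n.+1 (- n%:R) 0 (gn n).
Proof.
elim: n => [|n IH].
  split=> [r hr|r hr|r hr||]; rewrite ?oppr0 ?scale0r.
  - by apply: vac_create0; lia.
  - by apply: vac_create0; lia.
  - by split; apply: vac_create0; lia.
  - by apply: vac_create0.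
  - by apply: vac_create0.
have := FH_up Ho IH; rewrite -[o GM _ _]/(gn n.+1) -opprD natr1.
by congr (FH _ _ _ _ _); lia.
Qed.

Lemma gn0 n : gn n <> 0.
Proof.
elim: n => [//|n IH] g0; apply: IH; have := FH_upK Ho (gn_FH n).
rewrite -[o GM _ _]/(gn n.+1) g0 (lin0 (lo _ _)) add0r => /esym/eqP.
by rewrite scaler_eq0 -pmulrn (negbTE (natC_neq0 R n)) => /eqP.
Qed.

Lemma opn_modes : modes opn.
Proof.
split=> [a r c x y|a b r s x]; apply/funext => n.
  rewrite /opn -[(c *: x + y) n]/(c *: x n + y n) -[RHS]/(c *: opn a r x n + opn a r y n) /opn.
  rewrite /flow (lo _ _); lmod.
rewrite -[RHS]/(sgn (gpar a && gpar b) *: opn b s (opn a r x) n + cf R a b *: opn (tg a b) (r + s) x n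
  + (r%:~R * kap R a b * (r + s == 0)%:R) *: x n) /opn.
have lf a' r' : linear (flow o n.+1 a' r') := lo a' _.
rewrite !(linD (lf _ _)) !(linZ (lf _ _)) (flow_rel Ho) /flow_k.
have e0 : (r + n.+1%:Z * gch a + (s + n.+1%:Z * gch b) == 0) = (r + s + n.+1%:Z * (gch a + gch b) == 0).
  by rewrite mulrDr addrACA.
have -> : (r + n.+1%:Z * gch a)%:~R * kap R a b * (r + n.+1%:Z * gch a + (s + n.+1%:Z * gch b) == 0)%:R
   = cf R a b * scn (tg a b) (r + s) n + r%:~R * kap R a b * (r + s == 0)%:R :> C.
  rewrite e0 /scn {e0}; case: a; case: b => /=;
  rewrite ?(mulr0, mul0r, addr0, add0r, mulr1, mulrN1, subrr, addNr, if_same) //; case: (r + s == 0) => /=;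
  rewrite ?intrD ?intrN -?pmulrn; ring.
have [->|[-> ->]] : sgn (gpar a && gpar b) = 1 \/ (scn a r n = 0 /\ scn b s n = 0).
- by rewrite /scn; case: (a); case: (b); rewrite /= ?sgn0 ?sgn1; do ?[by left]; right; rewrite !if_same.
- lmod.
- lmod.
Qed.

Definition evp (P : {poly C}) (n : nat) : C := P.[n.+1%:R].
(** The top space of the family: multiples of the highest-weight vectors, or of their images under
    psi^-_0, with coefficients polynomial in the energy. *)
Definition T0n (x : fam) := exists P : {poly C}, x = (fun n => evp P n *: gn n) \/ x = (fun n => evp P n *: gn n.+1).

Lemma opn_pos x a (r : int) : T0n x -> 0 < r -> opn a r x = 0.
Proof.
move=> [P hx] r0; apply/funext => n; have r1 : (r == 0) = false by lia.
rewrite /opn /scn r1 scale0r addr0; case: hx => ->; rewrite /flow (linZ (lo _ _)).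
  by have := FHset_pos Ho (gn_FH n) a (r := r) (or_introl erefl) r0; rewrite /flow => ->; rewrite scaler0.
by have := FHset_pos Ho (gn_FH n) a (r := r) (or_intror erefl) r0; rewrite /flow => ->; rewrite scaler0.
Qed.

Lemma opn_zero x a : T0n x -> T0n (opn a 0 x).
Proof.
have fP (P : {poly C}) (c : C) n : evp (c *: P) n = c * evp P n by rewrite /evp hornerZ.
have fX (P : {poly C}) n : evp ('X * P) n = n.+1%:R * evp P n by rewrite /evp hornerM hornerX.
have f0 n : evp 0 n = 0 by rewrite /evp horner0.
have N0 n := FH_N0 (gn_FH n); have E0 n := FH_E0 (gn_FH n).
have oN (y : fam) n : opn GN 0 y n = o GN 0 (y n) + (nu + n%:R) *: y n by rewrite /opn /flow mulr0 addr0.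
have oE (y : fam) n : opn GE 0 y n = o GE 0 (y n) + n.+1%:R *: y n by rewrite /opn /flow mulr0 addr0.
have oP (y : fam) n : opn GP 0 y n = o GP n.+1 (y n) by rewrite /opn /flow mulr1 add0r scale0r addr0.
have oM (y : fam) n : opn GM 0 y n = o GM (- n.+1%:Z) (y n) by rewrite /opn /flow mulrN1 add0r scale0r addr0.
have gS n : o GM (- n.+1%:Z) (gn n) = gn n.+1 by [].
move=> [P [->|->]]; case: a.
- exists (nu *: P); left; apply/funext => n; rewrite oN (linZ (lo _ _)) N0 fP; lmod.
- exists ('X * P); left; apply/funext => n; rewrite oE (linZ (lo _ _)) E0 fX; lmod.
- exists 0; left; apply/funext => n; rewrite oP (linZ (lo _ _)) (FH_P (gn_FH n)) // f0; lmod.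
- exists P; right; apply/funext => n; rewrite oM (linZ (lo _ _)); lmod.
- exists ((nu - 1) *: P); right; apply/funext => n; rewrite oN (linZ (lo _ _)) N0 fP -natr1; lmod.
- exists ('X * P); right; apply/funext => n; rewrite oE (linZ (lo _ _)) E0 fX; lmod.
- exists ('X * P); left; apply/funext => n; rewrite oP (linZ (lo _ _)) -gS (FH_upK Ho (gn_FH n)) fX -pmulrn; lmod.
- exists 0; left; apply/funext => n; rewrite oM (linZ (lo _ _)) (FH_M (gn_FH n.+1)) ?f0; [lmod|lia].
Qed.

Definition gfam : fam := fun n => gn n.
Definition wdeg (u : word) : int := foldr (fun a d => a.2 + d) 0 u.
Lemma wdeg_cat u v : wdeg (u ++ v) = wdeg u + wdeg v.
Proof. by elim: u => [|a u IH]; rewrite ?add0r //= IH addrA. Qed.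

Lemma gfam_T0 : T0n gfam.
Proof. by exists 1; left; apply/funext => n; rewrite /evp hornerC scale1r. Qed.

Lemma word_TT u : TTz opn T0n (- wdeg u) (wact opn u gfam).
Proof.
elim: u => [|a u IH]; first by rewrite oppr0; apply: TT_base; apply: gfam_T0.
have kf0 a' b r s : r + s <> 0 -> r%:~R * kap R a' b * (r + s == 0)%:R = 0 :> C.
  by move=> /eqP/negbTE ->; rewrite mulr0.
have rl a' b r s x : opn a' r (opn b s x) = sgn (gpar a' && gpar b) *: opn b s (opn a' r x)
   + cf R a' b *: opn (tg a' b) (r + s) x + (r%:~R * kap R a' b * (r + s == 0)%:R) *: x := md_comm opn_modes a' b r s x.
rewrite /= opprD addrC; move: IH; case: (- wdeg u) => k /= IH.
  exact: (TT_mode (md_lin opn_modes) rl kf0 (fun x a r => @opn_pos x a r) (fun x a h => TT_base _ (opn_zero a h)) IH).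
by rewrite IH (lin0 (md_lin opn_modes _ _)); apply: TTz0.
Qed.

(** The charge separates [gn n] from [gn n.+1], so that P vanishes at all positive integers. *)
Lemma rep_zero (P Q : {poly C}) : (forall n, evp P n *: gn n + evp Q n *: gn n.+1 = 0) -> P = 0.
Proof.
move=> h; have Pn n : root P n.+1%:R.
  have e1 : o GN 0 (evp P n *: gn n + evp Q n *: gn n.+1) + n.+1%:R *: (evp P n *: gn n + evp Q n *: gn n.+1) = evp P n *: gn n.
    rewrite (linD (lo _ _)) !(linZ (lo _ _)) (FH_N0 (gn_FH n)) (FH_N0 (gn_FH n.+1)) -natr1; lmod.
  move: e1; rewrite h (lin0 (lo _ _)) scaler0 addr0 => /esym/eqP; rewrite scaler_eq0 => /orP[//|/eqP].
  by move/(@gn0 n).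
apply/eqP; apply: contraT => P0.
have := @max_poly_roots C P [seq n.+1%:R | n <- iota 0 (size P)] P0; rewrite size_map size_iota ltnn.
move=> h'; suff : false by []; apply: h'; first by apply/allP => x /mapP[n _ ->].
by rewrite map_inj_uniq ?iota_uniq // => i j /eqP; rewrite eqr_nat => /eqP [].
Qed.

Definition rep (x : fam) (P : {poly C}) := exists Q : {poly C}, forall n, x n = evp P n *: gn n + evp Q n *: gn n.+1.

Lemma rep_lin x y P Q c : rep x P -> rep y Q -> rep (c *: x + y) (c *: P + Q).
Proof.
move=> [P' hP] [Q' hQ]; exists (c *: P' + Q') => n.
by rewrite -[LHS]/(c *: x n + y n) hP hQ /evp !hornerD !hornerZ; lmod.
Qed.
Lemma rep0 : rep 0 0. Proof. by exists 0 => n; rewrite /evp !horner0 !scale0r addr0. Qed.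
Lemma rep_uniq x P Q : rep x P -> rep x Q -> P = Q.
Proof.
move=> hP hQ; apply/eqP; rewrite -subr_eq0 addrC -scaleN1r; apply/eqP.
have [Z hZ] := rep_lin (-1) hQ hP; apply: (@rep_zero _ Z) => n; rewrite -hZ.
by rewrite -[LHS]/(-1 *: x n + x n) scaleN1r addNr.
Qed.

Lemma rep_ex u : exists P, wdeg u = 0 -> rep (wact opn u gfam) P.
Proof.
have [u0|nu0] := eqVneq (wdeg u) 0; last by exists 0 => /eqP; rewrite (negbTE nu0).
have := word_TT u; rewrite u0 oppr0 => /(TT0_span) hs.
suff [P hP] : exists P, rep (wact opn u gfam) P by exists P.
elim: hs => [x [P [->|->]]||c x y _ [P hP] _ [Q hQ]].
- by exists P, 0 => n; rewrite /evp horner0 scale0r addr0.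
- by exists 0, P => n; rewrite /evp horner0 scale0r add0r.
- by exists 0; apply: rep0.
- by exists (c *: P + Q); apply: rep_lin.
Qed.
Definition repP u : {poly C} := projT1 (cid (rep_ex u)).
Lemma repPP u : wdeg u = 0 -> rep (wact opn u gfam) (repP u).
Proof. exact: (projT2 (cid (rep_ex u))). Qed.

Variable e : C.
Definition ell (u : word) : C := if wdeg u == 0 then (repP u).[e] else 0.

Lemma ell_rep u P : wdeg u = 0 -> rep (wact opn u gfam) P -> ell u = P.[e].
Proof. by move=> u0 hP; rewrite /ell u0 eqxx (rep_uniq (repPP u0) hP). Qed.

Lemma crep c u : (c <> 0 -> wdeg u = 0) -> exists P, rep (c *: wact opn u gfam) P /\ c * ell u = P.[e].
Proof.
have [->|c0] := eqVneq c 0; first by exists 0; rewrite mul0r horner0 scale0r; split=> //; apply: rep0.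
move=> h; have u0 := h (elimN eqP c0); exists (c *: repP u + 0).
rewrite -[c *: wact _ _ _]addr0; split; first by apply: rep_lin (repPP u0) rep0.
by rewrite addr0 hornerZ (ell_rep u0 (repPP u0)).
Qed.

Lemma ell_comb u1 u2 u3 u4 s c k : wact opn u1 gfam = s *: wact opn u2 gfam + c *: wact opn u3 gfam + k *: wact opn u4 gfam ->
  wdeg u2 = wdeg u1 -> (c <> 0 -> wdeg u3 = wdeg u1) -> (k <> 0 -> wdeg u4 = wdeg u1) ->
  ell u1 = s * ell u2 + c * ell u3 + k * ell u4.
Proof.
move=> h d2 d3 d4; have [u10|n] := eqVneq (wdeg u1) 0; last first.
  rewrite /ell d2 (negbTE n) mulr0 add0r.
  have [->|/eqP c0] := eqVneq c 0; have [->|/eqP k0] := eqVneq k 0; rewrite ?mul0r ?addr0 ?add0r //.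
  - by rewrite d4 // (negbTE n) mulr0.
  - by rewrite d3 // (negbTE n) mulr0.
  - by rewrite d4 // d3 // (negbTE n) !mulr0 addr0.
have [P2 [r2 e2]] := @crep s u2 ltac:(by rewrite d2).
have [P3 [r3 e3]] := @crep c u3 ltac:(by move=> /d3 ->).
have [P4 [r4 e4]] := @crep k u4 ltac:(by move=> /d4 ->).
have r : rep (wact opn u1 gfam) (P2 + P3 + P4).
  rewrite h -[_ + _ *: wact opn u3 _]scale1r -[P2 + P3]scale1r; apply: rep_lin r4.
  by rewrite -[s *: _]scale1r -[P2]scale1r; apply: rep_lin.
by rewrite (ell_rep u10 r) !hornerD e2 e3 e4.
Qed.

Lemma wact_pt u (c : nat -> C) (x : fam) n : wact opn u (fun n => c n *: x n) n = c n *: wact opn u x n.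
Proof.
elim: u => [//|a u IH]; rewrite /= /opn IH /flow (linZ (lo _ _)); lmod.
Qed.

Lemma ell_hwform : hwform nu e ell.
Proof.
have wl u := wact_lin u opn_modes.
have ext x (y : fam) : (forall n, x n = y n) -> x = y by move=> h; apply/funext.
have z1 u v : wact opn u gfam = 0 -> ell (u ++ v) = 0 -> True by [].
have ell0 u : wact opn u gfam = 0 -> ell u = 0.
  move=> h; have [u0|n] := eqVneq (wdeg u) 0; last by rewrite /ell (negbTE n).
  by rewrite (@ell_rep u 0) ?horner0 // h; apply: rep0.
have g0 (a : gen) (r : int) : 0 < r -> opn a r gfam = 0 by apply: opn_pos; apply: gfam_T0.
split=> [u a b r s v|u a r r0|u|u|u].
- apply: ell_comb.
  + rewrite !wact_cat -!(linZ (wl u)) -!(linD (wl u)); congr (wact _ _ _).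
    exact: (md_comm opn_modes a b r s (wact opn v gfam)).
  + by rewrite !wdeg_cat /= [s + _]addrCA.
  + by move=> _; rewrite !wdeg_cat /=; congr (_ + _); rewrite addrA.
  + by rewrite !wdeg_cat /kk /=; case: eqP => [rs|_]; rewrite ?mulr0 //; rewrite [r + _]addrA rs add0r.
- by apply: ell0; rewrite wact_cat /= g0 // (lin0 (wl u)).
- have := @ell_comb (u ++ [:: (GN, 0)]) u u u nu 0 0; rewrite !mul0r !addr0; apply=> //; last first.
    by rewrite wdeg_cat /= !addr0.
  rewrite !scale0r !addr0 wact_cat -(linZ (wl u)) /=; congr (wact _ _ _); apply: ext => n.
  rewrite /opn /flow mulr0 addr0 (FH_N0 (gn_FH n)) -[(nu *: gfam) n]/(nu *: gn n) /scn eqxx /gfam; lmod.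
- have [u0|n] := eqVneq (wdeg u) 0; last by rewrite /ell wdeg_cat /= !addr0 (negbTE n) mulr0.
  have [Q hQ] := repPP u0.
  rewrite (@ell_rep (u ++ [:: (GE, 0)]) ('X * repP u)) ?wdeg_cat /= ?addr0 //.
    by rewrite hornerM hornerX (ell_rep u0 (repPP u0)).
  exists ('X * Q) => n; rewrite wact_cat /=.
  rewrite [X in wact _ _ X](ext _ (fun n => n.+1%:R *: gfam n)) => [|m]; last first.
    by rewrite /opn /flow mulr0 addr0 (FH_E0 (gn_FH m)) /scn eqxx scale0r add0r.
  by rewrite wact_pt hQ /evp !hornerM !hornerX; lmod.
- apply: ell0; rewrite wact_cat /= (_ : opn GP 0 gfam = 0) ?(lin0 (wl u)) //; apply: ext => n.
  by rewrite /opn /flow mulr1 add0r (FH_P (gn_FH n)) // scale0r addr0.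
Qed.

Lemma ell1 : ell [::] = 1.
Proof.
rewrite (@ell_rep [::] 1) // ?hornerC //.
by exists 0 => n; rewrite /evp hornerC horner0 scale1r scale0r addr0.
Qed.

Lemma vhw_neq0 : vhw nu e <> 0.
Proof.
move=> h; have := vhwE (exist _ _ ell_hwform : hwf nu e); rewrite h vv0 /= ell1 => /esym/eqP.
by rewrite oner_eq0.
Qed.
End Interpolation.

(** * The listed modules *)

Section Listed.
Variable R : realType.
Local Notation C := (R[i]).
Local Notation sgn := (sgn R).
Variables (V : vosa R) (J : {linear gl11 R -> V}).
Hypothesis HV : is_V1gl11 J.
Hypothesis V0 : vac V <> 0.
Local Notation w := (Wop J).

Definition v1 : 'rV[C]_2 := row2 1 0.
Lemma row2E (a b : C) : (row2 a b 0 0 = a) * (row2 a b 0 1 = b).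
Proof. by rewrite !mxE. Qed.
Lemma row2_ext (x y : 'rV[C]_2) : x 0 0 = y 0 0 -> x 0 1 = y 0 1 -> x = y.
Proof.
move=> h0 h1; apply/rowP => -[[|[|j]] hj] //.
- by have -> : Ordinal hj = 0 by apply: val_inj.
- by have -> : Ordinal hj = 1 by apply: val_inj.
Qed.

Section Top.
Variables (M : superSpace R).

Lemma glV_FH n e p (rho : gl11 R -> int -> M -> M) (u : {linear glV n e p -> M}) :
  extends_action rho u ->
  [/\ FH (fun g => rho (glv R g)) 0 (n + 2^-1) e (u v1), parity p (u v1) &
   forall x : 'rV[C]_2, u x = x 0 0 *: u v1 + x 0 1 *: rho (glv R GM) 0 (u v1)].
Proof.
move=> [us uz up].
have zero g y : lact (glv R g) (v1 : glV n e p) = y -> rho (glv R g) 0 (u v1) = u y by move=> <-; rewrite uz.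
have eM : rho (glv R GM) 0 (u v1) = u (row2 0 1).
  by apply: zero; apply: row2_ext; rewrite /= /glv /glm !row2E !row4E; ring.
split.
- split=> [r hr|r hr|r hr||].
  + by apply: up; lia.
  + have [->|r0] := eqVneq r 0; last by apply: up; lia.
    by rewrite (zero GP 0) ?linear0 //; apply: row2_ext; rewrite /= /glv /glp !row2E !row4E !mxE; ring.
  + by split; apply: up.
  + by rewrite (zero GN ((n + 2^-1) *: v1)) ?linearZ //; apply: row2_ext; rewrite /= /glv /glN [in RHS]mxE !row2E !row4E; ring.
  + by rewrite (zero GE (e *: v1)) ?linearZ //; apply: row2_ext; rewrite /= /glv /glE [in RHS]mxE !row2E !row4E; ring.
- rewrite /parity -us -linearZ; congr (u _); apply: row2_ext; rewrite /= mul_mx_diag !mxE /= ?addbF; ring.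
- move=> x; rewrite eM -!linearZ -linearD; congr (u _); apply: row2_ext; rewrite [in RHS]mxE [in RHS]mxE [X in _ = _ + X]mxE !row2E; ring.
Qed.

Variable op : gen -> int -> M -> M.
Hypothesis Hm : modes op.
Hypothesis Hsg : forall a r x, sg M (op a r x) = sgn (gpar a) *: op a r (sg M x).

Lemma opsum0 (a : gl11 R) r x : (forall g, op g r x = 0) -> opsum op a r x = 0.
Proof. by move=> h; rewrite /opsum big1 // => g _; rewrite h scaler0. Qed.

Lemma glV_ext n e p (g : M) : FH op 0 (n + 2^-1) e g -> parity p g ->
  exists u : {linear glV n e p -> M}, extends_action (opsum op) u /\ u v1 = g.
Proof.
move=> fg pg; have lo a r := md_lin Hm a r.
have lu : linear (fun x : 'rV[C]_2 => x 0 0 *: g + x 0 1 *: op GM 0 g).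
  by move=> c x y; rewrite !mxE; lmod.
have PM : op GP 0 (op GM 0 g) = e *: g.
  by have := FH_upK Hm fg; rewrite oppr0 addr0.
exists (mklin lu); split; last by rewrite /= !row2E scale1r scale0r addr0.
have g0 a (r : int) : 0 < r -> op a r g = 0.
  by move=> r0; have := FH_pos a fg r0; rewrite /flow mul0r addr0.
have gM a (r : int) : 0 < r -> op a r (op GM 0 g) = 0.
  move=> r0; have := FHset_pos Hm fg a (r := r) (or_intror erefl) r0; rewrite /flow mul0r addr0 oppr0; exact.
split=> [x|a x|a r x r0] /=.
- rewrite linearD !linearZ /= Hsg pg (linZ (lo _ _)) mul_mx_diag !mxE /= addbF sgn1.
  by rewrite !scalerA addbT; congr (_ *: _ + _ *: _); case: (p); rewrite /= ?sgn0 ?sgn1; ring.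
- rewrite !row2E (linD (aff_linr (modes_affine Hm Hsg) _ _)) !(linZ (aff_linr (modes_affine Hm Hsg) _ _)).
  rewrite /opsum !big_cons !big_nil (FH_N0 fg) (FH_E0 fg) (FH_P fg) // PM.
  rewrite (N0_op Hm GM) (E0_op Hm GM) (FH_N0 fg) (FH_E0 fg) !(linZ (lo _ _)) /= mulrN1z.
  have -> : op GM 0 (op GM 0 g) = 0 by apply: sq0; rewrite {1}(mMM Hm).
  rewrite /cg; apply: lin_ext => phi pD pN pZ p0; rewrite !(pD, pN, pZ, p0); field; rewrite ?pnatr_eq0 //.
- by rewrite (linD (aff_linr (modes_affine Hm Hsg) _ _)) !(linZ (aff_linr (modes_affine Hm Hsg) _ _)) !opsum0
    ?scaler0 ?addr0 // => b; [apply: gM|apply: g0].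
Qed.

Lemma glA_ext n p (g : M) : FH op 0 n 0 g -> op GM 0 g = 0 -> parity p g ->
  exists u : {linear glA n p -> M}, extends_action (opsum op) u /\ u (1 : C^o) = g.
Proof.
move=> fg mg pg; have ll := aff_linr (modes_affine Hm Hsg).
have lu : linear (fun z : C^o => (z : C) *: g).
  by move=> c y z; rewrite -[c *: y]/(c * y : C) scalerDl scalerA.
exists (mklin lu); split; last by rewrite /= scale1r.
have g0 a (r : int) : 0 < r -> op a r g = 0.
  by move=> r0; have := FH_pos a fg r0; rewrite /flow mul0r addr0.
split=> [x|a x|a r x r0] /=.
- by rewrite linearZ /= pg scalerA mulrC.
- rewrite (linZ (ll _ _)) /opsum !big_cons !big_nil (FH_N0 fg) (FH_E0 fg) (FH_P fg) // mg /cg.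
  by rewrite scale0r !scaler0 !addr0 !scalerA; congr (_ *: _); rewrite -[X in X = _]/((a : 'rV[C]_4) 0 0 * n * x); ring.
- by rewrite (linZ (ll _ _)) opsum0 ?scaler0 // => b; apply: g0.
Qed.
End Top.

Lemma glA_FH (M : superSpace R) n p (rho : gl11 R -> int -> M -> M) (u : {linear glA n p -> M}) :
  extends_action rho u -> let s := u (1 : C^o) in
  [/\ FH (fun g => rho (glv R g)) 0 n 0 s, rho (glv R GM) 0 s = 0, parity p s & forall x : C^o, u x = (x : C) *: s].
Proof.
move=> [us uz up] s.
have zero g : rho (glv R g) 0 s = ((glv R g : 'rV[C]_4) 0 0 * n) *: s.
  by rewrite /s -uz /= linearZ.
have ux (x : C^o) : u x = (x : C) *: s by rewrite /s -linearZ; congr (u _); rewrite -[RHS]/(x * 1 : C) mulr1.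
split=> //.
- split=> [r hr|r hr|r hr||].
  + by apply: up; lia.
  + have [->|r0] := eqVneq r 0; last by apply: up; lia.
    by rewrite zero /glv /glp row4E mul0r scale0r.
  + by split; apply: up.
  + by rewrite zero /glv /glN row4E mul1r.
  + by rewrite zero /glv /glE row4E mul0r.
- by rewrite zero /glv /glm row4E mul0r scale0r.
- by rewrite /parity /s -us -[sg (glA n p) _]/(sgn p *: (1 : C^o)) linearZ.
Qed.

Lemma rho_op (M : superSpace R) (rho : gl11 R -> int -> M -> M) : affine_module 1 rho ->
  rho = opsum (fun g => rho (glv R g)).
Proof. by move=> h; apply/funext => a; apply/funext => r; apply/funext => x; apply: affine_opsum. Qed.

Lemma aff_op_sg (M : superSpace R) (rho : gl11 R -> int -> M -> M) : affine_module 1 rho ->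
  forall a r x, sg M (rho (glv R a) r x) = sgn (gpar a) *: rho (glv R a) r (sg M x).
Proof. by move=> h a r x; rewrite (aff_sg h) glv_parity (linZ (aff_linl h _ _)). Qed.

(** Graph form of the universality of x among highest-weight vectors g with the same data. The
    implication about psi^-_0 makes it fit both Verma modules, where psi^-_0 x is nonzero, and
    modules induced from A_n, where psi^-_0 kills both vectors. *)
Definition no_graph (W : vmod V) (x : W) nu e b := forall (M : superSpace R) (op : gen -> int -> M -> M) (g : M),
  modes op -> (forall a r x, sg M (op a r x) = sgn (gpar a) *: op a r (sg M x)) ->
  FH op 0 nu e g -> (w GM 0 x = 0 -> op GM 0 g = 0) -> parity b g ->
  forall y, mspan (opP (@w W) op) (eq^~ (x, g)) (0, y) -> y = 0.

Section Build.
Variables (W : vmod V) (x : W) (nu e : C) (b : bool).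
Hypotheses (gx : generates (eq^~ x)) (fx : FH (@w W) 0 nu e x) (bx : parity b x).

Lemma uniq_hom (M : superSpace R) (rho : gl11 R -> int -> M -> M) (f f' : {linear W -> M}) :
  affine_module 1 rho ->
  (forall a r z, f (w a r z) = rho (glv R a) r (f z)) ->
  (forall a r z, f' (act (v0 := W) (J a) r z) = rho a r (f' z)) -> f x = f' x -> forall z, f' z = f z.
Proof.
move=> ha hf hf' e0; apply: gx => [|_ ->] //; apply: (Jclosed_actsub HV) => [|c u v hu hv|a r u hu].
- by rewrite !linear0.
- by rewrite !linearP hu hv.
- by rewrite hf -[w a r u]/(act (v0 := W) (J (glv R a)) r u) hf' hu.
Qed.

Lemma hom_rho (M : superSpace R) (rho : gl11 R -> int -> M -> M) (f : {linear W -> M}) : affine_module 1 rho ->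
  (forall a r z, f (w a r z) = rho (glv R a) r (f z)) -> forall a r z, f (act (v0 := W) (J a) r z) = rho a r (f z).
Proof.
move=> ha hf a r z; rewrite (affine_opsum (W_aff HV W)) (affine_opsum ha) /opsum linear_sum.
by apply: eq_bigr => g _; rewrite linearZ /=; congr (_ *: _); apply: hf.
Qed.

Lemma Vhat_build : no_graph x nu e b -> w GM 0 x <> 0 -> is_Vhat J (nu - 2^-1) e W.
Proof.
move=> ng m0; exists b; have fx' : FH (@w W) 0 (nu - 2^-1 + 2^-1) e x by rewrite subrK.
have [u [ue u1]] := glV_ext (Wop_modes HV W) (Wop_sg HV (W := W)) fx' bx.
have eW : opsum (@w W) = (fun a r => act (v0 := W) (J a) r) by rewrite [RHS](rho_op (W_aff HV W)).
rewrite eW in ue; exists u; split=> // [|M rho u' ha ext]; first exact: W_aff.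
have [fg pg ug] := glV_FH ext; rewrite subrK in fg.
have [_ _ uW] := glV_FH ue.
have [|f [f1 f2 f3]] := hw_map HV gx (affine_modes ha) (aff_op_sg ha) bx pg.
  by apply: (ng _ _ _ (affine_modes ha) (aff_op_sg ha) fg _ pg).
exists f; split=> // [|z|f' s' r' e']; first exact: hom_rho.
- rewrite uW ug u1 linearD !linearZ /= f1; congr (_ + _ *: _).
  by rewrite -f1; exact: (f2 GM 0 x).
- by apply: (uniq_hom ha f2 r'); rewrite f1 -e' u1.
Qed.

Lemma Ahat0_build : no_graph x nu e b -> e = 0 -> w GM 0 x = 0 -> is_Ahat J nu 0 W.
Proof.
move=> ng e0 m0; rewrite /is_Ahat eqxx; exists b; have fx0 := fx; rewrite e0 in fx0.
have [u [ue u1]] := glA_ext (Wop_modes HV W) (Wop_sg HV (W := W)) fx0 m0 bx.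
have eW : opsum (@w W) = (fun a r => act (v0 := W) (J a) r) by rewrite [RHS](rho_op (W_aff HV W)).
rewrite eW in ue; exists u; split=> // [|M rho u' ha ext]; first exact: W_aff.
have [fg mg pg ug] := glA_FH ext.
have [_ _ _ uW] := glA_FH ue.
have [|f [f1 f2 f3]] := hw_map HV gx (affine_modes ha) (aff_op_sg ha) bx pg.
  by apply: (ng _ _ _ (affine_modes ha) (aff_op_sg ha)) => //; rewrite e0.
exists f; split=> // [|z|f' s' r' e']; first exact: hom_rho.
- by rewrite uW ug u1 linearZ /= f1.
- by apply: (uniq_hom ha f2 r'); rewrite f1 -e' u1.
Qed.
End Build.

(** The module generated by (x, g) is a highest-weight module with the same data, hence simple by
    [verma_irr] or [atypical_irr]. The kernel of its projection to W misses the generator, so it is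
    zero. *)
Lemma no_graph_irr (W : vmod V) (x : W) nu e b : FH (@w W) 0 nu e x -> parity b x -> x <> 0 ->
  (forall z : int, e <> z%:~R) \/ (e = 0 /\ w GM 0 x = 0) -> no_graph x nu e b.
Proof.
move=> fx bx x0 he M op g Hm Hsg fg mg pg y hy; have HW := Wop_modes HV W.
have HP := opP_modes HW Hm; have fP := FH_pair fx fg.
have HPs a r (z : pairSS W M) : sg (pairSS W M) (opP (@w W) op a r z)
    = sgn (gpar a) *: (opP (@w W) op a r (sg (pairSS W M) z) : pairSS W M).
  by case: z => u v; rewrite -[LHS]/(sg W (w a r u), sg M (op a r v)) Hsg (Wop_sg HV).
have pP : parity b ((x, g) : pairSS W M) by rewrite /parity -[LHS]/(sg W x, sg M g) bx pg.
have [U [i [z0 [ii isg iw iz gz]]]] := @hw_mod _ _ _ HV (pairSS W M) (opP (@w W) op) HP HPs _ b pP (FH_smooth HP fP).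
have fz : FH (@w U) 0 nu e z0 by apply: (FH_inj ii iw); rewrite iz.
have z00 : z0 <> 0 by move=> z00; move: iz; rewrite z00 linear0 => -[] /esym.
have pz : parity b z0 by apply: ii; rewrite isg iz linearZ /= iz; apply: pP.
have irrU : irreducible U.
  case: he => [he|[e0 m0]]; first exact: (verma_irr HV he fz pz z00 gz).
  rewrite e0 in fz; apply: (atypical_irr HV fz _ pz z00 gz).
  by apply: ii; rewrite iw iz linear0 /opP /= m0 mg.
have wsp z : mspan (opP (@w W) op) (eq^~ (x, g)) z -> exists y, i y = z.
  elim=> [u ->||c u v _ [u' <-] _ [v' <-]|a r u _ [u' <-]].
  - by exists z0.
  - by exists 0; rewrite linear0.
  - by exists (c *: u' + v'); rewrite linearP.
  - by exists (w a r u'); rewrite iw.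
pose K (z : U) := (i z).1 = 0.
have aK : actsub K.
  apply: (Jclosed_actsub HV) => [|c u v hu hv|a r u hu]; rewrite /K.
  - by rewrite linear0.
  - by rewrite linearP -[LHS]/(c *: (i u).1 + (i v).1) hu hv scaler0 addr0.
  - by rewrite iw -[LHS]/(w a r (i u).1) hu (lin0 (md_lin HW _ _)).
have sK : submodule K.
  split; try exact: actsub0 aK; try exact: actsubP aK; last exact: actsub_act aK.
  by move=> z hz; rewrite /K isg -[LHS]/(sg W (i z).1) hz linear0.
have [t ht] := wsp _ hy.
case: (irrU.2 K sK) => [K0|KT].
  by have t0 : t = 0 by [apply: K0; rewrite /K ht]; move: ht; rewrite t0 linear0 => -[].
by have := KT z0; rewrite /K iz.
Qed.

Lemma verma_vmod nu e : exists (W : vmod V) (x : W),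
  [/\ FH (@w W) 0 nu e x, parity false x, generates (eq^~ x), x <> 0 & no_graph x nu e false].
Proof.
have fv := vhw_FH nu e.
have [W [i [x [ii isg iw ix gx]]]] := @hw_mod _ _ _ HV (verma nu e) (@vop _ nu e) (vop_modes nu e) (@vop_sg _ nu e)
  _ false (vhw_par nu e) (FH_smooth (vop_modes nu e) fv).
exists W, x; split=> //.
- by apply: (FH_inj ii iw); rewrite ix.
- by apply: ii; rewrite isg ix linearZ /= ix; apply: vhw_par.
- by move=> x0; apply: (vhw_neq0 HV V0 (nu := nu) (e := e)); rewrite -ix x0 linear0.
move=> M op g Hm Hsg fg _ pg y hy; apply: (verma_univ Hm fg).
suff key z : mspan (opP (@w W) op) (eq^~ (x, g)) z -> mspan (opP (@vop _ nu e) op) (eq^~ (vhw nu e, g)) (i z.1, z.2).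
  by have := key _ hy; rewrite linear0.
elim=> {z} [z ->||c z z' _ IH _ IH'|a r z _ IH] /=.
- by rewrite ix; apply: mspan_gen.
- by rewrite linear0; apply: mspan0.
- by rewrite linearP; apply: (mspan_lin c IH IH').
- by rewrite iw; apply: (mspan_op a r IH).
Qed.

Lemma induced_generates (W : vmod V) (U : lieModule (gl11 R)) (u : {linear U -> W}) (s : W) :
  induced_along 1 (fun a r => act (v0 := W) (J a) r) u ->
  (forall x, exists c d : C, u x = c *: s + d *: w GM 0 s) -> generates (eq^~ s).
Proof.
move=> hi hu K aK Ks z; elim: (induced_gen hi z) => {z} [_ [x ->]||c x y _ kx _ ky|a r x _ kx].
- have [c [d ->]] := hu x; have k := Ks s erefl.
  by apply: (actsubP aK) => //; rewrite -[_ *: _]addr0; apply: (actsubP aK);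
    [apply: (actsub_act aK)|apply: (actsub0 aK)].
- exact: actsub0.
- exact: actsubP.
- exact: actsub_act.
Qed.

Lemma twist_par (M : superSpace R) p (x : M) : parity false x -> parity p (x : twist p M).
Proof. by move=> px; rewrite /parity /= /twist_sg px sgn0 scale1r. Qed.
Lemma twist_op_sg (M : superSpace R) (op : gen -> int -> M -> M) p : modes op ->
  (forall a r x, sg M (op a r x) = sgn (gpar a) *: op a r (sg M x)) ->
  forall a r x, sg (twist p M) (op a r x) = sgn (gpar a) *: op a r (sg (twist p M) x).
Proof. by move=> Hm Hsg a r x; rewrite /= /twist_sg Hsg (linZ (md_lin Hm _ _)); lmod. Qed.

(** The universal property maps the generator to that of the explicit Verma module, which is
    nonzero. *)
Lemma Vhat_hw n e (W : vmod V) : is_Vhat J n e W -> exists s b,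
  [/\ FH (@w W) 0 (n + 2^-1) e s, parity b s, s <> 0 & generates (eq^~ s)].
Proof.
move=> [p [u hu]]; have [ha ext univ] := hu; have [fs ps us] := glV_FH ext.
exists (u v1), p; split=> //; last first.
  by apply: (induced_generates hu) => x; exists ((x : 'rV[C]_2) 0 0), ((x : 'rV[C]_2) 0 1); apply: us.
have [W' [s' [fs' ps' _ s0 _]]] := verma_vmod (n + 2^-1) e.
have hm := Wop_modes HV W'; have hs := twist_op_sg p hm (Wop_sg HV (W := W')).
have [u' [e' us']] := @glV_ext (twist p W') (@w W') hm hs n e p s' fs' (twist_par p ps').
have [f [_ _ fu _]] := univ _ _ _ (modes_affine (M := twist p W') hm hs) e'.
by move=> z; apply: s0; rewrite -us' -fu z linear0.
Qed.

(** N_0 is shifted by c. The relations survive because no bracket has a component along N; applied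
    to the vacuum module, this gives a model of charge c for the module induced from A_n. *)
Definition opS (c : C) (W : vmod V) (a : gen) (r : int) (x : W) : W :=
  w a r x + (if r == 0 then match a with GN => c | _ => 0 end else 0) *: x.
Lemma opS_modes c (W : vmod V) : modes (opS c (W := W)).
Proof.
have hm := Wop_modes HV W; split=> [a r k x y|a b r s x]; first by rewrite /opS (md_lin hm); lmod.
rewrite /opS !(linD (md_lin hm _ _)) !(linZ (md_lin hm _ _)) (md_comm hm).
case: a; case: b => /=; rewrite ?if_same ?sgn0 ?sgn1; lmod.
Qed.
Lemma opS_sg c (W : vmod V) a r (x : W) : sg W (opS c a r x) = sgn (gpar a) *: opS c a r (sg W x).
Proof.
rewrite /opS linearD linearZ /= (Wop_sg HV) scalerDr; congr (_ + _).
by case: a; rewrite /= ?sgn0 ?sgn1 ?if_same ?scale1r ?scale0r ?scaler0.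
Qed.

Lemma Ahat0_hw n (W : vmod V) : is_Ahat J n 0 W -> exists s b,
  [/\ FH (@w W) 0 n 0 s, parity b s, s <> 0, generates (eq^~ s) & w GM 0 s = 0].
Proof.
rewrite /is_Ahat eqxx => -[p [u hu]]; have [ha ext univ] := hu; have [fs ms ps us] := glA_FH ext.
exists (u (1 : C^o)), p; split=> //; last first.
  by apply: (induced_generates hu) => x; exists x, 0; rewrite scale0r addr0; apply: us.
have hm := opS_modes n (vself V); have hs := twist_op_sg p hm (@opS_sg n (vself V)).
have z a (r : int) : 0 <= r -> w a r (vac V : vself V) = 0 by move=> r0; apply: vac_create0.
have fv : FH (opS n (W := vself V)) 0 n 0 (vac V).
  split=> [r hr|r hr|r hr||]; rewrite /opS ?if_same ?scale0r ?addr0 ?z ?add0r //; try lia.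
  have r1 : (r == 0) = false by apply/negbTE; rewrite gt_eqF.
  by rewrite r1 scale0r; split.
have mv : opS n (W := vself V) GM 0 (vac V) = 0 by rewrite /opS z // scale0r addr0.
have vp : parity false (vac V) by rewrite /parity vac_even sgn0 scale1r.
have [u' [e' us']] := @glA_ext (twist p (vself V)) _ hm hs n p (vac V) fv mv (twist_par (M := vself V) p vp).
have [f [_ _ fu _]] := univ _ _ _ (modes_affine (M := twist p (vself V)) hm hs) e'.
by move=> h; apply: V0; rewrite -us' -fu h linear0.
Qed.

(** For l nonzero A_{n,l} is a quotient of a Verma module, whose highest-weight vector has charge n
    + 1/2; for l = 0 the charge is n itself. *)
Definition nshift (l : int) : C := if l == 0 then 0 else 2^-1.

Lemma Vhat_irr n e (W : vmod V) : (forall z : int, e <> z%:~R) -> is_Vhat J n e W ->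
  irreducible W /\ exists s b, [/\ FH (@w W) 0 (n + 2^-1) e s, parity b s & s <> 0].
Proof.
move=> he /Vhat_hw[s [b [fs ps s0 gs]]]; split; first exact: (verma_irr HV he fs ps s0 gs).
by exists s, b.
Qed.

Lemma Ahat_irr n l (W : vmod V) : is_Ahat J n l W -> irreducible W /\
  exists s b, [/\ FH (@w W) 0 (n + nshift l) l%:~R s, parity b s, s <> 0 & l = 0 -> w GM 0 s = 0].
Proof.
have [-> /Ahat0_hw[s [b [fs ps s0 gs ms]]]|l0] := eqVneq l 0.
  split; first exact: (atypical_irr HV fs ms ps s0 gs).
  by exists s, b; split=> //; rewrite /nshift eqxx addr0.
rewrite /is_Ahat (negbTE l0) => -[irr [M [p [f [/Vhat_hw[s [b [fs ps s0 gs]]] fsurj]]]]].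
split=> //; exists (f s), (b (+) p).
have fw g r (x : M) : f (w g r x) = sgn (p && gpar g) *: w g r (f x).
  by apply: shf_act; apply: (J_parity HV); apply: glv_parity.
have z x : f x = 0 -> forall g r, w g r x = w g r x -> True by [].
split; last by move/eqP; rewrite (negbTE l0).
- rewrite /nshift (negbTE l0); have [hM hP hNE hN hE] := fs.
  have k g r : w g r s = 0 -> w g r (f s) = 0.
    move=> e0; apply: (scalerI (sgn_neq0 R (p && gpar g))).
    by rewrite -fw e0 linear0 scaler0.
  split=> [r hr|r hr|r hr||]; try exact/k/hM; try exact/k/hP.
  + by have [e1 e2] := hNE r hr; split; apply: k.
  + by have := fw GN 0 s; rewrite hN linearZ /= andbF sgn0 scale1r.
  + by have := fw GE 0 s; rewrite hE linearZ /= andbF sgn0 scale1r.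
- by rewrite /parity shf_sg ps linearZ /= scalerA sgn_addb mulrC.
move=> fs0; have [y y0] := irr.1; apply: y0; have [x <-] := fsurj y.
apply: (gs (fun x => f x = 0)) => [|_ ->] //; apply: (Jclosed_actsub HV) => [|c u v hu hv|g r u hu].
- by rewrite linear0.
- by rewrite linearP hu hv scaler0 addr0.
- by rewrite fw hu (lin0 (md_lin (Wop_modes HV W) _ _)) scaler0.
Qed.

Lemma hw_Vhat (S : vmod V) nu e s b : (forall z : int, e <> z%:~R) -> irreducible S ->
  FH (@w S) 0 nu e s -> parity b s -> s <> 0 -> is_Vhat J (nu - 2^-1) e S.
Proof.
move=> he irr fs ps s0; apply: (Vhat_build (irr_gen irr ps s0) fs ps).
  by apply: (no_graph_irr fs ps s0); left.
move=> m0; have := FH_upK (Wop_modes HV S) fs; rewrite oppr0 m0 addr0 (lin0 (md_lin (Wop_modes HV S) _ _)).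
by move/esym/eqP; rewrite scaler_eq0 => /orP[/eqP e0|/eqP //]; apply: (he 0); rewrite e0.
Qed.

(** For l = 0 simplicity forces psi^-_0 s = 0, by [flow_gone]. For l nonzero S must be exhibited as
    a quotient of a Verma module, and [verma_vmod] supplies one with the required universality. *)
Lemma hw_Ahat (S : vmod V) nu l s b : irreducible S ->
  FH (@w S) 0 nu l%:~R s -> parity b s -> s <> 0 -> is_Ahat J (nu - nshift l) l S.
Proof.
move=> irr fs ps s0; have gs := irr_gen irr ps s0; have hS := Wop_modes HV S.
have [l0|l0] := eqVneq l 0.
  rewrite l0 /nshift eqxx subr0; rewrite l0 in fs.
  have ms : w GM 0 s = 0.
    by rewrite -oppr0; apply: (flow_gone HV irr fs (FH_top HV fs) s0 ps); rewrite addr0.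
  apply: (Ahat0_build gs fs ps _ _ ms) => //.
  by apply: (no_graph_irr fs ps s0); right.
rewrite /nshift (negbTE l0) /is_Ahat (negbTE l0); split=> //.
have [M [x [fx px gx x0 ng]]] := verma_vmod nu l%:~R; exists M, b.
have HT := opT_modes b hS; have pT : parity false (s : twist b S).
  by rewrite /parity /= /twist_sg ps scalerA sgnK sgn0 scale1r.
have m0 : w GM 0 x <> 0.
  move=> m0; have := FH_upK (Wop_modes HV M) fx; rewrite oppr0 m0 addr0 (lin0 (md_lin (Wop_modes HV M) _ _)).
  by move/esym/eqP; rewrite scaler_eq0 intr_eq0 (negbTE l0) => /eqP.
have [f [fx1 fw fsg]] := @hw_map _ _ _ HV M x (twist b S) (opT b (@w S)) s false gx HT (@opT_sg _ _ _ HV b S) px pT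
  (ng (twist b S) _ s HT (@opT_sg _ _ _ HV b S) (FH_opT b fs) (fun m => False_ind _ (m0 m)) pT).
have fsg' z : sg S ((f : {linear M -> S}) z) = sgn b *: f (sg M z).
  by rewrite fsg /= /twist_sg scalerA sgnK scale1r.
pose F := @Shom R V b M S f fsg' (Jhom_act HV fw).
exists F; split; first exact: (Vhat_build gx fx px ng m0).
by apply: (@irr_shom_surj _ _ _ _ _ F x irr); rewrite /= fx1.
Qed.
End Listed.

(** * Objects of the categories *)

Section Categories.
Variable R : realType.
Local Notation C := (R[i]).
Local Notation sgn := (sgn R).
Variables (V : vosa R) (J : {linear gl11 R -> V}).
Hypothesis HV : is_V1gl11 J.
Local Notation w := (Wop J).

Lemma hw_Ofin (S : vmod V) nu e s b : irreducible S -> FH (@w S) 0 nu e s -> parity b s -> s <> 0 -> Ofin J S.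
Proof.
move=> irr fs ps s0; have gs := irr_gen irr ps s0.
have [lg lb lN lE] := lowest_gen HV fs gs.
have scal (G : C -> S -> Prop) : (forall c a y, G a y -> G a (c *: y)) ->
    forall (c : C) y, (exists a, G a y) -> exists a, G a (c *: y).
  by move=> h c y [a ha]; exists a; apply: h.
split; first split=> //.
- move=> x; apply: lspan_spanned (lg x); apply: scal => c a y hy.
  by rewrite -[c *: y]addr0; apply: weight_lin hy (weight0 _ _).
- move=> h; have [[z [hz z0]]|nz] := pselect (exists z, weight_space (W := S) h z /\ z <> 0); last first.
    exists [::] => x hx; exists (fun=> 0); rewrite big_ord0; apply: contrapT => x0; apply: nz; by exists x.
  have [k [ek _]] := weight_deg HV fs gs hz z0.
  have fd := @TT_fd _ _ (flow (@w S) 0) (fun a r => md_lin (Wop_modes HV S) a _) (FHset (@w S) 0 s)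
    [:: s; w GM (- 0) s].
  have [t ht] : finite_dim (TT (flow (@w S) 0) (FHset (@w S) 0 s) k).
    by apply: fd => x [->|->]; rewrite !inE eqxx ?orbT.
  exists t => x hx; have [->|/eqP x0] := eqVneq x 0; first exact: in_span0.
  have [k' [ek' tk']] := weight_deg HV fs gs hx x0.
  have kk' : k = k' by move: ek'; rewrite -ek => /addrI/eqP; rewrite eqr_nat => /eqP.
  by apply: ht; rewrite kk'.
- exists 1%N, (fun i => if i is 0%N then fun x => x = 0 else fun _ => True); split=> //.
  + case=> [|i] _; last by split.
    by split=> [//|c x y -> ->|x ->|v n x ->]; rewrite ?scaler0 ?addr0 ?linear0.
  + case=> // _; split=> [//||U sU _ _]; first by have [y y0] := irr.1; exists y.
    by case: (irr.2 U sU) => h; [left|right].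
- move=> x; apply: lspan_spanned (lN x); apply: scal => c a y hy.
  by rewrite (linZ (md_lin (Wop_modes HV S) GN 0)) hy !scalerA mulrC.
- move=> x; apply: lspan_spanned (lE x); apply: scal => c a y hy.
  by rewrite (linZ (md_lin (Wop_modes HV S) GE 0)) hy !scalerA mulrC.
Qed.

Lemma Ofin_IndO (S : vmod V) : Ofin J S -> IndO J S.
Proof.
move=> h; split; first by case: h => -[].
by move=> x; exists S, (shid S); split=> //; exists x.
Qed.

Lemma Ofin_lowest (S : vmod V) : Ofin J S -> lowest J S.
Proof.
by move=> [[g fd bnd] fl dN dE]; split=> // x; apply: spanned_lspan; [apply: g|apply: dN|apply: dE].
Qed.

Lemma shom_w p (W1 W2 : vmod V) (f : shom p W1 W2) g r x :
  f (w g r x) = sgn (p && gpar g) *: w g r (f x).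
Proof. by apply: shf_act; apply: (J_parity HV); apply: glv_parity. Qed.

Lemma shom0_w (W1 W2 : vmod V) (f : shom false W1 W2) g r x : f (w g r x) = w g r (f x).
Proof. by rewrite shom_w sgn0 scale1r. Qed.

Lemma FH_shom p (W1 W2 : vmod V) (f : shom p W1 W2) q nu e x : FH (@w W1) q nu e x -> FH (@w W2) q nu e (f x).
Proof.
have k g r : w g r x = 0 -> w g r (f x) = 0.
  move=> e0; apply: (scalerI (sgn_neq0 R (p && gpar g))).
  by rewrite -shom_w e0 linear0 scaler0.
move=> [hM hP hNE hN hE]; split=> [r hr|r hr|r hr||]; try exact/k/hM; try exact/k/hP.
- by have [e1 e2] := hNE r hr; split; apply: k.
- by have := shom_w f GN 0 x; rewrite hN linearZ /= andbF sgn0 scale1r.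
- by have := shom_w f GE 0 x; rewrite hE linearZ /= andbF sgn0 scale1r.
Qed.

Lemma parity_shom p (W1 W2 : vmod V) (f : shom p W1 W2) b x : parity b x -> parity (p (+) b) (f x).
Proof. by move=> px; rewrite /parity shf_sg px linearZ /= scalerA sgn_addb. Qed.

Lemma IndO_hw (W : vmod V) (K : W -> Prop) : IndO J W -> submodule K -> (exists x, K x /\ x <> 0) ->
  exists x nu e b, [/\ K x, x <> 0, FH (@w W) 0 nu e x & parity b x].
Proof.
move=> [_ hW] sK [x [Kx x0]]; have [U [i [oU ii [u ux]]]] := hW x.
have [|y [nu [e [b [Ky y0 fy py]]]]] := singular_exists HV (Ofin_lowest oU) (sub_preim i sK).
  by exists u; rewrite ux; split=> // u0; apply: x0; rewrite -ux u0 linear0.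
exists (i y), nu, e, b; split=> //; last exact: (parity_shom i py).
- by move=> h; apply: y0; apply: ii; rewrite h linear0.
- exact: FH_shom.
Qed.

Lemma Ofin_minimal (U : vmod V) : Ofin J U -> nonzero U -> exists K : U -> Prop, [/\ submodule K,
  exists x, K x /\ x <> 0 & forall K' : U -> Prop, submodule K' -> (forall x, K' x -> K x) ->
    (forall x, K' x -> x = 0) \/ (forall x, K x -> K' x)].
Proof.
move=> [_ [n [F [Fs F0 Fn Fi]]] _ _] [y y0].
case: n Fs Fn Fi => [|n] Fs Fn Fi; first by case: y0; apply/F0; apply: Fn.
have [F01 [x [F1x nF0x]] mx] := Fi 0%N isT; exists (F 1%N); split; first exact: Fs.
  by exists x; split=> // x0; apply: nF0x; apply/F0.
move=> K' sK' h; have [|h1|h1] := mx K' sK' _ h; last by right.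
- by move=> z /F0 ->; apply: (submod0 sK').
- by left=> z /h1 /F0.
Qed.

Lemma shom0_act (W1 W2 : vmod V) (f : shom false W1 W2) v n x : f (act v n x) = act v n (f x).
Proof.
rewrite (epartE v) (linD (act_linl n x)) linearD /= !(shf_act f _ _ (epart_parity _ _)) /= sgn0 !scale1r.
by rewrite -(linD (act_linl n (f x))).
Qed.

Lemma shom0_sg (W1 W2 : vmod V) (f : shom false W1 W2) x : f (sg W1 x) = sg W2 (f x).
Proof. by rewrite (shf_sg f) sgn0 scale1r. Qed.

Lemma shom_Lop p (W1 W2 : vmod V) (f : shom p W1 W2) n x : f (Lop n x) = Lop n (f x).
Proof.
have po : parity false (omega V) by rewrite /parity omega_even sgn0 scale1r.
by rewrite /Lop (shf_act f _ _ po) andbF sgn0 scale1r.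
Qed.

Lemma iter_shom p (W1 W2 : vmod V) (f : shom p W1 W2) h n x :
  f (iter n (fun y => Lop 0 y - h *: y) x) = iter n (fun y => Lop 0 y - h *: y) (f x).
Proof. by elim: n => //= n IH; rewrite linearB linearZ /= shom_Lop IH. Qed.

Lemma weight_shom p (W1 W2 : vmod V) (f : shom p W1 W2) h x : weight_space h x -> weight_space h (f x).
Proof. by move=> [n hn]; exists n; rewrite -iter_shom hn linear0. Qed.

Lemma weight_shom_inv p (W1 W2 : vmod V) (f : shom p W1 W2) h x : injective f ->
  weight_space h (f x) -> weight_space h x.
Proof. by move=> fi [n hn]; exists n; apply: fi; rewrite iter_shom hn linear0. Qed.

Lemma shom_factor p q (W0 W1 W : vmod V) (i : shom p W1 W) (f : shom q W0 W) : injective i ->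
  (forall x, exists y, i y = f x) -> exists g : shom (p (+) q) W0 W1, forall x, i (g x) = f x.
Proof.
move=> ii /choice[g hg].
have lg : linear g by move=> c x y; apply: ii; rewrite linearP !hg linearP.
have gs : forall x, sg W1 (mklin lg x) = sgn (p (+) q) *: mklin lg (sg W0 x).
  move=> x; apply: ii; rewrite linearZ /= hg.
  have := shf_sg i (g x); rewrite hg (shf_sg f) => e.
  apply: (scalerI (sgn_neq0 R p)); rewrite -[X in X = _]e scalerA; congr (_ *: _).
  by rewrite sgn_addb mulrA sgnK mul1r.
have ga : forall a v n x, parity a v -> mklin lg (act v n x) = sgn ((p (+) q) && a) *: act v n (mklin lg x).
  move=> a v n x av; apply: ii; rewrite linearZ /= hg (shf_act f _ _ av) (shf_act i _ _ av) hg scalerA.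
  by rewrite sgn_andb_addb mulrAC sgnK mul1r.
by exists (Shom gs ga).
Qed.

Lemma sub_push (W : vmod V) (U : W -> Prop) (hU : submodule U) (L : subvmod hU -> Prop) :
  submodule L -> submodule (fun x => exists z, L z /\ subinc hU z = x).
Proof.
move=> hL; split.
- by exists 0; rewrite linear0; split=> //; apply: submod0.
- by move=> c _ _ [y [Ly <-]] [z [Lz <-]]; exists (c *: y + z); rewrite linearP; split=> //; apply: submodP.
- by move=> _ [y [Ly <-]]; exists (sg _ y); rewrite shom0_sg; split=> //; apply: submod_sg.
- by move=> v n _ [y [Ly <-]]; exists (act v n y); rewrite shom0_act; split=> //; apply: submod_act.
Qed.

(* Not necessarily strict filtrations by submodules with simple or zero steps. *)
Inductive FL (W : vmod V) : (W -> Prop) -> Prop :=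
| FL0 : FL (fun x => x = 0)
| FLS (U U' : W -> Prop) : FL U -> submodule U' -> (forall x, U x -> U' x) ->
    (forall T, submodule T -> (forall x, U x -> T x) -> (forall x, T x -> U' x) ->
       (forall x, T x -> U x) \/ (forall x, U' x -> T x)) -> FL U'.

Lemma sub_zero (W : vmod V) : submodule (fun x : W => x = 0).
Proof. by split=> [//|c x y -> ->|x ->|v n x ->]; rewrite ?scaler0 ?addr0 ?linear0 ?(lin0 (act_linr _ _)). Qed.

Lemma sub_cap (W : vmod V) (U K : W -> Prop) : submodule U -> submodule K -> submodule (fun x => U x /\ K x).
Proof.
move=> hU hK; split=> [|c x y [? ?] [? ?]|x [? ?]|v n x [? ?]]; split;
by [apply: submod0|apply: submodP|apply: submod_sg|apply: submod_act].
Qed.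

Lemma sub_add (W : vmod V) (U K : W -> Prop) : submodule U -> submodule K ->
  submodule (fun x => exists u k, [/\ U u, K k & x = u + k]).
Proof.
move=> hU hK; split.
- by exists 0, 0; rewrite addr0; split=> //; apply: submod0.
- move=> c _ _ [u [k [? ? ->]]] [u' [k' [? ? ->]]]; exists (c *: u + u'), (c *: k + k').
  by split; [apply: submodP|apply: submodP|rewrite scalerDr addrACA].
- by move=> _ [u [k [? ? ->]]]; exists (sg _ u), (sg _ k); split; [apply: submod_sg|apply: submod_sg|rewrite linearD].
- move=> v n _ [u [k [? ? ->]]]; exists (act v n u), (act v n k).
  by split; [apply: submod_act|apply: submod_act|rewrite (linD (act_linr v n))].
Qed.

Lemma subB (W : vmod V) (U : W -> Prop) x y : submodule U -> U x -> U y -> U (x - y).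
Proof. by move=> hU ux uy; rewrite addrC -scaleN1r; apply: (submodP hU). Qed.

Lemma FL_sub (W : vmod V) (U : W -> Prop) : FL U -> submodule U.
Proof. by case=> // ; apply: sub_zero. Qed.

(** A filtration step may become trivial after intersection with K, which [FL] allows. Otherwise
    maximality is applied to U + T, and the modular law leads back to T. *)
Lemma FL_cap (W : vmod V) (U K : W -> Prop) : FL U -> submodule K -> FL (fun x => U x /\ K x).
Proof.
move=> fU hK; elim: fU => [|{}U U' fU IH hU' sUU' mx].
  have -> : (fun x : W => x = 0 /\ K x) = (fun x => x = 0); last exact: FL0.
  by apply/funext => x; apply/propext; split=> [[]//|->]; split=> //; apply: submod0.
have hU := FL_sub fU.
apply: FLS IH (sub_cap hU' hK) _ _ => [x [/sUU' ? ?]//|T hT sT Ts].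
have [|x [u [t [/sUU' Uu /Ts[? _] ->]]]|h|h] := mx _ (sub_add hU hT).
- by move=> x Ux; exists x, 0; rewrite addr0; split=> //; apply: submod0.
- by rewrite -[u]scale1r; apply: submodP.
- left=> x Tx; split; last by case: (Ts x Tx).
  by apply: h; exists 0, x; rewrite add0r; split=> //; apply: submod0.
- right=> x [/h[u [t [Uu Tt ->]]] Kx].
  have Ku : K u by rewrite -(addrK t u); apply: (subB hK Kx); case: (Ts t Tt).
  by rewrite -[u]scale1r; apply: submodP => //; apply: sT.
Qed.

Lemma FL_chain (W : vmod V) (U : W -> Prop) : FL U -> exists n (F : nat -> W -> Prop),
  [/\ forall i, (i <= n)%N -> submodule (F i), F 0%N = (fun x => x = 0), F n = U &
      forall i, (i < n)%N ->
        [/\ forall x, F i x -> F i.+1 x, exists x, F i.+1 x /\ ~ F i x &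
            forall T : W -> Prop, submodule T -> (forall x, F i x -> T x) -> (forall x, T x -> F i.+1 x) ->
              (forall x, T x -> F i x) \/ (forall x, F i.+1 x -> T x)]].
Proof.
elim=> [|{}U U' fU [n [F [Fs F0 Fn Fi]]] hU' sUU' mx].
  by exists 0%N, (fun _ x => x = 0); split=> // i _; apply: sub_zero.
have [[x [U'x nUx]]|nx] := pselect (exists x, U' x /\ ~ U x); last first.
  exists n, F; split=> //; rewrite Fn; apply/funext => x; apply/propext; split=> [/sUU'//|U'x].
  by apply: contrapT => nUx; apply: nx; exists x.
exists n.+1, (fun i => if (i <= n)%N then F i else U'); rewrite ltnn; split=> // i hi.
  by case: ifP => // /Fs.
have := hi; rewrite ltnS => ->; have [lt|->] : (i < n)%N \/ i = n by lia.
  by rewrite lt; apply: Fi.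
by rewrite ltnn Fn; split=> //; exists x.
Qed.

Lemma finite_length_FL (W : vmod V) : finite_length W -> FL (fun _ : W => True).
Proof.
move=> [n [F [Fs F0 Fn Fi]]].
have h i : (i <= n)%N -> FL (F i).
  elim: i => [|i IH] hi; last by have [a _ b] := Fi i hi; apply: FLS (IH (ltnW hi)) (Fs _ hi) a b.
  have -> : F 0%N = (fun x => x = 0); last exact: FL0.
  by apply/funext => x; apply/propext; apply: F0.
have <- : F n = (fun _ => True); last exact: h.
by apply/funext => x; apply/propext; split.
Qed.

Lemma FL_subvmod (W : vmod V) (U : W -> Prop) (hU : submodule U) : FL U -> finite_length (subvmod hU).
Proof.
move=> /FL_chain[n [F [Fs F0 Fn Fi]]].
have FU i : (i <= n)%N -> forall x, F i x -> U x.
  move=> hi; rewrite -(subKn hi); elim: (n - i)%N (leq_subr i n) => [|k IH] hk x; first by rewrite subn0 Fn.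
  have lt : (n - k.+1 < n)%N by lia.
  have [a _ _] := Fi _ lt; rewrite (_ : (n - k.+1).+1 = n - k)%N in a; last by lia.
  by move=> /a; apply: IH; lia.
exists n, (fun i z => F i (subinc hU z)); split.
- by move=> i /Fs; apply: sub_preim.
- by move=> z; rewrite F0; split=> [h|->]; [apply: (@subinc_inj _ _ _ _ hU); rewrite h linear0|rewrite linear0].
- by move=> z; rewrite Fn; apply: subincP.
move=> i hi; have [a [x [F1 nF]] b] := Fi i hi; split; first by move=> z; apply: a.
  by have [z hz] := subinc_im hU (FU _ hi _ F1); exists z; rewrite hz.
move=> T hT sT Ts; have [y Fy|_ [z [Tz <-]]|h|h] := b _ (sub_push hT); last 1 first.
- right=> z /h[z' [Tz' e]]; by rewrite -(@subinc_inj _ _ _ _ hU _ _ e).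
- by have [z hz] := subinc_im hU (FU _ (ltnW hi) _ Fy); exists z; split=> //; apply: sT; rewrite hz.
- exact: Ts.
- by left=> z Tz; apply: h; exists z.
Qed.

Lemma in_span_cons (W : lmodType C) (a : W) s x :
  in_span (a :: s) x <-> exists c d, x = c *: a + d /\ in_span s d.
Proof.
split=> [[c ->]|[c [d [-> [f ->]]]]].
  by exists (c 0%N), (\sum_(i < size s) c i.+1 *: s`_i); rewrite big_ord_recl; split=> //; exists (fun i => c i.+1).
by exists (fun i => if i is k.+1 then f k else c); rewrite big_ord_recl.
Qed.

(** Elimination: if some p in P involves the first vector a, it takes the place of a and clears this
    coordinate from the others; if none does, a is dropped. *)
Lemma in_span_sub (W : lmodType C) (P : W -> Prop) (s : seq W) : P 0 ->
  (forall (c : C) x y, P x -> P y -> P (c *: x + y)) ->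
  exists t : seq W, (forall y, y \in t -> P y) /\ forall x, P x -> in_span s x -> in_span t x.
Proof.
move=> P0 Pl; elim: s => [|a s [t [tP ht]]]; first by exists [::].
have [[p [Pp [c [d [c0 [ep hd]]]]]]|np] :=
  pselect (exists p, P p /\ exists c d, c != 0 /\ p = c *: a + d /\ in_span s d); last first.
  exists t; split=> // x Px /in_span_cons[c [d [e hd]]]; apply: ht => //.
  have [c0|c0] := eqVneq c 0; first by rewrite e c0 scale0r add0r.
  by case: np; exists x; split=> //; exists c, d.
exists (p :: t); split=> [y|x Px /in_span_cons[c' [d' [e hd']]]].
  by rewrite inE => /orP[/eqP ->|/tP].
apply/in_span_cons; exists (c' / c), (x - (c' / c) *: p); split; first by rewrite addrC subrK.
have ex : x - (c' / c) *: p = (- (c' / c)) *: d + d'.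
  rewrite e ep; apply: lin_ext => phi pD pN pZ p0; rewrite !(pD,pN,pZ,p0); by field.
apply: ht; last by rewrite ex; apply: in_span_lin.
by rewrite addrC -scaleNr; apply: Pl.
Qed.

(** Membership in O^fin of a submodule U, stated inside W, so that submodules can be enlarged within
    a fixed ambient module. *)
Record OfinP (W : vmod V) (U : W -> Prop) : Prop := {
  op_sub : submodule U;
  op_gen : forall x, U x -> lspan (fun y => U y /\ exists h, weight_space h y) x;
  op_fd : forall h, exists s : seq W, (forall y, y \in s -> U y) /\
    forall x, U x -> weight_space h x -> in_span s x;
  op_bnd : forall h, exists N : nat, forall n : nat, (N <= n)%N -> forall x, U x ->
    weight_space (h - n%:R) x -> x = 0;
  op_FL : FL U;
  op_N : forall x, U x -> lspan (fun y => U y /\ exists a : C, w GN 0 y = a *: y) x;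
  op_E : forall x, U x -> lspan (fun y => U y /\ exists a : C, w GE 0 y = a *: y) x }.

Lemma lspan_pull (W : vmod V) (U : W -> Prop) (hU : submodule U) (Q : W -> Prop) x :
  lspan (fun y => U y /\ Q y) x -> exists z, subinc hU z = x /\ lspan (fun z => Q (subinc hU z)) z.
Proof.
elim=> [y [/(subinc_im hU)[z <-] Qy]||c y z _ [y' [<- hy]] _ [z' [<- hz]]].
- by exists z; split=> //; apply: lspan_gen.
- by exists 0; rewrite linear0; split=> //; apply: lspan0.
- by exists (c *: y' + z'); rewrite linearP; split=> //; apply: lspan_lin.
Qed.

Lemma OfinP_Ofin (W : vmod V) (U : W -> Prop) (hU : submodule U) : OfinP U -> Ofin J (subvmod hU).
Proof.
move=> [_ hg hf hb hF hN hE]; have inj := @subinc_inj _ _ _ _ hU; pose inc := subinc hU.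
have pull (Q : W -> Prop) : (forall x, U x -> lspan (fun y => U y /\ Q y) x) ->
    (forall (c : C) y, Q y -> Q (c *: y)) -> forall z, spanned_by (fun z => Q (inc z)) z.
  move=> h hc z; have [z' [/inj <- hz']] := lspan_pull hU (h _ (subincP z)).
  by apply: lspan_spanned hz' => c y; rewrite linearZ; apply: hc.
split; first split.
- move=> z; have [|s [hs ->]] := pull _ hg _ z.
    by move=> c y [h hy]; exists h; rewrite -[c *: y]addr0; apply: weight_lin hy (weight0 _ _).
  by exists s; split=> // x /hs[h hx]; exists h; apply: weight_shom_inv hx.
- move=> h; have [s [sU hs]] := hf h.
  have [t et] : exists t, s = map inc t.
    elim: s sU {hs} => [|a s IH] sU; first by exists [::].
    have [y hy] := subinc_im hU (sU a (mem_head _ _)).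
    have [|t ->] := IH; first by move=> y' hy'; apply: sU; rewrite inE hy' orbT.
    by exists (y :: t); rewrite -hy.
  exists t => z hz; have [c hc] := hs _ (subincP z) (weight_shom inc hz).
  exists c; apply: inj; rewrite [LHS]hc et size_map linear_sum; apply: eq_bigr => i _.
  by rewrite linearZ /= (nth_map 0).
- move=> h; have [N h1] := hb h; exists N => n hn z hz; apply: inj; rewrite linear0.
  exact: (h1 n hn _ (subincP z) (weight_shom inc hz)).
- exact: FL_subvmod.
- move=> z; have [|s [hs ->]] := pull _ hN _ z.
    by move=> c y [a e]; exists a; rewrite (linZ (md_lin (Wop_modes HV W) GN 0)) e !scalerA mulrC.
  by exists s; split=> // x /hs[a hx]; exists a; apply: inj; rewrite linearZ -[RHS]hx; apply: (shom0_w inc GN).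
- move=> z; have [|s [hs ->]] := pull _ hE _ z.
    by move=> c y [a e]; exists a; rewrite (linZ (md_lin (Wop_modes HV W) GE 0)) e !scalerA mulrC.
  by exists s; split=> // x /hs[a hx]; exists a; apply: inj; rewrite linearZ -[RHS]hx; apply: (shom0_w inc GE).
Qed.

Lemma sub_Lop (W : vmod V) (U : W -> Prop) n x : submodule U -> U x -> U (Lop n x).
Proof. by move=> hU; apply: submod_act. Qed.
Lemma sub_w (W : vmod V) (U : W -> Prop) g r x : submodule U -> U x -> U (w g r x).
Proof. by move=> hU; apply: submod_act. Qed.

Lemma Ofin_subP (W : vmod V) (U : W -> Prop) : Ofin J W -> submodule U -> OfinP U.
Proof.
move=> oW hU; have [lg lb lN lE] := Ofin_lowest oW; have [[_ fd _] fl _ _] := oW.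
have U0 := submod0 hU; have Ul := submodP hU; split=> //.
- by move=> x Ux; apply: weight_ops => // y; apply: sub_Lop.
- move=> h; have [s hs] := fd h.
  have [||t [tP ht]] := @in_span_sub W (fun x => U x /\ weight_space h x) s; first by split=> //; apply: weight0.
    by move=> c x y [? ?] [? ?]; split; [apply: Ul|apply: weight_lin].
  by exists t; split=> [y /tP[]//|x Ux hx]; apply: ht => //; apply: hs.
- by move=> h; have [N hN] := lb h; exists N => n hn x _; apply: hN.
- have -> : U = (fun x => True /\ U x) by apply/funext => x; apply/propext; split=> [|[]].
  exact: FL_cap (finite_length_FL fl) hU.
- move=> x Ux; apply: eig_ops => //; [exact: (md_lin (Wop_modes HV W))|by move=> y; apply: sub_w].
- move=> x Ux; apply: eig_ops => //; [exact: (md_lin (Wop_modes HV W))|by move=> y; apply: sub_w].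
Qed.

(** Around a vector of U, take an object of O^fin inside W that contains it and restrict to the
    preimage of U. *)
Lemma IndO_sub (W : vmod V) (U : W -> Prop) (hU : submodule U) : IndO J W -> IndO J (subvmod hU).
Proof.
move=> [hg hW]; have inj := @subinc_inj _ _ _ _ hU; pose inc := subinc hU; split=> [z|z].
  have hx : lspan (fun y => U y /\ exists h, weight_space h y) (inc z).
    apply: weight_ops; [exact: submod0|exact: submodP|by move=> y; apply: sub_Lop| |exact: subincP].
    exact/spanned_lspan/hg.
  have [z' [/inj <- hz']] := lspan_pull hU hx.
  have [|s [hs ->]] := lspan_spanned _ hz'.
    move=> c y [h hy]; exists h; rewrite linearZ /= -[c *: _]addr0; exact: weight_lin hy (weight0 _ _).
  by exists s; split=> // x /hs[h hy]; exists h; apply: weight_shom_inv hy.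
have [N [i [oN ii [u ux]]]] := hW (inc z).
have hK := sub_preim i hU; pose K := subvmod hK.
have [g hgK] := @shom_factor _ _ K _ _ inc (shomc i (subinc hK)) inj (fun x => subinc_im hU (subincP x)).
exists K, g; split; first exact: OfinP_Ofin (Ofin_subP oN hK).
- move=> a b e; apply: (@subinc_inj _ _ _ _ hK); apply: ii.
  by rewrite -[LHS]/(shomc i (subinc hK) a) -hgK e hgK.
- have [|k hk] := subinc_im hK (x := u); first by rewrite ux; apply: subincP.
  by exists k; apply: inj; rewrite hgK -ux -hk.
Qed.

(** A nonzero vector lies in some object of O^fin, whose finite length yields a minimal nonzero
    submodule. *)
Lemma IndO_irr (W : vmod V) : IndO J W -> nonzero W -> exists (S : vmod V) (i : shom false S W),
  [/\ irreducible S, injective i & exists s nu e b, [/\ FH (@w S) 0 nu e s, parity b s & s <> 0]].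
Proof.
move=> [_ hW] [x x0]; have [U [i [oU ii [u ux]]]] := hW x.
have [|K [sK [k [Kk k0]] mK]] := Ofin_minimal oU.
  by exists u => u0; apply: x0; rewrite -ux u0 linear0.
have inj := @subinc_inj _ _ _ _ sK; pose inc := subinc sK.
have [y [nu [e [b [Ky y0 fy py]]]]] := singular_exists HV (Ofin_lowest oU) sK (ex_intro _ k (conj Kk k0)).
have [s hs] := subinc_im sK Ky.
exists (subvmod sK), (shomc i inc); split; last 1 first.
- exists s, nu, e, b; split; last by move=> s0; apply: y0; rewrite -hs s0 linear0.
    apply: (@FH_inj _ _ _ (@w (subvmod sK)) (@w U) inc) => //; last by rewrite hs.
  by apply: inj; rewrite shom0_sg hs py linearZ -hs.
- split.
    by exists s => s0; apply: y0; rewrite -hs s0 linear0.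
  move=> L hL; have [_ [z [_ <-]]|h|h] := mK _ (sub_push hL); first exact: subincP.
    left=> z Lz; apply: inj; rewrite linear0; apply: h; by exists z.
  by right=> z; have [z' [Lz' /inj <-]] := h _ (subincP z).
- by move=> a b' /ii; apply: subinc_inj.
Qed.

Lemma OfinP_zero (W : vmod V) : OfinP (fun x : W => x = 0).
Proof.
split; [exact: sub_zero|by move=> x ->; apply: lspan0| |by move=> h; exists 0%N|exact: FL0|by move=> x ->; apply: lspan0..].
by move=> h; exists [::]; split=> // x -> _; apply: in_span0.
Qed.

(** As M is simple, its image lies in U or meets it in 0; in the second case weight spaces split and
    the filtration gains one simple step. *)
Lemma OfinP_add (W M : vmod V) p (i : shom p M W) (U : W -> Prop) : OfinP U -> irreducible M -> Ofin J M ->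
  exists U' : W -> Prop, [/\ OfinP U', forall x, U x -> U' x & forall m, U' (i m)].
Proof.
move=> oU irM oM; have [hU hg hf hb hF hN hE] := oU; have hI := sub_im i.
have [hz|hz] := irM.2 _ (sub_preim i hU); last by exists U.
have [lg lb lN lE] := Ofin_lowest oM; have [[_ fd _] _ _ _] := oM.
pose U' x := exists u k, [/\ U u, (exists m, i m = k) & x = u + k].
have hU' : submodule U' := sub_add hU hI.
have iU x : U x -> U' x by move=> ux; exists x, 0; rewrite addr0; split=> //; exact: (submod0 hI).
have iM m : U' (i m) by exists 0, (i m); rewrite add0r; split=> //; [exact: (submod0 hU)|exists m].
have gen (Q : W -> Prop) (QM : M -> Prop) : (forall x, U x -> lspan (fun y => U y /\ Q y) x) ->
    (forall m, lspan QM m) -> (forall m, QM m -> Q (i m)) -> forall x, U' x -> lspan (fun y => U' y /\ Q y) x.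
  move=> h1 h2 h3 _ [u [_ [/h1 hu [m <-] ->]]]; apply: lspanD.
    by apply: lspan_sub hu => y [/iU ? ?]; apply: lspan_gen.
  elim: (h2 m) => [y hy||c y z _ hy _ hz']; first by apply: lspan_gen; split=> //; apply: h3.
    by rewrite linear0; apply: lspan0.
  by rewrite linearP; apply: lspan_lin.
have split_wt h u m : U u -> weight_space h (u + i m) -> weight_space h u /\ weight_space h m.
  move=> Uu [n]; set T := fun y => _; have lT : linear T.
    by move=> c y z; rewrite /T (@Lop_lin _ _ W 0); lmod.
  have Ui x : U x -> U (iter n T x).
    by elim: n => //= n IH /IH ux; apply: subB => //; [apply: sub_Lop|rewrite -[h *: _]addr0; apply: submodP => //; apply: submod0].
  rewrite (linD (iter_lin lT n)) -iter_shom => e.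
  have e' : iter n T u = - i (iter n (fun y => Lop 0 y - h *: y) m) by apply/eqP; rewrite -addr_eq0 e.
  have m0 : iter n (fun y => Lop 0 y - h *: y) m = 0.
    by apply: hz; rewrite -[i _]opprK -e' -sub0r; apply: subB; [done|apply: submod0|apply: Ui].
  by split; exists n => //; rewrite -[LHS]/(iter n T u) e' m0 linear0 oppr0.
exists U'; split=> //; split=> //.
- by apply: (gen _ (fun m => exists h, weight_space h m)) => // m [h hm]; exists h; apply: weight_shom.
- move=> h; have [s [sU hs]] := hf h; have [t ht] := fd h.
  exists (s ++ map i t); split=> [y|_ [u [_ [Uu [m <-] ->]]] /(split_wt _ _ _ Uu)[hu hm]].
    by rewrite mem_cat => /orP[/sU/iU//|/mapP[m _ ->]].
  rewrite -[u]scale1r; apply: in_span_lin.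
    by apply: (@in_span_map _ W W id s) (hs _ Uu hu) => // y hy; apply: in_span_mem; rewrite mem_cat hy.
  apply: (@in_span_map _ M W i t) (ht _ hm); first exact: linearP.
  by move=> y hy; apply: in_span_mem; rewrite mem_cat (map_f i hy) orbT.
- move=> h; have [N1 h1] := hb h; have [N2 h2] := lb h; exists (maxn N1 N2) => n.
  rewrite geq_max => /andP[n1 n2] _ [u [_ [Uu [m <-] ->]]] /(split_wt _ _ _ Uu)[hu hm].
  by rewrite (h1 n n1 _ Uu hu) (h2 n n2 _ hm) linear0 addr0.
- apply: FLS hF hU' iU _ => T hT sT Ts; have [h|h] := irM.2 _ (sub_preim i hT).
    left=> x Tx; have [u [_ [Uu [m <-] e]]] := Ts x Tx.
    suff m0 : m = 0 by rewrite e m0 linear0 addr0.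
    by apply: h; rewrite -(addKr u (i m)) -e addrC; apply: (subB hT Tx); apply: sT.
  by right=> _ [u [_ [/sT ? [m <-] ->]]]; rewrite -[u]scale1r; apply: submodP.
- apply: (gen _ (fun m => exists a : C, w GN 0 m = a *: m)) => // m [a e]; exists a.
  by have := shom_w i GN 0 m; rewrite andbF sgn0 scale1r => <-; rewrite e linearZ.
- apply: (gen _ (fun m => exists a : C, w GE 0 m = a *: m)) => // m [a e]; exists a.
  by have := shom_w i GE 0 m; rewrite andbF sgn0 scale1r => <-; rewrite e linearZ.
Qed.

Lemma IndO_cover (W : vmod V) : (forall x : W, exists U : W -> Prop, OfinP U /\ U x) -> IndO J W.
Proof.
move=> h; split=> x; have [U [oU Ux]] := h x.
  apply: lspan_spanned => [c y [k hy]|].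
    by exists k; rewrite -[c *: y]addr0; apply: weight_lin hy (weight0 _ _).
  by apply: lspan_sub (op_gen oU Ux) => y [_ hy]; apply: lspan_gen.
have hU := op_sub oU; exists (subvmod hU), (subinc hU); split; first exact: OfinP_Ofin.
- exact: subinc_inj.
- exact: subinc_im.
Qed.

Lemma fsum_seq (W : nmodType) (F : int -> W) (L : seq int) : uniq L -> (forall m, m \notin L -> F m = 0) ->
  \sum_(m \in [set: int]) F m = \sum_(m <- L) F m.
Proof.
move=> uL h; rewrite (fsbigE L) //; last by move=> m _; apply: h.
by apply: eq_bigl => m; rewrite in_setT.
Qed.

Lemma IndO_dsum (W : vmod V) (M : int -> vmod V) : is_direct_sum W M ->
  (forall m, irreducible (M m) /\ Ofin J (M m)) -> IndO J W.
Proof.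
move=> [p [i h]] hM; apply: IndO_cover => x; have [y [[fy ->] _]] := h x.
have [L] := (finite_seqP _).1 fy; move=> /seteqP[LL _].
rewrite (@fsum_seq _ _ (undup L)) ?undup_uniq //; last first.
  move=> m; rewrite mem_undup => mL; have [->|/eqP ym] := eqVneq (y m) 0; first by rewrite linear0.
  by move: mL; rewrite (LL m ym).
elim: (undup L) => [|m s [U [oU Us]]].
  by rewrite big_nil; exists (fun x => x = 0); split=> //; apply: OfinP_zero.
have [irm om] := hM m; have [U' [oU' UU' iU']] := OfinP_add (i m) oU irm om.
exists U'; split=> //; rewrite big_cons -[i m _]scale1r.
by apply: (submodP (op_sub oU')) => //; apply: UU'.
Qed.
End Categories.

(** * Leading coefficients of intertwining operators *)

Section Descend.
Variable R : realType.
Local Notation C := (R[i]).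
Variables (W : lmodType C) (U : W -> Prop) (z : C -> nat -> W) (q0 : C) (c : nat -> C).
Hypothesis U0 : U 0.
Hypothesis Ul : forall (a : C) x y, U x -> U y -> U (a *: x + y).
Hypothesis c0 : forall k, c k != 0.
Hypothesis trunc : forall q, exists N : nat, forall n k, (N <= n)%N -> z (q + n%:R) k = 0.
Hypothesis logz : forall q, exists K : nat, forall k, (K <= k)%N -> z q k = 0.
Hypothesis step : forall q, (forall i k, U (z (q + 1 + i%:R) k)) ->
  forall k, U ((q - q0) *: z q k - c k *: z q k.+1).

Let UZ (a : C) x : U x -> U (a *: x). Proof. by move=> h; rewrite -[_ *: _]addr0; apply: Ul. Qed.
Let UV (a : C) x : a != 0 -> U (a *: x) -> U x.
Proof. by move=> a0 /(UZ a^-1); rewrite scalerA mulVf // scale1r. Qed.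

(** High powers of the logarithm are absent, so one descends in k; for q different from q0 the
    factor q - q0 can be divided out. *)
Lemma descend_step q : (forall i k, U (z (q + 1 + i%:R) k)) -> q <> q0 -> forall k, U (z q k).
Proof.
move=> h /eqP qq; have [K hK] := logz q.
suff g j k : (K <= k + j)%N -> U (z q k) by move=> k; apply: (g K); lia.
elim: j k => [|j IH] k hk; first by rewrite hK //; lia.
apply: (@UV (q - q0)); first by rewrite subr_eq0.
rewrite -[_ *: _](subrK (c k *: z q k.+1)) -[_ - _]scale1r; apply: Ul; first exact: step.
by apply/UZ/IH; lia.
Qed.

Lemma descend_off q : (forall n : nat, q + n%:R <> q0) -> forall k, U (z q k).
Proof.
move=> hq; have [N hN] := trunc q.
suff g j n : (N <= n + j)%N -> forall k, U (z (q + n%:R) k) by rewrite -[q]addr0; apply: (g N 0%N); lia.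
elim: j n => [|j IH] n hn k; first by rewrite hN //; lia.
apply: descend_step => // i k'.
rewrite (_ : q + n%:R + 1 + i%:R = q + (n + i).+1%:R); first by apply: IH; lia.
by rewrite -addn1 !natrD; ring.
Qed.

Lemma descend_above n k : U (z (q0 + 1 + n%:R) k).
Proof.
apply: descend_off => i /eqP; rewrite -!addrA addrC -subr_eq0 addrK => /eqP.
by rewrite -natrD -[1]/(1%:R) -natrD => /eqP; rewrite pnatr_eq0.
Qed.

(** At q = q0 the first term of [step] disappears and leaves the coefficient of the next power of
    the logarithm. *)
Lemma descend_log k : U (z q0 k.+1).
Proof.
have := step (fun i k => descend_above i k) k; rewrite subrr scale0r sub0r -scaleNr.
by apply: UV; rewrite oppr_eq0.
Qed.

Lemma descend_all : U (z q0 0) -> forall q k, U (z q k).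
Proof.
move=> u0 q; have [[n hn]|nq] := pselect (exists n : nat, q + n%:R = q0); last first.
  by apply: descend_off => n hn; apply: nq; exists n.
have -> : q = q0 - n%:R by rewrite -hn addrK.
elim/ltn_ind: n {q hn} => -[|n] IH k; first by rewrite subr0; case: k => // k; apply: descend_log.
apply: descend_step => [i k'|/eqP]; last first.
  by rewrite -subr_eq0 addrAC subrr add0r oppr_eq0 pnatr_eq0.
have [le|lt] := leqP i n.
  rewrite (_ : _ + i%:R = q0 - (n - i)%:R); first by apply: IH; lia.
  by rewrite natrB // -[n.+1]addn1 natrD; ring.
rewrite (_ : _ + i%:R = q0 + 1 + (i - n.+1)%:R); first exact: descend_above.
by rewrite natrB // -[n.+1]addn1 natrD; ring.
Qed.
End Descend.

(** * The first-order equation satisfied by products with extremal vectors *)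

Section Leading.
Variable R : realType.
Local Notation C := (R[i]).
Local Notation sgn := (sgn R).
Variables (V : vosa R) (J : {linear gl11 R -> V}).
Hypothesis HV : is_V1gl11 J.
Local Notation w := (Wop J).
Local Notation al := (alpha J).

Definition alv : V := J ((- 2) *: glN R - glE R).

Lemma alphaE (W : vmod V) r (x : W) : al r x = act alv r x.
Proof.
rewrite /alpha /alv linearB linearZ /=.
have la := @act_linl _ _ W r x.
rewrite (linD la) -[- J _]scaleN1r (linZ la (-1)) scaleN1r; congr (_ - _).
exact/esym/(linZ la).
Qed.

Lemma alv_even : parity false alv.
Proof.
apply: (J_parity HV); rewrite /parity linearB linearZ sgn0 scale1r.
have h g : gpar g = false -> sg (gl11 R) (glv R g) = glv R g.
  by move=> e; have := glv_parity R g; rewrite /parity e sgn0 scale1r.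
by have := h GN erefl; have := h GE erefl; rewrite /= => -> ->.
Qed.

Lemma alpha_lin (W : vmod V) r : linear (@alpha R V J W r).
Proof. by move=> c x y; rewrite !alphaE act_linr. Qed.

Lemma alpha_shom p (W1 W2 : vmod V) (f : shom p W1 W2) r x : f (al r x) = al r (f x).
Proof. by rewrite !alphaE (shf_act f _ _ alv_even) andbF sgn0 scale1r. Qed.

Lemma alpha_sub (W : vmod V) (U : W -> Prop) r x : actsub U -> U x -> U (al r x).
Proof. by move=> hU ux; rewrite alphaE; apply: actsub_act. Qed.

(** The part of the highest-weight condition that involves only L_0 and the Heisenberg modes of
    alpha. It is inherited by leading coefficients, see [left_Hw]. *)
Record Hw (lam D : C) (W : vmod V) (x : W) : Prop := HwMk {
  Hw_pos : forall r : int, 0 < r -> al r x = 0;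
  Hw_0 : al 0 x = lam *: x;
  Hw_L0 : Lop 0 x = D *: x }.

Record Ext (m : int) (W : vmod V) (x : W) : Prop := ExtMk {
  Ext_Hw : Hw (4 * m%:~R) (2 * m%:~R ^+ 2) x;
  Ext_L : Lop (-1) x = m%:~R *: al (-1) x }.

Lemma Hw_shom p (W1 W2 : vmod V) (f : shom p W1 W2) lam D x : Hw lam D x -> Hw lam D (f x).
Proof.
by move=> [h1 h2 h3]; split=> [r /h1 e||]; rewrite -?alpha_shom -?shom_Lop ?e ?h2 ?h3 ?linear0 ?linearZ.
Qed.

Lemma Ext_shom p (W1 W2 : vmod V) (f : shom p W1 W2) m x : Ext m x -> Ext m (f x).
Proof. by move=> [h1 h2]; split; [apply: Hw_shom|rewrite -shom_Lop h2 linearZ /= alpha_shom]. Qed.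

Lemma FH_Hw (W : vmod V) nu e (x : W) : FH (@w W) 0 nu e x ->
  Hw (- 2 * nu - e) ((nu - 2^-1) * e + 2^-1 * e ^+ 2) x.
Proof.
move=> fx; split=> [r r0||]; last exact: (FH_top HV fx).
  by have [eN eE] := FH_NE fx r0; rewrite /alpha eN eE scaler0 subr0.
by rewrite /alpha (FH_N0 fx) (FH_E0 fx) scalerA -scalerBl.
Qed.

Lemma extremal_Ext (W : vmod V) m b (x : W) : irreducible W -> extremal J m x -> x <> 0 -> parity b x -> Ext m x.
Proof.
move=> irr ex x0 px; split; last exact: (extremal_deriv HV irr ex x0 px).
have fx := ex_FH ex; split=> [r r0||]; last exact: ex_L0 ex.
  by have [eN eE] := FH_NE fx r0; rewrite /alpha eN eE scaler0 subr0.
by rewrite /alpha (FH_N0 fx) (FH_E0 fx) scalerA -scalerBl; congr (_ *: _); rewrite -mulr_natr; ring.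
Qed.

Section Intw.
Variables (p : bool) (W1 W2 W3 : vmod V) (I : intw p W1 W2 W3).
Local Notation HI := (jop_intw I).

Lemma I_comm v (r : int) h k w1 w2 N0 : parity false v -> (forall i : nat, (N0 <= i)%N -> act v i w1 = 0) ->
  act v r (I w1 h k w2) = I w1 h k (act v r w2)
    + \sum_(i < N0) cbin r%:~R i *: I (act v i w1) (r%:~R + h - i%:R) k w2.
Proof.
move=> pv hN; have := @jop_comm _ _ _ _ _ _ _ _ (HI k) false v w1 w2 r h N0 pv hN.
by rewrite andbF sgn0 scale1r => <-; rewrite addrC subrK.
Qed.

Lemma I_alpha lam D w1 r h k w2 : Hw lam D w1 ->
  al r (I w1 h k w2) = I w1 h k (al r w2) + lam *: I w1 (r%:~R + h) k w2.
Proof.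
move=> [hp h0 _]; rewrite !alphaE (@I_comm alv r h k w1 w2 1 alv_even) => [|i hi]; last first.
  by rewrite -alphaE hp //; lia.
rewrite big_ord1 cbin0 scale1r subr0 /= -alphaE.
by rewrite -[act alv _ w1]/(act alv 0 w1) -alphaE h0 (linZ (lfun_linl I _ _ _)).
Qed.

Lemma omega_par : parity false (omega V). Proof. by rewrite /parity omega_even sgn0 scale1r. Qed.

Lemma I_comm0 v h k w1 w2 : parity false v ->
  act v 0 (I w1 h k w2) = I w1 h k (act v 0 w2) + I (act v 0 w1) h k w2.
Proof.
move=> pv; have [N0 h0] := act_trunc_ge v 0 w1.
rewrite (@I_comm v 0 h k w1 w2 N0.+1 pv) => [|i hi]; last by rewrite -[i%:Z]add0r h0 //; lia.
rewrite big_ord_recl big1 => [|i _]; last by rewrite mulr0z cbin0n scale0r.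
by rewrite cbin0 scale1r subr0 add0r addr0.
Qed.

Lemma I_L1 w1 h k w2 : Lop (-1) (I w1 h k w2) =
  I w1 h k (Lop (-1) w2) - h *: I w1 (h - 1) k w2 + k.+1%:R *: I w1 (h - 1) k.+1 w2.
Proof.
have := I_comm0 h k w1 w2 omega_par; rewrite -[act _ 0 w1]/(Lop (-1) w1) lfun_deriv => e.
by rewrite /Lop [act _ _ _]e; lmod.
Qed.

Lemma I_L0 w1 h k w2 : Lop 0 (I w1 h k w2) =
  I w1 h k (Lop 0 w2) + I (Lop 0 w1) h k w2 - (h + 1) *: I w1 h k w2 + k.+1%:R *: I w1 h k.+1 w2.
Proof.
have [N0 h0] := act_trunc_ge (omega V) 0 w1.
have := @I_comm (omega V) 1 h k w1 w2 N0.+2 omega_par; rewrite 2!big_ord_recl big1 => [e|i _]; last first.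
  by rewrite (@cbin_nat R 1) bin_small ?scale0r.
rewrite /Lop [LHS]e => [|i hi]; last by rewrite -[i%:Z]add0r h0 //; lia.
rewrite cbin0 (@cbin_nat R 1) bin1 !scale1r subr0 addr0 /=.
rewrite -[act (omega V) _ w1]/(Lop (-1) w1) -[act (omega V) (Posz (bump 0 0)) w1]/(Lop 0 w1) lfun_deriv.
rewrite (_ : 1%:~R + h - 1 = h); last by rewrite [1%:~R + h]addrC addrK.
by rewrite /Lop add0r [1%:~R + h]addrC; lmod.
Qed.

Lemma I_E0 w1 h k w2 : w GE 0 (I w1 h k w2) = I w1 h k (w GE 0 w2) + I (w GE 0 w1) h k w2.
Proof. by apply: I_comm0; apply: (J_parity HV); exact: (glv_parity R GE). Qed.

Lemma I_parity a b w1 h k w2 : parity a w1 -> parity b w2 -> parity (p (+) (a (+) b)) (I w1 h k w2).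
Proof.
rewrite /parity => pa pb; rewrite lfun_sg pa pb (linZ (lfun_linr I _ _ _)) (linZ (lfun_linl I _ _ _)) !scalerA !sgn_addb.
by congr (_ *: _); ring.
Qed.

Section Tops.
Variables (lam D : C) (m : int).
Let q0 : C := - 1 - m%:~R * lam.

Section LeftExt.
Variables (e : W1) (x : W2).
Hypothesis he : Ext m e.
Hypothesis hx : Hw lam D x.

(** Coefficients of the equation d/dx Y(e, x) x = m Y(alpha_{-1} e, x) x. The left side is the
    derivative property, the right side the iterate formula; alpha_0 on the highest-weight vector
    contributes lam and thereby fixes the exponent [q0]. *)
Lemma left_rec q k : exists N0, forall N, (N0 <= N)%N ->
  (q - q0) *: I e q k x - k.+1%:R *: I e q k.+1 x
  = - m%:~R *: \sum_(i < N) al (- i.+1%:Z) (I e (q + 1 + i%:R) k x).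
Proof.
have [N0 h0] := @jop_iter _ _ _ _ _ _ _ _ (HI k) false alv e x (-1) (q + 1) alv_even.
exists N0.+1 => -[//|N] hN; have := h0 N.+1 ltac:(lia).
rewrite -alphaE; under eq_bigr => i _.
  rewrite [in cbin _ _](_ : (-1)%:~R = -1 :> C) // cbinN1 -exprMn mulrNN mulr1 expr1n scale1r.
  rewrite andbF sgn0 scale1r -!alphaE (_ : (-1 : C) ^ (-1) = -1); last by rewrite exprN1 invrN1.
  rewrite scaleN1r opprK (_ : -1 - i%:Z = - i.+1%:Z); last by lia.
  over.
rewrite big_split /= => e1; rewrite [X in _ = _ + X](_ : _ = lam *: I e q k x) in e1.
  have := congr1 (fun y => m%:~R *: y) e1; rewrite /= -(linZ (lfun_linl I _ _ _)) -(Ext_L he) lfun_deriv addrK.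
  move=> e2; rewrite scalerDr in e2; rewrite scaleNr.
  rewrite (_ : m%:~R *: \sum_(i < N.+1) _ = - (q + 1) *: I e q k x + k.+1%:R *: I e q k.+1 x - m%:~R *: (lam *: I e q k x)).
    by rewrite /q0; lmod.
  by rewrite e2 addrK.
rewrite big_ord_recl big1 ?addr0; last by move=> i _; rewrite (Hw_pos hx) ?(lin0 (lfun_linr I _ _ _)) // ltz_nat.
rewrite (Hw_0 hx) (linZ (lfun_linr I _ _ _)) subr0; congr (_ *: I e _ k x); rewrite (_ : (-1)%:~R = -1 :> C) //; ring.
Qed.

Lemma left_step (U : W3 -> Prop) q : actsub U -> (forall i k, U (I e (q + 1 + i%:R) k x)) ->
  forall k, U ((q - q0) *: I e q k x - k.+1%:R *: I e q k.+1 x).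
Proof.
move=> hU h k; have [N0 /(_ N0 (leqnn _)) ->] := left_rec q k.
apply: actsubZ => //; apply: actsub_sum => // i _; exact: alpha_sub.
Qed.
End LeftExt.

Section RightExt.
Variables (x : W1) (e : W2).
Hypothesis he : Ext m e.
Hypothesis hx : Hw lam D x.

(** With the extremal vector in the second place, L_{-1} and alpha_{-1} are commuted through Y(x)
    and their results compared by L_{-1} e = m alpha_{-1} e. *)
Lemma right_step (U : W3 -> Prop) q : actsub U -> (forall i k, U (I x (q + 1 + i%:R) k e)) ->
  forall k, U ((q - q0) *: I x q k e - k.+1%:R *: I x q k.+1 e).
Proof.
move=> hU h k; have := I_L1 x (q + 1) k e; rewrite addrK (Ext_L he) (linZ (lfun_linr I _ _ _)) => e1.
have := I_alpha (-1) (q + 1) k e hx; rewrite (_ : (-1)%:~R + (q + 1) = q); last first.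
  by rewrite (_ : (-1)%:~R = -1 :> C) //; ring.
move=> e2; rewrite (_ : _ - _ = m%:~R *: al (-1) (I x (q + 1) k e) - Lop (-1) (I x (q + 1) k e)).
  have h0 : U (I x (q + 1) k e) by have := h 0%N k; rewrite addr0.
  apply: actsubP => //; [exact: alpha_sub|apply: actsubN => //; exact: actsub_act].
by rewrite e1 e2 /q0; lmod.
Qed.
End RightExt.
End Tops.
End Intw.

(* Shared by [z q k = Y(e)_(q, k) x] and [z q k = Y(x)_(q, k) e], for [e] extremal. *)
Section LeadingTerms.
Variables (W3 : vmod V) (z : C -> nat -> W3) (q0 : C).
Record leading : Prop := Leading {
  ld_trunc : forall q, exists N : nat, forall n k, (N <= n)%N -> z (q + n%:R) k = 0;
  ld_log : forall q, exists K : nat, forall k, (K <= k)%N -> z q k = 0;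
  ld_step : forall (U : W3 -> Prop) q, actsub U -> (forall i k, U (z (q + 1 + i%:R) k)) ->
    forall k, U ((q - q0) *: z q k - k.+1%:R *: z q k.+1) }.
Hypothesis H : leading.
Let n0 k : k.+1%:R != 0 :> C. Proof. exact: natC_neq0. Qed.
Let actsub_zero : actsub (fun x : W3 => x = 0) := submodule_actsub (@sub_zero _ _ W3).

Lemma ld_off q k : (forall n : nat, q + n%:R <> q0) -> z q k = 0.
Proof.
move=> h; apply: (@descend_off _ _ (fun x => x = 0) z q0 (fun k => k.+1%:R)) => //; [|exact: ld_trunc|exact: ld_log|].
  by move=> a x y -> ->; rewrite scaler0 addr0.
by move=> q' h'; exact: (ld_step H actsub_zero h').
Qed.

Lemma ld_above n k : z (q0 + n.+1%:R) k = 0.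
Proof.
rewrite -add1n natrD addrA.
apply: (@descend_above _ _ (fun x => x = 0) z q0 (fun k => k.+1%:R)) => //; [|exact: ld_trunc|exact: ld_log|].
  by move=> a x y -> ->; rewrite scaler0 addr0.
by move=> q' h'; exact: (ld_step H actsub_zero h').
Qed.

Lemma ld_top k : z q0 k.+1 = 0.
Proof.
apply: (@descend_log _ _ (fun x => x = 0) z q0 (fun k => k.+1%:R)) => //; [|exact: ld_trunc|exact: ld_log|].
  by move=> a x y -> ->; rewrite scaler0 addr0.
by move=> q' h'; exact: (ld_step H actsub_zero h').
Qed.

Lemma ld_all (U : W3 -> Prop) : actsub U -> U (z q0 0) -> forall q k, U (z q k).
Proof.
move=> hU u0; apply: (@descend_all _ _ U z q0 (fun k => k.+1%:R)) => //.
- exact: actsub0.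
- by move=> a x y; apply: actsubP.
- exact: ld_trunc.
- exact: ld_log.
- by move=> q h k; apply: ld_step.
Qed.
End LeadingTerms.

(** Index of the leading coefficient: index q belongs to the power x^(-q-1), here to x^(m lam). *)
Definition top lam (m : int) : C := - 1 - m%:~R * lam.

Section Lead.
Variables (p : bool) (W1 W2 W3 : vmod V) (I : intw p W1 W2 W3) (lam D : C) (m : int).

Lemma leading_left e x : Ext m e -> Hw lam D x -> leading (fun q k => I e q k x) (top lam m).
Proof.
move=> he hx; split; [by move=> q; apply: lfun_trunc|by move=> q; apply: lfun_log|].
by move=> U q hU h k; have := left_step he hx hU h k.
Qed.

Lemma leading_right x e : Ext m e -> Hw lam D x -> leading (fun q k => I x q k e) (top lam m).
Proof.
move=> he hx; split; [by move=> q; apply: lfun_trunc|by move=> q; apply: lfun_log|].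
by move=> U q hU h k; have := right_step he hx hU h k.
Qed.

Variables (e : W1) (x : W2).
Hypothesis he : Ext m e.
Hypothesis hx : Hw lam D x.
Local Notation ld := (leading_left he hx).

(** [ld_top] removes the logarithms at the leading index; the descent is then run on the family with
    k shifted by one and the zero subspace. *)
Lemma left_nolog q k : I e q k.+1 x = 0.
Proof.
have Ul : forall (a : C) (u v : W3), u = 0 -> v = 0 -> a *: u + v = 0.
  by move=> a u v -> ->; rewrite scaler0 addr0.
apply: (@descend_all _ _ (fun y => y = 0) (fun q k => I e q k.+1 x) (top lam m) (fun k => k.+2%:R)) => //.
- by move=> k'; exact: natC_neq0.
- by move=> q'; have [N hN] := lfun_trunc I e q' x; exists N => n k' hn; apply: hN.
- by move=> q'; have [K hK] := lfun_log I e q' x; exists K => k' hk; apply: hK; lia.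
- move=> q' h k'; have [N0 /(_ N0 (leqnn _)) ->] := left_rec I he hx q' k'.+1.
  by rewrite big1 ?scaler0 // => i _; rewrite h (lin0 (@alpha_lin _ _)).
- exact: (ld_top ld 0).
Qed.

(** Recursion for the coefficients of exp(m sum_{r > 0} alpha_{-r} x^r / r) applied to the leading
    coefficient. *)
Lemma left_tower i : i%:R *: I e (top lam m - i%:R) 0 x
  = m%:~R *: \sum_(r < i) al (- r.+1%:Z) (I e (top lam m - (i - r.+1)%:R) 0 x).
Proof.
have [N0 /(_ (N0 + i)%N (leq_addr _ _))] := left_rec I he hx (top lam m - i%:R) 0.
rewrite left_nolog scaler0 subr0 addrAC subrr add0r scaleNr scaleNr => /oppr_inj ->; congr (_ *: _).
rewrite (@sum_widen _ (fun r => al (- r.+1%:Z) (I e (top lam m - i%:R + 1 + r%:R) 0 x)) i); first last.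
- move=> r hr; rewrite (_ : _ + r%:R = top lam m + (r - i).+1%:R); last first.
    by rewrite -[(r - i).+1]addn1 natrD natrB //; ring.
  by rewrite (ld_above ld) (lin0 (@alpha_lin _ _)).
- lia.
apply: eq_bigr => r _; congr (al _ (I e _ 0%N x)); rewrite natrB // -[r.+1]addn1 natrD; ring.
Qed.

Lemma left_L0 q : Lop 0 (I e q 0 x) = (D + 2 * m%:~R ^+ 2 - (q + 1)) *: I e q 0 x.
Proof.
rewrite I_L0 left_nolog (Hw_L0 hx) (Hw_L0 (Ext_Hw he)) (linZ (lfun_linr I _ _ _)) (linZ (lfun_linl I _ _ _)); lmod.
Qed.

Lemma left_Hw : Hw (lam + 4 * m%:~R) (D + 2 * m%:~R ^+ 2 + m%:~R * lam) (I e (top lam m) 0 x).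
Proof.
split=> [r r0||]; last by rewrite left_L0; congr (_ *: _); rewrite /top; ring.
  rewrite (I_alpha I r _ 0 x (Ext_Hw he)) (Hw_pos hx r0) (lin0 (lfun_linr I _ _ _)) add0r.
  have [n ->] : exists n : nat, r = n.+1 by exists `|r|.-1%N; lia.
  by rewrite addrC -[(Posz n.+1)%:~R]/(n.+1%:R : C) (ld_above ld) scaler0.
by rewrite (I_alpha I 0 _ 0 x (Ext_Hw he)) (Hw_0 hx) (linZ (lfun_linr I _ _ _)) add0r -scalerDl.
Qed.
End Lead.

(** L_{-1} of the leading coefficient involves the next one, which is m alpha_{-1} of the leading
    one by [left_tower], and Y(e) applied to alpha_{-1} e', which [I_alpha] evaluates. The total is
    (m + m') alpha_{-1}. *)
Lemma left_Ext p (W1 W2 W3 : vmod V) (I : intw p W1 W2 W3) m m' e e' : Ext m e -> Ext m' e' ->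
  Ext (m + m') (I e (top (4 * m'%:~R) m) 0 e').
Proof.
move=> he he'; have [h1 h2 h3] := left_Hw I he (Ext_Hw he'); set y := I e _ _ _ in h1 h2 h3 *.
split; first by split=> //; rewrite ?h2 ?h3 intrD; congr (_ *: _); ring.
have tw1 : I e (top (4 * m'%:~R) m - 1) 0 e' = m%:~R *: al (-1) y.
  by have := left_tower I he (Ext_Hw he') 1; rewrite scale1r big_ord1 subnn subr0.
rewrite /y I_L1 (left_nolog I he (Ext_Hw he')) scaler0 addr0 (Ext_L he') (linZ (lfun_linr I _ _ _)) -/y.
have := I_alpha I (-1) (top (4 * m'%:~R) m) 0 e' (Ext_Hw he); rewrite -/y.
rewrite [_ + top _ _]addrC -[top _ _ + _]/(top _ _ - 1%:R) tw1 => e2.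
have -> : I e (top (4 * m'%:~R) m) 0 (al (-1) e') = al (-1) y - (4 * m%:~R) *: (m%:~R *: al (-1) y).
  by apply/eqP; rewrite eq_sym subr_eq; apply/eqP.
by rewrite intrD /top; lmod.
Qed.
End Leading.

(** * Generators of tensor products *)

Section TensorGen.
Variable R : realType.
Local Notation C := (R[i]).
Local Notation sgn := (sgn R).
Variables (V : vosa R) (J : {linear gl11 R -> V}).
Hypothesis HV : is_V1gl11 J.

Lemma intw_corestrict p (W1 W2 W3 : vmod V) (I : intw p W1 W2 W3) (K : W3 -> Prop) (hK : submodule K) :
  (forall a h k b, K (I a h k b)) ->
  exists I' : intw p W1 W2 (subvmod hK), forall a h k b, subinc hK (I' a h k b) = I a h k b.
Proof.
move=> hI; pose F a h k b : subvmod hK := ssmk (submod_subsp hK) (hI a h k b).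
have inj := @subinc_inj _ _ _ _ hK; pose inc := subinc hK.
have incF a h k b : inc (F a h k b) = I a h k b by [].
have f1 h k b : linear (fun a => F a h k b) by move=> c x y; apply: inj; rewrite linearP -!/inc !incF lfun_linl.
have f2 a h k : linear (F a h k) by move=> c x y; apply: inj; rewrite linearP -!/inc !incF lfun_linr.
have f3 a h k b : sg _ (F a h k b) = sgn p *: F (sg _ a) h k (sg _ b).
  by apply: inj; rewrite shom0_sg linearZ -!/inc !incF lfun_sg.
have f4 a h b : exists N : nat, forall k, (N <= k)%N -> F a h k b = 0.
  by have [N hN] := lfun_log I a h b; exists N => k hk; apply: inj; rewrite linear0 -/inc incF hN.
have f5 a h b : exists N : nat, forall n k, (N <= n)%N -> F a (h + n%:R) k b = 0.
  by have [N hN] := lfun_trunc I a h b; exists N => n k hk; apply: inj; rewrite linear0 -/inc incF hN.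
have f6 k : jacobi (act (v0 := W1)) (act (v0 := W2)) (act (v0 := subvmod hK)) p (fun a h b => F a h k b).
  move=> a b v w1 av bw1 w2 m n h; apply: inj.
  have hl (f : nat -> subvmod hK) : (exists N, forall i, (N <= i)%N -> f i = 0) ->
      inc (\sum_(i \in [set: nat]) f i) = \sum_(i \in [set: nat]) inc (f i).
    case=> N hN; rewrite (fsumE hN) (@fsumE _ (fun i => inc (f i)) N); first by rewrite linear_sum.
    by move=> i /hN ->; rewrite linear0.
  have [N1 h1] := act_trunc_ge v n w1.
  have [N2 h2] := lfun_trunc I w1 h w2.
  have [N3 h3] := act_trunc_ge v m w2.
  rewrite -!/inc !hl; first exact: (@lfun_jacobi _ _ _ _ _ _ I k a b v w1 av bw1 w2 m n h).
  - exists (N2 + N3)%N => i hi.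
    have -> : F w1 (h + i%:R) k w2 = 0 by apply: val_inj; apply: h2; lia.
    rewrite h3; last lia.
    by rewrite (lin0 (f2 _ _ _)) (lin0 (act_linr _ _)) !scaler0 subr0 scaler0.
  by exists N1 => i hi; rewrite h1 ?(lin0 (f1 _ _ _)) ?scaler0 //; lia.
have f7 a h k b : F (Lop (-1) a) h k b = - h *: F a (h - 1) k b + k.+1%:R *: F a (h - 1) k.+1 b.
  by apply: inj; rewrite linearD !linearZ -!/inc !incF lfun_deriv.
by exists (Intw f1 f2 f3 f4 f5 f6 f7).
Qed.

Variable T : vtensor (IndO J).
Local Notation "W1 ** W2" := (tens T W1 W2) (at level 40).

(** The intersection K of all such subspaces is a submodule and lies in the category by [IndO_sub].
    The universal map into K followed by the inclusion is the identity, by uniqueness. *)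
Lemma tens_span (W1 W2 : vmod V) (U : W1 ** W2 -> Prop) : IndO J W1 -> IndO J W2 -> actsub U ->
  (forall a h k b, U (tY T W1 W2 a h k b)) -> forall x, U x.
Proof.
move=> c1 c2 hU hY x.
pose K x := forall U : W1 ** W2 -> Prop, actsub U -> (forall a h k b, U (tY T W1 W2 a h k b)) -> U x.
suff Kx : K x by apply: Kx.
have hK : submodule K.
  split.
  - by move=> U' h _; apply: actsub0.
  - by move=> c y z hy hz U' h h'; apply: actsubP; [|apply: hy|apply: hz].
  - move=> y hy U' h h'; apply: (hy (fun y => U' (sg _ y))) => [|a q k b].
      split=> [|c u v hu hv|v n u hu]; first by rewrite linear0; apply: actsub0.
        by rewrite linearP; apply: actsubP.
      by rewrite act_sg; apply: actsub_act.
    by rewrite lfun_sg; apply: actsubZ.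
  - by move=> v n y hy U' h h'; apply: actsub_act => //; apply: hy.
have [I' hI'] := intw_corestrict hK (fun a h k b U' _ h' => h' a h k b).
have [f [fI _]] := tens_univ T I' c1 c2 (IndO_sub HV hK (tens_cat T c1 c2)).
have [g [_ gu]] := tens_univ T (tY T W1 W2) c1 c2 (tens_cat T c1 c2).
have e1 := gu (shid _) (fun _ _ _ _ => erefl) x.
have e2 : shomc (subinc hK) f x = g x by apply: gu => a h k b; rewrite /= fI; apply: hI'.
by have := subincP (f x); rewrite -[subinc hK (f x)]/(shomc (subinc hK) f x) e2 -e1.
Qed.

Section Gen.
Variables (W1 W2 : vmod V) (G1 : W1 -> Prop) (G2 : W2 -> Prop) (U : W1 ** W2 -> Prop).
Hypothesis c1 : IndO J W1.
Hypothesis c2 : IndO J W2.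
Hypothesis g1 : generates G1.
Hypothesis g2 : generates G2.
Hypothesis hU : actsub U.

Lemma gen_tens : (forall a b h k, G1 a -> G2 b -> U (tY T W1 W2 a h k b)) -> forall x, U x.
Proof.
move=> h; apply: tens_span => // a q k b; move: a q b.
apply: (jop_gen (jop_intw (tY T W1 W2) k) hU g1 g2) => a b q ga gb; exact: h.
Qed.

Lemma gen_left :
  (forall a b, G1 a -> G2 b -> exists m lam D,
     [/\ Ext J m a, Hw J lam D b & U (tY T W1 W2 a (top lam m) 0 b)]) -> forall x, U x.
Proof.
move=> h; apply: gen_tens => a b q k ga gb; have [m [lam [D [ea eb u]]]] := h a b ga gb.
exact: (ld_all (leading_left HV (tY T W1 W2) ea eb) hU u).
Qed.

Lemma gen_right :
  (forall a b, G1 a -> G2 b -> exists m lam D,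
     [/\ Hw J lam D a, Ext J m b & U (tY T W1 W2 a (top lam m) 0 b)]) -> forall x, U x.
Proof.
move=> h; apply: gen_tens => a b q k ga gb; have [m [lam [D [ea eb u]]]] := h a b ga gb.
exact: (ld_all (leading_right HV (tY T W1 W2) eb ea) hU u).
Qed.
End Gen.

Lemma eq_shom_actsub p q (W1 W2 : vmod V) (f : shom p W1 W2) (g : shom q W1 W2) : p = q ->
  actsub (fun x => f x = g x).
Proof.
move=> pq; split=> [|c x y hx hy|v n x hx]; rewrite ?linear0 ?linearP ?hx ?hy //.
rewrite (epartE v) (linD (act_linl n x)) !linearD /=.
by rewrite !(shf_act f _ _ (epart_parity _ _)) !(shf_act g _ _ (epart_parity _ _)) hx pq.
Qed.
End TensorGen.

(** * The associativity constraint on leading terms *)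

Section Limits.
Variable R : realType.
Local Notation C := (R[i]).

Definition lim1 (u : nat -> C) (s : C) := forall eps : C, 0 < eps ->
  exists n0, forall n, (n0 <= n)%N -> `|u n - s| < eps.

(** A finite set containing J0 may be enlarged by the first n points of the progression; points off
    the progression contribute 0. *)
Lemma csum_seq (F : C -> C) (c s : C) : csum F s -> (forall z, (forall i : nat, z <> c + i%:R) -> F z = 0) ->
  lim1 (fun n => \sum_(i < n) F (c + i%:R)) s.
Proof.
move=> hs hF eps e0; have [J0 hJ] := hs eps e0.
have [n0 hn0] : exists n0, forall z, z \in (J0 : seq C) -> forall i : nat, z = c + i%:R -> (i < n0)%N.
  elim: (J0 : seq C) => [|a l [n1 h1]]; first by exists 0%N.
  have [[i ei]|ni] := pselect (exists i : nat, a = c + i%:R).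
    exists (maxn n1 i.+1) => z; rewrite inE => /orP[/eqP ->|/h1 h] i' ei'; rewrite leq_max.
      by move: ei'; rewrite ei => /addrI/eqP; rewrite eqr_nat => /eqP <-; rewrite ltnSn orbT.
    by rewrite h.
  exists n1 => z; rewrite inE => /orP[/eqP ->|/h1 h] i' ei'; last exact: h.
  by case: ni; exists i'.
exists n0 => n hn; pose L := [seq c + i%:R | i <- iota 0 n].
have := hJ (J0 `|` [fset x in L])%fset (fsubsetUl _ _); rewrite (_ : \sum_(i <- _) _ = \sum_(i < n) F (c + i%:R)) //.
have uL : uniq L.
  rewrite map_inj_uniq ?iota_uniq // => i k /addrI/eqP; by rewrite eqr_nat => /eqP.
rewrite (bigID (mem L)) /= [X in _ + X]big1_seq ?addr0; last first.
  move=> z /andP[zL]; rewrite in_fsetU => /orP[zJ|]; last by rewrite !inE (negbTE zL).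
  apply: hF => i ei; case/negP: zL; apply/mapP; exists i => //.
  by rewrite mem_iota /=; apply: leq_trans (hn0 _ zJ _ ei) hn.
rewrite -big_filter (perm_big L) ?big_map; last first.
  apply: uniq_perm => //; first by rewrite filter_uniq ?fset_uniq.
  by move=> z; rewrite mem_filter in_fsetU !inE; case: (z \in L) => //=; rewrite orbT.
by rewrite -(subn0 n) -/(index_iota 0 n) big_mkord subn0.
Qed.

Lemma lim1_uniq u s s' : lim1 u s -> lim1 u s' -> s = s'.
Proof.
move=> h h'; apply/eqP; rewrite -subr_eq0 -normr_eq0; apply/negPn/negP => nz.
have e0 : 0 < `|s - s'| / 2 by rewrite divr_gt0 // lt_def nz normr_ge0.
have [n1 h1] := h _ e0; have [n2 h2] := h' _ e0.
have := h1 (maxn n1 n2) (leq_maxl _ _); have := h2 (maxn n1 n2) (leq_maxr _ _).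
set a := u _ => l2 l1.
have := ler_normD (s - a) (a - s'); rewrite addrA subrK [ `|s - a|]distrC.
move=> /le_lt_trans /(_ (ltrD l1 l2)); rewrite -mulr2n -[X in _ < X]mulr_natr divfK ?pnatr_eq0 // ltxx //.
Qed.

Lemma lim1_eq u v s : (exists N, forall n, (N <= n)%N -> u n = v n) -> lim1 u s -> lim1 v s.
Proof.
move=> [N h] hu eps e0; have [n0 h0] := hu eps e0; exists (maxn N n0) => n.
by rewrite geq_max => /andP[n1 n2]; rewrite -h // h0.
Qed.

Lemma lim1_shift u s : lim1 u s -> lim1 (fun n => u n.+1) s.
Proof. by move=> h eps /h[n0 h0]; exists n0 => n hn; apply: h0; lia. Qed.

Lemma lim1_unshift u s : lim1 (fun n => u n.+1) s -> lim1 u s.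
Proof. by move=> h eps /h[n0 h0]; exists n0.+1 => -[//|n] hn; apply: h0. Qed.

Lemma lim1_cst s : lim1 (fun=> s) s.
Proof. by move=> eps e0; exists 0%N => n _; rewrite subrr normr0. Qed.

Lemma lim1Z c u s : lim1 u s -> lim1 (fun n => c * u n) (c * s).
Proof.
move=> h eps e0; have [->|c0] := eqVneq c 0.
  by exists 0%N => n _; rewrite !mul0r subr0 normr0.
have cp : 0 < `|c| by rewrite normr_gt0.
have [n0 h0] := h _ (divr_gt0 e0 cp); exists n0 => n hn.
by rewrite -mulrBr normrM mulrC -ltr_pdivlMr // h0.
Qed.

Lemma lim1D u v s t : lim1 u s -> lim1 v t -> lim1 (fun n => u n + v n) (s + t).
Proof.
move=> hu hv eps e0; have e2 : 0 < eps / 2 by rewrite divr_gt0.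
have [n1 h1] := hu _ e2; have [n2 h2] := hv _ e2; exists (maxn n1 n2) => n.
rewrite geq_max => /andP[/h1 l1 /h2 l2]; rewrite opprD addrACA.
apply: le_lt_trans (ler_normD _ _) _; apply: lt_le_trans (ltrD l1 l2) _.
by rewrite (_ : eps / 2 + eps / 2 = eps) //; field.
Qed.

Definition binser (z x : C) n := \sum_(i < n) cbin z i * x ^+ i.

Lemma binserP z x n : binser (z + 1) x n.+1 = binser z x n.+1 + x * binser z x n.
Proof.
rewrite /binser !big_ord_recl !cbin0 -addrA; congr (_ + _).
rewrite mulr_sumr -big_split; apply: eq_bigr => i _ /=.
by rewrite -[bump 0 i]/(i.+1) cbinP exprS; ring.
Qed.

Lemma binser_lim z x s : lim1 (binser z x) s -> lim1 (binser (z + 1) x) ((1 + x) * s).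
Proof.
move=> h; apply: lim1_unshift; apply: (@lim1_eq (fun n => binser z x n.+1 + x * binser z x n)).
  by exists 0%N => n _; rewrite binserP.
by rewrite mulrDl mul1r; apply: lim1D; [apply: lim1_shift|apply: lim1Z].
Qed.

Lemma binser_limn z x s k : lim1 (binser z x) s -> lim1 (binser (z + k%:R) x) ((1 + x) ^+ k * s).
Proof.
elim: k z s => [|k IH] z s h; first by rewrite addr0 expr0 mul1r.
by rewrite -addn1 natrD addrA exprD expr1 [_ ^+ k * _]mulrC -mulrA; apply/binser_lim/IH.
Qed.

Lemma binser0 x : lim1 (binser 0 x) 1.
Proof.
apply: lim1_unshift; apply: lim1_eq (lim1_cst 1); exists 0%N => n _.
by rewrite /binser big_ord_recl big1 ?addr0 ?cbin0 ?mulr1 // => i _; rewrite cbin0n mul0r.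
Qed.

(** Convergence is part of the hypothesis, as the associativity axiom provides it. The limit is then
    found by Pascal's rule from exponent 0, for negative N by raising the exponent back to 0. *)
Lemma binser_int (N : int) x s : 1 + x != 0 -> lim1 (binser N%:~R x) s -> s = (1 + x) ^ N.
Proof.
move=> x0; case: N => n h.
  have := binser_limn n (binser0 x); rewrite add0r mulr1 => h'.
  by rewrite (lim1_uniq h h').
have := binser_limn n.+1 h; rewrite NegzE mulrNz addNr => h'.
have e := lim1_uniq h' (binser0 x).
by rewrite -exprnN; apply: (mulfI (expf_neq0 n.+1 x0)); rewrite e mulfV ?expf_neq0.
Qed.

Lemma binser_int_scaled (N : int) x K X s : 1 + x != 0 -> K != 0 ->
  lim1 (fun n => K * binser N%:~R x n * X) s -> s = K * (1 + x) ^ N * X.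
Proof.
move=> x0 K0 h; have [X0|X0] := eqVneq X 0.
  rewrite X0 mulr0 in h *; apply: lim1_uniq h _; apply: lim1_eq (lim1_cst 0).
  by exists 0%N => n _; rewrite mulr0.
have h' : lim1 (binser N%:~R x) ((K * X)^-1 * s).
  apply: lim1_eq (lim1Z (K * X)^-1 h); exists 0%N => n _.
  by field; rewrite K0 X0.
rewrite -(binser_int x0 h') invfM; field; by rewrite K0 X0.
Qed.

(** With a natural number M >= max(1, |z|) one has |C(z, i)| <= M^i, so at x = 1 / (4 M) the terms
    with i > 0 add up to at most 1/3 and cannot cancel the first term 1. *)
Lemma binser_nz (z : C) : exists x : R, 0 < x /\ x < 1 /\ ~ lim1 (binser z x%:C%C) 0.
Proof.
have [M [M1 hM]] : exists M : nat, (0 < M)%N /\ `|z| <= M%:R.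
  have h : 0 <= Num.sqrt (complex.Re z ^+ 2 + complex.Im z ^+ 2) := sqrtr_ge0 _.
  exists (Num.Def.archi_bound (Num.sqrt (complex.Re z ^+ 2 + complex.Im z ^+ 2))).+1; split=> //.
  rewrite normc_def -(rmorph_nat (real_complex R)) lecR.
  by apply: le_trans (ltW (archi_boundP h)) _; rewrite ler_nat.
have cb i : `|cbin z i| <= M%:R ^+ i.
  elim: i => [|i IH]; first by rewrite cbin0 normr1 expr0.
  have e : cbin z i.+1 = (z - i%:R) / i.+1%:R * cbin z i.
    by rewrite mulrAC -cbinS [_ * cbin _ _]mulrC mulfK ?natC_neq0.
  rewrite e normrM exprS ler_pM // normrM normfV normr_nat ler_pdivrMr ?ltr0n //.
  apply: le_trans (ler_normB _ _) _; rewrite normr_nat -natr1 mulrDr mulr1 addrC lerD //.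
  by rewrite -natrM ler_nat leq_pmull.
have M0 : (4 * M)%:R != 0 :> C by rewrite pnatr_eq0 muln_eq0 /= -lt0n.
exists ((4 * M)%:R^-1); split; [|split].
- by rewrite invr_gt0 ltr0n muln_gt0.
- by rewrite invf_lt1 ?ltr0n ?muln_gt0 //= ltr1n; lia.
have -> : (((4 * M)%:R^-1 : R)%:C)%C = (4 * M)%:R^-1 :> C by rewrite fmorphV rmorph_nat.
move=> h; have q0 : 0 < 4^-1 :> C by rewrite invr_gt0 ltr0n.
have [n0 /(_ n0.+1 (leqnSn _))] := h _ q0; rewrite subr0.
rewrite /binser big_ord_recl cbin0 mul1r expr0; set S := \sum_(i < n0) _.
have hS : `|S| <= 3^-1.
  apply: le_trans (ler_norm_sum _ _ _) _.
  have t i : `|cbin z (lift ord0 i) * (4 * M)%:R^-1 ^+ (lift (@ord0 n0) i)| <= 4^-1 ^+ i.+1.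
    rewrite lift0 normrM normrX normfV normr_nat.
    apply: le_trans (ler_wpM2r _ (cb _)) _; first by rewrite exprn_ge0 // invr_ge0 ler0n.
    rewrite -exprMn natrM invfM mulrCA mulfV ?mulr1 // pnatr_eq0 -lt0n //.
  apply: le_trans (ler_sum _ (fun i _ => t i)) _.
  suff -> : \sum_(i < n0) 4^-1 ^+ i.+1 = 3^-1 - 3^-1 * 4^-1 ^+ n0 :> C.
    by rewrite lerBlDr lerDl mulr_ge0 ?exprn_ge0 // invr_ge0 ler0n.
  elim: (n0) => [|n IH]; first by rewrite big_ord0 expr0 mulr1 subrr.
  by rewrite big_ord_recr /= IH exprS; field.
move=> h1; have := lerB_normD 1 S; rewrite normr1 => h2.
have h3 : 1 - 3^-1 < 4^-1 :> C.
  by apply: le_lt_trans h1; apply: le_trans h2; rewrite lerD2l lerN2.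
have h4 : (8 : C) < 3.
  have := h3; rewrite -(ltr_pM2r (_ : 0 < 12 :> C)) ?ltr0n //.
  rewrite (_ : (1 - 3^-1) * 12 = 8); last by field.
  by rewrite (_ : 4^-1 * 12 = 3); last by field.
by move: h4; rewrite ltr_nat.
Qed.

(** Coefficients of x d/dx (1 + x)^z = z x (1 + x)^(-1) (1 + x)^z. *)
Lemma cbin_log (z : C) i : i%:R * cbin z i = z * \sum_(s < i) (-1) ^+ s * cbin z (i - s.+1).
Proof.
elim: i => [|i IH]; first by rewrite big_ord0 mul0r mulr0.
rewrite cbinS mulrBl IH big_ord_recl expr0 mul1r subSS subn0 mulrDr; congr (_ + _).
rewrite -mulrN -sumrN; congr (_ * _); apply: eq_bigr => s _.
by rewrite lift0 exprS mulN1r mulNr subSS.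
Qed.

Lemma cexp0 : cexp (0 : C) = 1.
Proof. by rewrite /cexp /= expR0 cos0 sin0 mulr1 mulr0. Qed.

Lemma cexpD (a b : C) : cexp (a + b) = cexp a * cexp b.
Proof.
case: a b => [a1 a2] [b1 b2]; rewrite /cexp /= expRD cosD sinD.
by apply/eqP; rewrite eq_complex /=; apply/andP; split; apply/eqP; ring.
Qed.

Lemma cexp_neq0 (a : C) : cexp a != 0.
Proof.
apply/eqP => h; have := cexpD a (- a); rewrite subrr cexp0 h mul0r => /eqP; by rewrite oner_eq0.
Qed.

Lemma cexpN (a : C) : cexp (- a) = (cexp a)^-1.
Proof.
by apply: (mulfI (cexp_neq0 a)); rewrite -cexpD subrr cexp0 mulfV // cexp_neq0.
Qed.

Lemma cexp_int (a : C) (n : int) : cexp (n%:~R * a) = cexp a ^ n.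
Proof.
have h (k : nat) : cexp (k%:R * a) = cexp a ^+ k.
  by elim: k => [|k IH]; rewrite ?mul0r ?cexp0 // -addn1 natrD mulrDl mul1r cexpD IH exprD.
by case: n => n; rewrite ?h // NegzE mulrNz mulNr cexpN h exprnN.
Qed.

Lemma cexp_ln (x : R) : 0 < x -> cexp ((ln x)%:C%C : C) = x%:C%C.
Proof. by move=> x0; rewrite /cexp /= cos0 sin0 mulr1 mulr0 lnK. Qed.
End Limits.

(** * The associativity axiom in the lowest conformal weight *)

Section Assoc.
Variable R : realType.
Local Notation C := (R[i]).
Local Notation sgn := (sgn R).
Variables (V : vosa R) (J : {linear gl11 R -> V}).
Hypothesis HV : is_V1gl11 J.

Lemma icompE p (W1 W2 W3 : vmod V) (I : intw p W1 W2 W3) r h1 h2 h w1 w2 :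
  (forall k, I w1 (h1 + h2 - h - 1) k.+1 w2 = 0) ->
  icomp I r h1 h2 h w1 w2 = cexp ((h - h1 - h2) * (ln r)%:C%C) *: I w1 (h1 + h2 - h - 1) 0 w2.
Proof.
move=> hk; rewrite /icomp (@fsumE _ _ 1) ?big_ord1 ?expr0 ?mul1r //.
by case=> // k _; rewrite hk scaler0.
Qed.

Section Towers.
Variables (p : bool) (W1 W2 W3 : vmod V) (I : intw p W1 W2 W3).
Variables (W4 W5 : vmod V) (q : bool).
Let n0 i : i.+1%:R != 0 :> C := natC_neq0 R i.

(** For j = 0 these are the coefficients of (1 - t)^(4 m m'). [left_tower] expresses the inner
    coefficient by modes of alpha, passing them through Y(e) produces the factor 4 m, and [cbin_log]
    sums the result. The vanishing for j > 0 is carried along for the induction. *)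
Lemma tower_left (K : intw q W4 W5 W2) (e : W1) (e' : W4) (s : W5) m m' lam D i j k :
  Ext J m e -> Ext J m' e' -> Hw J lam D s ->
  I e (top (lam + 4 * m'%:~R) m + i%:R + j%:R) k (K e' (top lam m' - i%:R) 0 s)
  = if (j == 0)%N then ((-1) ^+ i * cbin ((4 * m * m')%:~R) i) *:
      I e (top (lam + 4 * m'%:~R) m) k (K e' (top lam m') 0 s) else 0.
Proof.
move=> he he' hs; have hw := left_Hw HV K he' hs; set Q := top _ m.
have ld := leading_left HV I he hw.
elim/ltn_ind: i j k => i IH j k; case: i IH => [|i] IH.
  rewrite addr0 subr0 expr0 cbin0 mulr1 scale1r; case: j => [|j] /=; first by rewrite addr0.
  by have := ld_above ld j k.
have lr := lfun_linr I e (Q + i.+1%:R + j%:R) k.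
have tw := left_tower HV K he' hs i.+1.
apply: (scalerI (n0 i)); rewrite -(linZ lr) tw (linZ lr) (lin_sum _ _ _ lr).
have step (r : 'I_i.+1) : I e (Q + i.+1%:R + j%:R) k (alpha J (- r.+1%:Z) (K e' (top lam m' - (i.+1 - r.+1)%:R) 0 s))
    = if (j == 0)%N then (- (4 * m%:~R) * ((-1) ^+ (i.+1 - r.+1) * cbin ((4 * m * m')%:~R) (i.+1 - r.+1))) *:
      I e Q k (K e' (top lam m') 0 s) else 0.
  have er : (i.+1 - r.+1 < i.+1)%N by lia.
  have := I_alpha HV I (- r.+1%:Z) (Q + i.+1%:R + j%:R) k (K e' (top lam m' - (i.+1 - r.+1)%:R) 0 s) (Ext_Hw he).
  have i1 : Q + i.+1%:R + j%:R = Q + (i.+1 - r.+1)%:R + (j + r.+1)%:R.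
    by rewrite (natrB _ (ltn_ord r)) [(j + _)%:R]natrD; ring.
  have i2 : (- r.+1%:Z)%:~R + (Q + i.+1%:R + j%:R) = Q + (i.+1 - r.+1)%:R + j%:R.
    by rewrite (natrB _ (ltn_ord r)) mulrNz -[(Posz _)%:~R]/(r.+1%:R : C); ring.
  rewrite i2 (IH _ er j k) i1 (IH _ er (j + r.+1)%N k) addnS /= (lin0 (@alpha_lin _ _ _ _ _)) => /esym/eqP.
  rewrite addr_eq0 => /eqP ->; case: ifP => _; last by rewrite scaler0 oppr0.
  by rewrite scalerA mulNr scaleNr.
rewrite (eq_bigr _ (fun r _ => step r)); case: ifP => _; last by rewrite big1 ?scaler0.
rewrite -scaler_suml !scalerA; congr (_ *: _).
rewrite mulrCA cbin_log mulr_sumr !mulr_sumr; apply: eq_bigr => r _.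
have -> : (-1) ^+ i.+1 = (-1) ^+ (i.+1 - r.+1) * (-1) ^+ r * -1 :> C.
  by rewrite -exprD -exprSr; congr (_ ^+ _); have := ltn_ord r; lia.
have -> : (4 * m * m')%:~R = 4 * m%:~R * m'%:~R :> C by rewrite !intrM.
have e2 : (-1) ^+ r * (-1) ^+ r = 1 :> C by rewrite -exprMn mulrNN mulr1 expr1n.
by rewrite [RHS](_ : _ = ((-1) ^+ r * (-1) ^+ r) * (- ((-1) ^+ (i.+1 - r.+1) * (4 * m%:~R * m'%:~R * cbin (4 * m%:~R * m'%:~R) (i.+1 - r.+1)))));
  [rewrite e2; ring|ring].
Qed.

(** The analogue for the iterate, with the coefficients of (1 + t)^(m lam): now the modes of alpha
    reach s and contribute its charge lam. *)
Lemma tower_right (K : intw q W4 W5 W1) (e : W4) (e' : W5) (s : W2) m m' lam D i j k :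
  Ext J m e -> Ext J m' e' -> Hw J lam D s ->
  I (K e (top (4 * m'%:~R) m - i%:R) 0 e') (top lam (m + m') + i%:R + j%:R) k s
  = if (j == 0)%N then cbin (m%:~R * lam) i *:
      I (K e (top (4 * m'%:~R) m) 0 e') (top lam (m + m')) k s else 0.
Proof.
move=> he he' hs; have hy := left_Ext HV K he he'; set Q := top lam _.
have ld := leading_left HV I hy hs.
elim/ltn_ind: i j k => i IH j k; case: i IH => [|i] IH.
  rewrite addr0 subr0 cbin0 scale1r; case: j => [|j] /=; first by rewrite addr0.
  by have := ld_above ld j k.
have ll := lfun_linl I (Q + i.+1%:R + j%:R) k s.
have tw := left_tower HV K he (Ext_Hw he') i.+1.
apply: (scalerI (n0 i)); rewrite -(linZ ll) tw (linZ ll) (lin_sum _ _ _ ll).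
have step (r : 'I_i.+1) : I (alpha J (- r.+1%:Z) (K e (top (4 * m'%:~R) m - (i.+1 - r.+1)%:R) 0 e')) (Q + i.+1%:R + j%:R) k s
    = if (j == 0)%N then (lam * ((-1) ^+ r * cbin (m%:~R * lam) (i.+1 - r.+1))) *:
      I (K e (top (4 * m'%:~R) m) 0 e') Q k s else 0.
  have er : (i.+1 - r.+1 < i.+1)%N by lia.
  have ir := ltn_ord r.
  have [N0 /(_ N0.+1 (leqnSn _))] := @jop_iter _ _ _ _ _ _ _ _ (jop_intw I k) false (alv J)
    (K e (top (4 * m'%:~R) m - (i.+1 - r.+1)%:R) 0 e') s (- r.+1%:Z) (Q + i.+1%:R + j%:R) (alv_even HV).
  rewrite -alphaE => ->; rewrite big_ord_recl big1 ?addr0; last first.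
    move=> l _; rewrite andbF sgn0 scale1r lift0 -[act _ _ s]alphaE (Hw_pos hs) // (lin0 (lfun_linr I _ _ _)) scaler0 subr0.
    rewrite (_ : Q + i.+1%:R + j%:R + l.+1%:R = Q + (i.+1 - r.+1)%:R + (j + l.+1 + r.+1)%:R); last first.
      by rewrite (natrB _ ir) !natrD; ring.
    by rewrite (IH _ er) addnS /= (lin0 (act_linr _ _)) scaler0.
  rewrite expr0 cbin0 mul1r scale1r !subr0 andbF sgn0 scale1r.
  rewrite [X in act _ _ X](_ : _ = 0); last first.
    rewrite (_ : Q + i.+1%:R + j%:R = Q + (i.+1 - r.+1)%:R + (j + r.+1)%:R).
      by rewrite (IH _ er) addnS.
    by rewrite (natrB _ ir) natrD; ring.
  rewrite (lin0 (act_linr _ _)) sub0r -[X in I _ _ _ X]alphaE (Hw_0 hs) (linZ (lfun_linr I _ _ _)) /=.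
  rewrite (_ : (- r.+1%:Z)%:~R + _ = Q + (i.+1 - r.+1)%:R + j%:R); last first.
    by rewrite (natrB _ ir) mulrNz -[(Posz _)%:~R]/(r.+1%:R : C); ring.
  rewrite (IH _ er j k) -exprnN.
  have -> : ((-1) ^- r.+1 : C) = - (-1) ^+ r.
    by rewrite exprSr mulrN1 invrN -exprVn invrN1.
  by rewrite scaleNr opprK; case: ifP => _; rewrite ?scaler0 // !scalerA; congr (_ *: _); ring.
rewrite (eq_bigr _ (fun r _ => step r)); case: ifP => _; last by rewrite big1 ?scaler0.
rewrite -scaler_suml !scalerA; congr (_ *: _).
by rewrite cbin_log !mulr_sumr; apply: eq_bigr => r _; rewrite mulrA.
Qed.
End Towers.

Variable T : vtensor (IndO J).
Local Notation "W1 ** W2" := (tens T W1 W2) (at level 40).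

Section Triple.
Variables (W1 W2 W3 : vmod V).
Hypothesis (c1 : IndO J W1) (c2 : IndO J W2) (c3 : IndO J W3).
Variables (m m' : int) (lam D : C) (e : W1) (e' : W2) (s : W3).
Hypothesis (he : Ext J m e) (he' : Ext J m' e') (hs : Hw J lam D s).
Let N : int := 4 * m * m'.
Let X := tY T W1 (W2 ** W3) e (top (lam + 4 * m'%:~R) m) 0 (tY T W2 W3 e' (top lam m') 0 s).
Let Y := tY T (W1 ** W2) W3 (tY T W1 W2 e (top (4 * m'%:~R) m) 0 e') (top lam (m + m')) 0 s.
Let h1 : C := 2 * m%:~R ^+ 2.
Let h2 : C := 2 * m'%:~R ^+ 2.
Let h : C := h1 + h2 + D + N%:~R + (m + m')%:~R * lam.
Let NE : N%:~R = 4 * m%:~R * m'%:~R :> C. Proof. by rewrite /N !intrM. Qed.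

(* Both sides of the associativity axiom at [r2 = 1], [r1 = 1 + x], in the
   lowest conformal weight, are binomial series in [x]. *)
Lemma assoc_series (x : R) (phi : {linear (W1 ** W2) ** W3 -> C^o}) : 0 < x -> x < 1 ->
  exists S : C,
    csum (fun n => phi (assoc T W1 W2 W3 (icomp (tY T W1 (W2 ** W3)) (1 + x) h1 n h e
         (icomp (tY T W2 W3) 1 h2 D n e' s)))) S /\
    lim1 (fun n => x%:C%C ^ N * binser (m%:~R * lam) x%:C%C n * phi Y) S.
Proof.
move=> x0 x1.
have [||//|S [hl hr]] := @assocE _ _ _ T W1 W2 W3 c1 c2 c3 (1 + x) 1 _ _ _ _ _ _ _ _ _
  (weight_eig (Hw_L0 (Ext_Hw he))) (weight_eig (Hw_L0 (Ext_Hw he'))) (weight_eig (Hw_L0 hs)) h phi.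
- by rewrite addrC addKr.
- by rewrite addrC addKr.
- by rewrite ltrDl.
exists S; split=> //; rewrite (_ : 1 + x - 1 = x) in hr; last by rewrite addrC addKr.
have noY := left_nolog HV (tY T W1 W2) he (Ext_Hw he').
have hY := left_Ext HV (tY T W1 W2) he he'.
apply: lim1_eq (csum_seq (c := h1 + h2 + N%:~R) hr _); last first.
  move=> z nz; rewrite [icomp (tY T W1 W2) _ _ _ _ _ _]icompE; last by move=> k; apply: noY.
  rewrite (ld_off (leading_left HV (tY T W1 W2) he (Ext_Hw he'))) ?scaler0; last first.
    move=> n en; apply: (nz n); move: en; rewrite /top /h1 /h2 NE => en.
    by apply/eqP; rewrite eq_sym -subr_eq0; apply/eqP; rewrite -[RHS](subrr (- 1 - m%:~R * (4 * m'%:~R))) -{1}en; ring.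
  rewrite /icomp (@fsumE _ _ 0) ?big_ord0 ?linear0 // => k _.
  by rewrite (lin0 (lfun_linl _ _ _ _)) scaler0.
exists 0%N => n _; rewrite /binser mulr_sumr mulr_suml; apply: eq_bigr => i _.
rewrite [icomp (tY T W1 W2) _ _ _ _ _ _]icompE; last by move=> k; apply: noY.
rewrite (_ : _ - _ - 1 = top (4 * m'%:~R) m - i%:R); last by rewrite /top /h1 /h2 NE; ring.
have tr k := tower_right (tY T (W1 ** W2) W3) (tY T W1 W2) i 0 k he he' hs.
have ei : h1 + h2 + N%:~R + i%:R + D - h - 1 = top lam (m + m') + i%:R + 0%:R.
  by rewrite /top /h /h1 /h2; ring.
rewrite icompE => [|k]; last first.
  rewrite (linZ (lfun_linl _ _ _ _)) ei tr /= (ld_top (leading_left HV (tY T (W1 ** W2) W3) hY hs)).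
  by rewrite !scaler0.
have eZ c y : phi (c *: y) = c * phi y by rewrite linearZ.
rewrite ln1 mulr0 cexp0 scale1r (linZ (lfun_linl _ _ _ _)) ei tr /= !eZ.
rewrite (_ : _ - h1 - h2 = (N + i%:Z)%:~R); last by rewrite intrD /h1 /h2 /=; ring.
rewrite cexp_int cexp_ln // expfzDr; last by rewrite fmorph_eq0 gt_eqF.
by rewrite -exprnP; ring.
Qed.

(** Here lam is arbitrary. The left series is identically 0, while the right one is a nonzero
    multiple of [phi Y] times the binomial series of exponent m lam, which does not tend to 0 at the
    point given by [binser_nz]. *)
Lemma assoc_weak (phi : {linear (W1 ** W2) ** W3 -> C^o}) :
  (forall q k q' k', phi (assoc T W1 W2 W3 (tY T W1 (W2 ** W3) e q k (tY T W2 W3 e' q' k' s))) = 0) -> phi Y = 0.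
Proof.
move=> h0; have [x [x0 [x1 nx]]] := binser_nz (m%:~R * lam).
have [S [hl hr]] := assoc_series phi x0 x1.
have l0 n : phi (assoc T W1 W2 W3 (icomp (tY T W1 (W2 ** W3)) (1 + x) h1 n h e
    (icomp (tY T W2 W3) 1 h2 D n e' s))) = 0.
  rewrite [icomp (tY T W2 W3) _ _ _ _ _ _]icompE; last by move=> k; apply: (left_nolog HV (tY T W2 W3) he' hs).
  have [K hK] := lfun_log (tY T W1 (W2 ** W3)) e (h1 + n - h - 1) (tY T W2 W3 e' (h2 + D - n - 1) 0 s).
  rewrite /icomp (@fsumE _ _ K) => [|k /hK hk]; last first.
    by rewrite (linZ (lfun_linr _ _ _ _)) hk !scaler0.
  by rewrite !linear_sum big1 // => k _; rewrite (linZ (lfun_linr _ _ _ _)) !linearZ /= h0 ?(mulr0, scaler0).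
have S0 : S = 0.
  apply: (lim1_uniq (u := fun=> 0)); last exact: lim1_cst.
  apply: lim1_eq (csum_seq (c := 0) hl _) => [|z _]; last exact: l0.
  by exists 0%N => n _; rewrite big1.
apply/eqP/negPn/negP => Y0; apply: nx.
have xN : (x%:C%C : C) ^ N != 0 by rewrite expfz_neq0 // fmorph_eq0 gt_eqF.
have := lim1Z (phi Y * x%:C%C ^ N)^-1 hr; rewrite S0 mulr0; apply: lim1_eq; exists 0%N => n _.
by field; rewrite Y0 xN.
Qed.

(** Integrality of lam makes both exponents integers, so [binser_int_scaled] sums both series in
    closed form. A linear form separating the two vectors is tested. *)
Lemma assoc_top : (exists l : int, lam = l%:~R) -> assoc T W1 W2 W3 X = Y.
Proof.
move=> [l el]; apply/eqP; rewrite -subr_eq0; apply/negPn/negP => /eqP /separate[phi].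
suff -> : phi (assoc T W1 W2 W3 X - Y) = 0 by move=> /esym/eqP; rewrite oner_eq0.
(* At x = 1/2 the series have the factors (3/2)^(N + m l) (1 - 2/3)^N and (1/2)^N (3/2)^(m l), which
   are the same nonzero number. *)
have x0 : 0 < 2^-1 :> R by rewrite invr_gt0.
have x1 : 2^-1 < 1 :> R by rewrite invf_lt1 // ltr1n.
have [S [hl hr]] := assoc_series phi x0 x1; set x : R := 2^-1 in x0 x1 hl hr.
have xC : (x%:C%C : C) = 2^-1 by rewrite /x fmorphV rmorph_nat.
have tC : ((1 + x)%:C%C : C) = 3 / 2 by rewrite rmorphD rmorph1 /= xC; field.
have n2 : (2^-1 : C) != 0 by rewrite invr_eq0 pnatr_eq0.
have n32 : (3 / 2 : C) != 0 by rewrite mulf_neq0 ?invr_eq0 ?pnatr_eq0.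
have er : m%:~R * lam = (m * l)%:~R by rewrite el intrM.
rewrite er xC in hr; have e1 := binser_int_scaled _ _ hr.
have t0 : 0 < 1 + x by apply: addr_gt0.
have hw := left_Hw HV (tY T W2 W3) he' hs.
have tl i k := tower_left (tY T W1 (W2 ** W3)) (tY T W2 W3) i 0 k he he' hs.
have l1 : lim1 (fun n => (3 / 2) ^ (N + m * l) * binser N%:~R (- (2 / 3)) n * phi (assoc T W1 W2 W3 X)) S.
  apply: lim1_eq (csum_seq (c := h2 + D + m'%:~R * lam) hl _); last first.
    move=> z nz; rewrite [icomp (tY T W2 W3) _ _ _ _ _ _]icompE; last by move=> k; apply: (left_nolog HV (tY T W2 W3) he' hs).
    rewrite (ld_off (leading_left HV (tY T W2 W3) he' hs)) ?scaler0; last first.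
      move=> n en; apply: (nz n); move: en; rewrite /top => en.
      by apply/eqP; rewrite eq_sym -subr_eq0; apply/eqP; rewrite -[RHS](subrr (- 1 - m'%:~R * lam)) -{1}en; ring.
    rewrite /icomp (@fsumE _ _ 0) ?big_ord0 ?linear0 // => k _.
    by rewrite (lin0 (lfun_linr _ _ _ _)) scaler0.
  exists 0%N => n _; rewrite /binser mulr_sumr mulr_suml; apply: eq_bigr => i _.
  rewrite [icomp (tY T W2 W3) _ _ _ _ _ _]icompE; last by move=> k; apply: (left_nolog HV (tY T W2 W3) he' hs).
  rewrite (_ : _ - _ - 1 = top lam m' - i%:R); last by rewrite /top; ring.
  have ei : h1 + (h2 + D + m'%:~R * lam + i%:R) - h - 1 = top (lam + 4 * m'%:~R) m + i%:R + 0%:R.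
    by rewrite /top /h /h1 /h2 NE intrD; ring.
  rewrite icompE => [|k]; last first.
    rewrite (linZ (lfun_linr _ _ _ _)) ei tl /= (ld_top (leading_left HV (tY T W1 (W2 ** W3)) he hw)).
    by rewrite !scaler0.
  have eZ c y : phi (assoc T W1 W2 W3 (c *: y)) = c * phi (assoc T W1 W2 W3 y) by rewrite !linearZ.
  rewrite ln1 mulr0 cexp0 scale1r ei tl /= !eZ.
  rewrite (_ : h - _ - _ = (N + m * l - i%:Z)%:~R); last first.
    by rewrite /h /h1 /h2 !intrD mulrNz intrM el /=; ring.
  rewrite cexp_int cexp_ln // tC expfzDr // -exprnN.
  rewrite -/X -/N [in RHS]exprNn (_ : 2 / 3 = (3 / 2)^-1); last by rewrite invf_div.
  by rewrite exprVn; ring.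
have e2 := binser_int_scaled _ _ l1.
have nz : 1 + - (2 / 3) != 0 :> C.
  by rewrite (_ : 1 + - (2 / 3) = 3^-1); [rewrite invr_eq0 pnatr_eq0|field].
rewrite linearB /=; apply/eqP; rewrite subr_eq0; apply/eqP.
have K0 : (3 / 2 : C) ^ (m * l) * 2^-1 ^ N != 0 by rewrite mulf_neq0 // expfz_neq0.
apply: (mulfI K0).
have -> : (3 / 2 : C) ^ (m * l) * 2^-1 ^ N * phi Y = S.
  rewrite e1 ?expfz_neq0 //; last by rewrite (_ : 1 + 2^-1 = 3 / 2) //; field.
  by rewrite (_ : 1 + 2^-1 = 3 / 2); [ring|field].
have e3 : 1 + - (2 / 3) = (3 / 2)^-1 * 2^-1 :> C by rewrite invf_div; field.
rewrite (e2 nz (expfz_neq0 _ n32)) (expfzDr _ _ n32) e3.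
rewrite (expfzMl (3 / 2)^-1 2^-1 N) (exprz_inv (3 / 2) N) -(invr_expz (3 / 2) N).
have b0 := expfz_neq0 N n32; move: (_ ^ N) b0 (_ ^ (m * l)) (2^-1 ^ N) (phi _) => b b0 a c f.
by field.
Qed.
End Triple.
End Assoc.

(** * The braiding on leading terms *)

Section Braiding.
Variable R : realType.
Local Notation C := (R[i]).
Local Notation sgn := (sgn R).

Lemma cexp_pi : cexp (piI R) = -1.
Proof.
rewrite /cexp /piI /= expR0 cospi sinpi !mul1r.
by apply/eqP; rewrite eq_complex /= oppr0 !eqxx.
Qed.

Lemma monodromy_int (n : int) : cexp (piI R * n%:~R) ^+ 2 = 1.
Proof. by rewrite mulrC cexp_int cexp_pi exprnP exprzAC -exprnP sqrrN expr1n exp1rz. Qed.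

(** Subtracting the floor of Re z leaves f in [0, 1). The imaginary part gives sin(pi f) = 0, hence
    f = 0, and then the modulus gives Im z = 0. *)
Lemma monodromy_trivial (z : C) : cexp (piI R * z) ^+ 2 = 1 -> exists n : int, z = n%:~R.
Proof.
case: z => a b h; pose n := Num.floor a; pose f := a - n%:~R.
have /andP[n1 n2] := floor_itv a; rewrite -/n in n1 n2.
have f0 : 0 <= f by rewrite subr_ge0.
have f1 : f < 1 by rewrite ltrBlDl -[1]/(1%:~R) -intrD.
have e2 : cexp (piI R * (f +i* b)%C) ^+ 2 = 1.
  have -> : (f +i* b)%C = (a +i* b)%C + (- n)%:~R.
    by apply/eqP; rewrite -(rmorph_int (real_complex R)) eq_complex /= addr0 mulrNz !eqxx.
  by rewrite mulrDr cexpD exprMn h monodromy_int mulr1.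
have ew : cexp (piI R * (f +i* b)%C) = ((expR (- (pi * b)) * cos (pi * f)) +i* (expR (- (pi * b)) * sin (pi * f)))%C.
  by rewrite /cexp /= !mul0r sub0r add0r.
have s0 : sin (pi * f) = 0.
  move/eqP: e2; rewrite sqrf_eq1 ew => /orP[]/eqP[_] /eqP; rewrite ?oppr0 mulf_eq0 gt_eqF ?expR_gt0 //= => /eqP //.
have f00 : f = 0.
  apply/eqP; rewrite eq_le f0 andbT leNgt; apply/negP => fp.
  have : 0 < sin (pi * f).
    by apply: sin_gt0_pi; apply/andP; split; rewrite ?mulr_gt0 ?pi_gt0 // -[ltRHS]mulr1 ltr_pM2l ?pi_gt0.
  by rewrite s0 ltxx.
have e1 : expR (- (pi * b)) = 1.
  move/eqP: e2; rewrite sqrf_eq1 ew f00 mulr0 cos0 mulr1 => /orP[]/eqP[// e _].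
  by have := expR_gt0 (- (pi * b)); rewrite e oppr_gt0 ltr10.
have b0 : b = 0.
  have := congr1 (@ln R) e1; rewrite expRK ln1 => /eqP; rewrite oppr_eq0 mulf_eq0 gt_eqF ?pi_gt0 //=.
  by move/eqP.
exists n; apply/eqP; rewrite -(rmorph_int (real_complex R)) eq_complex /= b0 eqxx andbT.
by move/eqP: f00; rewrite subr_eq0.
Qed.

Variables (V : vosa R) (J : {linear gl11 R -> V}).
Hypothesis HV : is_V1gl11 J.
Variable T : vtensor (IndO J).

(** The factor e^{x L_{-1}} and the logarithms only bring in coefficients beyond the leading one,
    which vanish; the phase is all that remains. *)
Lemma braid_lead (W1 W2 : vmod V) a b (u : W1) (v : W2) q0 : IndO J W1 -> IndO J W2 ->
  leading (fun q k => tY T W2 W1 v q k u) q0 -> parity a u -> parity b v ->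
  braid T W1 W2 (tY T W1 W2 u q0 0 v)
  = (sgn (a && b) * cexp (piI R * (- q0 - 1))) *: tY T W2 W1 v q0 0 u.
Proof.
move=> c1 c2 ld pa pb; rewrite (braidE T c1 c2 q0 0 pa pb) -scalerA; congr (_ *: _).
have l0 n : iter n (Lop (W := tens T W2 W1) (-1)) 0 = 0.
  by elim: n => //= n ->; rewrite /Lop (lin0 (act_linr _ _)).
rewrite (@fsumE _ _ 1) ?big_ord1; last first.
  case=> // n _; rewrite (@fsumE _ _ 0) ?big_ord0 ?l0 ?scaler0 // => l _.
  by rewrite (ld_above ld) scaler0.
rewrite fact0 invr1 scale1r /= (@fsumE _ _ 1) ?big_ord1; last first.
  by case=> // l _; rewrite addr0 add0n (ld_top ld) scaler0.
by rewrite addn0 bin0 expr0 !mul1r addr0 subr0.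
Qed.

Section Monodromy.
Variables (W1 W2 : vmod V) (a b : bool) (m : int) (lam D : C) (e : W1) (x : W2).
Hypotheses (c1 : IndO J W1) (c2 : IndO J W2).
Hypotheses (he : Ext J m e) (hx : Hw J lam D x) (pe : parity a e) (px : parity b x).
Let z : C := piI R * (m%:~R * lam).
Let tE : - top lam m - 1 = m%:~R * lam. Proof. by rewrite /top; ring. Qed.

Lemma braid_ext : braid T W1 W2 (tY T W1 W2 e (top lam m) 0 x)
  = (sgn (a && b) * cexp z) *: tY T W2 W1 x (top lam m) 0 e.
Proof. by rewrite (braid_lead c1 c2 (leading_right HV _ he hx) pe px) tE. Qed.

Lemma braid_ext' : braid T W2 W1 (tY T W2 W1 x (top lam m) 0 e)
  = (sgn (a && b) * cexp z) *: tY T W1 W2 e (top lam m) 0 x.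
Proof. by rewrite (braid_lead c2 c1 (leading_left HV _ he hx) px pe) tE andbC. Qed.

Lemma braid2_left : braid T W2 W1 (braid T W1 W2 (tY T W1 W2 e (top lam m) 0 x))
  = (cexp z ^+ 2) *: tY T W1 W2 e (top lam m) 0 x.
Proof.
rewrite braid_ext linearZ /= braid_ext' scalerA; congr (_ *: _).
by rewrite mulrACA sgnK mul1r expr2.
Qed.

Lemma braid2_right : braid T W1 W2 (braid T W2 W1 (tY T W2 W1 x (top lam m) 0 e))
  = (cexp z ^+ 2) *: tY T W2 W1 x (top lam m) 0 e.
Proof.
rewrite braid_ext' linearZ /= braid_ext scalerA; congr (_ *: _).
by rewrite mulrACA sgnK mul1r expr2.
Qed.
End Monodromy.

Lemma tmor0E (W1 W2 W1' W2' : vmod V) p (f : shom p W1 W1') (g : shom false W2 W2') a h k b :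
  IndO J W1 -> IndO J W2 -> IndO J W1' -> IndO J W2' ->
  tmor T f g (tY T W1 W2 a h k b) = tY T W1' W2' (f a) h k (g b).
Proof.
move=> c1 c2 c3 c4; have l1 := lfun_linl (tY T W1 W2) h k b; have l2 := lfun_linl (tY T W1' W2') h k (g b).
rewrite (epartE a) (linD l1) !linearD /= !(tmorE T f g c1 c2 c3 c4 _ _ _ (epart_parity _ _)) /= sgn0 !scale1r.
by rewrite -(linD l2).
Qed.
End Braiding.

(** * Direct sums *)

Section DirectSum.
Variable R : realType.
Local Notation C := (R[i]).
Local Notation sgn := (sgn R).
Variable V : vosa R.

Lemma actsub_preim p (W1 W2 : vmod V) (f : shom p W1 W2) (U : W2 -> Prop) : actsub U -> actsub (fun x => U (f x)).
Proof.
move=> hU; split=> [|c x y hx hy|v n x hx]; first by rewrite linear0; apply: actsub0.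
  by rewrite linearP; apply: actsubP.
rewrite (epartE v) (linD (act_linl n x)) linearD /= !(shf_act f _ _ (epart_parity _ _)).
by apply: actsubD => //; apply: actsubZ => //; apply: actsub_act.
Qed.

(** Choice turns the decomposition into a function, and its uniqueness makes the coordinates linear
    and compatible with the action. *)
Lemma dsum_proj (W : vmod V) (M : int -> vmod V) : is_direct_sum W M ->
  exists (p : int -> bool) (i : forall m, shom (p m) (M m) W),
    (forall m, exists q : shom (p m) W (M m), forall x, q (i m x) = x) /\
    (forall U : W -> Prop, actsub U -> (forall m x, U (i m x)) -> forall x, U x) /\
    (forall x, lspan (fun y => exists m z, y = i m z) x).
Proof.
move=> [p [i H]]; exists p, i.
have cov x : exists d : forall m, M m, exists L, [/\ uniq L, forall m, m \notin L -> d m = 0 & x = \sum_(m <- L) i m (d m)].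
  have [d [[fd ed] _]] := H x; have [L] := (finite_seqP _).1 fd; move=> /seteqP[LL _].
  have z m : m \notin undup L -> d m = 0.
    by rewrite mem_undup => /negP mL; apply: contrapT => dm; apply: mL; apply: LL.
  exists d, (undup L); rewrite undup_uniq; split=> //; rewrite {1}ed.
  by apply: fsum_seq => [|m /z ->]; rewrite ?undup_uniq ?linear0.
have unq d d' L L' : uniq L -> uniq L' -> (forall m, m \notin L -> d m = 0) -> (forall m, m \notin L' -> d' m = 0) ->
    \sum_(m <- L) i m (d m) = \sum_(m <- L') i m (d' m) -> d = d' :> (forall m, M m).
  have key e K : uniq K -> (forall m, m \notin K -> e m = 0) ->
      finite_set [set m | e m <> 0] /\ \sum_(m \in [set: int]) i m (e m) = \sum_(m <- K) i m (e m).
    move=> uK hK; split; last by apply: fsum_seq => // m /hK ->; rewrite linear0.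
    apply: (@sub_finite_set _ _ [set` K]); last by apply/finite_seqP; exists K.
    by move=> m /= em; apply/negPn/negP => /hK.
  move=> uL uL' hL hL' e; have [f1 s1] := key _ _ uL hL; have [f2 s2] := key _ _ uL' hL'.
  have [d0 [_ h0]] := H (\sum_(m <- L) i m (d m)).
  by rewrite -(h0 d) // -(h0 d') //; split; rewrite ?s1 ?s2.
have [d hd] := choice cov.
have widen x (L : seq int) : exists L', [/\ uniq L', {subset L <= L'}, forall m, m \notin L' -> d x m = 0
    & x = \sum_(m <- L') i m (d x m)].
  have [K [uK hK eK]] := hd x; exists (undup (K ++ L)); rewrite undup_uniq.
  have sK m : m \notin undup (K ++ L) -> m \notin K by rewrite mem_undup mem_cat => /norP[].
  split=> // [m mL|m /sK/hK //|]; first by rewrite mem_undup mem_cat mL orbT.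
  rewrite [LHS]eK -(@fsum_seq _ (fun m => i m (d x m))) // => [|m /hK ->]; last by rewrite linear0.
  by apply: fsum_seq => [|m /sK/hK ->]; rewrite ?undup_uniq ?linear0.
have dE x e L : uniq L -> (forall m, m \notin L -> e m = 0) -> x = \sum_(m <- L) i m (e m) -> d x = e.
  by move=> uL hL ex; have [K [uK hK eK]] := hd x; apply: (unq _ _ K L) => //; rewrite -eK.
split; last split.
- move=> m.
  have lq : linear (fun x => d x m).
    move=> c x y; have [L [_ _ hL _]] := widen x [::]; have [L1 [_ _ hL1 _]] := widen y L.
    have [K [uK hK eK]] := hd x; have [K' [uK' sK hK' eK']] := widen y K.
    have zx k : k \notin K' -> d x k = 0 by move=> kK; apply: hK; apply: contra kK; apply: sK.
    have ex : x = \sum_(k <- K') i k (d x k).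
      rewrite [LHS]eK -(@fsum_seq _ (fun m => i m (d x m))) // => [|k /hK ->]; last by rewrite linear0.
      by apply: fsum_seq => // k /zx ->; rewrite linear0.
    rewrite (dE (c *: x + y) (fun k => c *: d x k + d y k) K') // => [k kK|].
      by rewrite zx // hK' // scaler0 addr0.
    rewrite [in LHS]ex [in LHS]eK' scaler_sumr -big_split; apply: eq_bigr => k _.
    by rewrite linearP.
  have qs : forall x, sg _ (mklin lq x) = sgn (p m) *: mklin lq (sg _ x).
    move=> x; have [K [uK hK eK]] := hd x.
    rewrite /= (dE (sg _ x) (fun k => sgn (p k) *: sg _ (d x k)) K) // => [|k /hK ->|]; last 2 first.
    - by rewrite linear0 scaler0.
    - by rewrite [in LHS]eK linear_sum; apply: eq_bigr => k _; rewrite shf_sg linearZ.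
    by rewrite scalerA sgnK scale1r.
  have qa : forall a v n x, parity a v -> mklin lq (act v n x) = sgn (p m && a) *: act v n (mklin lq x).
    move=> a v n x av; have [K [uK hK eK]] := hd x.
    rewrite /= (dE (act v n x) (fun k => sgn (p k && a) *: act v n (d x k)) K) // => [k /hK ->|].
      by rewrite (lin0 (act_linr _ _)) scaler0.
    rewrite [in LHS]eK (lin_sum _ _ _ (act_linr v n)); apply: eq_bigr => k _.
    by rewrite linearZ /= (shf_act (i k) _ _ av) scalerA sgnK scale1r.
  exists (Shom qs qa) => x /=.
  (* The family with x at the index m and 0 elsewhere; the transport is needed because the type of
     the entry depends on k. *)
  pose e k : M k := if pselect (m = k) is left h then eq_rect m M x k h else 0.
  have em : e m = x by rewrite /e; case: pselect => // h; rewrite (eq_axiomK h).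
  rewrite (dE (i m x) e [:: m]) // => [k|]; last by rewrite big_seq1 em.
  rewrite inE /e => /eqP km; case: pselect => // h; by case: km.
- move=> U hU h x; have [K [_ _ ->]] := hd x; exact: actsub_sum.
- move=> x; have [K [_ _ ->]] := hd x; apply: lspan_sum => k _; apply: lspan_gen; by exists k, (d x k).
Qed.
End DirectSum.

(** * The extension algebra *)

Section Extension.
Variable R : realType.
Local Notation C := (R[i]).
Local Notation sgn := (sgn R).
Variables (V : vosa R) (J : {linear gl11 R -> V}).
Hypothesis HV : is_V1gl11 J.
Local Notation w := (Wop J).

Lemma E0_graded (W : vmod V) (G : int -> W -> Prop) (c mu : C) x :
  (forall m y, G m y -> w GE 0 y = (c - 2 * m%:~R) *: y) -> (forall m, G m 0) ->
  (forall m (k : C) y z, G m y -> G m z -> G m (k *: y + z)) ->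
  lspan (fun y => exists m, G m y) x -> w GE 0 x = mu *: x ->
  x = 0 \/ exists m, c - 2 * m%:~R = mu /\ G m x.
Proof.
move=> hG G0 Gl hx ex; have lE := md_lin (Wop_modes HV W) GE 0.
apply: (@eig_graded _ W (w GE 0) lE (fun a y => w GE 0 y = a *: y) _ _ _ _ (fun m => c - 2 * m%:~R) G mu x) => //.
- by move=> a; rewrite (lin0 lE) scaler0.
- by move=> a k y z ey ez; rewrite lE ey ez scalerDr !scalerA mulrC.
- by move=> a y ey; exists 1%N; rewrite expr1 (pevalXsubC lE) ey subrr.
- move=> m m' /addrI/oppr_inj h; apply/eqP; rewrite -(eqr_int C); apply/eqP.
  by apply: (mulfI _ h); rewrite pnatr_eq0.
Qed.

Variables (A : vosa R) (j : vosaHom V A).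
Hypothesis irrA : irreducible (vself A).
Hypothesis Hj : is_sl21_extension J j.
Local Notation AV := (vres j).

Lemma vacA_neq0 : vac A <> 0.
Proof.
move=> h; have [x x0] := irrA.1; apply: x0; rewrite -(vac_create x) h.
exact: (lin0 (vprod_linr x (-1))).
Qed.

Lemma vacV_neq0 : vac V <> 0.
Proof. by move=> h; apply: vacA_neq0; rewrite -(vhom_vac j) h linear0. Qed.

Lemma vac_FH (W : vmod V) (x : W) : (forall v (n : int), 0 <= n -> act v n x = 0) ->
  FH (@w W) 0 0 0 x /\ w GM 0 x = 0.
Proof.
move=> h; split; last by apply: h.
by split=> [r r1|r r0|r r0||]; rewrite ?scale0r; try split; apply: h => //; lia.
Qed.

Lemma vacV_gen : generates (W := vself V) (eq^~ (vac V)).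
Proof.
move=> U hU h; apply: (V_ind HV) => [||c x y|a r x hx]; [exact: (h _ erefl)|exact: (actsub0 hU)|exact: (actsubP hU)|].
exact: (actsub_act hU (J a) r hx).
Qed.

Lemma vacV_parity : parity false (vac V).
Proof. by rewrite /parity vac_even sgn0 scale1r. Qed.

Lemma IndO_V : IndO J (vself V).
Proof.
have [|f m] := @vac_FH (vself V) (vac V); first by move=> v n; apply: vac_create0.
have irr := atypical_irr HV f m vacV_parity vacV_neq0 vacV_gen.
exact: Ofin_IndO (hw_Ofin HV irr f vacV_parity vacV_neq0).
Qed.

Lemma current_hw m (M : vmod V) : is_current J m M -> [/\ irreducible M, Ofin J M &
  exists s b, [/\ FH (@w M) 0 (cnu R m) (- m%:~R *+ 2) s, parity b s, s <> 0 & m = 0 -> w GM 0 s = 0]].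
Proof.
move=> hM; have [irr [s [b [fs ps s0 h0]]]] := Ahat_irr HV vacV_neq0 hM.
have e1 : m%:~R - epsilon R m + nshift R (- (m *+ 2)) = cnu R m.
  rewrite /epsilon /nshift /cnu oppr_eq0 mulrn_eq0 /=.
  case: (ltgtP m 0) => [lt|gt|->]; last by rewrite sgr0 mulr0z mul0r subr0 addr0.
    by rewrite (ltr0_sg lt) (_ : (-1)%:~R = -1 :> C) // -[true%:R]/(1 : C); field.
  by rewrite (gtr0_sg gt) mulr1z -[false%:R]/(0 : C); field.
have e2 : (- (m *+ 2))%:~R = - m%:~R *+ 2 :> C by rewrite !mulr2n mulrNz intrD; ring.
rewrite e1 e2 in fs; split=> //; first exact: (hw_Ofin HV irr fs ps s0).
by exists s, b; split=> // m0; apply: h0; rewrite m0 mul0rn oppr0.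
Qed.

Lemma current_ext m (M : vmod V) : is_current J m M ->
  exists (y : M) b, [/\ Ext J m y, parity b y, y <> 0 & forall x : M, w GE 0 x = (- 2 * m%:~R) *: x].
Proof.
move=> /current_hw[irr _ [s [b [fs ps s0 h0]]]].
have [y [b' [ex y0 py _]]] := extremal_exists HV irr fs h0 ps s0.
exists y, b'; split=> //; first exact: (extremal_Ext HV irr ex y0 py).
apply: (generates_E0 HV _ (irr_gen irr py y0)).
by rewrite (FH_E0 (ex_FH ex)); congr (_ *: _); rewrite mulr2n; ring.
Qed.

Lemma IndO_A : IndO J AV.
Proof.
have [M [hM ds]] := Hj; apply: (IndO_dsum HV ds) => m.
by have [? ? _] := current_hw (hM m).
Qed.

(** One extremal vector in each simple current inside A, normalised to the vacuum for m = 0.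
    [ef_mod] remembers the current as a direct summand of A, and [ef_vac1] recognises multiples of
    the vacuum in [pr_inv]. *)
Record ext_family (e : int -> AV) : Prop := ExtFamily {
  ef_vac : e 0 = vac A;
  ef_ext : forall m, Ext J m (e m);
  ef_E : forall m, w GE 0 (e m) = (- 2 * m%:~R) *: e m;
  ef_nz : forall m, e m <> 0;
  ef_par : forall m, exists b, parity b (e m);
  ef_gen : generates (fun x => exists m, x = e m);
  ef_mod : forall m, exists (M : vmod V) p (i : shom p M AV) (q : shom p AV M) y b,
    [/\ is_current J m M, cancel i q, i y = e m, parity b y & Ext J m y];
  ef_vac1 : forall x : AV, w GE 0 x = 0 -> Lop 0 x = 0 -> exists c, x = c *: vac A }.

Lemma ext_family_exists : exists e, ext_family e.
Proof.
have [M [hM ds]] := Hj; have [p [i [hq [hU hs]]]] := dsum_proj ds.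
pose y m := sval (cid (current_ext (hM m))).
have hy m : exists b, [/\ Ext J m (y m), parity b (y m), y m <> 0 & forall x : M m, w GE 0 x = (- 2 * m%:~R) *: x].
  by rewrite /y; case: cid.
have irr m : irreducible (M m) by have [] := current_hw (hM m).
have Ei m (z : M m) : w GE 0 (i m z) = (- 2 * m%:~R) *: i m z.
  have [b [_ _ _ hE]] := hy m; have := shom_w HV (i m) GE 0 z.
  by rewrite andbF sgn0 scale1r => <-; rewrite hE linearZ.
have grade (x : AV) : w GE 0 x = 0 -> x = 0 \/ exists z, x = i 0 z.
  move=> ex; have [|||||h|[m [em [z hz]]]] := @E0_graded AV (fun m x => exists z, x = i m z) 0 0 x; [| | | | |by left|].
  - by move=> m _ [z ->]; rewrite Ei sub0r mulNr.
  - by move=> m; exists 0; rewrite linear0.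
  - by move=> m k _ _ [u ->] [v ->]; exists (k *: u + v); rewrite linearP.
  - by apply: lspan_sub (hs x) => _ [m [z ->]]; apply: lspan_gen; exists m, z.
  - by rewrite ex scale0r.
  right; have m0 : m = 0.
    apply/eqP; rewrite -(intr_eq0 C); move/eqP: em.
    by rewrite sub0r oppr_eq0 mulf_eq0 pnatr_eq0.
  by move: z hz; rewrite m0 => z ->; exists z.
have vA v (n : int) : 0 <= n -> act (v0 := AV) v n (vac A) = 0 by move=> n0; apply: vac_create0.
have [fv mv] := vac_FH vA.
have [|/vacA_neq0//|[x0 ex0]] := grade (vac A); first by rewrite (FH_E0 fv) scale0r.
have [q0 hq0] := hq 0.
have i0 m : injective (i m) by have [q qq] := hq m; apply: can_inj qq.
have px0 : parity (p 0) x0.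
  apply: i0; have := shf_sg (i 0) x0; rewrite -ex0 vac_even linearZ -ex0 => ->.
  by rewrite /= scalerA sgnK scale1r.
have x00 : x0 <> 0 by move=> h; apply: vacA_neq0; rewrite ex0 h linear0.
have gx0 := irr_gen (irr 0) px0 x00.
have q0v : q0 (vac A) = x0 by rewrite ex0 hq0.
have fx0 := FH_shom HV q0 fv; rewrite q0v in fx0.
have mx0 : w GM 0 x0 = 0.
  have := shom_w HV q0 GM 0 (vac A); rewrite mv linear0 q0v => /esym/eqP.
  by rewrite scaler_eq0 (negbTE (sgn_neq0 _ _)) => /eqP.
pose e m : AV := if m == 0 then vac A else i m (y m).
have e0 : e 0 = vac A by rewrite /e eqxx.
have em m : m != 0 -> e m = i m (y m) by rewrite /e => /negbTE ->.
have Ext0 : Ext J 0 (vac A : AV).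
  split; last by rewrite /Lop vA // scale0r.
  split=> [r r0||]; first by rewrite alphaE vA //; lia.
    by rewrite alphaE vA // mulr0 scale0r.
  by rewrite /Lop vA // expr0n mulr0 scale0r.
exists e; split=> //.
- move=> m; have [->|m0] := eqVneq m 0; first by rewrite e0.
  by rewrite (em _ m0); have [b [h _ _ _]] := hy m; apply: Ext_shom.
- move=> m; have [->|m0] := eqVneq m 0; first by rewrite e0 (FH_E0 fv) mulr0.
  by rewrite (em _ m0) Ei.
- move=> m; have [->|m0] := eqVneq m 0; first by rewrite e0; apply: vacA_neq0.
  rewrite (em _ m0) => h; have [b [_ _ y0 _]] := hy m; apply: y0; apply: i0; by rewrite h linear0.
- move=> m; have [->|m0] := eqVneq m 0; first by exists false; rewrite e0 /parity vac_even sgn0 scale1r.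
  by rewrite (em _ m0); have [b [_ h _ _]] := hy m; exists (p m (+) b); apply: parity_shom.
- move=> U hUa he x; apply: hU => // m z; have [m0|m0] := eqVneq m 0.
    subst m; apply: (gx0 _ (actsub_preim (i 0) hUa)) => _ ->; rewrite -ex0 -e0; apply: he; by exists 0.
  have [b [_ h y0 _]] := hy m; apply: (irr_gen (irr m) h y0 (actsub_preim (i m) hUa)) => _ ->.
  by rewrite -em //; apply: he; exists m.
- move=> m; have [q qq] := hq m; have [m0|m0] := eqVneq m 0.
    subst m; exists (M 0), (p 0), (i 0), q, x0, (p 0).
    by split; [exact: hM|exact: qq|rewrite e0|exact: px0|rewrite -q0v; apply: Ext_shom].
  have [b [h1 h2 _ _]] := hy m; exists (M m), (p m), (i m), q, (y m), b.
  by split; [exact: hM|exact: qq|rewrite em|exact: h2|exact: h1].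
- move=> x ex lx; have [->|[z ez]] := grade x ex; first by exists 0; rewrite scale0r.
  have lz : Lop 0 z = 0 by apply: i0; rewrite shom_Lop -ez lx linear0.
  have [z0|/eqP z0] := eqVneq z 0; first by exists 0; rewrite scale0r ez z0 linear0.
  have wz : weight_space 0 z by apply: weight_eig; rewrite lz scale0r.
  have [k [ek tk]] := weight_deg HV fx0 gx0 wz z0.
  have k0 : k = 0%N by apply/eqP; rewrite -(pnatr_eq0 C) -ek mulr0 expr0n mulr0 addr0 add0r.
  rewrite k0 in tk; have ls := TT0_span tk.
  have [c ec] : exists c, z = c *: x0.
    elim: ls => [u [->|->]||c u v _ [c1 ->] _ [c2 ->]].
    - by exists 1; rewrite scale1r.
    - by exists 0; rewrite oppr0 mx0 scale0r.
    - by exists 0; rewrite scale0r.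
    - by exists (c * c1 + c2); rewrite scalerDl scalerA.
  by exists c; rewrite ez ec linearZ -ex0.
Qed.

(** * Products of extremal vectors in the algebra A *)

Section Products.
Variable e : int -> AV.
Hypothesis he : ext_family e.
Variables (T : vtensor (IndO J)) (mu : shom false (tens T AV AV) AV).
Hypothesis Hmu : is_multiplication mu.

Definition tz (m m' : int) : int := - 1 - 4 * m * m'.

Lemma tzE m m' : (tz m m')%:~R = top (4 * m'%:~R) m :> C.
Proof. by rewrite /tz /top intrB !intrM; ring. Qed.

Lemma mu_top m m' (a a' : AV) : mu (tY T AV AV a (top (4 * m'%:~R) m) 0 a') = vprod (a : A) (tz m m') a'.
Proof. by rewrite -tzE (Hmu a a').1. Qed.

Definition pr m m' : AV := vprod (e m : A) (tz m m') (e m').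

Lemma pr_mu m m' : pr m m' = mu (tY T AV AV (e m) (top (4 * m'%:~R) m) 0 (e m')).
Proof. by rewrite mu_top. Qed.

Lemma pr_ext m m' : Ext J (m + m') (pr m m').
Proof. by rewrite pr_mu; apply: Ext_shom => //; apply: (left_Ext HV); apply: ef_ext. Qed.

Lemma pr_van m m' (i : nat) : vprod (e m : A) (tz m m' + i.+1%:Z) (e m') = 0.
Proof.
have ld := leading_left HV (tY T AV AV) (ef_ext he m) (Ext_Hw (ef_ext he m')).
by rewrite -(Hmu (e m) (e m')).1 intrD tzE -[(Posz _)%:~R]/(i.+1%:R : C) (ld_above ld) linear0.
Qed.

Lemma pr_vac m : pr 0 m = e m.
Proof. by rewrite /pr (ef_vac he) /tz mulr0 mul0r subr0 vac_prod. Qed.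

(** The product has E_0 and L_0 equal to 0, so it lies on the vacuum line. If it were 0, [ld_all]
    would annihilate all products of e_m with e_{-m}; as each of them generates the simple A, all
    products in A would vanish. *)
Lemma pr_inv m : exists c : C, c != 0 /\ pr m (- m) = c *: vac A.
Proof.
have [||c ec] := ef_vac1 he (x := pr m (- m)).
- rewrite pr_mu -(shom0_w HV) (I_E0 HV) !(ef_E he) (linZ (lfun_linr _ _ _ _)) (linZ (lfun_linl _ _ _ _)) -scalerDl.
  by rewrite mulrNz mulrN addNr scale0r linear0.
- by rewrite (Hw_L0 (Ext_Hw (pr_ext m (- m)))) subrr expr0n mulr0 scale0r.
exists c; split=> //; apply/eqP => c0; rewrite c0 scale0r in ec.
have ld := leading_left HV (tY T AV AV) (ef_ext he m) (Ext_Hw (ef_ext he (- m))).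
have hU := submodule_actsub (sub_ker mu).
have all0 n : vprod (e m : A) n (e (- m)) = 0.
  by rewrite -(Hmu (e m) (e (- m))).1; apply: (ld_all ld hU); rewrite -pr_mu ec.
have [b1 p1] := ef_par he m; have [b2 p2] := ef_par he (- m).
have g1 : generates (W := vself A) (eq^~ (e m)) := irr_gen irrA p1 (ef_nz (m := m) he).
have g2 : generates (W := vself A) (eq^~ (e (- m))) := irr_gen irrA p2 (ef_nz (m := - m) he).
apply: vacA_neq0; rewrite -[LHS](vac_create (vac A)).
apply: (jop_gen (jop_act (vself A)) (U := fun x => x = 0) _ g1 g2) => [|_ _ h -> ->]; last exact: all0.
exact: (submodule_actsub (@sub_zero _ A (vself A))).
Qed.

(** Weak associativity in A with the index one above the leading mode of e_m on e_m'': on each side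
    only the term i = 0 survives. *)
Lemma pr_assoc m m' m'' :
  vprod (e m : A) (tz m (m' + m'')) (pr m' m'') = vprod (pr m m' : A) (tz (m + m') m'') (e m'').
Proof.
have [b pb] := ef_par he m.
have tr i : act (v0 := vself A) (e m) (tz m m'' + 1 + i%:Z) (e m'') = 0.
  by rewrite -addrA -[1 + _]/(Posz i.+1) [LHS]pr_van.
have [N0 /(_ N0.+1 (leqnSn _))] :=
  @jop_assoc _ _ _ _ _ _ _ _ (jop_act (vself A)) b (e m) (e m') (e m'') (tz m m'' + 1) (tz m m') (tz m' m'') pb tr.
rewrite !big_ord_recl !big1 => [|i _|i _]; last 2 first.
- rewrite lift0 (_ : _ + i.+1%:R = tz m' m'' + i.+1%:Z); last by rewrite -[i.+1%:R]/(i.+1%:R : int) natz.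
  by rewrite [X in act _ _ X]pr_van (lin0 (act_linr _ _)) !scaler0.
- rewrite lift0 [X in act X _ _](_ : _ = 0); last exact: pr_van.
  by rewrite (lin0 (act_linl _ _)) scaler0.
rewrite !cbin0 expr0 mul1r !scale1r !addr0 intz.
rewrite (_ : tz m m'' + 1 + tz m' m'' = tz (m + m') m''); last by rewrite /tz; ring.
rewrite (_ : tz m m'' + 1 + tz m m' = tz m (m' + m'')); last by rewrite /tz; ring.
by move=> E; exact: (esym E).
Qed.
End Products.
End Extension.

(** * Induced modules *)

Section Induction.
Variable R : realType.
Local Notation C := (R[i]).
Local Notation sgn := (sgn R).
Variables (V : vosa R) (J : {linear gl11 R -> V}).
Hypothesis HV : is_V1gl11 J.
Local Notation w := (Wop J).
Variables (A : vosa R) (j : vosaHom V A).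
Hypothesis irrA : irreducible (vself A).
Hypothesis Hj : is_sl21_extension J j.
Local Notation AV := (vres j).
Variable T : vtensor (IndO J).
Local Notation "W1 ** W2" := (tens T W1 W2) (at level 40).
Variable mu : shom false (AV ** AV) AV.
Hypothesis Hmu : is_multiplication mu.
Variable e : int -> AV.
Hypothesis he : ext_family J e.

Let cA : IndO J AV := IndO_A HV irrA Hj.
Let cV : IndO J (vself V) := IndO_V HV j irrA.
Let cT := tens_cat T.
Let eE m : Ext J m (e m) := ef_ext he m.
Let V0 : vac V <> 0 := vacV_neq0 j irrA.

Lemma m1E : (-1)%:~R = -1 :> C. Proof. by []. Qed.
Lemma top0 lam : top lam 0 = -1 :> C. Proof. by rewrite /top mul0r subr0. Qed.

Lemma repE (X Y : algMod j T) p (h : shom p X Y) : IndO J X -> IndO J Y -> rep_hom h ->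
  forall b a q k x, parity b a ->
  h (amu X (tY T AV X a q k x)) = sgn (p && b) *: amu Y (tY T AV Y a q k (h x)).
Proof. by move=> cX cY hh b a q k x pa; rewrite hh (tmorE T _ _ cA cX cA cY _ _ _ pa) linearZ. Qed.

Lemma amu_unit (X : algMod j T) : isRep mu X -> forall x : X, amu X (tY T AV X (vac A) (-1) 0 x) = x.
Proof.
move=> rX x; have cX := rep_cat rX; have := rep_unit rX (tY T (vself V) X (vac V) (-1)%:~R 0 x).
rewrite (lunitE T cV cX (vac V) x).1 act_vac eqxx (tmor0E _ _ _ _ _ _ _ cV cX cA cX) m1E.
by rewrite -[vinc j (vac V)]/(j (vac V)) vhom_vac.
Qed.

(** Multiply by e_{-m}: weak associativity would annihilate (e_{-m} . e_m) . x on every linear form,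
    whereas it is a nonzero multiple of x. Nothing is assumed about lam, so this applies before its
    integrality is known. *)
Lemma nonvanish (X : algMod j T) m lam D (x : X) : isRep mu X -> Hw J lam D x ->
  amu X (tY T AV X (e m) (top lam m) 0 x) = 0 -> x = 0.
Proof.
move=> rX hx h0; apply: contrapT => x0; have cX := rep_cat rX.
have [psi psi1] := separate x0.
have van q k : amu X (tY T AV X (e m) q k x) = 0.
  exact: (ld_all (leading_left HV _ (eE m) hx) (submodule_actsub (sub_ker (amu X)))).
pose phi : {linear (AV ** AV) ** X -> C^o} := psi \o (amu X \o tmor T mu (shid X)).
have H := @assoc_weak R V J HV T AV AV X cA cA cX (- m) m lam D (e (- m)) (e m) x (eE _) (eE _) hx phi.
have {H} := H (fun q k q' k' => _); rewrite addNr top0.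
rewrite -![phi _]/(psi (amu X (tmor T mu (shid X) _))) (tmor0E _ _ _ _ _ _ _ (cT cA cA) cX cA cX).
have [c [c0 ec]] := pr_inv HV irrA he Hmu (- m); rewrite opprK in ec.
rewrite -(pr_mu e Hmu) ec (linZ (lfun_linl _ _ _ _)) !linearZ (amu_unit rX) /= psi1 => h.
move: c0; suff -> : c = 0 by rewrite eqxx.
rewrite -[c]mulr1; apply: h => q k q' k'.
rewrite -[LHS]/(psi (amu X (tmor T mu (shid X) _))) -(rep_assoc rX) (tmor0E _ _ _ _ _ _ _ cA (cT cA cX) cA cX).
by rewrite van (lin0 (lfun_linr _ _ _ _)) !linear0.
Qed.

Section Iota.
Variable S : vmod V.
Lemma iota_lin : linear (tY T AV S (vac A) (-1) 0).
Proof. exact: lfun_linr. Qed.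

Lemma iota_sg x : sg _ (mklin iota_lin x) = sgn false *: mklin iota_lin (sg S x).
Proof. by rewrite /= lfun_sg [sg (vres j) _]vac_even. Qed.

Lemma iota_act a v n x : parity a v -> mklin iota_lin (act v n x) = sgn (false && a) *: act v n (mklin iota_lin x).
Proof.
move=> av /=; have := @jop_comm _ _ _ _ _ _ _ _ (jop_intw (tY T AV S) 0) a v (vac A : AV) x n (-1) 0 av.
rewrite big_ord0 => h; rewrite sgn0 scale1r in h *; apply/esym/eqP; rewrite -subr_eq0; apply/eqP.
rewrite -[RHS]h => [|i _]; last exact: vac_create0.
by case: (a) => //=; rewrite [sg (vres j) _]vac_even.
Qed.

Definition iota : shom false S (AV ** S) := Shom iota_sg iota_act.
End Iota.

(** * Induction of a simple module of integral charge *)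

Section OnSimple.
Variables (S : vmod V) (nu eps : C) (s : S) (bs : bool) (l : int).
Hypothesis irrS : irreducible S.
Hypothesis fs : FH (@w S) 0 nu eps s.
Hypothesis ps : parity bs s.
Hypothesis s0 : s <> 0.
Let lam : C := - 2 * nu - eps.
Hypothesis lamZ : lam = l%:~R.
Let hs := FH_Hw HV fs.
Let gs : generates (eq^~ s) := irr_gen irrS ps s0.
Let cS : IndO J S := Ofin_IndO (hw_Ofin HV irrS fs ps s0).
Local Notation F := (induce mu S).
Let cF : IndO J F := cT cA cS.

Definition gf m : F := tY T AV S (e m) (top lam m) 0 s.

Lemma gf_Hw m : exists D, Hw J (lam + 4 * m%:~R) D (gf m).
Proof. eexists; exact: (left_Hw HV (tY T AV S) (eE m) hs). Qed.

Lemma gf_E m : w GE 0 (gf m) = (eps - 2 * m%:~R) *: gf m.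
Proof.
rewrite (I_E0 HV) (ef_E he) (FH_E0 fs) (linZ (lfun_linr _ _ _ _)) (linZ (lfun_linl _ _ _ _)) -scalerDl.
by rewrite mulNr.
Qed.

Lemma gf_gen : generates (fun y => exists m, y = gf m).
Proof.
move=> U hU h; apply: (@gen_left R V J HV T AV S _ _ U cA cS (ef_gen he) gs hU) => _ _ [m ->] ->.
by exists m, lam; eexists; split; [exact: eE|exact: hs|apply: h; exists m].
Qed.

Lemma gf_par m : exists b, parity b (gf m).
Proof. have [b pb] := ef_par he m; eexists; exact: (I_parity (tY T AV S) _ _ pb ps). Qed.

Let lamZ' m : exists k : int, lam + 4 * m%:~R = k%:~R.
Proof. by exists (l + 4 * m); rewrite intrD intrM lamZ. Qed.

(** This is where the integrality of lam enters: [assoc_top] turns the action on F, defined through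
    the associator, into a . (a' . s) = (a . a') . s. *)
Lemma amu_top m m' (a a' : AV) : Ext J m a -> Ext J m' a' ->
  amu F (tY T AV F a (top (lam + 4 * m'%:~R) m) 0 (tY T AV S a' (top lam m') 0 s))
  = tY T AV S (vprod (a : A) (tz m m') a') (top lam (m + m')) 0 s.
Proof.
move=> ha ha'; rewrite /= (assoc_top HV T cA cA cS ha ha' hs); last by exists l.
by rewrite (tmor0E _ _ _ _ _ _ _ (cT cA cA) cS cA cS) (mu_top Hmu).
Qed.

Lemma gf_iota m : gf m = amu F (tY T AV F (e m) (top lam m) 0 (iota S s)).
Proof.
have := amu_top (eE m) (eE 0); rewrite mulr0z mulr0 addr0 addr0 top0 (ef_vac he) => -> ; congr (tY _ _ _ _ _ _ _).
by rewrite /tz mulr0 subr0 vac_create.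
Qed.

Lemma gf2_gen (U : AV ** F -> Prop) : actsub U ->
  (forall m m', U (tY T AV F (e m) (top (lam + 4 * m'%:~R) m) 0 (gf m'))) -> forall x, U x.
Proof.
move=> hU h; apply: (@gen_left R V J HV T AV F _ _ U cA cF (ef_gen he) gf_gen hU) => _ _ [m ->] [m' ->].
by have [D hD] := gf_Hw m'; exists m, (lam + 4 * m'%:~R), D.
Qed.

(** The axioms are compared on the generators e_m . (e_m' . (e_m'' . s)), where associativity
    becomes [pr_assoc] and the unit law becomes [pr_vac]. *)
Lemma isRep_induce : isRep mu F.
Proof.
split; first exact: cF.
- have cAF := cT cA cF; pose W := AV ** (AV ** F).
  pose G (y : AV ** F) := exists m m', y = tY T AV F (e m) (top (lam + 4 * m'%:~R) m) 0 (gf m').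
  have gG : generates G by move=> U hU h; apply: gf2_gen => // m m'; apply: h; exists m, m'.
  pose f1 := shcomp (amu F) (tmor T (shid AV) (amu F)).
  pose f2 := shcomp (amu F) (shcomp (tmor T mu (shid F)) (assoc T AV AV F)).
  have hU := eq_shom_actsub f1 f2 erefl.
  have f1E y : f1 y = amu F (tmor T (shid AV) (amu F) y) by [].
  have f2E y : f2 y = amu F (tmor T mu (shid F) (assoc T AV AV F y)) by [].
  suff h : forall x, f1 x = f2 x by exact: h.
  apply: (@gen_left R V J HV T AV (AV ** F) _ _ _ cA cAF (ef_gen he) gG hU) => _ _ [m ->] [m' [m'' ->]].
  have [D hD] := gf_Hw m''; exists m, (lam + 4 * m''%:~R + 4 * m'%:~R); eexists; split; [exact: eE|exact: (left_Hw HV _ (eE m') hD)|].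
  have pe := pr_ext HV he Hmu.
  rewrite f1E f2E (tmor0E _ _ _ _ _ _ _ cA cAF cA cF) (amu_top (eE m') (eE m'')).
  rewrite (_ : lam + 4 * m''%:~R + 4 * m'%:~R = lam + 4 * (m' + m'')%:~R); last by rewrite intrD; ring.
  rewrite (amu_top (eE m) (pe m' m'')).
  rewrite (_ : lam + 4 * (m' + m'')%:~R = lam + 4 * m''%:~R + 4 * m'%:~R); last by rewrite intrD; ring.
  rewrite (assoc_top HV T cA cA cF (eE m) (eE m') hD); last exact: lamZ'.
  rewrite (tmor0E _ _ _ _ _ _ _ (cT cA cA) cF cA cF) -(pr_mu e Hmu).
  by rewrite (amu_top (pe m m') (eE m'')) -(pr_assoc HV he Hmu) addrA.
- pose f1 := shcomp (amu F) (tmor T (vinc j) (shid F)).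
  have hU := eq_shom_actsub f1 (lunit T F) erefl.
  suff h : forall x, f1 x = lunit T F x by exact: h.
  apply: (@gen_left R V J HV T (vself V) F _ _ _ cV cF (vacV_gen HV) gf_gen hU) => _ _ -> [m ->].
  have [D hD] := gf_Hw m; exists 0, (lam + 4 * m%:~R), D; split=> //.
    have vv (v : V) (n : int) : 0 <= n -> act (v0 := vself V) v n (vac V) = 0 by move=> n0; apply: vac_create0.
    split; last by rewrite /Lop vv // scale0r.
    split=> [r r0||]; first by rewrite alphaE vv //; lia.
      by rewrite alphaE vv // mulr0 scale0r.
    by rewrite /Lop vv // expr0n mulr0 scale0r.
  rewrite -[f1 _]/(amu F _) (tmor0E _ _ _ _ _ _ _ cV cF cA cF) -[vinc j (vac V)]/(j (vac V)) vhom_vac -(ef_vac he).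
  rewrite [shid F _]/= (amu_top (eE 0) (eE m)) add0r -/(pr e 0 m) (pr_vac he).
  by rewrite top0 -m1E (lunitE T cV cF (vac V) (gf m)).1 act_vac eqxx.
Qed.

Lemma isRep0_induce : isRep0 mu F.
Proof.
split; first exact: isRep_induce.
move=> x; congr (amu F _).
apply: (@gf2_gen (fun x => shcomp (braid T F AV) (braid T AV F) x = shid _ x)); first exact: eq_shom_actsub.
move=> m m'; have [b pb] := ef_par he m; have [b' pb'] := gf_par m'; have [D hD] := gf_Hw m'.
have := braid2_left HV T cA cF (eE m) hD pb pb'; rewrite /= => ->.
have [k ->] := lamZ' m'; by rewrite -intrM monodromy_int scale1r.
Qed.

(** Projecting A to its summand of index 0, identifying this with V and applying the left unit gives
    back s. *)
Lemma iota_neq0 : iota S s <> 0.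
Proof.
have [M [p [i [q [y [b [hM iq ey py _]]]]]]] := ef_mod he 0.
have [irrM _ _] := current_hw HV j irrA hM.
have qv : q (vinc j (vac V)) = y by rewrite -[vinc j _]/(j (vac V)) vhom_vac -(ef_vac he) -ey iq.
have y0 : y <> 0 by move=> h; apply: (ef_nz he (m := 0)); rewrite -ey h linear0.
have [f [mg irrV]] : exists f : shom (p (+) false) (vself V) M, f (vac V) = y /\ irreducible (vself V).
  exists (shomc q (vinc j)); split=> //.
  have [|f m] := @vac_FH _ _ J (vself V) (vac V); first by move=> v n; apply: vac_create0.
  exact: (atypical_irr HV f m (vacV_parity V) V0 (vacV_gen HV)).
have fi : injective f by apply: (@irr_shom_inj _ _ _ _ _ f (vac V) irrV); rewrite mg.
have fsj := @irr_shom_surj _ _ _ _ _ f (vac V) irrM; rewrite mg in fsj.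
have [r [fr rf]] := shom_inv (bij_inj_surj fi (fsj y0)).
move=> h; apply: s0.
have : lunit T S (tmor T r (shid S) (tmor T q (shid S) (iota S s))) = s.
  have cM : IndO J M by apply: Ofin_IndO; have [_ ? _] := current_hw HV j irrA hM.
  rewrite (tmor0E _ _ _ _ _ _ _ cA cS cM cS) (tmor0E _ _ _ _ _ _ _ cM cS cV cS).
  rewrite (_ : vac A = vinc j (vac V)) ?qv; last by rewrite -[vinc j _]/(j (vac V)) vhom_vac.
  by rewrite -mg fr -m1E (lunitE T cV cS _ _).1 act_vac eqxx.
by rewrite h !linear0 => ->.
Qed.

Lemma iota_inj : injective (iota S).
Proof. exact: (@irr_shom_inj _ _ _ _ _ _ s irrS iota_neq0). Qed.

Lemma gf_neq0 m : gf m <> 0.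
Proof.
rewrite gf_iota => h; apply: iota_neq0.
exact: (nonvanish isRep_induce (Hw_shom HV (iota S) hs) h).
Qed.

Lemma E_actsub (W : vmod V) c : actsub (fun x : W => w GE 0 x = c *: x).
Proof.
have lE := md_lin (Wop_modes HV W) GE 0; have Hm := Wop_modes HV W.
apply: (Jclosed_actsub HV) => [|k x y hx hy|g r x hx]; first by rewrite (lin0 lE) scaler0.
  by rewrite lE hx hy scalerDr !scalerA mulrC.
by rewrite (E0_op Hm) hx (linZ (md_lin Hm g r)).
Qed.

Lemma F_graded (y : F) mu' : w GE 0 y = mu' *: y -> y = 0 \/
  exists m, eps - 2 * m%:~R = mu' /\ forall U : F -> Prop, actsub U -> U (gf m) -> U y.
Proof.
move=> ey; apply: (@E0_graded R V J HV F (fun m y => forall U : F -> Prop, actsub U -> U (gf m) -> U y)) ey.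
- by move=> m z hz; apply: (hz (fun y => w GE 0 y = _)); [exact: E_actsub|exact: gf_E].
- by move=> m U hU _; apply: actsub0.
- by move=> m k u v hu hv U hU h; apply: actsubP => //; [apply: hu|apply: hv].
apply: (gf_gen (U := lspan _)) => [|_ [m ->]]; last by apply: lspan_gen; exists m.
have Hm := Wop_modes HV F.
apply: (Jclosed_actsub HV) => [|k u v|g r u hu]; [exact: lspan0|exact: lspan_lin|].
elim: hu => [z [m hz]||k u' v' _ h1 _ h2].
- by apply: lspan_gen; exists m => U hU h; apply: (actsub_act hU); apply: hz.
- by rewrite (lin0 (md_lin Hm g r)); apply: lspan0.
- by rewrite (md_lin Hm g r); apply: lspan_lin.
Qed.

Lemma F_eps (y : F) : w GE 0 y = eps *: y -> exists x, iota S x = y.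
Proof.
move=> /F_graded[->|[m [em h]]]; first by exists 0; rewrite linear0.
have m0 : m = 0.
  apply/eqP; rewrite -(intr_eq0 C); have : 2 * m%:~R == 0 :> C.
    by rewrite -oppr_eq0; apply/eqP/(addrI eps); rewrite em addr0.
  by rewrite mulf_eq0 pnatr_eq0.
apply: (h (fun z => exists x, iota S x = z)); first exact: submodule_actsub (sub_im (iota S)).
by exists s; rewrite m0 /gf top0 (ef_vac he).
Qed.

(** Stated for subspaces closed under the action, so that it applies alike to kernels, giving
    injectivity, and to images, giving simplicity. *)
Lemma F_closed (K : F -> Prop) : submodule K -> (exists y, K y /\ y <> 0) ->
  (forall a b q k y, parity b a -> K y -> K (amu F (tY T AV F a q k y))) -> forall x, K (iota S x).
Proof.
move=> hK nz cl; have [u [nu' [eps' [b [Ku u0 fu pu]]]]] := IndO_hw HV cF hK nz.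
have [/u0//|[m [em _]]] := F_graded (FH_E0 fu).
have hu := FH_Hw HV fu; set v := tY T AV F (e (- m)) (top (- 2 * nu' - eps') (- m)) 0 u.
have v0 : amu F v <> 0 by move=> h; apply: u0; exact: (nonvanish isRep_induce hu h).
have ev : w GE 0 (amu F v) = eps *: amu F v.
  rewrite -(shom0_w HV) (I_E0 HV) (ef_E he) (FH_E0 fu) (linZ (lfun_linr _ _ _ _)) (linZ (lfun_linl _ _ _ _)).
  by rewrite -scalerDl -/v [LHS]linearZ -em mulrNz -[LHS]/(_ *: amu F v); congr (_ *: _); ring.
have [x ex] := F_eps ev; have [bm pm] := ef_par he (- m).
have [h|//] := irrS.2 _ (sub_preim (iota S) hK).
by case: v0; rewrite -ex (h x) ?linear0 // ex; apply: (cl _ bm).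
Qed.

(** Frobenius reciprocity: a . x is sent to a . t(x). Compatibility with the action is checked on
    e_m . (e_m' . s), with the associativity axiom of X. *)
Lemma hom_from_induce (X : algMod j T) p (t : shom p S X) : isRep mu X ->
  exists g : shom p F X, rep_hom g /\ forall x, g (iota S x) = t x.
Proof.
move=> rX; have cX := rep_cat rX; pose g : shom p F X := shomc (amu X) (tmor T (shid AV) t).
have gE a b q k x : parity b a -> g (tY T AV S a q k x) = sgn (p && b) *: amu X (tY T AV X a q k (t x)).
  by move=> pa; rewrite /= (tmorE T _ _ cA cS cA cX _ _ _ pa) linearZ.
have vp : parity false (vac A : AV) by rewrite /parity [sg _ _]vac_even sgn0 scale1r.
exists g; split; last by move=> x; rewrite [iota S x]/= (gE _ _ _ _ _ vp) andbF sgn0 scale1r (amu_unit rX).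
have hU := eq_shom_actsub (shomc g (amu F)) (shomc (amu X) (tmor T (shid AV) g)) (addbF p).
move=> x; apply: (gf2_gen hU) => m m'.
have [b pb] := ef_par he m; have [b' pb'] := ef_par he m'; have ht := Hw_shom HV t hs.
rewrite -[LHS]/(g (amu F _)) (amu_top (eE m) (eE m')) -[RHS]/(amu X (tmor _ _ g _)).
have pp : parity (b (+) b') (pr e m m').
  by rewrite (pr_mu e Hmu); apply: (parity_shom mu); exact: (I_parity (tY T AV AV) _ _ pb pb').
rewrite (gE _ _ _ _ _ pp) (tmorE T _ _ cA cF cA cX _ _ _ pb) (gE _ _ _ _ _ pb') /=.
rewrite (linZ (lfun_linr _ _ _ _)) !linearZ /= scalerA.
have := rep_assoc rX (tY T AV (AV ** X) (e m) (top (lam + 4 * m'%:~R) m) 0 (tY T AV X (e m') (top lam m') 0 (t s))).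
rewrite (assoc_top HV T cA cA cX (eE m) (eE m') ht); last by exists l.
rewrite (tmor0E _ _ _ _ _ _ _ cA (cT cA cX) cA cX) (tmor0E _ _ _ _ _ _ _ (cT cA cA) cX cA cX) -(pr_mu e Hmu) /= => ->.
by congr (_ *: _); rewrite -sgn_addb; congr sgn; case: (p) (b) (b') => -[] [].
Qed.

Lemma hom_induce_inj (X : algMod j T) p (g : shom p F X) : isRep mu X -> rep_hom g ->
  (exists x, g (iota S x) <> 0) -> injective g.
Proof.
move=> rX hg [x gx]; apply: shom_inj => y gy; apply: contrapT => y0; apply: gx.
apply: (F_closed (sub_ker g)); first by exists y.
by move=> a b q k z pa gz; rewrite (repE cF (rep_cat rX) hg _ _ _ pa) gz (lin0 (lfun_linr _ _ _ _)) linear0 scaler0.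
Qed.

Lemma simple_induce : simple_Rep0 mu F.
Proof.
split; [exact: isRep0_induce|by exists (iota S s); exact: iota_neq0|].
move=> Z p h [rZ _] hh hi; have [[z z0]|nz] := pselect (nonzero Z); last by left.
right; have cZ := rep_cat rZ.
have him : forall x, exists z, h z = iota S x.
  apply: (F_closed (sub_im h)) => [|a b q k _ pa [y <-]].
    by exists (h z); split; [exists z|move=> h0; apply: z0; apply: hi; rewrite h0 linear0].
  exists (sgn (p && b) *: amu Z (tY T AV Z a q k y)).
  by rewrite linearZ /= (repE cZ cF hh _ _ _ pa) scalerA sgnK scale1r.
(* [iota] lifts through h, and the extension g of the lift to F is a section of h; hence h is
   onto. *)
have [t ht] := shom_factor hi (f := iota S) him.
have [g [hg gi]] := hom_from_induce t rZ.
apply: bij_inj_surj => // y; exists (g y).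
have hU : actsub (fun y => shomc h g y = shid _ y) by apply: eq_shom_actsub; case: (p).
apply: (gf_gen hU) => _ [m ->]; have [b pb] := ef_par he m.
rewrite -[LHS]/(h (g _)) gf_iota (repE cF cZ hg _ _ _ pb) linearZ (repE cZ cF hh _ _ _ pb) /= scalerA gi ht.
by rewrite -sgn_addb (_ : _ (+) _ = false) ?sgn0 ?scale1r //; case: (p) (b) => -[].
Qed.
End OnSimple.
End Induction.

(** * Classification of the simple local modules *)

Section Classification.
Variable R : realType.
Local Notation C := (R[i]).
Local Notation sgn := (sgn R).
Variables (V : vosa R) (J : {linear gl11 R -> V}).
Hypothesis HV : is_V1gl11 J.
Local Notation w := (Wop J).
Variables (A : vosa R) (j : vosaHom V A).
Hypothesis irrA : irreducible (vself A).
Hypothesis Hj : is_sl21_extension J j.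
Local Notation AV := (vres j).
Variable T : vtensor (IndO J).
Local Notation "W1 ** W2" := (tens T W1 W2) (at level 40).
Variable mu : shom false (AV ** AV) AV.
Hypothesis Hmu : is_multiplication mu.
Variable e : int -> AV.
Hypothesis he : ext_family J e.

Let cA : IndO J AV := IndO_A HV irrA Hj.
Let V0 : vac V <> 0 := vacV_neq0 j irrA.

(** Common form of both listed families: a simple highest-weight module of integral charge. The two
    half-integrality conditions of the list are this integrality, rewritten with the shift between n
    and nu. *)
Record hw_int (S : vmod V) (nu eps : C) (s : S) (b : bool) (l : int) : Prop := HwInt {
  hi_irr : irreducible S;
  hi_FH : FH (@w S) 0 nu eps s;
  hi_par : parity b s;
  hi_nz : s <> 0;
  hi_int : - 2 * nu - eps = l%:~R }.

Lemma listed_hw (S : vmod V) : listed J S -> exists nu eps s b l, @hw_int S nu eps s b l.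
Proof.
case=> [[n [l [[a en] hS]]]|[n [eps [eZ [z ez] hS]]]].
  have [irr [s [b [fs ps s0 _]]]] := Ahat_irr HV V0 hS.
  exists (n + nshift R l), l%:~R, s, b, (- a - l - (if l == 0 then 0 else 1)); split=> //.
  by rewrite en /nshift; case: ifP => _; rewrite !intrB mulrNz ?mulr0z ?mulr1z; field.
have [irr [s [b [fs ps s0]]]] := Vhat_irr HV V0 eZ hS.
exists (n + 2^-1), eps, s, b, (- z - 1); split=> //.
by rewrite intrB mulrNz -ez mulr1z; field.
Qed.

Lemma hw_listed (S : vmod V) nu eps (s : S) b l : hw_int nu eps s b l -> listed J S.
Proof.
move=> [irr fs ps s0 hl]; have [[k ek]|nk] := pselect (exists k : int, eps = k%:~R).
  left; exists (nu - nshift R k), k; rewrite ek in fs hl; split; last exact: (hw_Ahat HV V0 irr fs ps s0).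
  exists (- l - k - (if k == 0 then 0 else 1)); rewrite !intrB mulrNz -hl /nshift.
  by case: ifP => _; rewrite ?mulr0z ?mulr1z; field.
have eZ z : eps <> z%:~R by move=> h; apply: nk; exists z.
right; exists (nu - 2^-1), eps; split=> //; last exact: (hw_Vhat HV eZ irr fs ps s0).
by exists (- l - 1); rewrite intrB mulrNz -hl mulr1z; field.
Qed.

Lemma rep_iso_sym (X Y : algMod j T) p (h : shom p X Y) : IndO J X -> IndO J Y ->
  rep_hom h -> bijective h -> rep_iso Y X.
Proof.
move=> cX cY hh hb; have [g [hg gh]] := shom_inv hb; exists p, g; split; last by exists h.
move=> y; apply: (can_inj hg); rewrite gh hh; congr (amu Y _).
have hU : actsub (fun y => y = tmor T (shid AV) h (tmor T (shid AV) g y)).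
  have := @eq_shom_actsub _ _ _ _ _ _ (shid (AV ** Y)) (shomc (tmor T (shid AV) h) (tmor T (shid AV) g)).
  by apply; case: (p).
apply: (tens_span HV cA cY hU) => a q k b.
have ll := lfun_linl (tY T AV Y) q k b.
have hp c : tY T AV Y (epart c a) q k b = tmor T (shid AV) h (tmor T (shid AV) g (tY T AV Y (epart c a) q k b)).
  have pa := epart_parity c a.
  rewrite (tmorE T _ _ cA cY cA cX _ _ _ pa) linearZ /= (tmorE T _ _ cA cX cA cY _ _ _ pa) scalerA gh.
  by rewrite sgnK scale1r.
rewrite (epartE a) (linD ll); apply: (actsubD hU); exact: hp.
Qed.

Lemma shomc_bij p q (W1 W2 W3 : vmod V) (f : shom p W2 W3) (g : shom q W1 W2) : bijective f -> bijective g ->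
  bijective (shomc f g).
Proof. exact: bij_comp. Qed.

Section Braid.
Variables (S M : vmod V) (m : int) (y : M) (s : S) (a b : bool) (lam D : C).
Hypotheses (cM : IndO J M) (cS : IndO J S).
Hypotheses (gy : generates (eq^~ y)) (gs : generates (eq^~ s)).
Hypotheses (hy : Ext J m y) (hs : Hw J lam D s) (py : parity a y) (ps : parity b s).

Lemma scalar_actsub (W : vmod V) (f : shom false W W) c : actsub (fun x => f x = c *: x).
Proof.
split=> [|k x z hx hz|v n x hx]; first by rewrite linear0 scaler0.
  by rewrite linearP hx hz scalerDr !scalerA mulrC.
by rewrite shom0_act hx (linZ (act_linr v n)).
Qed.

(** The data contain no inverse braiding. In both orders the double braiding is the same nonzero
    scalar on a generator, hence everywhere, and this provides the inverse. *)
Lemma braid_bij : bijective (braid T M S).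
Proof.
pose c : C := cexp (piI R * (m%:~R * lam)) ^+ 2.
have c0 : c != 0 by rewrite expf_neq0 // cexp_neq0.
have h1 : forall x, shcomp (braid T S M) (braid T M S) x = c *: x.
  apply: (gen_left HV cM cS gy gs (scalar_actsub _ c)) => _ _ -> ->.
  by exists m, lam, D; split=> //; exact: (braid2_left HV T cM cS hy hs py ps).
have h2 : forall x, shcomp (braid T M S) (braid T S M) x = c *: x.
  apply: (gen_right HV cS cM gs gy (scalar_actsub _ c)) => _ _ -> ->.
  by exists m, lam, D; split=> //; exact: (braid2_right HV T cM cS hy hs py ps).
exists (fun x => c^-1 *: braid T S M x) => x.
  by rewrite [braid T S M _]h1 scalerA mulVf // scale1r.
by rewrite linearZ /= [braid T M S _]h2 scalerA mulVf // scale1r.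
Qed.
End Braid.

Section Single.
Variables (S : vmod V) (nu eps : C) (s : S) (bs : bool) (l : int).
Hypothesis H : hw_int nu eps s bs l.
Local Notation F := (induce mu S).

Lemma hi_cat : IndO J S.
Proof. by case: H => irr fs ps s0 _; apply: Ofin_IndO (hw_Ofin HV irr fs ps s0). Qed.

Lemma hi_simple : simple_Rep0 mu F.
Proof. by case: H => irr fs ps s0 hl; apply: (simple_induce HV irrA Hj Hmu he irr fs ps s0 hl). Qed.

Lemma hi_rep : isRep mu F. Proof. by case: hi_simple => -[]. Qed.

Lemma hi_embed (X : algMod j T) p (t : shom p S X) : isRep mu X -> t s <> 0 ->
  exists g : shom p F X, [/\ rep_hom g, injective g & forall x, g (iota j T S x) = t x].
Proof.
case: H => irr fs ps s0 hl rX ts.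
have [g [hg gi]] := hom_from_induce HV irrA Hj Hmu he irr fs ps s0 hl t rX; exists g; split=> //.
apply: (hom_induce_inj HV irrA Hj Hmu he irr fs ps s0 hl rX hg); by exists s; rewrite gi.
Qed.
End Single.

Lemma simple_is_induced (X : algMod j T) : simple_Rep0 mu X ->
  exists S : vmod V, listed J S /\ rep_iso X (induce mu S).
Proof.
move=> [[rX locX] nzX maxX]; have cX := rep_cat rX.
have [S [i [irr ii [s [nu [eps [b [fs ps s0]]]]]]]] := IndO_irr HV cX nzX.
have is0 : i s <> 0 by move=> h; apply: s0; apply: ii; rewrite h linear0.
have hs := FH_Hw HV (FH_shom HV i fs); have psi := parity_shom i ps.
have [b1 pb1] := ef_par he 1.
(* Monodromy with e_1 suffices: on the nonzero vector e_1 . s locality says exp(2 pi i lam) = 1. *)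
have [l el] : exists l : int, - 2 * nu - eps = l%:~R.
  apply: monodromy_trivial; have := locX (tY T AV X (e 1) (top (- 2 * nu - eps) 1) 0 (i s)).
  rewrite (braid2_left HV T cA cX (ef_ext he 1) hs pb1 psi) mulr1z mul1r linearZ => h.
  have nz : amu X (tY T AV X (e 1) (top (- 2 * nu - eps) 1) 0 (i s)) <> 0.
    by move=> h0; apply: is0; exact: (nonvanish HV irrA Hj Hmu he rX hs h0).
  apply/eqP; rewrite -subr_eq0; apply/negPn/negP => z0; apply: nz.
  apply: (scalerI z0); rewrite scaler0 scalerBl scale1r; apply/eqP; rewrite subr_eq0; exact/eqP.
have H : hw_int nu eps s b l by split.
have [g [hg gi _]] := hi_embed H rX is0.
exists S; split; first exact: hw_listed H.
have [iF nzF _] := hi_simple H.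
have [//|bg] := maxX _ _ g iF hg gi.
exact: (rep_iso_sym (rep_cat (hi_rep H)) cX hg bg).
Qed.

(** W is identified with the summand M of A of the same index by [hw_iso]. The composite from S'
    through S ** W, W ** S and M ** S to F(S) is nonzero, so it extends to an embedding of F(S') in
    the simple F(S). *)
Lemma iso_current_induced (S S' W : vmod V) (m : int) : listed J S -> listed J S' ->
  is_current J m W -> iso S' (S ** W) -> rep_iso (induce mu S) (induce mu S').
Proof.
move=> /listed_hw[nu [eps [s [b [l H]]]]] /listed_hw[nu' [eps' [s' [b' [l' H']]]]] hW [p0 [tau bt]].
have [M [p [i [q [y [c [hM iq ey py ex]]]]]]] := ef_mod he m.
have [irrM oM [sM [bM [fM pM sM0 _]]]] := current_hw HV j irrA hM.
have [irrW oW [sW [bW [fW pW sW0 _]]]] := current_hw HV j irrA hW.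
have cM := Ofin_IndO oM; have cW := Ofin_IndO oW; have cS := hi_cat H; have rF := hi_rep H.
have [p1 [th bth]] := hw_iso HV irrW irrM fW fM pW pM sW0 sM0.
have [ph [thph phth]] := shom_inv bth.
case: (H) => irr fs ps s0 hl; have hs := FH_Hw HV fs.
pose sigma := shomc (tmor T i (shid S)) (shomc (tmor T th (shid S)) (shomc (braid T S W) tau)).
pose f := gf mu e nu eps s m.
have f0 : f <> 0 := gf_neq0 HV irrA Hj Hmu he irr fs ps s0 hl (m := m).
(* The leading vector of S ** W goes to a nonzero multiple of e_m . s, so that [sigma] is
   nonzero. *)
have [x' ex'] : exists x', sigma x' = (sgn ((p1 (+) c) && b) * cexp (piI R * (m%:~R * (- 2 * nu - eps)))) *: f.
  have [ti _ tiK] := bt; exists (ti (tY T S W s (top (- 2 * nu - eps) m) 0 (ph y))).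
  rewrite /sigma /= tiK (braid_ext' HV T cW cS (Ext_shom HV ph ex) hs (parity_shom ph py) ps).
  by rewrite !linearZ /= (tmor0E _ _ _ _ _ _ _ cW cS cM cS) (tmor0E _ _ _ _ _ _ _ cM cS cA cS) /= phth ey.
have nz : sigma s' <> 0.
  move=> h; have [irr' _ ps' s0' _] := H'; apply: f0.
  have := irr_gen irr' ps' s0' (submodule_actsub (sub_ker sigma)) (fun _ e => etrans (congr1 _ e) h) x'.
  rewrite ex' => /eqP; rewrite scaler_eq0 mulf_eq0 (negbTE (sgn_neq0 _ _)) (negbTE (cexp_neq0 _)) /=.
  by move/eqP.
have [g [hg gi _]] := hi_embed H' rF nz.
have [iF' nzF' _] := hi_simple H'; have [_ _ maxF] := hi_simple H.
have [//|bg] := maxF _ _ g iF' hg gi.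
exact: (rep_iso_sym (rep_cat (hi_rep H')) (rep_cat rF) hg bg).
Qed.

Lemma induced_iso_current (S S' : vmod V) : listed J S -> listed J S' ->
  rep_iso (induce mu S) (induce mu S') ->
  exists (m : int) (W : vmod V), is_current J m W /\ iso S' (S ** W).
Proof.
move=> /listed_hw[nu [eps [s [b [l H]]]]] /listed_hw[nu' [eps' [s' [b' [l' H']]]]] [p [phi [hphi bphi]]].
case: (H) => irr fs ps s0 hl; case: (H') => irr' fs' ps' s0' hl'.
have [psi [phiK psiK]] := shom_inv bphi; have cS := hi_cat H; have hs := FH_Hw HV fs.
have i'0 := iota_neq0 HV irrA Hj (T := T) he irr' fs' ps' s0'.
have i'i := iota_inj HV irrA Hj (T := T) he irr' fs' ps' s0'.
have Eu : w GE 0 (psi (iota j T S' s')) = eps' *: psi (iota j T S' s').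
  have := shom_w HV psi GE 0 (iota j T S' s'); rewrite andbF sgn0 scale1r => <-.
  by rewrite -(shom0_w HV) (FH_E0 fs') !linearZ.
have [u0|[m [em _]]] := F_graded HV irrA Hj he irr fs ps s0 Eu.
  by case: i'0; apply: (can_inj psiK); rewrite u0 linear0.
have [M [pM [i [q [y [c [hM iq ey py ex]]]]]]] := ef_mod he m.
exists m, M; split=> //.
have [irrM oM _] := current_hw HV j irrA hM; have cM := Ofin_IndO oM.
have y0 : y <> 0 by move=> h; apply: (ef_nz he (m := m)); rewrite -ey h linear0.
have gy := irr_gen irrM py y0; have gs := irr_gen irr ps s0.
have Ey : w GE 0 y = (- 2 * m%:~R) *: y.
  have := shom_w HV q GE 0 (e m); rewrite andbF sgn0 scale1r -ey iq => <-.
  by rewrite ey (ef_E he) linearZ /= -ey iq.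
pose a := tmor T i (shid S).
(* The summand M of A has the projection [q], so M ** S embeds in F(S). *)
have aK : cancel a (tmor T q (shid S)).
  have hU : actsub (fun x => shomc (tmor T q (shid S)) a x = shid (M ** S) x).
    by apply: eq_shom_actsub; case: (pM).
  move=> x; apply: (gen_tens HV cM cS gy gs hU) => u v h k -> ->.
  by rewrite [LHS]/= (tmor0E _ _ _ _ _ _ _ cM cS cA cS) (tmor0E _ _ _ _ _ _ _ cA cS cM cS) /= iq.
have EX : forall x : M ** S, w GE 0 x = eps' *: x.
  apply: (gen_left HV cM cS gy gs (@E_actsub R V J HV (M ** S) eps')) => _ _ -> ->; exists m, (- 2 * nu - eps); eexists.
  split; [exact: ex|exact: hs|].
  rewrite (I_E0 HV) Ey (FH_E0 fs) (linZ (lfun_linr _ _ _ _)) (linZ (lfun_linl _ _ _ _)) -scalerDl -em.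
  by rewrite mulNr.
pose fa := shomc phi a.
have Ea x : w GE 0 (fa x) = eps' *: fa x.
  have := shom_w HV fa GE 0 x; rewrite andbF sgn0 scale1r => <-; by rewrite EX linearZ.
(* The image of M ** S in F(S') has E_0-eigenvalue eps', and that eigenspace is S'. *)
have fa_im x : exists z, iota j T S' z = fa x := F_eps HV irrA Hj he irr' fs' ps' s0' (Ea x).
have [r hr] := shom_factor i'i (f := fa) fa_im.
have fai : injective fa by apply: inj_comp; [exact: can_inj phiK|exact: can_inj aK].
have ri : injective r by move=> u v h; apply: fai; rewrite -!hr h.
have f0 : gf mu e nu eps s m <> 0 := gf_neq0 HV irrA Hj Hmu he irr fs ps s0 hl (m := m).
have rnz : r (tY T M S y (top (- 2 * nu - eps) m) 0 s) <> 0.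
  move=> h; apply: f0; have : tY T M S y (top (- 2 * nu - eps) m) 0 s = 0 by apply: ri; rewrite h linear0.
  move=> /(congr1 a); rewrite linear0 /a (tmor0E _ _ _ _ _ _ _ cM cS cA cS) ey; exact.
have rb : bijective r by apply: (bij_inj_surj ri); exact: (irr_shom_surj irr' rnz).
have [r' [rK r'K]] := shom_inv rb.
have bb := braid_bij cM cS gy gs ex hs py ps.
by eexists; exists (shomc (braid T M S) r'); apply: shomc_bij => //; exists r.
Qed.
End Classification.

Unset Implicit Arguments.
Set Strict Implicit.
Set Printing Implicit Defensive.

Theorem proposition5p0p1 (R : realType)
  (V : vosa R) (J : {linear gl11 R -> V}) (HV : is_V1gl11 J)
  (A : vosa R) (JA : {linear sl21 R -> A}) (HA : is_simple_affine (- 2^-1) JA)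
  (j : vosaHom V A) (Hj : is_sl21_extension J j)
  (T : vtensor (IndO J))
  (mu : shom false (tens T (vres j) (vres j)) (vres j))
  (Hmu : is_multiplication mu) :
  [/\ forall S : vmod V, listed J S -> simple_Rep0 mu (induce mu S),
      forall X : algMod j T, simple_Rep0 mu X ->
        exists S : vmod V, listed J S /\ rep_iso X (induce mu S) &
      forall S S' : vmod V, listed J S -> listed J S' ->
        (rep_iso (induce mu S) (induce mu S') <->
         exists (m : int) (W : vmod V), is_current J m W /\ iso S' (tens T S W))].
Proof.
have irrA := aff_simple HA; have [e he] := ext_family_exists HV irrA Hj; split.
- move=> S /(listed_hw HV j irrA)[nu [eps [s [b [l H]]]]].
  exact: (hi_simple HV irrA Hj Hmu he H).
- by move=> X; apply: (simple_is_induced HV irrA Hj Hmu he).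
- move=> S S' hS hS'; split=> [|[m [W [hW h]]]].
    exact: (induced_iso_current HV irrA Hj Hmu he).
  exact: (iso_current_induced HV irrA Hj Hmu he hS hS' hW h).
Qed.
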